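(* Let $\bar u\in U_{\rm ad}$, with state $\bar y=y_{\bar u}$ and adjoint state $\bar\varphi=\varphi_{\bar u}$, satisfy the first-order optimality conditions, i.e. $\int_\Sigma(\kappa\bar u-\bar y\bar\varphi)(u-\bar u)\,dx\,dt\ge0$ for all $u\in U_{\rm ad}$. Assume that the strict complementarity condition $|\Sigma_{\bar u}|=0$ is satisfied at $\bar u$. Then: 1. $E^0_{\bar u}=C_{\bar u}$. 2. If $\bar u$ satisfies the second-order optimality condition $J''(\bar u)v^2>0$ for all $v\in C_{\bar u}\setminus\{0\}$, then there exist $\tau>0$ and $\nu>0$ such that $$J''(\bar u)v^2\ge\nu\|v\|^2_{L^2(\Sigma)}\quad\forall v\in E^\tau_{\bar u}.$$
   Context: Setting. $0<T<\infty$; $\Omega\subset\mathbb{R}^d$, $d\in\{2,3\}$, is bounded, open, connected with Lipschitz boundary $\Gamma$; $Q=\Omega\times(0,T)$, $\Sigma=\Gamma\times(0,T)$; $n(x)$ is the outward unit normal. $Ay=-\sum_{i,j=1}^d\partial_{x_j}[a_{ij}(x)\partial_{x_i}y]$ with $a_{ij}\in L^\infty(\Omega)$ and $\lambda_A,\Lambda_A>0$ with $\Lambda_A|h|^2\le\sum a_{ij}(x)h_ih_j\le\lambda_A|h|^2$ for a.a. $x\in\Omega$, all $h\in\mathbb{R}^d$; $\partial_{n_A}y=\sum a_{ij}\partial_{x_i}y\,n_j$; $A^*\varphi=-\sum\partial_{x_j}[a_{ji}\partial_{x_i}\varphi]$, $\partial_{n_{A^*}}\varphi=\sum a_{ji}\partial_{x_i}\varphi\,n_j$.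 $W(0,T)=\{y\in L^2(0,T;H^1(\Omega)):\partial_ty\in L^2(0,T;H^1(\Omega)^* )\}$; $Y=W(0,T)\cap L^\infty(Q)$. Parabolic equations are understood in the weak sense and boundary values as traces. Data. $a:Q\times\mathbb{R}\to\mathbb{R}$ is Carathéodory, $C^2$ in the last variable, and for a.a. $(x,t)$: $a(\cdot,\cdot,0)\in L^r(0,T;L^s(\Omega))$ for some $r,s\ge2$ with $\frac1r+\frac d{2s}<1$; $\partial_ya(x,t,y)\ge C_a$ for all $y$, for some $C_a\in\mathbb{R}$; for each $M>0$ there are $C_{a,M},K_{a,M}$ with $\sum_{j=1}^2|\partial_y^ja(x,t,y)|\le C_{a,M}$ and $|\partial^2_{yy}a(x,t,y_1)-\partial^2_{yy}a(x,t,y_2)|\le K_{a,M}|y_1-y_2|$ for $|y|,|y_1|,|y_2|\le M$ (constants independent of $(x,t)$). $y_0\in L^\infty(\Omega)$; $g\in L^2(\Sigma)\cap L^{\hat r}(0,T;L^{\hat s}(\Gamma))$ with $\frac1{\hat r}+\frac{d-1}{2\hat s}<\frac12$. $L:Q\times\mathbb{R}\to\mathbb{R}$, $l:\Omega\times\mathbb{R}\to\mathbb{R}$ are Carathéodory, $C^2$ in the last variable, $L(\cdot,\cdot,0)\in L^1(Q)$, $l(\cdot,0)\in L^1(\Omega)$, and for each $M>0$ there are $\Psi_{L,M}\in L^r(0,T;L^s(\Omega))$ and constants with, for $|y|,|y_1|,|y_2|\le M$: $|\partial_yL(x,t,y)|\le\Psi_{L,M}(x,t)$, $|\partial_y^jl(x,y)|\le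 C_{l,M}$ ($j=1,2$), $|\partial^2_{yy}L(x,t,y)|\le C_{L,M}$, $|\partial^2_{yy}L(x,t,y_1)-\partial^2_{yy}L(x,t,y_2)|\le K_{L,M}|y_1-y_2|$, $|\partial^2_{yy}l(x,y_1)-\partial^2_{yy}l(x,y_2)|\le K_{l,M}|y_1-y_2|$. At least one of the following holds: (I) $\partial^2_{yy}l(x,y)\ge0$ for all $y\in\mathbb{R}$; (II) $\Gamma$ is a $C^{1,1}$ manifold and $a_{ij}\in C^{0,1}(\bar\Omega)$ for all $i,j$. Control problem. $\kappa>0$, $0\le\alpha<\beta<\infty$, $U_{\rm ad}=\{u\in L^2(\Sigma):\alpha\le u\le\beta\text{ a.e. in }\Sigma\}$. For $u\in U_{\rm ad}$, $y_u\in Y$ is the unique solution of $\partial_ty+Ay+a(x,t,y)=0$ in $Q$, $\partial_{n_A}y+uy=g$ on $\Sigma$, $y(0)=y_0$; $\varphi_u\in Y$ is the unique solution of $-\partial_t\varphi+A^*\varphi+\partial_ya(x,t,y_u)\varphi=\partial_yL(x,t,y_u)$ in $Q$, $\partial_{n_{A^*}}\varphi+u\varphi=0$ on $\Sigma$, $\varphi(T)=\partial_yl(x,y_u(T))$. $J(u)=\int_QL(x,t,y_u)\,dx\,dt+\int_\Omega l(x,y_u(x,T))\,dx+\frac\kappa2\int_\Sigma u^2\,dx\,dt$. Second derivative. For $v\in L^2(\Sigma)$ let $z_{\bar u,v}\in W(0,T)$ solve $\partial_tz+Az+\partial_ya(x,t,\bar y)z=0$ in $Q$, $\partial_{n_A}z+\bar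 uz+\bar yv=0$ on $\Sigma$, $z(0)=0$. Then $$J''(\bar u)v^2=\int_Q[\partial^2_{yy}L(x,t,\bar y)-\bar\varphi\,\partial^2_{yy}a(x,t,\bar y)]z_{\bar u,v}^2\,dx\,dt+\int_\Omega\partial^2_{yy}l(x,\bar y(T))z_{\bar u,v}(T)^2\,dx-2\int_\Sigma vz_{\bar u,v}\bar\varphi\,dx\,dt+\kappa\int_\Sigma v^2\,dx\,dt$$ (the continuous extension to $L^2(\Sigma)$ of the second derivative of $J$ on $L^p(\Sigma)$, $p>d+1$). Sets. $C_{\bar u}$ is the set of $v\in L^2(\Sigma)$ such that, a.e. on $\Sigma$, $v=0$ where $\kappa\bar u-\bar y\bar\varphi\ne0$, $v\ge0$ where $\bar u=\alpha$, and $v\le0$ where $\bar u=\beta$. $\Sigma_{\bar u}=\{(x,t)\in\Sigma:\bar u(x,t)\in\{\alpha,\beta\}\text{ and }\kappa\bar u(x,t)-\bar y(x,t)\bar\varphi(x,t)=0\}$, and $|\cdot|$ is the $d$-dimensional Lebesgue measure on $\Sigma$. For $\tau\ge0$, $E^\tau_{\bar u}=\{v\in L^2(\Sigma):v(x,t)=0\text{ if }|\kappa\bar u(x,t)-\bar y(x,t)\bar\varphi(x,t)|>\tau\}$. *)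

(* Defs.v *)
(* Elements of the Lebesgue and Sobolev spaces below are Borel representatives:
   total functions on the ambient space, of which only the values a.e. on the
   relevant domain matter. *)
From HB Require Import structures.
From mathcomp Require Import all_boot all_order all_algebra.
From mathcomp Require Import all_classical all_reals all_analysis.
Set Implicit Arguments.
Unset Strict Implicit.
Unset Printing Implicit Defensive.
Import Order.TTheory GRing.Theory Num.Theory.
Import numFieldNormedType.Exports.
Local Open Scope classical_set_scope.
Local Open Scope ring_scope.

Section rV_measurable.
Context {R : realType} (n : nat).

Let coord : 'I_n -> 'rV[R]_n -> measurableTypeR R := fun i x => x ord0 i.

Let rV_set0 : g_sigma_preimage coord set0.
Proof. exact: sigma_algebra0. Qed.

Let rV_setC A : g_sigma_preimage coord A -> g_sigma_preimage coord (~` A).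
Proof. exact: sigma_algebraC. Qed.

Let rV_bigcup (F : _^nat) : (forall i, g_sigma_preimage coord (F i)) ->
  g_sigma_preimage coord (\bigcup_i (F i)).
Proof. exact: sigma_algebra_bigcup. Qed.

(* The sigma-algebra generated by the coordinates: the Borel sets of R^n. *)
HB.instance Definition _ := @isMeasurable.Build default_measure_display
  'rV[R]_n (g_sigma_preimage coord) rV_set0 rV_setC rV_bigcup.

Lemma measurable_coord (i : 'I_n) :
  measurable_fun [set: 'rV[R]_n] (fun x : 'rV[R]_n => x ord0 i : measurableTypeR R).
Proof.
move=> _ Y mY; rewrite setTI; apply: sub_sigma_algebra => /=.
rewrite -bigcup_seq/=; exists i => /=; first by rewrite mem_index_enum.
by exists Y => //; rewrite setTI.
Qed.

Lemma measurable_fun_coordP d (T1 : measurableType d) (f : T1 -> 'rV[R]_n) :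
  (forall i, measurable_fun [set: T1] (fun x => f x ord0 i : measurableTypeR R)) ->
  measurable_fun [set: T1] f.
Proof.
move=> mf _ A mA; rewrite setTI.
have : g_sigma_preimage (fun i => coord i \o f) (f @^-1` A).
  rewrite g_sigma_preimage_comp; exists A => //; by rewrite setTI.
apply: smallest_sub; first exact: sigma_algebra_measurable.
move=> B; rewrite -bigcup_seq/= => -[i _ [C mC <-]].
exact: mf.
Qed.

End rV_measurable.

Section lebesgue_rV.
Context {R : realType}.
Local Notation lam := (@lebesgue_measure R).

Definition rV_cons n (p : 'rV[R]_n * measurableTypeR R) : 'rV[R]_n.+1 :=
  \row_i oapp (fun j => p.1 ord0 j) p.2 (unlift ord0 i).

Lemma measurable_rV_cons n : measurable_fun setT (@rV_cons n).
Proof.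
apply: measurable_fun_coordP => i.
case: (unliftP ord0 i) => [j|] ->.
- rewrite (_ : (fun _ => _) = (fun x : 'rV[R]_n => x ord0 j : measurableTypeR R)
      \o fst); last first.
    by apply/funext => p /=; rewrite mxE liftK.
  by apply: measurableT_comp; [exact: measurable_coord|exact: measurable_fst].
- rewrite (_ : (fun _ => _) = snd); first exact: measurable_snd.
  by apply/funext => p /=; rewrite mxE unlift_none.
Qed.

(* Lebesgue measure on R^n: image of the iterated product measure. *)
Fixpoint leb (n : nat) : {measure set 'rV[R]_n -> \bar R} :=
  match n with
  | 0 => @dirac _ 'rV[R]_0 0 R
  | n'.+1 => measure_function_pushforward__canonical__measure_function_Measure
        (leb n' \x lam)%E (@measurable_rV_cons n')
  end.

End lebesgue_rV.

Section function_spaces.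
Context {R : realType}.

Definition L2 {dsp} {X : measurableType dsp} (mu : set X -> \bar R)
    (D : set X) (f : X -> R) : Prop :=
  measurable_fun D f /\ mu.-integrable D (fun x => (f x ^+ 2)%:E).

Definition sqnorm {dsp} {X : measurableType dsp}
    (mu : {measure set X -> \bar R}) (D : set X) (f : X -> R) : R :=
  \int[mu]_(x in D) (f x ^+ 2).

Definition Linfty {dsp} {X : measurableType dsp}
    (mu : {measure set X -> \bar R}) (D : set X) (f : X -> R) : Prop :=
  measurable_fun D f /\ exists C : R, \forall x \ae mu, D x -> `|f x| <= C.

(* L^r(0,T;L^s(D)) for finite exponents. *)
Definition Lmixed {dsp} {X : measurableType dsp}
    (mu : {measure set X -> \bar R}) (D : set X) (T r s : R)
    (f : X * measurableTypeR R -> R) : Prop :=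
  measurable_fun (D `*` `]0, T[) f /\
  (\int[lebesgue_measure]_(t in `]0%R, T[)
     ((\int[mu]_(x in D) (`|f (x, t)| `^ s)%R%:E) `^ (r / s)%R) < +oo)%E.

Fixpoint class_C (V : normedModType R) (k : nat) (f : V -> R^o) : Prop :=
  continuous f /\
  match k with
  | 0 => True
  | k'.+1 => forall v, (forall x, derivable f x v) /\ class_C k' ('D_v f)
  end.

Definition smooth (V : normedModType R) (f : V -> R^o) : Prop :=
  forall k, class_C k f.

(* C_c^oo(D) *)
Definition test_function (V : normedModType R) (D : set V) (f : V -> R^o) :=
  smooth f /\
  exists K : set V, [/\ compact K, K `<=` D & forall x, ~ K x -> f x = 0].

Definition caratheodory {dsp} {X : measurableType dsp}
    (mu : {measure set X -> \bar R}) (D : set X) (f : X -> R -> R) : Prop :=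
  (forall y, measurable_fun D (f ^~ y)) /\
  (\forall x \ae mu, D x -> continuous (f x)).

Definition dy {X : Type} (f : X -> R -> R) : X -> R -> R :=
  fun x y => derive1 (f x : R -> R^o) y.

Definition dyy {X : Type} (f : X -> R -> R) : X -> R -> R := dy (dy f).

End function_spaces.

Section geometry.
Context {R : realType}.

Definition enorm n (x : 'rV[R]_n) : R := Num.sqrt (\sum_i x ord0 i ^+ 2).

(* 0 is added so that the empty set has diameter 0. *)
Definition diam n (A : set 'rV[R]_n) : \bar R :=
  ereal_sup (0%E |` [set (enorm (p.1 - p.2))%:E | p in A `*` A]).

(* k-dimensional Hausdorff measure, normalised by the volume of the unit ball
   so that it agrees with the surface area on k-dimensional surfaces. *)
Definition hausdorff_pre n (k : nat) (delta : R) (A : set 'rV[R]_n) : \bar R :=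
  ereal_inf [set (\sum_(0 <= j <oo)
      leb k [set x | (enorm x <= 1)%R] * (2 ^- k)%R%:E * diam (F j) ^+ k)%E
    | F in [set F : nat -> set 'rV[R]_n |
        A `<=` \bigcup_j F j /\ forall j, (diam (F j) <= delta%:E)%E]].

Definition hausdorff n (k : nat) (A : set 'rV[R]_n) : \bar R :=
  ereal_sup [set hausdorff_pre k delta A | delta in [set delta : R | 0 < delta]].

Definition bdry n (Om : set 'rV[R]_n) : set 'rV[R]_n := closure Om `\` Om°.

Definition surface_measure n (Om : set 'rV[R]_n)
    (sigma : {measure set 'rV[R]_n -> \bar R}) : Prop :=
  forall A, measurable A -> sigma A = hausdorff n.-1 (A `&` bdry Om).

(* Near each boundary point, after an orthogonal change of coordinates, Om is
   the strict epigraph of a function of class K of the remaining variables. *)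
Definition graph_boundary n (K : ('rV[R]_n.-1 -> R^o) -> Prop)
    (Om : set 'rV[R]_n) : Prop :=
  forall p, bdry Om p ->
  exists (O : 'M[R]_n) (i : 'I_n) (gamma : 'rV[R]_n.-1 -> R^o) (eps : R),
    [/\ 0 < eps, O *m O^T = 1%:M, K gamma &
      forall x, ball p eps x ->
        Om x <-> gamma (col' i (x *m O)) < (x *m O) ord0 i].

Definition lipschitz_boundary n : set 'rV[R]_n -> Prop :=
  graph_boundary (fun gamma => lipschitz gamma).

Definition C11_boundary n : set 'rV[R]_n -> Prop :=
  graph_boundary (fun gamma =>
    class_C 1 gamma /\ forall v, lipschitz ('D_v gamma)).

End geometry.

Section sobolev.
Context {R : realType} {d : nat}.
Local Notation E := 'rV[R]_d.
Local Notation lam := (@lebesgue_measure R).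

Variables (Om : set E) (sigma : {measure set E -> \bar R}) (T : R).

Definition partial (i : 'I_d) (f : E -> R^o) : E -> R := 'D_(delta_mx ord0 i) f.

(* w belongs to H^1(Om), with weak gradient Dw. *)
Definition H1 (w : E -> R) (Dw : 'I_d -> E -> R) : Prop :=
  [/\ L2 (leb d) Om w, forall i, L2 (leb d) Om (Dw i) &
    forall (f : E -> R) i, test_function Om f ->
      \int[leb d]_(x in Om) (w x * partial i f x) =
      - \int[leb d]_(x in Om) (Dw i x * f x)].

Definition H1norm (w : E -> R) (Dw : 'I_d -> E -> R) : R :=
  Num.sqrt (sqnorm (leb d) Om w + \sum_i sqnorm (leb d) Om (Dw i)).

(* tw is the trace on bdry Om of w in H^1(Om) with gradient Dw, i.e. the
   extension by continuity of the restriction of smooth functions. *)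
Definition trace_of (w : E -> R) (Dw : 'I_d -> E -> R) (tw : E -> R) : Prop :=
  L2 sigma (bdry Om) tw /\
  exists f : nat -> E -> R,
    [/\ forall k, smooth (f k),
        H1norm (fun x => f k x - w x) (fun i x => partial i (f k) x - Dw i x)
          @[k --> \oo] --> (0 : R) &
        (\int[sigma]_(x in bdry Om) ((f k x - tw x) ^+ 2)%:E
          @[k --> \oo] --> 0)%E].

(* F : H^1(Om) -> R is linear and bounded with norm at most k. *)
Definition H1dual_le (F : (E -> R) -> R) (k : R) : Prop :=
  (forall w1 Dw1 w2 Dw2 (c : R), H1 w1 Dw1 -> H1 w2 Dw2 ->
     F (fun x => c * w1 x + w2 x) = c * F w1 + F w2) /\
  (forall w Dw, H1 w Dw -> `|F w| <= k * H1norm w Dw).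

(* An element of W(0,T) together with the objects it determines: weak spatial
   gradient, trace on Sigma, representative in C([0,T];L^2(Om)), and weak time
   derivative t |-> (w |-> <d_t y(t), w>). *)
Record trajectory := Trajectory {
  value : E * measurableTypeR R -> R ;
  grad : 'I_d -> E * measurableTypeR R -> R ;
  trace : E * measurableTypeR R -> R ;
  at_time : R -> E -> R ;
  dt : R -> (E -> R) -> R }.

Local Notation Q := (Om `*` `]0, T[).
Local Notation Sigma := (bdry Om `*` `]0, T[).

Definition in_L2H1 (y : trajectory) : Prop :=
  [/\ L2 (leb d \x lam)%E Q (value y),
      forall i, L2 (leb d \x lam)%E Q (grad y i) &
      \forall t \ae lam, t \in `]0, T[ ->
        H1 (fun x => value y (x, t)) (fun i x => grad y i (x, t))].

Definition is_trace (y : trajectory) : Prop :=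
  L2 (sigma \x lam)%E Sigma (trace y) /\
  \forall t \ae lam, t \in `]0, T[ ->
    trace_of (fun x => value y (x, t)) (fun i x => grad y i (x, t))
             (fun x => trace y (x, t)).

Definition is_L2H1dual_dt (y : trajectory) : Prop :=
  [/\ forall w Dw, H1 w Dw -> measurable_fun `]0, T[ (fun t => dt y t w),
      exists2 k : R -> R, L2 lam `]0, T[ k &
        \forall t \ae lam, t \in `]0, T[ -> H1dual_le (dt y t) (k t) &
      forall (theta : R -> R) w Dw, test_function `]0, T[ theta -> H1 w Dw ->
        \int[lam]_(t in `]0, T[) (dt y t w * theta t) =
        - \int[lam]_(t in `]0, T[)
            ((\int[leb d]_(x in Om) (value y (x, t) * w x)) *
             derive1 (theta : R -> R^o) t)].

Definition is_continuous_rep (y : trajectory) : Prop :=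
  [/\ forall t, t \in `[0, T] -> L2 (leb d) Om (at_time y t),
      \forall t \ae lam, t \in `]0, T[ ->
        \forall x \ae leb d, Om x -> at_time y t x = value y (x, t) &
      forall t0, t0 \in `[0, T] ->
        sqnorm (leb d) Om (fun x => at_time y t x - at_time y t0 x)
          @[t --> within `[0, T] (nbhs t0)] --> (0 : R)].

Definition in_W (y : trajectory) : Prop :=
  [/\ in_L2H1 y, is_L2H1dual_dt y, is_trace y & is_continuous_rep y].

Definition in_Y (y : trajectory) : Prop :=
  in_W y /\ Linfty (leb d \x lam)%E Q (value y).

(* Weak form of
     s d_t y - sum_ij d_j (A_ij d_i y) + f = 0 in Q,
     sum_ij A_ij (d_i y) n_j = h on Sigma. *)
Definition weak_solution (s : R) (A : 'I_d -> 'I_d -> E -> R)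
    (f h : E * measurableTypeR R -> R) (y : trajectory) : Prop :=
  \forall t \ae lam, t \in `]0, T[ ->
    forall w Dw tw, H1 w Dw -> trace_of w Dw tw ->
      s * dt y t w
      + \int[leb d]_(x in Om) (\sum_i \sum_j A i j x * grad y i (x, t) * Dw j x)
      + \int[leb d]_(x in Om) (f (x, t) * w x)
      = \int[sigma]_(x in bdry Om) (h (x, t) * tw x).

End sobolev.

Section control_problem.
Context {R : realType} {d : nat}.
Local Notation E := 'rV[R]_d.
Local Notation lam := (@lebesgue_measure R).
Local Notation ER := (E * measurableTypeR R)%type.

Variables (Om : set E) (sigma : {measure set E -> \bar R}) (T : R).

Local Notation Q := (Om `*` `]0, T[).
Local Notation Sigma := (bdry Om `*` `]0, T[).
Local Notation lamQ := (leb d \x lam)%E.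
Local Notation lamS := (sigma \x lam)%E.

Definition elliptic (A : 'I_d -> 'I_d -> E -> R) (LamA lamA : R) : Prop :=
  [/\ forall i j, Linfty (leb d) Om (A i j), 0 < LamA, 0 < lamA &
    \forall x \ae leb d, Om x -> forall h : E,
      LamA * enorm h ^+ 2 <= \sum_i \sum_j A i j x * h ord0 i * h ord0 j
        <= lamA * enorm h ^+ 2].

Definition lipschitz_coefficients (A : 'I_d -> 'I_d -> E -> R) : Prop :=
  forall i j, exists f : E -> R^o, [lipschitz f x | x in closure Om] /\
    \forall x \ae leb d, Om x -> A i j x = f x.

Definition assumption_a (r s : R) (a : ER -> R -> R) : Prop :=
  [/\ caratheodory lamQ Q a /\ (\forall q \ae lamQ, Q q -> class_C 2 (a q)),
      Lmixed (leb d) Om T r s (a ^~ 0),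
      exists Ca : R, \forall q \ae lamQ, Q q -> forall y, Ca <= dy a q y &
      forall M : R, 0 < M -> exists CaM KaM : R,
        \forall q \ae lamQ, Q q ->
          (forall y, `|y| <= M -> `|dy a q y| + `|dyy a q y| <= CaM) /\
          (forall y1 y2, `|y1| <= M -> `|y2| <= M ->
             `|dyy a q y1 - dyy a q y2| <= KaM * `|y1 - y2|)].

Definition assumption_L (r s : R) (L : ER -> R -> R) : Prop :=
  [/\ caratheodory lamQ Q L /\ (\forall q \ae lamQ, Q q -> class_C 2 (L q)),
      lamQ.-integrable Q (fun q => (L q 0)%:E) &
      forall M : R, 0 < M -> exists (Psi : ER -> R) (CLM KLM : R),
        Lmixed (leb d) Om T r s Psi /\
        \forall q \ae lamQ, Q q ->
          (forall y, `|y| <= M -> `|dy L q y| <= Psi q /\ `|dyy L q y| <= CLM) /\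
          (forall y1 y2, `|y1| <= M -> `|y2| <= M ->
             `|dyy L q y1 - dyy L q y2| <= KLM * `|y1 - y2|)].

Definition assumption_l (l : E -> R -> R) : Prop :=
  [/\ caratheodory (leb d) Om l /\ (\forall x \ae leb d, Om x -> class_C 2 (l x)),
      (leb d).-integrable Om (fun x => (l x 0)%:E) &
      forall M : R, 0 < M -> exists ClM KlM : R,
        \forall x \ae leb d, Om x ->
          (forall y, `|y| <= M -> `|dy l x y| <= ClM /\ `|dyy l x y| <= ClM) /\
          (forall y1 y2, `|y1| <= M -> `|y2| <= M ->
             `|dyy l x y1 - dyy l x y2| <= KlM * `|y1 - y2|)].

Definition Uad (alpha beta : R) : set (ER -> R) :=
  [set u | L2 lamS Sigma u /\
    \forall q \ae lamS, Sigma q -> alpha <= u q <= beta].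

(* y is the state y_u *)
Definition is_state (A : 'I_d -> 'I_d -> E -> R) (a : ER -> R -> R)
    (g : ER -> R) (y0 : E -> R) (u : ER -> R) (y : trajectory) : Prop :=
  [/\ in_Y Om sigma T y,
      weak_solution Om sigma T 1 A (fun q => a q (value y q))
        (fun q => g q - u q * trace y q) y &
      \forall x \ae leb d, Om x -> at_time y 0 x = y0 x].

(* phi is the adjoint state phi_u, given y = y_u *)
Definition is_adjoint_state (A : 'I_d -> 'I_d -> E -> R) (a L : ER -> R -> R)
    (l : E -> R -> R) (u : ER -> R) (y phi : trajectory) : Prop :=
  [/\ in_Y Om sigma T phi,
      weak_solution Om sigma T (-1) (fun i j => A j i)
        (fun q => dy a q (value y q) * value phi q - dy L q (value y q))
        (fun q => - (u q * trace phi q)) phi &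
      \forall x \ae leb d, Om x -> at_time phi T x = dy l x (at_time y T x)].

(* z is z_{u,v}, given y = y_u *)
Definition is_linearized_state (A : 'I_d -> 'I_d -> E -> R) (a : ER -> R -> R)
    (u : ER -> R) (y : trajectory) (v : ER -> R) (z : trajectory) : Prop :=
  [/\ in_W Om sigma T z,
      weak_solution Om sigma T 1 A (fun q => dy a q (value y q) * value z q)
        (fun q => - (u q * trace z q + trace y q * v q)) z &
      \forall x \ae leb d, Om x -> at_time z 0 x = 0].

(* J''(u)v^2, given y = y_u, phi = phi_u and z = z_{u,v} *)
Definition second_derivative (kappa : R) (a L : ER -> R -> R) (l : E -> R -> R)
    (y phi : trajectory) (v : ER -> R) (z : trajectory) : R :=
  \int[lamQ]_(q in Q)
     ((dyy L q (value y q) - value phi q * dyy a q (value y q)) * value z q ^+ 2)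
  + \int[leb d]_(x in Om) (dyy l x (at_time y T x) * at_time z T x ^+ 2)
  - 2 * \int[lamS]_(q in Sigma) (v q * trace z q * trace phi q)
  + kappa * sqnorm lamS Sigma v.

(* Trace on Sigma of kappa u - y phi *)
Definition switching (kappa : R) (u : ER -> R) (y phi : trajectory) : ER -> R :=
  fun q => kappa * u q - trace y q * trace phi q.

Definition first_order (kappa alpha beta : R) (u : ER -> R)
    (y phi : trajectory) : Prop :=
  forall u', Uad alpha beta u' ->
    0 <= \int[lamS]_(q in Sigma) (switching kappa u y phi q * (u' q - u q)).

Definition critical_cone (kappa alpha beta : R) (u : ER -> R)
    (y phi : trajectory) : set (ER -> R) :=
  [set v | L2 lamS Sigma v /\ \forall q \ae lamS, Sigma q ->
    [/\ switching kappa u y phi q != 0 -> v q = 0,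
        u q = alpha -> 0 <= v q & u q = beta -> v q <= 0]].

Definition degenerate_set (kappa alpha beta : R) (u : ER -> R)
    (y phi : trajectory) : set ER :=
  Sigma `&`
  [set q | (u q = alpha \/ u q = beta) /\ switching kappa u y phi q = 0].

Definition extended_cone (kappa tau : R) (u : ER -> R)
    (y phi : trajectory) : set (ER -> R) :=
  [set v | L2 lamS Sigma v /\ \forall q \ae lamS, Sigma q ->
    tau < `|switching kappa u y phi q| -> v q = 0].

End control_problem.

(* Main.v *)
(* The map v |-> z is compact: an energy estimate bounds z in L^2(0, T; H^1), and an Ehrling inequality with
   time increments tested against smooth functions bounds |z| by e |v| up to finitely many functionals.
   Hence J'' is coercive up to finitely many functionals. If no pair (tau, nu) existed, near-minimizers v_k
   of J''(v) v / |v|^2 on E^(1/k) along which these functionals converge would be Cauchy by the parallelogram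
   law; the limit lies in E^0 = C, has norm 1, and J'' is nonpositive at it. *)
Require Import Defs.
From HB Require Import structures.
From mathcomp Require Import all_boot all_order all_algebra.
From mathcomp Require Import all_classical all_reals all_analysis.
From mathcomp Require Import measurable_realfun.
From mathcomp Require Import ring lra.
Set Implicit Arguments.
Unset Strict Implicit.
Unset Printing Implicit Defensive.
Import Order.TTheory GRing.Theory Num.Theory.
Import numFieldNormedType.Exports.
Local Open Scope classical_set_scope.
Local Open Scope ring_scope.

(** Two features of the setting shape the proof. A trajectory is a record of plain functions, and
    its time derivative acts, at almost every time, on a function [w] without its gradient. A state
    is therefore assembled field by field from strongly convergent sequences, and this is why
    minimizing sequences are made Cauchy, at a geometric rate which also passes to almost every time
    slice. Secondly, the surface measure is a Hausdorff measure on a boundary that is only locally a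
    rotated Lipschitz graph. What is extracted from it is that boundary pieces of radius [d] have
    measure at most a constant times [d ^+ n.-1]; together with uniform cones pointing into the
    domain this yields traces, density of smooth functions and the Ehrling inequality. The terminal
    and boundary terms of J'' are not controlled by the norm of z in L^2(Q) alone, but the energy
    estimate bounds them by a multiple of that norm squared and an arbitrarily small multiple of
    |v|^2. This is what makes finitely many functionals of z sufficient for coercivity. *)

Lemma eqW {disp} {P : porderType disp} (x y : P) : x = y -> (x <= y)%O. Proof. by move->. Qed.

(** * Hilbert space calculus for square integrable functions *)

Section L2_space.
Context {R : realType} {dsp} {X : measurableType dsp}.
Variables (m : {measure set X -> \bar R}) (D : set X).
Hypothesis mD : measurable D.
Local Notation L := (L2 m D).
Local Notation sq := (sqnorm m D).
Local Notation intble f := (m.-integrable D (fun x => (f x)%:E)).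
Implicit Types f g h b : X -> R.

Definition inner f g : R := \int[m]_(x in D) (f x * g x).
Local Notation ip := inner.

Lemma le_intble f g : measurable_fun D f -> (forall x, D x -> `|f x| <= g x) ->
  intble g -> intble f.
Proof.
move=> mf fg ig; apply: (le_integrable mD _ _ ig); first exact/measurable_EFinP.
by move=> x Dx /=; rewrite lee_fin (le_trans (fg x Dx))// ler_norm.
Qed.

Lemma intbleD f g : intble f -> intble g -> intble (fun x => f x + g x).
Proof. by move=> i1 i2; have := integrableD mD i1 i2. Qed.

Lemma intbleZ c f : intble f -> intble (fun x => c * f x).
Proof. by move=> i1; have := integrableZl mD c i1. Qed.

Lemma intbleN f : intble f -> intble (fun x => - f x).
Proof. by move=> /(intbleZ (-1)); apply: eq_integrable => // x _; rewrite mulN1r. Qed.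

Lemma intbleB f g : intble f -> intble g -> intble (fun x => f x - g x).
Proof. by move=> i1 /intbleN i2; exact: intbleD. Qed.

Lemma intble_sum (I : Type) (s : seq I) (F : I -> X -> R) :
  (forall i, intble (F i)) -> intble (fun x => \sum_(i <- s) F i x).
Proof.
move=> iF; elim: s => [|i s ih].
  by apply: eq_integrable (integrable0 _ _) => // x _; rewrite big_nil.
by apply: eq_integrable (intbleD (iF i) ih) => // x _; rewrite big_cons.
Qed.

Lemma L2_meas f : L f -> measurable_fun D f. Proof. by case. Qed.

Lemma L2_eq f g : (forall x, D x -> f x = g x) -> L f -> L g.
Proof.
move=> fg [mf intf]; split.
  by apply: eq_measurable_fun mf => x /set_mem /fg.
by apply: eq_integrable intf => // x /set_mem /fg ->.
Qed.

Lemma L2_intble f : measurable_fun D f -> intble (fun x => f x ^+ 2) -> L f.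
Proof. by []. Qed.

Lemma L2M f g : L f -> L g -> intble (fun x => f x * g x).
Proof.
move=> [mf f2] [mg g2]; apply: (@le_intble _ (fun x => f x ^+ 2 + g x ^+ 2)).
- exact: measurable_funM.
- move=> x _; rewrite normrM -(real_normK (num_real (f x))) -(real_normK (num_real (g x))).
  have := sqr_ge0 (`|f x| - `|g x|); nra.
- exact: intbleD.
Qed.

Lemma L2D f g : L f -> L g -> L (fun x => f x + g x).
Proof.
move=> Lf Lg; split; first by apply: measurable_funD; exact: L2_meas.
apply: eq_integrable (intbleD (intbleD Lf.2 (intbleZ 2 (L2M Lf Lg))) Lg.2) => //.
by move=> x _; congr EFin; ring.
Qed.

Lemma L2Z c f : L f -> L (fun x => c * f x).
Proof.
move=> Lf; split; first by apply: measurable_funM; [exact: measurable_cst|exact: L2_meas].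
by apply: eq_integrable (intbleZ (c ^+ 2) Lf.2) => // x _; rewrite exprMn.
Qed.

Lemma L2N f : L f -> L (fun x => - f x).
Proof. by move=> /(L2Z (-1)); apply: L2_eq => x _; rewrite mulN1r. Qed.

Lemma L2B f g : L f -> L g -> L (fun x => f x - g x).
Proof. by move=> Lf /L2N; exact: L2D. Qed.

Lemma L2_0 : L (fun _ => 0).
Proof.
split; first exact: measurable_cst.
by apply: eq_integrable (integrable0 _ _) => // x _; rewrite expr0n.
Qed.

Lemma L2_sum (I : Type) (s : seq I) (F : I -> X -> R) :
  (forall i, L (F i)) -> L (fun x => \sum_(i <- s) F i x).
Proof.
move=> iF; elim: s => [|i s ih].
  by apply: L2_eq L2_0 => x _; rewrite big_nil.
by apply: L2_eq (L2D (iF i) ih) => x _; rewrite big_cons.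
Qed.

Lemma ae_ge0P (P : X -> Prop) : (\forall x \ae m, D x -> P x) ->
  exists N, [/\ measurable N, m N = 0%E & forall x, D x -> ~ N x -> P x].
Proof.
move=> [N [mN N0 hN]]; exists N; split => // x Dx nNx.
by apply: contrapT => nP; apply: nNx; apply: hN => /(_ Dx).
Qed.

Lemma le_L2 f g : measurable_fun D f -> L g ->
  (\forall x \ae m, D x -> `|f x| <= `|g x|) -> L f.
Proof.
move=> mf [mg g2] fg; split => //; apply/integrableP; split.
  by apply/measurable_EFinP; exact: measurable_funX.
have /integrableP[_] := g2; apply: le_lt_trans.
apply: ae_ge0_le_integral => //.
- by apply: measurableT_comp => //; apply/measurable_EFinP; exact: measurable_funX.
- by apply: measurableT_comp => //; apply/measurable_EFinP; exact: measurable_funX.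
apply: filterS fg => x fgx Dx /=.
by rewrite lee_fin !normrX lerXn2r// fgx.
Qed.

Lemma L2_bM b f : Linfty m D b -> L f -> L (fun x => b x * f x).
Proof.
move=> [mb [M bM]] Lf; apply: (@le_L2 _ (fun x => M * f x)).
- by apply: measurable_funM => //; exact: L2_meas.
- exact: L2Z.
- apply: filterS bM => x bM Dx; rewrite !normrM ler_wpM2r//.
  by rewrite (le_trans (bM Dx))// ler_norm.
Qed.

Lemma sq_ge0 f : 0 <= sq f.
Proof. by apply: Rintegral_ge0 => x _; exact: sqr_ge0. Qed.

Lemma sqE f : sq f = ip f f.
Proof. by []. Qed.

Lemma eq_sq f g : (forall x, D x -> f x = g x) -> sq f = sq g.
Proof. by move=> fg; apply: eq_Rintegral => x /set_mem /fg ->. Qed.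

Lemma eq_ip f g f' g' : (forall x, D x -> f x * g x = f' x * g' x) -> ip f g = ip f' g'.
Proof. by move=> fg; apply: eq_Rintegral => x /set_mem /fg ->. Qed.

Lemma ipC f g : ip f g = ip g f.
Proof. by apply: eq_ip => x _; rewrite mulrC. Qed.

Lemma ipDl f g h : L f -> L g -> L h -> ip (fun x => f x + g x) h = ip f h + ip g h.
Proof.
move=> Lf Lg Lh; rewrite /ip -RintegralD//; try exact: L2M.
by apply: eq_Rintegral => x _; rewrite mulrDl.
Qed.

Lemma ipZl c f h : L f -> L h -> ip (fun x => c * f x) h = c * ip f h.
Proof.
move=> Lf Lh; rewrite /ip -RintegralZl//; try exact: L2M.
by apply: eq_Rintegral => x _; rewrite mulrA.
Qed.

Lemma ipBl f g h : L f -> L g -> L h -> ip (fun x => f x - g x) h = ip f h - ip g h.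
Proof.
move=> Lf Lg Lh; rewrite ipDl//; last exact: L2N.
congr (_ + _); rewrite -[RHS]mulN1r -ipZl//; apply: eq_ip => x _; ring.
Qed.

Lemma ipDr f g h : L f -> L g -> L h -> ip h (fun x => f x + g x) = ip h f + ip h g.
Proof. by move=> *; rewrite !(ipC h) ipDl. Qed.

Lemma ipZr c f h : L f -> L h -> ip h (fun x => c * f x) = c * ip h f.
Proof. by move=> *; rewrite !(ipC h) ipZl. Qed.

Lemma ipBr f g h : L f -> L g -> L h -> ip h (fun x => f x - g x) = ip h f - ip h g.
Proof. by move=> *; rewrite !(ipC h) ipBl. Qed.

Lemma sqD f g : L f -> L g -> sq (fun x => f x + g x) = sq f + 2 * ip f g + sq g.
Proof.
move=> Lf Lg; have Lfg := L2D Lf Lg.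
rewrite sqE ipDl// !ipDr// (ipC g f) -!sqE; ring.
Qed.

Lemma sqZ c f : L f -> sq (fun x => c * f x) = c ^+ 2 * sq f.
Proof. by move=> Lf; have := L2Z c Lf => Lc; rewrite sqE ipZl// ipZr// -sqE; ring. Qed.

Lemma sqN f : sq (fun x => - f x) = sq f.
Proof. by apply: eq_Rintegral => x _; rewrite sqrrN. Qed.

Lemma sqB f g : L f -> L g -> sq (fun x => f x - g x) = sq f - 2 * ip f g + sq g.
Proof.
move=> Lf Lg; rewrite sqD ?sqN//; last exact: L2N.
by congr (_ + _ + _); rewrite -mulrN; congr (_ * _); rewrite -mulN1r -ipZr//; apply: eq_ip => x _; ring.
Qed.

Lemma sqBC f g : sq (fun x => f x - g x) = sq (fun x => g x - f x).
Proof. by apply: eq_Rintegral => x _; ring. Qed.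

Lemma sq_parallelogram f g : L f -> L g ->
  sq (fun x => f x + g x) + sq (fun x => f x - g x) = 2 * sq f + 2 * sq g.
Proof. by move=> Lf Lg; rewrite sqD// sqB//; ring. Qed.

Lemma sqD_le f g : L f -> L g -> sq (fun x => f x + g x) <= 2 * sq f + 2 * sq g.
Proof.
by move=> Lf Lg; rewrite -sq_parallelogram// lerDl sq_ge0.
Qed.

Lemma sqB_le f g : L f -> L g -> sq (fun x => f x - g x) <= 2 * sq f + 2 * sq g.
Proof.
by move=> Lf Lg; rewrite -sq_parallelogram// lerDr sq_ge0.
Qed.

Lemma ip_young e f g : 0 < e -> L f -> L g -> 2 * `|ip f g| <= e * sq f + e^-1 * sq g.
Proof.
move=> e0 Lf Lg.
(* The sign [s] treats both signs of the pairing at once: expand the square norm of [g - s e f] and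
   divide by [e]. *)
have key s : s ^+ 2 = 1 -> 2 * (s * ip f g) <= e * sq f + e^-1 * sq g.
  move=> s1; have := sq_ge0 (fun x => (- (s * e)) * f x + g x).
  rewrite sqD//; last exact: L2Z.
  rewrite sqZ// ipZl// sqrrN exprMn s1 mul1r => h.
  have : 0 <= e^-1 * (e ^+ 2 * sq f + 2 * (- (s * e) * ip f g) + sq g).
    by apply: mulr_ge0 => //; rewrite invr_ge0 ltW.
  have -> : e^-1 * (e ^+ 2 * sq f + 2 * (- (s * e) * ip f g) + sq g) =
     (e * sq f + e^-1 * sq g) - 2 * (s * ip f g).
    by field; rewrite gt_eqF.
  by rewrite subr_ge0.
have [h|h] := ger0P (ip f g).
  by have := key 1 (expr1n _ _); rewrite mul1r.
by have := key (-1) (etrans (sqrrN _) (expr1n _ _)); rewrite mulN1r.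
Qed.

Lemma ip_sq f g : L f -> L g -> ip f g ^+ 2 <= sq f * sq g.
Proof.
move=> Lf Lg; have [f0|f0] := eqVneq (sq f) 0.
  have [->|p0] := eqVneq (ip f g) 0; first by rewrite expr0n/= f0 mul0r.
  (* If [f] has norm 0 but pairs nontrivially with [g], adding this multiple of [f] to [g] would
     give the square norm -1. *)
  have := sq_ge0 (fun x => (- ((sq g + 1) / (2 * ip f g))) * f x + g x).
  rewrite sqD//; last exact: L2Z.
  rewrite sqZ// ipZl// f0 mulr0.
  have -> : 0 + 2 * (- ((sq g + 1) / (2 * ip f g)) * ip f g) + sq g = - 1.
    by field.
  by rewrite ler0N1.
have fp : 0 < sq f by rewrite lt_def f0 sq_ge0.
have := sq_ge0 (fun x => (- (ip f g / sq f)) * f x + g x).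
rewrite sqD//; last exact: L2Z.
rewrite sqZ// ipZl//.
have -> : (- (ip f g / sq f)) ^+ 2 * sq f + 2 * (- (ip f g / sq f) * ip f g) + sq g =
  (sq f * sq g - ip f g ^+ 2) / sq f by field.
by rewrite pmulr_lge0 ?invr_gt0// subr_ge0.
Qed.

Lemma ip_le f g : L f -> L g -> `|ip f g| <= Num.sqrt (sq f) * Num.sqrt (sq g).
Proof.
move=> Lf Lg; rewrite -sqrtrM ?sq_ge0// -sqrtr_sqr ler_sqrt ?ip_sq//.
by rewrite mulr_ge0 ?sq_ge0.
Qed.

Lemma esq f : L f -> (\int[m]_(x in D) (f x ^+ 2)%:E)%E = (sq f)%:E.
Proof. by move=> [_ f2]; rewrite fineK//; exact: integrable_fin_num. Qed.

Lemma L2_lty f : measurable_fun D f ->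
  ((\int[m]_(x in D) (f x ^+ 2)%:E) < +oo)%E -> L f.
Proof.
move=> mf fo; split => //; apply/integrableP; split.
  by apply/measurable_EFinP; exact: measurable_funX.
by under eq_integral do rewrite gee0_abs ?lee_fin ?sqr_ge0//.
Qed.

Lemma le_sq f g : L f -> L g -> (\forall x \ae m, D x -> `|f x| <= `|g x|) -> sq f <= sq g.
Proof.
move=> Lf Lg fg; rewrite -lee_fin -!esq//; apply: ae_ge0_le_integral => //.
- by move=> x _; rewrite lee_fin sqr_ge0.
- by apply/measurable_EFinP; apply: measurable_funX; exact: L2_meas.
- by move=> x _; rewrite lee_fin sqr_ge0.
- by apply/measurable_EFinP; apply: measurable_funX; exact: L2_meas.
apply: filterS fg => x fgx Dx.
by rewrite lee_fin -(real_normK (num_real (f x))) -(real_normK (num_real (g x))) lerXn2r// fgx.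
Qed.

Lemma sq0_ae f : L f -> sq f = 0 -> \forall x \ae m, D x -> f x = 0.
Proof.
move=> Lf f0; have e0 : (\int[m]_(x in D) `|(f x ^+ 2)%:E| = 0)%E.
  by under eq_integral do rewrite gee0_abs ?lee_fin ?sqr_ge0//; rewrite esq// f0.
have := (ae_eq_integral_abs m mD (measurable_int m Lf.2)).1 e0.
by apply: filterS => x h /h /= [/eqP]; rewrite sqrf_eq0 => /eqP.
Qed.

Lemma ae_sq0 f : measurable_fun D f -> (\forall x \ae m, D x -> f x = 0) -> L f /\ sq f = 0.
Proof.
move=> mf f0; have Lf : L f.
  by apply: (le_L2 mf L2_0); apply: filterS f0 => x h /h ->.
split => //; apply/eqP; rewrite eq_le sq_ge0 andbT.
have := le_sq Lf L2_0; rewrite [X in _ <= X](_ : _ = 0).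
  by apply; apply: filterS f0 => x h /h ->.
rewrite /sqnorm /Rintegral (eq_integral (cst 0%E)) ?integral0// => x _.
by rewrite expr0n.
Qed.

Lemma sqD_cvg0 (u v : nat -> X -> R) : (forall k, L (u k)) -> (forall k, L (v k)) ->
  sq (u k) @[k --> \oo] --> 0 -> sq (v k) @[k --> \oo] --> 0 ->
  sq (fun x => u k x + v k x) @[k --> \oo] --> 0.
Proof.
move=> Lu Lv u0 v0.
have h : 2 * (sq (u k) + sq (v k)) @[k --> \oo] --> (0 : R).
  rewrite -[X in _ --> X](mulr0 2); apply: cvgM; first exact: cvg_cst.
  by rewrite -[X in _ --> X](addr0 0); apply: cvgD.
apply: squeeze_cvgr h; last exact: cvg_cst.
by near=> k; rewrite sq_ge0/= mulrDr sqD_le.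
Unshelve. all: by end_near. Qed.

Lemma ip_cvg0 (u v : nat -> X -> R) M : (forall k, L (u k)) -> (forall k, L (v k)) ->
  sq (u k) @[k --> \oo] --> 0 -> (forall k, sq (v k) <= M) ->
  ip (u k) (v k) @[k --> \oo] --> 0.
Proof.
move=> Lu Lv u0 vM; apply/norm_cvg0P.
have M0 : 0 <= M by apply: le_trans (vM 0%N); exact: sq_ge0.
apply: (@squeeze_cvgr _ _ _ _ (fun=> 0) (fun k => Num.sqrt (sq (u k) * M))).
- near=> k; rewrite normr_ge0/= (le_trans (ip_le (Lu k) (Lv k)))// sqrtrM ?sq_ge0//.
  by rewrite ler_wpM2l// ler_sqrt.
- exact: cvg_cst.
- have h : sq (u k) * M @[k --> \oo] --> 0 * M by apply: cvgM => //; exact: cvg_cst.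
  have := cvg_comp _ _ h (@sqrt_continuous R (0 * M)).
  by rewrite mul0r sqrtr0.
Unshelve. all: by end_near. Qed.

Lemma sq_cvg_bound (u : nat -> X -> R) f : (forall k, L (u k)) -> L f ->
  sq (fun x => u k x - f x) @[k --> \oo] --> 0 -> exists M, forall k, sq (u k) <= M.
Proof.
move=> Lu Lf uf.
have /cvg_seq_bounded[B [_ hB]] : cvgn (fun k => sq (fun x => u k x - f x)) by apply/cvg_ex; exists 0.
exists (2 * (B + 1) + 2 * sq f) => k.
rewrite (eq_sq (g := fun x => (u k x - f x) + f x)); last by move=> x _; ring.
apply: (le_trans (sqD_le _ Lf)); first exact: L2B.
rewrite lerD2r ler_pM2l//; apply: le_trans (ler_norm _) _.
by apply: hB; rewrite ?ltrDl.
Qed.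

Lemma ip_cvg (u v : nat -> X -> R) f g : (forall k, L (u k)) -> (forall k, L (v k)) ->
  L f -> L g ->
  sq (fun x => u k x - f x) @[k --> \oo] --> 0 ->
  sq (fun x => v k x - g x) @[k --> \oo] --> 0 ->
  ip (u k) (v k) @[k --> \oo] --> ip f g.
Proof.
move=> Lu Lv Lf Lg uf vg.
have [M hM] := sq_cvg_bound Lv Lg vg.
have h1 := ip_cvg0 (fun k => L2B (Lu k) Lf) Lv uf hM.
have h2 := ip_cvg0 (M := sq f) (fun k => L2B (Lv k) Lg) (fun=> Lf) vg (fun=> lexx _).
have -> : (fun k => ip (u k) (v k)) = (fun k => ip (fun x => u k x - f x) (v k) +
   ip (fun x => v k x - g x) f + ip f g).
  apply/funext => k; rewrite !ipBl// (ipC (v k)) (ipC g); ring.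
rewrite -[X in _ --> X]add0r; apply: cvgD; last exact: cvg_cst.
by rewrite -[X in _ --> X]addr0; apply: cvgD.
Qed.

Lemma sq_cvg (u : nat -> X -> R) f : (forall k, L (u k)) -> L f ->
  sq (fun x => u k x - f x) @[k --> \oo] --> 0 -> sq (u k) @[k --> \oo] --> sq f.
Proof.
by move=> Lu Lf uf; exact: ip_cvg.
Qed.

End L2_space.

(** A hook of [mfun_rec], redefined once continuous functions and translations of row vectors are
    known to be measurable. *)
Ltac mleaf := fail.

Ltac mhyp := match goal with
  | H : L2 _ _ ?f |- measurable_fun _ ?f => exact: H.1
  | H : Linfty _ _ ?f |- measurable_fun _ ?f => exact: H.1
  | H : forall i, L2 _ _ (?f i) |- measurable_fun _ (?f ?j) => exact: (H j).1
  | H : continuous ?f |- measurable_fun _ ?f => exact: (continuous_measurable_fun H)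
  | H : measurable_fun ?D ?f |- measurable_fun ?D ?f => exact: H
  | H : forall i, measurable_fun ?D (?f i) |- measurable_fun ?D (?f ?j) => exact: H
  | H : measurable_fun setT ?f |- measurable_fun _ ?f => exact: measurable_funTS
  | H : L2 _ _ ?f |- measurable_fun _ (fun x => ?f x) => exact: H.1
  end.

Ltac mfun_rec := rewrite /=; first [ mhyp | lazymatch goal with
  | |- measurable_fun _ (fun _ => ?c) => exact: measurable_cst
  | |- measurable_fun _ (fun x => (@?f x)%:E) => apply/measurable_EFinP; mfun_rec
  | |- measurable_fun _ (EFin \o _) => apply/measurable_EFinP; mfun_rec
  | |- measurable_fun _ (fun x => @?f x ^+ _) => apply: measurable_funX; mfun_rec
  | |- measurable_fun _ (fun x => @?f x - @?g x) => apply: measurable_funB; mfun_rec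
  | |- measurable_fun _ (fun x => @?f x + @?g x) => apply: measurable_funD; mfun_rec
  | |- measurable_fun _ (fun x => @?f x * @?g x) => apply: measurable_funM; mfun_rec
  | |- measurable_fun _ (fun x => - @?f x) => apply: measurable_funN; mfun_rec
  | |- measurable_fun _ (fun x => `|@?f x|) => apply: (measurableT_comp (@normr_measurable _ setT)); mfun_rec
  | |- measurable_fun _ (fun x => (@?f x, @?g x)) => apply/measurable_fun_pair; split; mfun_rec
  | |- measurable_fun _ (fun x => fst (@?f x)) => apply: (measurableT_comp measurable_fst); mfun_rec
  | |- measurable_fun _ (fun x => snd (@?f x)) => apply: (measurableT_comp measurable_snd); mfun_rec
  | |- measurable_fun _ (fun x => x) => exact: measurable_id
  | |- measurable_fun _ (fun x => fun_of_matrix (@?f x) _ _) => apply: (measurableT_comp (measurable_coord _)); mfun_rec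
  | |- measurable_fun _ fst => exact: measurable_funTS measurable_fst
  | |- measurable_fun _ snd => exact: measurable_funTS measurable_snd
  | |- measurable_fun _ (\1_ _) => exact: measurable_indic
  | |- measurable_fun _ (fun x => \1_ _ (@?f x)) => apply: (measurableT_comp (measurable_indic _)); mfun_rec
  | |- measurable_fun _ (fun x => ?F (@?f x)) => apply: (measurableT_comp (f := F)); mfun_rec
  | |- measurable_fun _ _ => mleaf
  | |- _ => by []
  end ].
Ltac mfun := by intros; mfun_rec.

(** * Convergence at a geometric rate and completeness of L2 *)

Lemma cvg_geo {R : realType} (q c : R) : `|q| < 1 -> c * q ^+ k @[k --> \oo] --> 0.
Proof.
by move=> q1; rewrite -[X in _ --> X](mulr0 c); apply: (cvgM (cvg_cst _)); exact: cvg_expr.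
Qed.

Lemma near_cvg0_lt {R : realType} (u : nat -> R) (e : R) : 0 < e -> u k @[k --> \oo] --> 0 ->
  exists N, forall k, (N <= k)%N -> `|u k| < e.
Proof.
move=> e0 /cvgr0Pnorm_lt /(_ e e0) [N _ h]; exists N => k Nk; exact: h.
Qed.

Lemma geometric_cvg {R : realType} (u : nat -> R) (C q : R) : 0 <= q -> q < 1 ->
  (forall k, `|u k.+1 - u k| <= C * q ^+ k) -> cvgn u.
Proof.
move=> q0 q1 h.
have -> : u = (fun n => u 0%N + series (telescope u) n) by apply/funext => n; exact: eq_sum_telescope.
apply: is_cvgD; first exact: is_cvg_cst.
apply: normed_cvg; apply: (@series_le_cvg _ _ (geometric C q)) => //.
- by move=> n /=.
- by move=> n; exact: le_trans (h n).
- by apply: is_cvg_geometric_series; rewrite ger0_norm.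
Qed.

(** The sum of the [h k] has a finite integral, hence is finite almost everywhere, and the terms of
    a convergent series tend to 0. *)
Lemma summable_ae_cvg0 {R : realType} {d} {X : measurableType d} (m : {measure set X -> \bar R}) (D : set X) (h : nat -> X -> R) C q :
  measurable D -> (forall k, measurable_fun D (h k)) -> (forall k x, 0 <= h k x) -> 0 <= q < 1 ->
  (forall k, (\int[m]_(x in D) (h k x)%:E <= (C * q ^+ k)%:E)%E) -> \forall x \ae m, D x -> h k x @[k --> \oo] --> 0.
Proof.
move=> mD mh h0 /andP[q0 q1] hh; pose e k x := (h k x)%:E.
have me k : measurable_fun D (e k) by apply/measurable_EFinP.
have e0 k x : (0 <= e k x)%E by rewrite lee_fin.
have fin : (\int[m]_(x in D) (\sum_(k <oo) e k x) < +oo)%E.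
  rewrite integral_nneseries//; apply: (@le_lt_trans _ _ (\sum_(k <oo) (C * q ^+ k)%:E)%E).
    by apply: lee_nneseries => [k _ _|k _]; [exact: integral_ge0|exact: hh].
  suff -> : (\sum_(k <oo) (C * q ^+ k)%:E)%E = (C / (1 - q))%:E by rewrite ltry.
  apply: cvg_lim => //; rewrite (_ : (fun n => _) = EFin \o series (geometric C q)).
    by apply: cvg_EFin; [exact: nearW|apply: cvg_geometric_series; rewrite ger0_norm].
  by apply/funext => n /=; rewrite -sumEFin.
have ie : m.-integrable D (fun x => \sum_(k <oo) e k x)%E.
  apply/integrableP; split; first by apply: ge0_emeasurable_sum => // k x _ _.
  by under eq_integral do rewrite gee0_abs ?nneseries_ge0//.
have := integrable_ae mD ie; apply: filterS => x hx Dx; have {hx} := hx Dx => Sfin.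
apply: cvg_series_cvg_0; apply: nondecreasing_is_cvgn; first by apply: nondecreasing_series => k _ _.
exists (fine (\sum_(k <oo) e k x)%E) => _ [k _ <-]; rewrite -lee_fin fineK// -sumEFin.
exact: (@nneseries_lim_ge _ (fun i => e i x) xpredT 0%N k (fun i _ _ => e0 i x)).
Qed.

Section L2_complete.
Context {R : realType} {dsp} {X : measurableType dsp}.
Variables (m : {measure set X -> \bar R}) (D : set X).
Hypothesis mD : measurable D.
Variable f : nat -> X -> R.
Hypothesis Lf : forall k, L2 m D (f k).
Hypothesis fast : forall k, sqnorm m D (fun x => f k.+1 x - f k x) <= 8^-1 ^+ k.

(** The squared increments weighted by [4 ^+ k] still have integrals at most [2^-1 ^+ k], so they
    are bounded in [k] at almost every point, and the increments themselves are at most a constant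
    times [2^-1 ^+ k] there. The rate 1/8 leaves room for this. *)
Lemma fast_ae_cvg : \forall x \ae m, D x -> cvgn (fun k => f k x).
Proof.
pose e k x := 4 ^+ k * (f k.+1 x - f k x) ^+ 2.
have me k : measurable_fun D (e k) by rewrite /e; mfun.
have e0 k x : 0 <= e k x by rewrite mulr_ge0 ?sqr_ge0.
have h2 : 0 <= (2^-1 : R) < 1 by apply/andP; split; lra.
have he k : (\int[m]_(x in D) (e k x)%:E <= (1 * 2^-1 ^+ k)%:E)%E.
  under eq_integral do rewrite /e EFinM.
  rewrite ge0_integralZl_EFin//; [|by move=> x _; rewrite lee_fin sqr_ge0|mfun].
  rewrite (esq mD); last exact: L2B.
  rewrite lee_fin mul1r (_ : 2^-1 ^+ k = 4 ^+ k * 8^-1 ^+ k); last by rewrite -exprMn; congr (_ ^+ _); lra.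
  by rewrite ler_wpM2l.
apply: filterS (summable_ae_cvg0 mD me e0 h2 he) => x h Dx.
have /cvg_seq_bounded[B [_ hB]] : cvgn (fun k => e k x) by apply/cvg_ex; exists 0; exact: h.
have bnd k : e k x <= B + 1 by apply: le_trans (ler_norm _) _; apply: hB; rewrite ?ltrDl.
have B0 : 0 <= B + 1 := le_trans (e0 0%N x) (bnd 0%N).
apply: (@geometric_cvg _ _ (Num.sqrt (B + 1)) 2^-1) => //; first lra.
move=> k; rewrite -sqrtr_sqr (_ : 2^-1 ^+ k = Num.sqrt (4^-1 ^+ k)); last first.
  by rewrite -[LHS]ger0_norm// -sqrtr_sqr -exprM mulnC exprM; congr (Num.sqrt (_ ^+ _)); lra.
rewrite -sqrtrM// ler_wsqrtr//.
rewrite exprVn ler_pdivlMr// mulrC; exact: bnd.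
Qed.

Lemma fast_tail k l : (k <= l)%N -> sqnorm m D (fun x => f l x - f k x) <= 4 * 8^-1 ^+ k.
Proof.
move=> /subnK <-; move: (l - k)%N => n; elim: n k => [k|n ih k].
  rewrite (@eq_sq _ _ _ m D _ (fun _ => 0 * 0)); last by move=> x _; ring.
  by rewrite (sqZ _ _ (L2_0 m mD))// expr0n/= mul0r//.
have -> : (n.+1 + k = n + k.+1)%N by rewrite addnS.
rewrite (@eq_sq _ _ _ m D _ (fun x => (f k.+1 x - f k x) + (f (n + k.+1)%N x - f k.+1 x))); last by move=> x _; ring.
apply: (le_trans (sqD_le mD (L2B mD (Lf _) (Lf _)) (L2B mD (Lf _) (Lf _)))).
have := fast k; have := ih k.+1; rewrite exprS.
have : 0 <= (8^-1 : R) ^+ k by [].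
by lra.
Qed.

Lemma L2_complete : exists g, [/\ L2 m D g,
  sqnorm m D (fun x => f k x - g x) @[k --> \oo] --> 0,
  (forall k, sqnorm m D (fun x => f k x - g x) <= 4 * 8^-1 ^+ k) &
  \forall x \ae m, D x -> f k x @[k --> \oo] --> g x].
Proof.
have [N [mN N0 hN]] := ae_ge0P fast_ae_cvg.
(* Multiplying by the indicator of the complement of [N] gives a sequence that converges at every
   point of [D], so that its limit is measurable. *)
pose g x := limn (fun k => f k x * \1_(~` N) x).
have fN x : N x -> (fun k => f k x * \1_(~` N) x) = fun=> 0.
  by move=> Nx; apply/funext => k; rewrite indicE memNset ?mulr0// => /(_ Nx).
have fNC x : ~ N x -> (fun k => f k x * \1_(~` N) x) = fun k => f k x.
  by move=> Nx; apply/funext => k; rewrite indicE mem_set ?mulr1.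
have fg x : D x -> f k x * \1_(~` N) x @[k --> \oo] --> g x.
  move=> Dx; rewrite /g; have [Nx|nNx] := pselect (N x).
    by rewrite (fN x Nx); apply: is_cvg_cst.
  by rewrite (fNC x nNx); exact: (hN x Dx nNx).
have mg : measurable_fun D g.
  apply: (@measurable_fun_cvg _ _ _ _ (fun k x => f k x * \1_(~` N) x)) => //.
  move=> k; apply: measurable_funM; first mfun.
  by apply: measurable_indic; exact: measurableC.
have aefg : \forall x \ae m, D x -> f k x @[k --> \oo] --> g x.
  exists N; split=> // x /= h; apply: contrapT => nNx; apply: h => Dx.
  by have := fg x Dx; rewrite (fNC x nNx).
(* Fatou's lemma with [f k] fixed turns the bound on the tails into a rate towards the limit. *)
have est k : (\int[m]_(x in D) ((f k x - g x) ^+ 2)%:E <= (4 * 8^-1 ^+ k)%:E)%E.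
  pose h l x := ((f l x - f k x) ^+ 2)%:E.
  have mh l : measurable_fun D (h l).
    by apply/measurable_EFinP; mfun.
  have h0 l x : D x -> (0 <= h l x)%E by move=> _; rewrite lee_fin sqr_ge0.
  have := fatou m mD mh h0.
  rewrite (@ge0_ae_eq_integral _ _ _ m D _ (fun x => ((f k x - g x) ^+ 2)%:E)) //; first last.
  - apply: filterS aefg => x hx Dx.
    rewrite is_cvg_limn_einfE.
      apply: cvg_lim => //; apply: cvg_EFin; first exact: nearW.
      have -> : (f k x - g x) ^+ 2 = (g x - f k x) ^+ 2 by ring.
      apply: (@cvg_comp _ _ _ (fun l => f l x - f k x) (fun y => y ^+ 2)); last exact: exprn_continuous.
      by apply: cvgB; [exact: hx|exact: cvg_cst].
    apply/cvg_ex; exists ((g x - f k x) ^+ 2)%:E; apply: cvg_EFin; first exact: nearW.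
    apply: (@cvg_comp _ _ _ (fun l => f l x - f k x) (fun y => y ^+ 2)); last exact: exprn_continuous.
    by apply: cvgB; [exact: hx|exact: cvg_cst].
  - by move=> x _; rewrite lee_fin sqr_ge0.
  - move=> x Dx; rewrite limn_einf_lim; apply: lime_ge; first exact: is_cvg_einfs.
    by near=> n; apply: le_ereal_inf_tmp => _ [l _ <-]; exact: h0.
  - mfun.
  - rewrite (_ : (fun x => _) = (fun x => - limn_esup (fun l => - h l x))%E)//.
    apply: measurableT_comp => //; apply: measurable_fun_limn_esup => l.
    mfun.
  move/le_trans; apply; rewrite limn_einf_lim; apply: lime_le.
    exact: is_cvg_einfs.
  near=> n; apply: ge_ereal_inf; exists (\int[m]_(x in D) h (n + k)%N x)%E.
    by exists (n + k)%N => //=; exact: leq_addr.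
  by rewrite (esq mD) ?lee_fin ?fast_tail ?leq_addl//; exact: L2B.
have Lfg k : L2 m D (fun x => f k x - g x).
  apply: L2_lty; first mfun.
  by apply: le_lt_trans (est k) _; rewrite ltry.
have Lg : L2 m D g by apply: (L2_eq mD _ (L2B mD (Lf 0) (Lfg 0))) => x _; ring.
have sqe k : sqnorm m D (fun x => f k x - g x) <= 4 * 8^-1 ^+ k by rewrite -lee_fin -(esq mD).
exists g; split => //.
apply: (@squeeze_cvgr _ _ _ _ (fun=> 0) (fun k => 4 * 8^-1 ^+ k)).
- by near=> k; rewrite sq_ge0 sqe.
- exact: cvg_cst.
- by apply: cvg_geo; rewrite ger0_norm////; lra.
Unshelve. all: by end_near. Qed.

End L2_complete.

(** The theorems of Tonelli and Fubini take sigma-finite measure structures, while [leb] and [sigma]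
    are plain measures; the packed measure is convertible with the original one. *)
Definition pack_sigma_finite {R : realType} {dsp} {X : measurableType dsp}
    (m : {measure set X -> \bar R}) (s : sigma_finite setT m) :
  {sigma_finite_measure set X -> \bar R}.
Proof.
pose h1 := isSFinite.Build _ _ _ _ (sfinite_measure_sigma_finite s).
pose h2 := isSigmaFinite.Build _ _ _ _ s.
exact: (HB.pack_for (SigmaFiniteMeasure.type X R) (Measure.sort m) h1 h2).
Defined.

(** * Sections, Tonelli and Fubini on product sets *)

Section slices.
Context {R : realType} {d1 d2} {X : measurableType d1} {Y : measurableType d2}.
Variables (m1 : {measure set X -> \bar R}) (m2 : {sigma_finite_measure set Y -> \bar R}).
Hypothesis s1 : sigma_finite setT m1.
Variables (A : set X) (B : set Y).
Hypotheses (mA : measurable A) (mB : measurable B).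
Local Notation mu := (m1 \x m2)%E.
Local Notation AB := (A `*` B).
Let M1 := pack_sigma_finite s1.

Let mAB : measurable AB. Proof. exact: measurableX. Qed.

Lemma measurable_ysec d3 (V : measurableType d3) (F : X * Y -> V) y :
  measurable_fun AB F -> B y -> measurable_fun A (fun x => F (x, y)).
Proof.
move=> mF By; apply: (measurable_comp mAB _ mF) => //; last exact: measurable_funTS (pair2_measurable y).
by move=> _ [x Ax <-].
Qed.

Lemma measurable_xsec d3 (V : measurableType d3) (F : X * Y -> V) x :
  measurable_fun AB F -> A x -> measurable_fun B (fun y => F (x, y)).
Proof.
move=> mF By; apply: (measurable_comp mAB _ mF) => //; last exact: measurable_funTS (pair1_measurable x).
by move=> _ [z Az <-].
Qed.

Section tonelli.
Variable F : X * Y -> \bar R.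
Hypotheses (mF : measurable_fun AB F) (F0 : forall q, AB q -> (0 <= F q)%E).
Local Open Scope ereal_scope.

Let G := F \_ AB.
Let mG : measurable_fun setT G. Proof. by apply/(measurable_restrictT _ mAB). Qed.
Let G0 q : 0 <= G q. Proof. by rewrite /G patchE; case: ifPn => // /set_mem; exact: F0. Qed.

Let GY y : \int[m1]_x G (x, y) = ((fun y => \int[m1]_(x in A) F (x, y)) \_ B) y.
Proof.
rewrite patchE; case: ifPn => yB.
  rewrite [RHS]integral_mkcond; apply: eq_integral => x _.
  congr (if _ then _ else _).
  by rewrite in_setX/= yB andbT.
rewrite (eq_integral (cst 0)) ?integral0// => x _.
by rewrite /G patchE in_setX/= (negbTE yB) andbF.
Qed.

Let GX x : \int[m2]_y G (x, y) = ((fun x => \int[m2]_(y in B) F (x, y)) \_ A) x.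
Proof.
rewrite patchE; case: ifPn => xA.
  rewrite [RHS]integral_mkcond; apply: eq_integral => y _.
  congr (if _ then _ else _).
  by rewrite in_setX/= xA.
rewrite (eq_integral (cst 0)) ?integral0// => y _.
by rewrite /G patchE in_setX/= (negbTE xA).
Qed.

Lemma tonelli_measurable_y : measurable_fun B (fun y => \int[m1]_(x in A) F (x, y)).
Proof.
apply/(measurable_restrictT _ mB).
rewrite (_ : _ \_ B = (fun y => \int[m1]_x G (x, y))); last by apply/funext => y.
by have h : measurable_fun setT (fun y => \int[m1]_x G (x, y)) := @measurable_fun_fubini_tonelli_G _ _ _ _ _ M1 G mG G0.
Qed.

Lemma tonelli_measurable_x : measurable_fun A (fun x => \int[m2]_(y in B) F (x, y)).
Proof.
apply/(measurable_restrictT _ mA).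
rewrite (_ : _ \_ A = (fun x => \int[m2]_y G (x, y))); last by apply/funext => x.
by have h : measurable_fun setT (fun x => \int[m2]_y G (x, y)) := @measurable_fun_fubini_tonelli_F _ _ _ _ _ m2 G mG G0.
Qed.

Lemma tonelli_y : \int[mu]_(q in AB) F q = \int[m2]_(y in B) \int[m1]_(x in A) F (x, y).
Proof.
have h : \int[mu]_q G q = \int[m2]_y \int[m1]_x G (x, y) := @fubini_tonelli2 _ _ _ _ _ M1 m2 G mG G0.
rewrite [LHS]integral_mkcond -/G h [RHS]integral_mkcond.
by apply: eq_integral => y _.
Qed.

Lemma tonelli_x : \int[mu]_(q in AB) F q = \int[m1]_(x in A) \int[m2]_(y in B) F (x, y).
Proof.
have h : \int[mu]_q G q = \int[m1]_x \int[m2]_y G (x, y) := @fubini_tonelli1 _ _ _ _ _ M1 m2 G mG G0.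
rewrite [LHS]integral_mkcond -/G h [RHS]integral_mkcond.
by apply: eq_integral => y _.
Qed.

End tonelli.

Lemma measurable_slice_int (F : X * Y -> R) : measurable_fun AB F ->
  measurable_fun B (fun y => \int[m1]_(x in A) F (x, y)).
Proof.
move=> mF; rewrite /Rintegral.
apply: (measurableT_comp (@fine_measurable _ _ measurableT)).
under eq_fun do rewrite integralE.
have mE : measurable_fun AB (EFin \o F) by mfun.
apply: emeasurable_funB.
- rewrite (_ : (fun x => _) = fun y => \int[m1]_(x in A) (EFin \o F)^\+%E (x, y))%E; last first.
    by apply/funext => y; apply: eq_integral => x _; rewrite !funeposE.
  by apply: tonelli_measurable_y => //; exact: measurable_funepos.
- rewrite (_ : (fun x => _) = fun y => \int[m1]_(x in A) (EFin \o F)^\-%E (x, y))%E; last first.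
    by apply/funext => y; apply: eq_integral => x _; rewrite !funenegE.
  by apply: tonelli_measurable_y => //; exact: measurable_funeneg.
Qed.

Section fubini.
Variable F : X * Y -> R.
Hypothesis iF : mu.-integrable AB (fun q => (F q)%:E).

Let mF : measurable_fun AB F.
Proof. by apply/measurable_EFinP; exact: measurable_int iF. Qed.

Let absF : (\int[m2]_(y in B) \int[m1]_(x in A) `|F (x, y)|%:E < +oo)%E.
Proof.
have /integrableP[_] := iF; rewrite (tonelli_y (F := fun q => `|(F q)%:E|%E))//.
mfun.
Qed.

Let mabs : measurable_fun B (fun y => \int[m1]_(x in A) `|F (x, y)|%:E)%E.
Proof.
apply: (@tonelli_measurable_y (fun q => `|F q|%:E)) => //.
mfun.
Qed.

Lemma slice_intble : \forall y \ae m2, B y -> m1.-integrable A (fun x => (F (x, y))%:E).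
Proof.
have /integrable_ae : m2.-integrable B (fun y => \int[m1]_(x in A) `|F (x, y)|%:E)%E.
  apply/integrableP; split => //.
  by under eq_integral do rewrite gee0_abs ?integral_ge0//.
move=> /(_ mB); apply: filterS => y h By; apply/integrableP; split.
  by apply/measurable_EFinP; exact: measurable_ysec.
by have := h By; rewrite ge0_fin_numE ?integral_ge0.
Qed.

Lemma slice_int_intble : m2.-integrable B (fun y => (\int[m1]_(x in A) F (x, y))%:E).
Proof.
apply/integrableP; split; first by apply/measurable_EFinP; exact: measurable_slice_int.
apply: le_lt_trans absF; apply: ge0_le_integral => //.
- by apply: measurableT_comp => //; apply/measurable_EFinP; exact: measurable_slice_int.
(* Where the section is not absolutely integrable the bound is infinite, whatever default value its
   integral takes. *)
move=> y By; have [ly|ly] := eqVneq (\int[m1]_(x in A) `|F (x, y)|%:E)%E +oo%E.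
  by rewrite ly leey.
have iy : m1.-integrable A (fun x => (F (x, y))%:E).
  apply/integrableP; split; last by rewrite ltey.
  by apply/measurable_EFinP; exact: measurable_ysec.
rewrite fineK; last exact: integrable_fin_num.
by apply: le_abse_integral => //; exact: (measurable_int _ iy).
Qed.

Lemma fubini_y : \int[mu]_(q in AB) F q = \int[m2]_(y in B) \int[m1]_(x in A) F (x, y).
Proof.
have iF1 := integrable_funepos mAB iF; have iF2 := integrable_funeneg mAB iF.
have mE : measurable_fun AB (EFin \o F) by mfun.
rewrite /Rintegral integralE -/(EFin \o F).
rewrite (tonelli_y (F := (EFin \o F)^\+%E))//; last exact: measurable_funepos.
rewrite (tonelli_y (F := (EFin \o F)^\-%E))//; last exact: measurable_funeneg.
congr fine; rewrite -integralB//; first last.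
- apply/integrableP; split; first by apply: (@tonelli_measurable_y ((EFin \o F)^\-%E)) => //; exact: measurable_funeneg.
  under eq_integral do rewrite gee0_abs ?integral_ge0//.
  rewrite -(tonelli_y (F := (EFin \o F)^\-%E))//; last exact: measurable_funeneg.
  by have /integrableP[_] := iF2; under eq_integral do rewrite gee0_abs//.
- apply/integrableP; split; first by apply: (@tonelli_measurable_y ((EFin \o F)^\+%E)) => //; exact: measurable_funepos.
  under eq_integral do rewrite gee0_abs ?integral_ge0//.
  rewrite -(tonelli_y (F := (EFin \o F)^\+%E))//; last exact: measurable_funepos.
  by have /integrableP[_] := iF1; under eq_integral do rewrite gee0_abs//.
apply: ae_eq_integral => //.
- apply: emeasurable_funB; last by apply: (@tonelli_measurable_y ((EFin \o F)^\-%E)) => //; exact: measurable_funeneg.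
  by apply: (@tonelli_measurable_y ((EFin \o F)^\+%E)) => //; exact: measurable_funepos.
- by apply/measurable_EFinP; exact: measurable_slice_int.
apply: filterS slice_intble => y iy By.
rewrite fineK; last exact: integrable_fin_num (iy By).
by rewrite [RHS]integralE; congr (_ - _)%E; apply: eq_integral => x _; rewrite ?funeposE ?funenegE.
Qed.

End fubini.

Lemma L2_slice f : L2 mu AB f -> \forall y \ae m2, B y -> L2 m1 A (fun x => f (x, y)).
Proof.
move=> [mf f2]; apply: filterS (slice_intble f2) => y h By; split; last exact: h.
exact: measurable_ysec.
Qed.

Lemma sq_slice_intble f : L2 mu AB f ->
  m2.-integrable B (fun y => (sqnorm m1 A (fun x => f (x, y)))%:E).
Proof. by move=> [mf f2]; exact: (slice_int_intble f2). Qed.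

Lemma sq_slice f : L2 mu AB f ->
  sqnorm mu AB f = \int[m2]_(y in B) sqnorm m1 A (fun x => f (x, y)).
Proof. by move=> [mf f2]; exact: (fubini_y f2). Qed.

Lemma ip_slice_intble f g : L2 mu AB f -> L2 mu AB g ->
  m2.-integrable B (fun y => (inner m1 A (fun x => f (x, y)) (fun x => g (x, y)))%:E).
Proof. by move=> Lf Lg; exact: (slice_int_intble (L2M mAB Lf Lg)). Qed.

Lemma ip_slice f g : L2 mu AB f -> L2 mu AB g ->
  inner mu AB f g = \int[m2]_(y in B) inner m1 A (fun x => f (x, y)) (fun x => g (x, y)).
Proof. by move=> Lf Lg; exact: (fubini_y (L2M mAB Lf Lg)). Qed.

Lemma sq_slice_L2 f : L2 mu AB f ->
  L2 m2 B (fun y => Num.sqrt (sqnorm m1 A (fun x => f (x, y)))).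
Proof.
move=> Lf; apply: L2_intble.
  apply: measurableT_comp; first exact: continuous_measurable_fun (@sqrt_continuous R).
  by apply: (measurable_slice_int (F := fun q => f q ^+ 2)); mfun.
by apply: eq_integrable (sq_slice_intble Lf) => // y _; rewrite sqr_sqrtr ?sq_ge0.
Qed.

(** Tonelli for the indicator of a null set: almost all of its sections are null sets. *)
Lemma ae_slice (P : X * Y -> Prop) : (\forall q \ae mu, AB q -> P q) ->
  \forall y \ae m2, B y -> \forall x \ae m1, A x -> P (x, y).
Proof.
move=> /ae_ge0P[N [mN N0 hN]].
have : (\int[m2]_y \int[m1]_x (\1_N (x, y))%:E = 0)%E.
  rewrite -[LHS](@fubini_tonelli2 _ _ _ _ _ M1 m2 (fun q => (\1_N q)%:E)).
  - by rewrite integral_indic// setIT.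
  - mfun.
  - by [].
have mI : measurable_fun setT (fun y => \int[m1]_x (\1_N (x, y))%:E)%E.
  have h := @measurable_fun_fubini_tonelli_G _ _ _ _ _ M1 (fun q => (\1_N q)%:E).
  apply: h.
  - mfun.
  - by [].
move=> I0; have := (ae_eq_integral_abs m2 measurableT mI).1.
rewrite -[X in X = 0%E -> _](_ : \int[m2]_y \int[m1]_x (\1_N (x, y))%:E = _)%E; last first.
  by apply: eq_integral => y _; rewrite gee0_abs ?integral_ge0// => x _.
move=> /(_ I0); apply: filterS => y /(_ I) /= h By.
exists (ysection N y); split; first exact: measurable_ysection.
  rewrite -h -[ysection N y]setIT -integral_indic//; last exact: measurable_ysection.
  by apply: eq_integral => x _; rewrite !indicE mem_ysection.
move=> x /= nP; rewrite /ysection/= inE; apply: contrapT => nN; apply: nP => Ax.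
by apply: hN.
Qed.

End slices.

Lemma integrable_cst_fin {R : realType} {d} {X : measurableType d} (m : {measure set X -> \bar R}) D (c : R) :
  measurable D -> (m D < +oo)%E -> m.-integrable D (fun=> c%:E).
Proof.
move=> mD mfin; apply: (@measurable_bounded_integrable _ _ _ _ (cst c)) => //.
by exists `|c|; split => // y cy x _; exact: ltW.
Qed.

Lemma measurable_sublevel {R : realType} {d} {X : measurableType d} (f : X -> R) c :
  measurable_fun setT f -> measurable [set x | f x <= c].
Proof.
move=> mf; have mI : measurable (`]-oo, c]%classic : set R) by exact: measurable_itv.
have := mf measurableT _ mI; rewrite setTI; by [].
Qed.

(** * Borel sets and Lebesgue measure on row vectors *)

Section borel_rV.
Context {R : realType} {n : nat}.
Local Notation E := 'rV[R]_n.

Lemma rV_ballP (x y : E) e : ball x e y <-> 0 < e /\ forall i, `|x ord0 i - y ord0 i| < e.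
Proof.
split=> [[e0 h]|[e0 h]]; first by split => // i; exact: h.
by split => // i j; rewrite ord1; exact: h.
Qed.

(** The sigma-algebra is generated by the coordinates, so an open set has to be exhibited as a
    countable union: that of the boxes with rational centre and radius which it contains. *)
Lemma open_measurable_rV (A : set E) : open A -> measurable A.
Proof.
move=> oA; pose box (p : 'rV[rat]_n * rat) : set E :=
  [set x | forall i, `|x ord0 i - ratr (p.1 ord0 i)| < ratr p.2].
have mbox p : measurable (box p).
  rewrite (_ : box p = \bigcap_(i in [set: 'I_n]) [set x : E | `|x ord0 i - ratr (p.1 ord0 i)| < ratr p.2]).
    apply: fin_bigcap_measurable => // i _.
    have mf : measurable_fun setT (fun x : E => `|x ord0 i - ratr (p.1 ord0 i)| : measurableTypeR R) by mfun.
    have := mf measurableT `]-oo, ratr p.2[%classic (measurable_itv _); rewrite setTI.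
    by [].
  by apply/seteqP; split => x h i; [move=> _|]; exact: (h i).
pose F k := if unpickle k is Some p then (if pselect (box p `<=` A) then box p else set0) else set0.
have -> : A = \bigcup_k F k.
  apply/seteqP; split => x.
    move=> Ax; have [e /= e0 hA] : exists2 e : R, 0 < e & ball x e `<=` A.
      by have := oA; rewrite openE => /(_ x Ax) /nbhs_ballP.
    have [r /andP[r0 re]] : exists r : rat, (0 < (ratr r : R)) && ((ratr r : R) < e / 2).
      have [r] := rat_in_itvoo (divr_gt0 e0 (ltr0n R 2)); rewrite in_itv => h.
      by exists r.
    have hq i : exists q, `|x ord0 i - (ratr q : R)| < ratr r.
      have [q] : exists q : rat, ratr q \in `]x ord0 i - ratr r, x ord0 i + ratr r[%R.
        by apply: rat_in_itvoo; rewrite ltrBlDr -addrA ltrDl addr_gt0.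
      by rewrite in_itv/= => /andP[h1 h2]; exists q; rewrite ltr_norml; lra.
    pose q : 'rV[rat]_n := \row_i projT1 (cid (hq i)).
    have hxq i : `|x ord0 i - ratr (q ord0 i)| < ratr r.
      by rewrite mxE; exact: projT2 (cid (hq i)).
    exists (pickle (q, r)) => //; rewrite /F pickleK; case: pselect => [_ i /=|[]]; first exact: hxq.
    move=> y hy; apply: hA; apply/rV_ballP; split => // i.
    have := hxq i; have := hy i => /=.
    have := ler_distD (ratr (q ord0 i)) (x ord0 i) (y ord0 i).
    rewrite (distrC (ratr _) (y _ _)); lra.
  by move=> [k _]; rewrite /F; case: unpickle => // p; case: pselect => // h; exact: h.
apply: bigcupT_measurable => k; rewrite /F; case: unpickle => // p.
by case: pselect => h /=.
Qed.

Lemma closed_measurable_rV (A : set E) : closed A -> measurable A.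
Proof. by move=> cA; rewrite -(setCK A); apply: measurableC; apply: open_measurable_rV; rewrite openC. Qed.

Lemma continuous_measurable_rV (f : E -> R) : continuous f -> measurable_fun setT f.
Proof.
move=> cf; apply: (measurability _ (RGenOInfty.measurableE R)) => _ [_ [a ->] <-].
rewrite setTI; apply: open_measurable_rV.
by apply: open_comp => // x _.
Qed.

Lemma measurable_shift (v : E) : measurable_fun setT (fun x : E => x + v).
Proof.
apply: measurable_fun_coordP => i.
under eq_fun do rewrite mxE; apply: measurable_funD => //; mfun.
Qed.

End borel_rV.

Section leb_rV.
Context {R : realType}.
Local Notation lam := (@lebesgue_measure R).

Lemma lebS_E n (A : set 'rV[R]_n.+1) : leb n.+1 A = (leb n \x lam)%E (@rV_cons R n @^-1` A).
Proof. by []. Qed.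

Lemma leb_integral n (f : 'rV[R]_n.+1 -> \bar R) : measurable_fun setT f -> (forall x, (0 <= f x)%E) ->
  (\int[leb n.+1]_x f x = \int[(leb n \x lam)%E]_p f (rV_cons p))%E.
Proof.
by move=> mf f0; apply: (ge0_integral_pushforward (@measurable_rV_cons R n) (leb n \x lam)%E measurableT mf).

Qed.

Lemma leb_cube_measurable n (r : R) : measurable [set x : 'rV[R]_n | forall i, (`|x ord0 i| <= r)%R].
Proof.
rewrite (_ : mkset _ = \bigcap_(i in [set: 'I_n]) [set x : 'rV[R]_n | `|x ord0 i| <= r]).
  apply: fin_bigcap_measurable => // i _.
  have mf : measurable_fun setT (fun x : 'rV[R]_n => `|x ord0 i| : measurableTypeR R) by mfun.
  have := mf measurableT `]-oo, r]%classic (measurable_itv _); rewrite setTI.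
  by [].
by apply/seteqP; split => x h i; [move=> _|]; exact: (h i).
Qed.

Lemma leb_cube_eq n (r : R) : 0 <= r ->
  leb n [set x : 'rV[R]_n | forall i, (`|x ord0 i| <= r)%R] = ((2 * r) ^+ n)%:E.
Proof.
move=> r0; elim: n => [|n ih].
  by rewrite /= diracE mem_set//= => -[].
rewrite lebS_E.
have -> : @rV_cons R n @^-1` [set x | forall i, `|x ord0 i| <= r] =
   [set x : 'rV[R]_n | forall i, `|x ord0 i| <= r] `*` `[- r, r]%classic.
  apply/seteqP; split => [p /= h|p [/= h1 h2] i].
    split => [i|]; first by have := h (lift ord0 i); rewrite mxE liftK.
    by have := h ord0; rewrite mxE unlift_none/= ler_norml.
  rewrite mxE; case: unliftP => [j _|_] /=; first exact: h1.
  by rewrite/= ler_norml.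
rewrite product_measure1E//; last exact: leb_cube_measurable.
rewrite ih exprSr EFinM; congr (_ * _)%E.
rewrite /= lebesgue_measure_itv/= lte_fin; case: ltgtP => [h|h|h].
- by congr EFin; ring.
- by exfalso; lra.
- by congr EFin; lra.
Qed.

Lemma leb_cube n (r : R) : (leb n [set x : 'rV[R]_n | forall i, (`|x ord0 i| <= r)%R] < +oo)%E.
Proof.
have h : (leb n [set x : 'rV[R]_n | forall i, (`|x ord0 i| <= `|r|)%R] < +oo)%E by rewrite leb_cube_eq// ltry.
apply: le_lt_trans h; apply: le_measure; rewrite ?inE; try exact: leb_cube_measurable.
by move=> x /= hx i; apply: le_trans (hx i) (ler_norm r).
Qed.

Lemma leb_sigma_finite n : sigma_finite setT (leb n : set 'rV[R]_n -> \bar R).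
Proof.
exists (fun k => [set x : 'rV[R]_n | forall i, `|x ord0 i| <= k%:R]); last first.
  by split; [exact: leb_cube_measurable|exact: leb_cube].
apply/esym; rewrite -subTset => x _.
exists (\big[maxn/0%N]_i (Num.truncn `|x ord0 i|).+1) => // i.
apply: (@le_trans _ _ (Num.truncn `|x ord0 i|).+1%:R); first exact/ltW/truncnS_gt.
by rewrite ler_nat; exact: (@leq_bigmax _ (fun i => (Num.truncn `|x ord0 i|).+1) i).
Qed.

(** The translated measure has the same values on half-open intervals, and these determine Lebesgue
    measure. *)
Lemma lebesgue_shift (c : R) (A : set R) : measurable A ->
  lam ((fun t => t + c) @^-1` A) = lam A.
Proof.
move=> mA; have ms : measurable_fun setT (fun t : measurableTypeR R => t + c : measurableTypeR R) by apply: measurable_funD.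
pose mu := measure_function_pushforward__canonical__measure_function_Measure lam ms.
apply/esym; apply: (@lebesgue_measure_unique R mu) => //.
move=> X /ocitvP[->|[[a b] /= ab ->]]; first by rewrite /mu /=.
rewrite /mu /= /pushforward (_ : _ @^-1` _ = `]a - c, b - c]%classic).
  rewrite /= !lebesgue_measure_itv/= !lte_fin ltrD2r; case: ifP => // _.
  by congr EFin; ring.
by apply/seteqP; split => x /=; rewrite !in_itv/=; lra.
Qed.

Lemma lebesgue_int_shift (c : R) (f : measurableTypeR R -> \bar R) :
  measurable_fun setT f -> (forall x, (0 <= f x)%E) ->
  (\int[lam]_t f (t + c)%R = \int[lam]_t f t)%E.
Proof.
move=> mf f0; have ms : measurable_fun setT (fun t : measurableTypeR R => t + c : measurableTypeR R) by apply: measurable_funD.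
have h := ge0_integral_pushforward ms lam measurableT mf (fun x _ => f0 x).
rewrite preimage_setT in h; transitivity (\int[pushforward lam (fun t : measurableTypeR R => t + c : measurableTypeR R)%R]_t f t)%E.
  by [].
pose mu := measure_function_pushforward__canonical__measure_function_Measure lam ms.
by apply: (@eq_measure_integral _ _ _ _ lam mu) => A mA _; exact: lebesgue_shift.
Qed.

(** [leb] is an iterated product, so invariance is reduced by Tonelli to the line and to one
    dimension less. *)
Lemma leb_int_shift n (v : 'rV[R]_n) (f : 'rV[R]_n -> \bar R) :
  measurable_fun setT f -> (forall x, (0 <= f x)%E) ->
  (\int[leb n]_x f (x + v)%R = \int[leb n]_x f x)%E.
Proof.
elim: n v f => [|n ih] v f mf f0.
  by apply: eq_integral => x _; congr f; apply/rowP => -[].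
have ms := measurableT_comp mf (measurable_shift v).
rewrite !leb_integral//.
pose g (p : 'rV[R]_n * measurableTypeR R) := f (rV_cons p).
have mg : measurable_fun setT g by apply: measurableT_comp => //; exact: measurable_rV_cons.
pose v' : 'rV[R]_n := \row_i v ord0 (lift ord0 i).
have hv p : f (rV_cons p + v) = g (p.1 + v', p.2 + v ord0 ord0).
  congr f; apply/rowP => i; rewrite !mxE; case: unliftP => [j ->|->] /=.
    by rewrite !mxE.
  by [].
under eq_integral do rewrite hv.
have mgs : measurable_fun setT (fun p : 'rV[R]_n * measurableTypeR R => g (p.1 + v', p.2 + v ord0 ord0)).
  apply: measurableT_comp => //; apply/measurable_fun_pair => /=.
    by apply: (measurableT_comp (measurable_shift v')).
  mfun.
have ty G : measurable_fun setT G -> (forall q, 0 <= G q)%E ->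
   (\int[(leb n \x lam)%E]_q G q = \int[lam]_y \int[leb n]_x G (x, y))%E.
  by move=> mG G0; rewrite -setXTT (tonelli_y lam (leb_sigma_finite n))// setXTT.
rewrite (ty _ mgs) ?(ty _ mg)//; last by move=> q; exact: f0.
rewrite -[RHS](lebesgue_int_shift (v ord0 ord0)); last 2 first.
- apply: (tonelli_measurable_y (leb_sigma_finite n) measurableT measurableT (F := fun q => f (rV_cons q))) => //.
  by rewrite setXTT.
- by move=> t; apply: integral_ge0 => x _; exact: f0.
apply: eq_integral => t _; apply: (ih v' (fun x => g (x, t + v ord0 ord0))) => //; last by move=> x; exact: f0.
by apply: (measurable_ysec (B := setT) measurableT measurableT) => //; rewrite setXTT.
by move=> q; exact: f0.
Qed.

End leb_rV.

Lemma cvg0P {R : realType} (u : nat -> R) : (forall k, 0 <= u k) ->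
  (forall e, 0 < e -> exists N, forall k, (N <= k)%N -> u k <= e) -> u k @[k --> \oo] --> 0.
Proof.
move=> u0 h; apply/cvgr0Pnorm_le => e e0; have [N hN] := h e e0.
by exists N => // k /= Nk; rewrite ger0_norm// hN.
Qed.

(** * Continuity of translations in the mean *)

Section approximate_identity.
Context {R : realType}.

Definition preserves {d} {X : measurableType d} (m : {measure set X -> \bar R}) (s : X -> X) :=
  measurable_fun setT s /\ forall f : X -> \bar R, measurable_fun setT f ->
    (forall x, (0 <= f x)%E) -> (\int[m]_x f (s x) = \int[m]_x f x)%E.

(** Phrased for arbitrary maps that preserve the measure, so that the property passes from the line
    to products one factor at a time. *)
Definition approx_id {d} {X : measurableType d} (m : {measure set X -> \bar R}) (s : nat -> X -> X) :=
  (forall k, preserves m (s k)) /\ forall F, L2 m setT F ->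
    sqnorm m setT (fun x => F (s k x) - F x) @[k --> \oo] --> (0 : R).

Lemma preserves_L2 {d} {X : measurableType d} (m : {measure set X -> \bar R}) s F :
  preserves m s -> L2 m setT F ->
  L2 m setT (fun x => F (s x)) /\ sqnorm m setT (fun x => F (s x)) = sqnorm m setT F.
Proof.
move=> [ms h] LF; have mF := L2_meas LF.
have hF : (\int[m]_x (F (s x) ^+ 2)%:E = \int[m]_x (F x ^+ 2)%:E)%E.
  apply: (h (fun x => (F x ^+ 2)%:E)); last by move=> x; rewrite lee_fin sqr_ge0.
  mfun.
have LFs : L2 m setT (fun x => F (s x)).
  apply: L2_lty => //; first mfun.
  by rewrite hF esq// ltry.
by split => //; apply: EFin_inj; rewrite -!esq.
Qed.

Lemma dominated_cvg0 {d} {X : measurableType d} (m : {measure set X -> \bar R}) D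
    (f : nat -> X -> \bar R) (g : X -> \bar R) : measurable D ->
  (forall k, measurable_fun D (f k)) -> (forall k x, (0 <= f k x)%E) -> m.-integrable D g ->
  (\forall x \ae m, D x -> (f k x @[k --> \oo] --> 0)%E) ->
  (\forall x \ae m, forall k, D x -> (f k x <= g x)%E) ->
  (\int[m]_(x in D) f k x @[k --> \oo] --> 0)%E.
Proof.
move=> mD mf f0 ig fc fg.
have [] := dominated_convergence mD mf (measurable_cst (0 : \bar R)) fc ig.
  by apply: filterS fg => x h k Dx; rewrite gee0_abs//; exact: h.
by rewrite integral0.
Qed.

Section product.
Context {d1 d2} {X : measurableType d1} {Y : measurableType d2}.
Variables (m1 : {measure set X -> \bar R}) (m2 : {sigma_finite_measure set Y -> \bar R}).
Hypothesis s1 : sigma_finite setT m1.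
Variables (s : nat -> X -> X) (t : nat -> Y -> Y).
Hypotheses (hs : approx_id m1 s) (ht : approx_id m2 t).
Local Notation mu := (m1 \x m2)%E.

Let p k (q : X * Y) := (s k q.1, t k q.2).

Let mp k : measurable_fun setT (p k).
Proof.
apply/measurable_fun_pair => /=; first by apply: measurableT_comp => //; have [] := hs.1 k.
by apply: measurableT_comp => //; have [] := ht.1 k.
Qed.

Let ty (G : X * Y -> \bar R) : measurable_fun setT G -> (forall q, 0 <= G q)%E ->
  (\int[mu]_q G q = \int[m2]_y \int[m1]_x G (x, y))%E.
Proof. by move=> mG G0; rewrite -setXTT (tonelli_y m2 s1)// setXTT. Qed.

Let tx (G : X * Y -> \bar R) : measurable_fun setT G -> (forall q, 0 <= G q)%E ->
  (\int[mu]_q G q = \int[m1]_x \int[m2]_y G (x, y))%E.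
Proof. by move=> mG G0; rewrite -setXTT (tonelli_x m2 s1)// setXTT. Qed.

Let my (G : X * Y -> \bar R) : measurable_fun setT G -> (forall q, 0 <= G q)%E ->
  measurable_fun setT (fun y => \int[m1]_x G (x, y))%E.
Proof. by move=> mG G0; apply: (tonelli_measurable_y s1) => //; rewrite setXTT. Qed.

Let mx (G : X * Y -> \bar R) : measurable_fun setT G -> (forall q, 0 <= G q)%E ->
  measurable_fun setT (fun x => \int[m2]_y G (x, y))%E.
Proof. by move=> mG G0; apply: (tonelli_measurable_x m2) => //; rewrite setXTT. Qed.

Lemma preserves_prod k : preserves mu (p k).
Proof.
split; first exact: mp.
move=> f mf f0; rewrite !ty//; last exact: measurableT_comp.
rewrite -[RHS](ht.1 k).2; [|exact: my|by move=> y; exact: integral_ge0].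
apply: eq_integral => y _; apply: ((hs.1 k).2 (fun x => f (x, t k y))) => //.
by apply: (measurable_ysec (A := setT) (B := setT)) => //; rewrite setXTT.
Qed.

(** Moving both variables is moving one after the other. For each variable the sections converge for
    almost every value of the other one, and their squared distances are dominated by four times the
    squared norm of the section of [F], so dominated convergence integrates the statement. *)
Lemma approx_id_prod : approx_id mu p.
Proof.
split; first exact: preserves_prod.
move=> F LF; have mF := L2_meas LF.
have mF1 k : measurable_fun setT (fun q : X * Y => F (s k q.1, q.2)).
  apply: measurableT_comp => //; apply/measurable_fun_pair => //=.
  by apply: measurableT_comp => //; have [] := hs.1 k.
have mF2 k : measurable_fun setT (fun q : X * Y => F (q.1, t k q.2)).
  apply: measurableT_comp => //; apply/measurable_fun_pair => //=.
  by apply: measurableT_comp => //; have [] := ht.1 k.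
have m2e (G : X * Y -> R) : measurable_fun setT G -> measurable_fun setT (fun q => (G q ^+ 2)%:E) by mfun.
have sq0 (G : X * Y -> R) q : (0 <= (G q ^+ 2)%:E)%E by rewrite lee_fin sqr_ge0.
pose D1 k (q : X * Y) := F (s k q.1, q.2) - F q.
pose D2 k (q : X * Y) := F (q.1, t k q.2) - F q.
have mD1 k : measurable_fun setT (D1 k) by apply: measurable_funB.
have mD2 k : measurable_fun setT (D2 k) by apply: measurable_funB.
have Fy : m2.-integrable setT (fun y => \int[m1]_x (F (x, y) ^+ 2)%:E)%E.
  apply/integrableP; split; first exact: (my (m2e _ mF)).
  under eq_integral do rewrite gee0_abs ?integral_ge0//.
  by rewrite -(ty (m2e _ mF))// esq// ltry.
have Fx : m1.-integrable setT (fun x => \int[m2]_y (F (x, y) ^+ 2)%:E)%E.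
  apply/integrableP; split; first exact: (mx (m2e _ mF)).
  under eq_integral do rewrite gee0_abs ?integral_ge0//.
  by rewrite -(tx (m2e _ mF))// esq// ltry.
have c1 : (\int[mu]_q (D1 k q ^+ 2)%:E @[k --> \oo] --> 0)%E.
  under eq_fun do rewrite (ty (m2e _ (mD1 _)))//.
  have Ly : \forall y \ae m2, L2 m1 setT (fun x => F (x, y)).
    have := integrable_ae measurableT Fy; apply: filterS => y /(_ I) h; apply: L2_lty => //.
      by apply: (measurable_ysec (A := setT) (B := setT)) => //; rewrite setXTT.
    by rewrite -ge0_fin_numE// integral_ge0.
  apply: (dominated_cvg0 (g := fun y => 4%:E * \int[m1]_x (F (x, y) ^+ 2)%:E)%E) => //.
  - by move=> k; exact: (my (m2e _ (mD1 k))).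
  - by move=> k y; exact: integral_ge0.
  - exact: integrableZl.
  - apply: filterS Ly => y Ly _; have h := hs.2 _ Ly.
    have e k : (\int[m1]_x (D1 k (x, y) ^+ 2)%:E = (sqnorm m1 setT (fun x => F (s k x, y) - F (x, y)))%:E)%E.
      by rewrite -esq//; apply: L2B => //; exact: (preserves_L2 (hs.1 k) Ly).1.
    by under eq_fun do rewrite e; apply: cvg_EFin => //; exact: nearW.
  - apply: filterS Ly => y Ly k _.
    have [Ls es] := preserves_L2 (hs.1 k) Ly.
    rewrite (_ : \int[m1]_x _ = (sqnorm m1 setT (fun x => F (s k x, y) - F (x, y)))%:E)%E; last first.
      by rewrite -esq//; exact: L2B.
    rewrite esq//; apply: le_trans (sqB_le _ Ls Ly) _ => //.
    by lra.
have c2 : (\int[mu]_q (D2 k q ^+ 2)%:E @[k --> \oo] --> 0)%E.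
  under eq_fun do rewrite (tx (m2e _ (mD2 _)))//.
  have Lx : \forall x \ae m1, L2 m2 setT (fun y => F (x, y)).
    have := integrable_ae measurableT Fx; apply: filterS => x /(_ I) h; apply: L2_lty => //.
      by apply: (measurable_xsec (A := setT) (B := setT)) => //; rewrite setXTT.
    by rewrite -ge0_fin_numE// integral_ge0.
  apply: (dominated_cvg0 (g := fun x => 4%:E * \int[m2]_y (F (x, y) ^+ 2)%:E)%E) => //.
  - by move=> k; exact: (mx (m2e _ (mD2 k))).
  - by move=> k x; exact: integral_ge0.
  - exact: integrableZl.
  - apply: filterS Lx => x Lx _; have h := ht.2 _ Lx.
    have e k : (\int[m2]_y (D2 k (x, y) ^+ 2)%:E = (sqnorm m2 setT (fun y => F (x, t k y) - F (x, y)))%:E)%E.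
      by rewrite -esq//; apply: L2B => //; exact: (preserves_L2 (ht.1 k) Lx).1.
    by under eq_fun do rewrite e; apply: cvg_EFin => //; exact: nearW.
  - apply: filterS Lx => x Lx k _.
    have [Ls es] := preserves_L2 (ht.1 k) Lx.
    rewrite (_ : \int[m2]_y _ = (sqnorm m2 setT (fun y => F (x, t k y) - F (x, y)))%:E)%E; last first.
      by rewrite -esq//; exact: L2B.
    rewrite esq//; apply: le_trans (sqB_le _ Ls Lx) _ => //.
    by lra.
have L1 k : L2 mu setT (fun q : X * Y => F (s k q.1, q.2)).
  apply: L2_lty => //.
  rewrite (ty (m2e _ (mF1 k)))//; apply: le_lt_trans (_ : \int[mu]_q (F q ^+ 2)%:E < +oo)%E; last by rewrite esq// ltry.
  rewrite (ty (m2e _ mF))//; apply: ge0_le_integral => //.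
  - by move=> y _; exact: integral_ge0.
  - exact: (my (m2e _ (mF1 k))).
  - exact: (my (m2e _ mF)).
  move=> y _; rewrite -((hs.1 k).2 (fun x => (F (x, y) ^+ 2)%:E))//.
  apply: (@measurable_ysec _ _ _ _ setT setT measurableT measurableT _ _ (fun q => (F q ^+ 2)%:E)) => //.
  by rewrite setXTT; exact: m2e.
have L2' k : L2 mu setT (fun q : X * Y => F (q.1, t k q.2)).
  apply: L2_lty => //.
  rewrite (tx (m2e _ (mF2 k)))//; apply: le_lt_trans (_ : \int[mu]_q (F q ^+ 2)%:E < +oo)%E; last by rewrite esq// ltry.
  rewrite (tx (m2e _ mF))//; apply: ge0_le_integral => //.
  - by move=> y _; exact: integral_ge0.
  - exact: (mx (m2e _ (mF2 k))).
  - exact: (mx (m2e _ mF)).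
  move=> x _; rewrite -((ht.1 k).2 (fun y => (F (x, y) ^+ 2)%:E))//.
  apply: (@measurable_xsec _ _ _ _ setT setT measurableT measurableT _ _ (fun q => (F q ^+ 2)%:E)) => //.
  by rewrite setXTT; exact: m2e.
have LD1 k : L2 mu setT (D1 k) by apply: L2B.
have LD2 k : L2 mu setT (D2 k) by apply: L2B.
have e k q : F (p k q) - F q = D1 k (q.1, t k q.2) + D2 k q by rewrite /D1 /D2 /= subrKA.
have pt k : preserves mu (fun q : X * Y => (q.1, t k q.2)).
  split; first by apply/measurable_fun_pair => //=; apply: measurableT_comp => //; have [] := ht.1 k.
  move=> f mf f0; rewrite !tx//.
    apply: eq_integral => x _; apply: ((ht.1 k).2 (fun y => f (x, y))) => //.
    by apply: (measurable_xsec (A := setT) (B := setT)) => //; rewrite setXTT.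
  apply: measurableT_comp => //; apply/measurable_fun_pair => //=; apply: measurableT_comp => //.
  by have [] := ht.1 k.
rewrite (_ : (fun k => _) = (fun k => sqnorm mu setT (fun q => D1 k (q.1, t k q.2) + D2 k q))); last first.
  by apply/funext => k; apply: eq_sq => q _.
apply: sqD_cvg0 => //.
- by move=> k; exact: (preserves_L2 (pt k) (LD1 k)).1.
- under eq_fun do rewrite (preserves_L2 (pt _) (LD1 _)).2.
  by apply: fine_cvg.
- by apply: fine_cvg.
Qed.

End product.
End approximate_identity.

(** The maps preserve the norm, so convergence only has to be checked on approximants of [F]. *)
Lemma approx_id_closed {R : realType} {d} {X : measurableType d} (m : {measure set X -> \bar R})
    (s : nat -> X -> X) F : (forall k, preserves m (s k)) -> L2 m setT F ->
  (forall e, 0 < e -> exists G, [/\ L2 m setT G, sqnorm m setT (fun x => F x - G x) <= e &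
     sqnorm m setT (fun x => G (s k x) - G x) @[k --> \oo] --> (0 : R)]) ->
  sqnorm m setT (fun x => F (s k x) - F x) @[k --> \oo] --> (0 : R).
Proof.
move=> ps LF h; apply: cvg0P => [k|e e0]; first exact: sq_ge0.
(* Applying [(a + b)^2 <= 2 a^2 + 2 b^2] twice to three terms of size [e / 12] gives at most ten
   times [e / 12]. *)
have [G [LG FG Gc]] := h (e / 12) ltac:(lra).
have e12 : 0 < e / 12 by lra.
have [N hN] := near_cvg0_lt e12 Gc.
exists N => k /hN; rewrite ger0_norm ?sq_ge0// => hk.
have LFG := L2B measurableT LF LG.
have [LFGs eFGs] := preserves_L2 (ps k) LFG.
have LGs := (preserves_L2 (ps k) LG).1.
have LGd := L2B measurableT LGs LG.
rewrite (@eq_sq _ _ _ m setT _ (fun x => (F (s k x) - G (s k x)) + ((G (s k x) - G x) - (F x - G x)))); last first.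
  by move=> x _; ring.
apply: (le_trans (sqD_le measurableT LFGs (L2B measurableT LGd LFG))).
have := sqB_le measurableT LGd LFG; lra.
Qed.

Section approx_id_line.
Context {R : realType}.
Local Notation lam := (@lebesgue_measure R).
Local Notation RR := (measurableTypeR R).

Lemma preserves_lam (c : R) : preserves lam (fun t : RR => t + c).
Proof. by split; [mfun|exact: lebesgue_int_shift]. Qed.

Variable (h : nat -> R).
Hypothesis h0 : h k @[k --> \oo] --> 0.

(** Approximate [G] by continuous functions in L1 on [E]. The margins 1 and 2 serve once
    [|h k| < 1]: outside [E1] both [G t] and [G (t + h k)] vanish, and from [E1] the translate stays
    in [E]. *)
Let bounded_support_case (G : R -> R) (M : R) : 0 < M -> measurable_fun setT G ->
  (forall t, `|G t| <= M) -> (forall t, M < `|t| -> G t = 0) ->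
  (\int[lam]_t (`|G (t + h k) - G t|)%:E @[k --> \oo] --> 0)%E.
Proof.
move=> M0 mG GM Gs.
pose E : set R := `[- (M + 2), M + 2]%classic; pose E1 : set R := `[- (M + 1), M + 1]%classic.
have mE : measurable E by exact: measurable_itv.
have mE1 : measurable E1 by exact: measurable_itv.
have Efin : (lam E < +oo)%E.
  by rewrite /= lebesgue_measure_itv/=; case: ifP; rewrite// -EFinD ltry.
have E1fin : (lam E1 < +oo)%E.
  by rewrite /= lebesgue_measure_itv/=; case: ifP; rewrite// -EFinD ltry.
have iG : lam.-integrable E (EFin \o G).
  apply: measurable_bounded_integrable => //; first mfun.
  by exists M; split; [exact: num_real|move=> y My t _; apply: le_trans (GM t) (ltW My)].
have [g_ [cg ig gG]] := approximation_continuous_integrable mE Efin iG.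
have u0 k : (0 <= \int[lam]_t (`|G (t + h k) - G t|)%:E)%E by apply: integral_ge0 => t _.
suff key e : 0 < e -> exists N, forall k, (N <= k)%N ->
    (\int[lam]_t (`|G (t + h k) - G t|)%:E <= e%:E)%E.
  have fin : \forall k \near \oo, (\int[lam]_t (`|G (t + h k) - G t|)%:E)%E \is a fin_num.
    have [N hN] := key 1 ltr01; exists N => // k /= /hN h1.
    by rewrite ge0_fin_numE//; apply: le_lt_trans h1 _; rewrite ltry.
  apply/fine_cvgP; split => //.
  apply: cvg0P => [k|e e0]; first exact: fine_ge0.
  have [N hN] := key e e0; have [N1 _ hN1] := fin; exists (maxn N N1) => k; rewrite geq_max => /andP[/hN hk /hN1 fk].
  by rewrite -lee_fin /= fineK.
move=> e0.
have [n gn] : exists n, (\int[lam]_(z in E) `|(G z - g_ n z)%:E| < (e / 4)%:E)%E.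
  move/fine_cvgP : gG => [[N1 _ f1] f2].
  have e4 : 0 < e / 4 by lra.
  have [N hN] := near_cvg0_lt e4 f2.
  exists (maxn N N1); have := hN _ (leq_maxl N N1).
  rewrite ger0_norm ?fine_ge0 ?integral_ge0// => hh.
  have fk := f1 _ (leq_maxr N N1 : N1 <= maxn N N1)%N.
  by rewrite -lte_fin/= fineK in hh.
set g := g_ n in gn; have cgn : continuous g by exact: cg.
have mg : measurable_fun setT g by mfun.
have gb : exists B, forall t, E t -> `|g t| <= B.
  have cE : compact E by exact: segment_compact.
  have := @compact_bounded _ _ _ (continuous_compact (continuous_subspaceT cgn) cE).
  move=> [B [_ hB]]; exists (B + 1) => t Et; apply: hB; first by rewrite ltrDl.
  by [].
have [B hB] := gb.
have [N1 hN1] := near_cvg0_lt ltr01 h0.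
have c2 : (\int[lam]_(t in E1) (`|g (t + h (k + N1)%N) - g t|)%:E @[k --> \oo] --> 0)%E.
  apply: (dominated_cvg0 (g := cst (2 * B)%:E)) => //.
  - move=> k; apply/measurable_EFinP; apply: measurableT_comp => //; apply: measurable_funB; last mfun.
    mfun.
  - exact: integrable_cst_fin.
  - apply: aeW => t Et; apply: cvg_EFin; first exact: nearW.
    rewrite /comp/= -[X in _ --> X](normr0 R) -[X in `|X|](subrr (g t)).
    apply: cvg_norm; apply: cvgB; last exact: cvg_cst.
    have ht : t + h (k + N1)%N @[k --> \oo] --> t.
      have h0' : h (k + N1)%N @[k --> \oo] --> 0 by rewrite cvg_shiftn.
      by rewrite -[X in _ --> X]addr0; apply: cvgD; [exact: cvg_cst|exact: h0'].
    exact: (cvg_comp _ _ ht (cgn t)).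
  - apply: aeW => t k Et; rewrite lee_fin.
    apply: le_trans (ler_normB _ _) _; rewrite mulr_natl mulr2n.
    have := hN1 _ (leq_addl k N1); rewrite ltr_norml => /andP[ha hb].
    move: Et; rewrite /E1/= in_itv/= => /andP[t1 t2].
    by apply: lerD; apply: hB; rewrite /E/= in_itv/=; apply/andP; split; lra.
have [N2 hN2] : exists N, forall k, (N <= k)%N -> (\int[lam]_(t in E1) (`|g (t + h (k + N1)%N) - g t|)%:E < (e / 4)%:E)%E.
  move/fine_cvgP : c2 => [[N2 _ f1] f2].
  have e4 : 0 < e / 4 by lra.
  have [N hN] := near_cvg0_lt e4 f2.
  exists (maxn N N2) => k; rewrite geq_max => /andP[k1 k2]; have := hN _ k1.
  rewrite ger0_norm ?fine_ge0 ?integral_ge0// => hh.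
  have fk := f1 _ (k2 : (N2 <= k)%N).
  by rewrite -lte_fin/= fineK in hh.
exists (N1 + N2)%N => k Nk.
have hk : `|h k| < 1 by apply: hN1; apply: leq_trans Nk; exact: leq_addr.
have {hN2} hk2 : (\int[lam]_(t in E1) (`|g (t + h k) - g t|)%:E < (e / 4)%:E)%E.
  by have := hN2 (k - N1)%N; rewrite subnK ?(leq_trans (leq_addr N2 _) Nk)//; apply; rewrite leq_subRL// (leq_trans (leq_addr N2 _) Nk).
pose d t : R := `|G t - g t| * \1_E t.
have md : measurable_fun setT d.
  apply: measurable_funM; last mfun.
  mfun.
have d0 t : 0 <= d t by rewrite /d.
have dI : (\int[lam]_t (d t)%:E < (e / 4)%:E)%E.
  have -> : (\int[lam]_t (d t)%:E = \int[lam]_(z in E) `|(G z - g z)%:E|)%E; last exact: gn.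
  rewrite [RHS]integral_mkcond; apply: eq_integral => t _.
  by rewrite /d patchE indicE; case: (t \in E); rewrite ?mulr1 ?mulr0.
have mds : measurable_fun setT (fun t : RR => d (t + h k)) := measurableT_comp md (preserves_lam (h k)).1.
have mgE : measurable_fun setT (fun t : RR => `|g (t + h k) - g t| * \1_E1 t) by mfun.
apply: (@le_trans _ _ (\int[lam]_t ((d (t + h k)%R)%:E + (`|g (t + h k) - g t| * \1_E1 t)%:E + (d t)%:E))%E).
  apply: ge0_le_integral => //.
  - apply/measurable_EFinP; apply: measurableT_comp => //; apply: measurable_funB => //.
    mfun.
  - by apply: emeasurable_funD; [apply: emeasurable_funD|]; mfun.
  move=> t _; rewrite lee_fin.
  move: hk; rewrite ltr_norml => /andP[ha hb].
  have [t1|t1] := leP `|t| (M + 1).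
    have Et1 : E1 t by move: t1; rewrite ler_norml/=.
    have Et : E t by move: Et1; rewrite /E1 /E/= !in_itv/= => /andP[? ?]; apply/andP; split; lra.
    have Eth : E (t + h k) by move: Et1; rewrite /E1 /E/= !in_itv/= => /andP[? ?]; apply/andP; split; lra.
    rewrite /d !indicE !mem_set// !mulr1.
    have -> : G (t + h k) - G t = (G (t + h k) - g (t + h k)) + (g (t + h k) - g t) - (G t - g t) by ring.
    apply: le_trans (ler_normB _ _) _; rewrite lerD2r; exact: ler_normD.
  rewrite !Gs ?subrr ?normr0 ?addr_ge0//; first lra.
  have := lerB_normD t (h k); have : `|h k| < 1 by rewrite ltr_norml ha.
  by lra.
have m1 := (measurable_EFinP setT _).2 mds; have m2 := (measurable_EFinP setT _).2 mgE; have m3 := (measurable_EFinP setT _).2 md.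
rewrite ge0_integralD; try first [done | by move=> t _; rewrite lee_fin ?addr_ge0 | exact: emeasurable_funD].
rewrite ge0_integralD; try first [done | by move=> t _; rewrite lee_fin ?mulr_ge0 | mfun].
rewrite (lebesgue_int_shift (h k) (f := fun t => (d t)%:E)); last 2 first.
- by [].
- by [].
have -> : (\int[lam]_t (`|g (t + h k) - g t| * \1_E1 t)%:E = \int[lam]_(t in E1) (`|g (t + h k) - g t|)%:E)%E.
  rewrite [RHS]integral_mkcond; apply: eq_integral => t _.
  by rewrite patchE indicE; case: (t \in E1); rewrite ?mulr1 ?mulr0.
have -> : e%:E = ((e / 4)%:E + (e / 4)%:E + (e / 2)%:E)%E by rewrite -!EFinD; congr EFin; lra.
apply: leeD; first by apply: leeD; exact: ltW.
by apply: le_trans (ltW dI) _; rewrite lee_fin; lra.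
Qed.

(** Truncating values and support reduces to the preceding case. For a function bounded by a
    constant the square of a difference is at most twice that constant times its absolute value, so
    convergence in L1 gives convergence in L2. *)
Lemma approx_id_lam : approx_id lam (fun k (t : RR) => t + h k).
Proof.
split => [k|F LF]; first exact: preserves_lam.
apply: (@approx_id_closed _ _ _ lam) => // [k|e e0]; first exact: preserves_lam.
have mF := L2_meas LF.
pose A (M : nat) : set R := [set t | `|F t| <= M%:R] `&` [set t | `|t| <= M%:R].
have mA M : measurable (A M : set RR).
  apply: measurableI; first by apply: (measurable_sublevel (f := fun t => `|F t|)); mfun.
  by apply: (measurable_sublevel (f := fun t : RR => `|t|)); mfun.
pose G M t := F t * \1_(A M) t.
have mG M : measurable_fun setT (G M) by apply: measurable_funM => //.
have GF M t : `|G M t| <= `|F t|.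
  by rewrite /G indicE; case: (_ \in _); rewrite ?mulr1 ?mulr0// normr0.
have LG M : L2 lam setT (G M).
  by apply: (le_L2 measurableT (mG M) LF); apply: aeW => t _.
have c : (\int[lam]_t ((F t - G M t) ^+ 2)%:E @[M --> \oo] --> 0)%E.
  apply: (dominated_cvg0 (g := fun t => (F t ^+ 2)%:E)) => //.
  - by mfun.
  - by move=> k x; rewrite lee_fin sqr_ge0.
  - exact: LF.2.
  - apply: aeW => t _; apply: cvg_near_cst.
    exists (maxn (Num.truncn `|F t|).+1 (Num.truncn `|t|).+1) => // M /=; rewrite geq_max => /andP[h1 h2].
    rewrite /G indicE mem_set ?mulr1 ?subrr ?expr0n//; split => /=.
      by apply: (le_trans (ltW (truncnS_gt _))); rewrite ler_nat.
    by apply: (le_trans (ltW (truncnS_gt _))); rewrite ler_nat.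
  - apply: aeW => t M _; rewrite lee_fin /G indicE; case: (_ \in _); rewrite ?mulr1 ?mulr0 ?subr0//.
    by rewrite subrr expr0n sqr_ge0.
have {}c : sqnorm lam setT (fun t => F t - G M t) @[M --> \oo] --> 0 by apply: fine_cvg.
have [M hM] := near_cvg0_lt e0 c.
exists (G M.+1); split=> //.
  by have := hM M.+1 (leqnSn M); rewrite ger0_norm ?sq_ge0// => /ltW.
have M0 : 0 < M.+1%:R :> R by [].
have GM t : `|G M.+1 t| <= M.+1%:R.
  rewrite /G indicE; case: (boolP (t \in _)) => [/set_mem[h1 _]|_]; first by rewrite mulr1.
  by rewrite mulr0 normr0.
have Gs t : M.+1%:R < `|t| -> G M.+1 t = 0.
  move=> tM; rewrite /G indicE memNset ?mulr0// => -[_ /=].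
  by rewrite leNgt tM.
have := bounded_support_case M0 (mG _) GM Gs.
set u := (fun k => _ : \bar R) => uc.
have mGd (k : nat) : measurable_fun setT (fun t : RR => G M.+1 (t + h k) - G M.+1 t) by mfun.
have : ((2 * M.+1%:R)%:E * u k @[k --> \oo] --> (2 * M.+1%:R)%:E * 0)%E by apply: cvgeZl.
rewrite mule0 => uc2.
apply: fine_cvg; apply: squeeze_cvge uc2; last exact: cvg_cst.
apply: nearW => k; rewrite integral_ge0/=; last by move=> t _; rewrite lee_fin sqr_ge0.
rewrite /u -ge0_integralZl_EFin//; last first.
  mfun.
apply: ge0_le_integral => //.
- by move=> t _; rewrite lee_fin sqr_ge0.
- mfun.
- by apply: measurable_funeM; mfun.
move=> t _; rewrite lee_fin -real_normK ?num_real// ler_wpM2r//.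
by apply: le_trans (ler_normB _ _) _; have := GM t; have := GM (t + h k); lra.
Qed.

End approx_id_line.

Lemma approx_id_leb {R : realType} n (z : nat -> 'rV[R]_n) :
  (forall i, z k ord0 i @[k --> \oo] --> (0 : R)) -> approx_id (leb n) (fun k x => x + z k).
Proof.
elim: n z => [|n ih] z z0.
  split => [k|F LF]; first by split; [exact: measurable_shift|exact: leb_int_shift].
  rewrite (_ : (fun k => _) = (fun=> 0)); first exact: cvg_cst.
  apply/funext => k; rewrite (@eq_sq _ _ _ _ _ _ (fun=> 0 * 0)).
    by rewrite (sqZ measurableT 0 (L2_0 _ measurableT)) expr0n mul0r.
  by move=> x _; rewrite (_ : x + z k = x) ?subrr ?mulr0//; apply/rowP => -[].
split => [k|F LF]; first by split; [exact: measurable_shift|exact: leb_int_shift].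
pose z' k : 'rV[R]_n := \row_i z k ord0 (lift ord0 i).
have hp := approx_id_prod (leb_sigma_finite n) (ih z' _) (approx_id_lam (z0 ord0)).
have [] := hp; first by move=> i; under eq_fun do rewrite mxE; exact: z0.
move=> _ {}hp.
pose F' (p : 'rV[R]_n * measurableTypeR R) := F (rV_cons p).
have mF := L2_meas LF.
have mF' : measurable_fun setT F' by apply: measurableT_comp => //; exact: measurable_rV_cons.
have m2 (G : 'rV[R]_n.+1 -> R) : measurable_fun setT G -> measurable_fun setT (fun x => (G x ^+ 2)%:E) by mfun.
have LF' : L2 (leb n \x lebesgue_measure)%E setT F'.
  apply: L2_lty => //; rewrite -(@leb_integral _ _ (fun x => (F x ^+ 2)%:E)); first by rewrite esq// ltry.
    exact: m2.
  by move=> x; rewrite lee_fin sqr_ge0.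
suff -> : (fun k => sqnorm (leb n.+1) setT (fun x => F (x + z k) - F x)) =
  (fun k => sqnorm (leb n \x lebesgue_measure)%E setT (fun q => F' (q.1 + z' k, q.2 + z k ord0 ord0) - F' q)).
  exact: hp.
apply/funext => k.
rewrite /sqnorm /Rintegral leb_integral; last 2 first.
- by apply: m2; apply: measurable_funB => //; apply: measurableT_comp => //; exact: measurable_shift.
- by move=> x; rewrite lee_fin sqr_ge0.
congr fine; apply: eq_integral => p _; congr ((_ - _) ^+ 2)%:E.
congr F; apply/rowP => i; rewrite !mxE; case: unliftP => [j ->|->] //=.
by rewrite !mxE.
Qed.

Ltac mleaf ::= first [exact: continuous_measurable_rV | exact: measurable_shift].

(** * Smooth functions, their closure properties and cutoffs *)

Section class_C_theory.
Context {R : realType}.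
Implicit Types V W : normedModType R.

Lemma class_C_continuous V k (f : V -> R^o) : class_C k f -> continuous f.
Proof. by case: k => [|k] []. Qed.

Lemma class_C_deriv V k (f : V -> R^o) v : class_C k.+1 f -> (forall x, derivable f x v) /\ class_C k ('D_v f).
Proof. by move=> [_]. Qed.

Lemma class_CS V k (f : V -> R^o) : class_C k.+1 f -> class_C k f.
Proof.
elim: k f => [|k ih] f [cf df]; first by split.
by split => // v; split; [exact: (df v).1|apply: ih; exact: (df v).2].
Qed.

Lemma class_C_cst V k (c : R) : class_C k (fun _ : V => c : R^o).
Proof.
elim: k c => [|k ih] c; split => //; try by move=> x; exact: cvg_cst.
split; first by move=> x.
rewrite (_ : 'D_v _ = fun=> 0); first exact: ih.
by apply/funext => x; exact: derive_cst.
Qed.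

Lemma class_CD V k (f g : V -> R^o) : class_C k f -> class_C k g -> class_C k (fun x => f x + g x : R^o).
Proof.
elim: k f g => [|k ih] f g [cf df] [cg dg]; (split; first by move=> x; apply: cvgD; [exact: cf|exact: cg]) => // v.
split; first by move=> x; apply: (derivableD ((df v).1 x) ((dg v).1 x)).
rewrite (_ : 'D_v _ = fun x => 'D_v f x + 'D_v g x); first by apply: ih; [exact: (df v).2|exact: (dg v).2].
by apply/funext => x; apply: (deriveD ((df v).1 x) ((dg v).1 x)).
Qed.

Lemma class_CM V k (f g : V -> R^o) : class_C k f -> class_C k g -> class_C k (fun x => f x * g x : R^o).
Proof.
elim: k f g => [|k ih] f g Cf Cg.
  by split => // x; apply: cvgM; [exact: Cf.1|exact: Cg.1].
have [cf df] := Cf; have [cg dg] := Cg.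
split; first by move=> x; apply: cvgM; [exact: cf|exact: cg].
split; first by move=> x; apply: (derivableM ((df v).1 x) ((dg v).1 x)).
rewrite (_ : 'D_v _ = fun x => f x * 'D_v g x + g x * 'D_v f x).
  by apply: class_CD; apply: ih; [exact: class_CS|exact: (dg v).2|exact: class_CS|exact: (df v).2].
by apply/funext => x; apply: (deriveM ((df v).1 x) ((dg v).1 x)).
Qed.

Lemma class_CZ V k c (f : V -> R^o) : class_C k f -> class_C k (fun x => c * f x : R^o).
Proof. by apply: class_CM => //; exact: class_C_cst. Qed.

Lemma class_CB V k (f g : V -> R^o) : class_C k f -> class_C k g -> class_C k (fun x => f x - g x : R^o).
Proof.
move=> Cf /(class_CZ (-1)) Cg; have := class_CD Cf Cg.
by congr class_C; apply/funext => x; rewrite mulN1r.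
Qed.

Lemma class_C_prod V k (I : Type) (s : seq I) (f : I -> V -> R^o) :
  (forall i, class_C k (f i)) -> class_C k (fun x => \prod_(i <- s) f i x : R^o).
Proof.
move=> Cf; elim: s => [|i s ih].
  rewrite (_ : (fun x => _) = fun=> 1); first exact: class_C_cst.
  by apply/funext => x; rewrite big_nil.
rewrite (_ : (fun x => _) = fun x => f i x * (\prod_(j <- s) f j x)); first exact: class_CM.
by apply/funext => x; rewrite big_cons.
Qed.

(** The condition on [A] and [L] makes the difference quotients of the composition in direction [v]
    equal to those of [f] in direction [L v], which replaces a chain rule at every order. *)
Lemma class_C_affine V W k (f : W -> R^o) (A : V -> W) (L : V -> W) : continuous A ->
  (forall (h : R) v x, A (h *: v + x) = h *: L v + A x) -> class_C k f -> class_C k (fun x => f (A x)).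
Proof.
move=> cA AL; elim: k f => [|k ih] f [cf df]; (split; first by move=> x; apply: continuous_comp; [exact: cA|exact: cf]) => // v.
have [d1 d2] := df (L v).
have e x : (fun h : R => h^-1 *: (((fun x => f (A x)) \o shift x) (h *: v) - f (A x))) =
   (fun h : R => h^-1 *: ((f \o shift (A x)) (h *: L v) - f (A x))).
  by apply/funext => h; rewrite/=/= AL.
split; first by move=> x; rewrite /derivable e; exact: d1.
rewrite (_ : 'D_v _ = fun x => 'D_(L v) f (A x)); first exact: (ih ('D_(L v) f)).
by apply/funext => x; rewrite /derive e.
Qed.

Lemma smooth_cst V (c : R) : smooth (fun _ : V => c : R^o). Proof. by move=> k; exact: class_C_cst. Qed.
Lemma smoothD V (f g : V -> R^o) : smooth f -> smooth g -> smooth (fun x => f x + g x : R^o).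
Proof. by move=> sf sg k; exact: class_CD. Qed.
Lemma smoothB V (f g : V -> R^o) : smooth f -> smooth g -> smooth (fun x => f x - g x : R^o).
Proof. by move=> sf sg k; exact: class_CB. Qed.
Lemma smoothM V (f g : V -> R^o) : smooth f -> smooth g -> smooth (fun x => f x * g x : R^o).
Proof. by move=> sf sg k; exact: class_CM. Qed.
Lemma smoothZ V c (f : V -> R^o) : smooth f -> smooth (fun x => c * f x : R^o).
Proof. by move=> sf k; exact: class_CZ. Qed.
Lemma smooth_deriv V (f : V -> R^o) v : smooth f -> smooth ('D_v f).
Proof. by move=> sf k; exact: (class_C_deriv v (sf k.+1)).2. Qed.
Lemma smooth_continuous V (f : V -> R^o) : smooth f -> continuous f.
Proof. by move=> /(_ 0%N) /class_C_continuous. Qed.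

Lemma derive_line (f : R -> R) (x v d : R) : is_derive x 1 f d -> derivable f x v /\ 'D_v f x = v * d.
Proof.
move=> [df <-]; have fx : differentiable f x by apply/derivable1_diffP.
split; first exact: diff_derivable.
by rewrite !deriveE// -[v in LHS]mulr1 -[v * 1]/(v *: (1 : R^o)) linearZ.
Qed.

(** The classical flat function divided by powers of [x]: this family is closed under
    differentiation up to linear combinations, so the smoothness of all its members follows by one
    induction. *)
Definition flat m (x : R) : R^o := if 0 < x then x^-1 ^+ m * expR (- x^-1) else 0.

Lemma flat_ge0 m x : 0 <= flat m x.
Proof. by rewrite /flat; case: ifPn => // x0; rewrite mulr_ge0// exprn_ge0// invr_ge0 ltW. Qed.

Lemma flat_gt0 m x : 0 < x -> 0 < flat m x.
Proof. by move=> x0; rewrite /flat x0 mulr_gt0 ?expR_gt0// exprn_gt0// invr_gt0. Qed.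

Lemma flat_le0 m x : x <= 0 -> flat m x = 0.
Proof. by move=> x0; rewrite /flat ltNge x0. Qed.

(** The exponential dominates each term of its series. A bound of second order at the origin gives
    the derivative 0 there. *)
Lemma flat_bound m x : flat m x <= (m.+2)`!%:R * x ^+ 2.
Proof.
rewrite /flat; case: ifPn => [x0|_]; last by rewrite mulr_ge0 ?sqr_ge0.
have y0 : 0 < x^-1 by rewrite invr_gt0.
have := expR_ge1Dxn m.+1 (ltW y0); set y := x^-1 in y0 *.
have -> : x = y^-1 by rewrite /y invrK.
move=> h; have {}h : y ^+ m.+2 / (m.+2)`!%:R <= expR y by apply: le_trans h; rewrite lerDr.
rewrite expRN -[X in X <= _]/(_ / _) ler_pdivrMr ?expR_gt0//.
apply: le_trans (_ : (m.+2)`!%:R * y^-1 ^+ 2 * (y ^+ m.+2 / (m.+2)`!%:R) <= _).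
  by apply: eqW; rewrite !exprS; field; rewrite !gt_eqF.
by rewrite ler_wpM2l// mulr_ge0// exprn_ge0// invr_ge0 ltW.
Qed.

Lemma is_derive_flat m (x : R) : is_derive x 1 (flat m) (flat m.+2 x - m%:R * flat m.+1 x).
Proof.
have [x0|x0|->] := ltgtP x 0.
- rewrite !flat_le0 ?(ltW x0)// mulr0 subrr.
  have := is_derive_cst (0 : R) x (1 : R); apply: near_eq_is_derive.
  near=> z; rewrite /= flat_le0//; apply: ltW; near: z; exact: (@lt_nbhsl R x 0 x0).
- have xn0 : x != 0 by rewrite gt_eqF.
  pose g (z : R) : R := z^-1 ^+ m * expR (- z^-1).
  apply: (@near_eq_is_derive _ _ _ g).
    by near=> z; rewrite /flat ifT//; near: z; exact: lt_nbhsr.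
  have d1 : is_derive x 1 (fun z : R => z^-1) (- x ^- 2 *: 1) by exact: (@is_deriveV R id x 1 1 xn0 (is_derive_id x (1 : R))).
  have d2 : is_derive x 1 (fun z : R => - z^-1) (- (- x ^- 2 *: 1)) by apply: is_deriveN.
  have d3 : is_derive x 1 (fun z : R => expR (- z^-1)) ((- (- x ^- 2 *: 1)) *: expR (- x^-1)).
    have := @is_derive1_comp R expR (fun z : R => - z^-1) x _ _ (is_derive_expR (- x^-1)) d2.
    move=> h; rewrite (_ : _ *: _ = expR (- x^-1) * - (- x ^- 2 *: (1 : R))); first exact: h.
    by rewrite/= mulrC.
  have d4 : is_derive x 1 (fun z : R => z^-1 ^+ m) (- (m%:R * x^-1 ^+ m.+1)).
    elim: (m) => [|k ih].
      rewrite mul0r oppr0 (_ : (fun z : R => z^-1 ^+ 0) = cst (1 : R)); first exact: (is_derive_cst (1 : R) x (1 : R)).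
      by [].
    rewrite (_ : (fun z : R => z^-1 ^+ k.+1) = (fun z : R => z^-1) * (fun z : R => z^-1 ^+ k)); last first.
      by apply/funext => z; rewrite exprS.
    rewrite (_ : - _ = x^-1 *: (- (k%:R * x^-1 ^+ k.+1)) + x^-1 ^+ k *: (- x ^- 2 *: (1 : R))); first exact: (is_deriveM d1 ih).
    rewrite /GRing.scale/= !exprS !exprVn; field.
    by rewrite xn0 expf_neq0.
  rewrite (_ : _ - _ = x^-1 ^+ m *: (- (- x ^- 2 *: (1 : R)) *: expR (- x^-1)) + expR (- x^-1) *: - (m%:R * x^-1 ^+ m.+1)).
    exact: (is_deriveM d4 d3).
  rewrite /flat x0 /GRing.scale/= !exprS !exprVn; field.
  by rewrite expf_neq0.
- rewrite !flat_le0// mulr0 subrr.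
  have h : h^-1 *: ((flat m \o shift 0) (h *: (1 : R)) - flat m 0) @[h --> (0 : R)^'] --> (0 : R^o).
    apply/cvgr0Pnorm_le => e e0; near=> h.
    rewrite/=/= addr0 (flat_le0 _ (lexx 0)) subr0 /GRing.scale/= mulr1 normrM normfV.
    rewrite mulrC ler_pdivrMr ?normr_gt0//; last by near: h; exact: nbhs_dnbhs_neq.
    rewrite ger0_norm ?flat_ge0//; apply: le_trans (flat_bound m h) _.
    rewrite -(real_normK (num_real h)) mulrA ler_wpM2r//.
    rewrite -ler_pdivlMl//; near: h.
    have c0 : 0 < (m.+2)`!%:R^-1 * e by rewrite mulr_gt0//.
    have := @dnbhs0_le R R^o _ c0; exact.
  by apply: DeriveDef; [apply/cvg_ex; exists 0; exact: h|exact: cvg_lim].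
Unshelve. all: by end_near. Qed.

Lemma smooth_flat m : smooth (flat m).
Proof.
move=> k; elim: k m => [|k ih] m; (split; first by move=> x; apply: differentiable_continuous; apply/derivable1_diffP; exact: (is_derive_flat m x).(ex_derive)) => // v.
split; first by move=> x; have [] := derive_line v (is_derive_flat m x).
rewrite (_ : 'D_v _ = fun x => v * (flat m.+2 x - m%:R * flat m.+1 x)).
  by apply: class_CZ; apply: class_CB => //; exact: class_CZ.
by apply/funext => x; have [] := derive_line v (is_derive_flat m x).
Qed.

Definition hump (x : R) : R^o := flat 0 x * flat 0 (1 - x).

Lemma smooth_hump : smooth hump.
Proof.
move=> k; apply: class_CM; first exact: smooth_flat.
apply: (@class_C_affine _ _ _ _ (fun x : R => 1 - x : R) (fun x => - x)); last exact: smooth_flat.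
- by move=> x; apply: cvgB; [exact: cvg_cst|exact: cvg_id].
- by move=> h v x; ring.
Qed.

Lemma hump_ge0 x : 0 <= hump x. Proof. by rewrite mulr_ge0 ?flat_ge0. Qed.

Lemma hump_out x : ~~ (0 < x < 1) -> hump x = 0.
Proof.
rewrite negb_and -!leNgt => /orP[h|h]; first by rewrite /hump flat_le0 ?mul0r.
by rewrite /hump [X in _ * X]flat_le0 ?mulr0// subr_le0.
Qed.

Local Notation lam := (@lebesgue_measure R).

Lemma hump_intble (D : set R) : measurable D -> lam.-integrable D (EFin \o hump).
Proof.
move=> mD; have h : lam.-integrable setT (EFin \o hump).
  have i01 : lam.-integrable `[0%R, 1%R] (EFin \o hump).
    by apply: continuous_compact_integrable; [exact: segment_compact|apply: continuous_subspaceT; exact: smooth_continuous smooth_hump].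
  move: i01; rewrite (@integrable_mkcond _ _ _ lam (`[0%R, 1%R]%classic : set R))//; apply: eq_integrable => // x _.
  rewrite patchE; case: ifPn => // xn /=; rewrite hump_out//.
  apply/negP => /andP[x0 x1]; move/negP: xn; rewrite inE/= in_itv/= !ltW//.
exact: integrableS h.
Qed.

Definition hump_mass : R := \int[lam]_(t in `]-oo, 1]) hump t.

Lemma hump_mass_gt0 : 0 < hump_mass.
Proof.
rewrite lt_def Rintegral_ge0 ?andbT; last by move=> x _; exact: hump_ge0.
apply/eqP => h0.
have ih := hump_intble (measurable_itv `]-oo, (1 : R)]).
have e0 : (\int[lam]_(t in `]-oo, 1%R]) `|(hump t)%:E| = 0)%E.
  under eq_integral do rewrite gee0_abs ?lee_fin ?hump_ge0//.
  rewrite -[LHS]fineK; last exact: integrable_fin_num.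
  by congr EFin.
have [N [mN N0 hN]] := (ae_eq_integral_abs lam (measurable_itv _) (measurable_int _ ih)).1 e0.
have : (lam `]0%R, 1%R[ <= lam N)%E.
  apply: le_measure; rewrite ?inE//.
  move=> x; rewrite /= in_itv/= => /andP[x0 x1]; apply: hN => /= h.
  have := h _; rewrite in_itv/= (ltW x1) => /(_ isT) [].
  by apply/eqP; rewrite gt_eqF// mulr_gt0 ?flat_gt0// subr_gt0.
by rewrite N0 /= lebesgue_measure_itv/= lte_fin ltr01 -EFinB subr0 lee_fin ler10.
Qed.

(** The primitive of [hump], normalised so that it climbs from 0 for [x <= 0] to 1 for [x >= 1]. *)
Definition step (x : R) : R^o := hump_mass^-1 * \int[lam]_(t in `]-oo, x]) hump t.

Lemma is_derive_step (x : R) : is_derive x 1 step (hump_mass^-1 * hump x).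
Proof.
have xu : x < x + 1 by rewrite ltrDl.
have [|d e] := continuous_FTC1 xu (hump_intble (measurable_itv `]-oo, x + 1])) _ (smooth_continuous smooth_hump (x := x)).
  exact: ltNyr.
have hd : is_derive x 1 (fun y => \int[lam]_(t in `]-oo, y]) hump t) (hump x).
  by apply: DeriveDef; [exact: d|rewrite -derive1E].
by have := is_deriveZ hump_mass^-1 hd.
Qed.

Lemma smooth_step : smooth step.
Proof.
have cs : continuous step.
  by move=> x; apply: differentiable_continuous; apply/derivable1_diffP; exact: (is_derive_step x).(ex_derive).
move=> [|k]; split => // v; split; first by move=> x; have [] := derive_line v (is_derive_step x).
rewrite (_ : 'D_v _ = fun x => v * (hump_mass^-1 * hump x)).
  by apply: class_CZ; apply: class_CZ; exact: smooth_hump.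
by apply/funext => x; have [] := derive_line v (is_derive_step x).
Qed.

Lemma step_le0 x : x <= 0 -> step x = 0.
Proof.
move=> x0; rewrite /step (_ : Rintegral _ _ _ = 0) ?mulr0//.
rewrite /Rintegral (eq_integral (cst 0%E)) ?integral0// => t; rewrite inE/= in_itv/= => tx.
by rewrite hump_out//; apply/negP => /andP[t0 _]; have := le_lt_trans x0 t0; rewrite ltNge tx.
Qed.

Lemma step_mono : {homo step : x y / x <= y}.
Proof.
move=> x y xy; rewrite ler_wpM2l ?invr_ge0 ?(ltW hump_mass_gt0)//.
rewrite fine_le ?integrable_fin_num ?hump_intble//.
apply: ge0_subset_integral => //.
- by apply/measurable_EFinP/measurable_funTS; apply: continuous_measurable_fun; exact: smooth_continuous smooth_hump.
- by move=> t _; rewrite lee_fin hump_ge0.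
- by move=> t /=; rewrite/= => /le_trans; apply.
Qed.

Lemma step_ge1 x : 1 <= x -> step x = 1.
Proof.
move=> x1; suff -> : step x = step 1 by rewrite /step mulVf// gt_eqF// hump_mass_gt0.
congr (_ * _).
rewrite Rintegral_mkcond [RHS]Rintegral_mkcond; apply: eq_Rintegral => t _.
rewrite !patchE !mem_setE !in_itv/=; have [t1|t1] := leP t 1; first by rewrite (le_trans t1 x1).
by case: ifP => // _; rewrite hump_out// negb_and -!leNgt (ltW t1) orbT.
Qed.

Lemma step_ge0 x : 0 <= step x.
Proof.
rewrite mulr_ge0 ?invr_ge0 ?(ltW hump_mass_gt0)//.
by apply: Rintegral_ge0 => t _; exact: hump_ge0.
Qed.

Lemma step_le1 x : step x <= 1.
Proof. by have [h|/ltW h] := leP 1 x; [rewrite step_ge1|rewrite -(step_ge1 (lexx 1)) step_mono]. Qed.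

End class_C_theory.

Section plateau.
Context {R : realType} {n : nat}.
Local Notation E := 'rV[R]_n.

(** A smooth cutoff: 1 on the cube of radius [r] around [p], 0 outside the cube of radius [2 * r].
    In each coordinate one factor cuts on the left and one on the right. *)
Definition plateau (p : E) (r : R) (x : E) : R^o :=
  \prod_(i < n) (step (2 + r^-1 * (x ord0 i - p ord0 i)) * step (2 - r^-1 * (x ord0 i - p ord0 i))).

Lemma coord_affine (i : 'I_n) (c b : R) k (f : R -> R^o) : class_C k f ->
  class_C k (fun x : E => f (b + c * x ord0 i) : R^o).
Proof.
apply: (@class_C_affine _ _ _ _ _ (fun x : E => b + c * x ord0 i : R) (fun x : E => c * x ord0 i : R)).
  move=> x; have hc : (fun x : E => x ord0 i) @ x --> x ord0 i by exact: coord_continuous.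
  exact: (cvgD (cvg_cst b) (cvgM (cvg_cst c) hc)).
by move=> h v x; rewrite !mxE /GRing.scale/=; ring.
Qed.

Lemma smooth_plateau p r : smooth (plateau p r).
Proof.
move=> k; apply: class_C_prod => i; apply: class_CM.
  rewrite (_ : (fun x => _) = fun x : E => step ((2 - r^-1 * p ord0 i) + r^-1 * x ord0 i)).
    by apply: coord_affine; exact: smooth_step.
  by apply/funext => x; congr step; ring.
rewrite (_ : (fun x => _) = fun x : E => step ((2 + r^-1 * p ord0 i) + (- r^-1) * x ord0 i)).
  by apply: coord_affine; exact: smooth_step.
by apply/funext => x; congr step; ring.
Qed.

Lemma plateau_ge0 p r x : 0 <= plateau p r x.
Proof. by apply: prodr_ge0 => i _; rewrite mulr_ge0 ?step_ge0. Qed.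

Lemma plateau_le1 p r x : plateau p r x <= 1.
Proof.
rewrite /plateau; apply: (@le_trans _ _ (\prod_(i < n) 1)); last by rewrite big1.
by apply: ler_prod => i _; rewrite mulr_ge0 ?step_ge0//= mulr_ile1 ?step_ge0 ?step_le1.
Qed.

Lemma plateau1 (p : E) (r : R) (x : E) : 0 < r -> (forall i, `|x ord0 i - p ord0 i| <= r) -> plateau p r x = 1.
Proof.
move=> r0 h; rewrite /plateau big1// => i _; have := h i.
have -> : `|x ord0 i - p ord0 i| = r * `|r^-1 * (x ord0 i - p ord0 i)|.
  by rewrite normrM gtr0_norm ?invr_gt0// mulrA mulfV ?mul1r// gt_eqF.
rewrite -[X in _ <= X]mulr1 ler_pM2l// ler_norml => /andP[h1 h2].
by rewrite !step_ge1//; lra.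
Qed.

Lemma plateau0 (p : E) (r : R) (x : E) : 0 < r -> (exists i, 2 * r <= `|x ord0 i - p ord0 i|) -> plateau p r x = 0.
Proof.
move=> r0 [i]; rewrite /plateau (bigD1 i)//=.
have -> : `|x ord0 i - p ord0 i| = r * `|r^-1 * (x ord0 i - p ord0 i)|.
  by rewrite normrM gtr0_norm ?invr_gt0// mulrA mulfV ?mul1r// gt_eqF.
rewrite mulrC ler_pM2l// ler_normr => /orP[h|h].
  by rewrite [X in _ * X * _]step_le0//; lra.
by rewrite step_le0//; lra.
Qed.

End plateau.

Section continuity.
Context {R : realType} {T : topologicalType}.
Implicit Types f g : T -> R.

Lemma contD f g : continuous f -> continuous g -> continuous (fun x => f x + g x).
Proof. by move=> cf cg x; exact: (cvgD (cf x) (cg x)). Qed.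

Lemma contB f g : continuous f -> continuous g -> continuous (fun x => f x - g x).
Proof. by move=> cf cg x; exact: (cvgB (cf x) (cg x)). Qed.

Lemma contM f g : continuous f -> continuous g -> continuous (fun x => f x * g x).
Proof. by move=> cf cg x; exact: (cvgM (cf x) (cg x)). Qed.

Lemma cont_cst (c : R) : continuous (fun _ : T => c).
Proof. by move=> x; exact: cvg_cst. Qed.

Lemma cont_norm f : continuous f -> continuous (fun x => `|f x|).
Proof. by move=> cf x; exact: (cvg_norm (cf x)). Qed.

Lemma cont_sum (I : Type) (s : seq I) (F : I -> T -> R) :
  (forall i, continuous (F i)) -> continuous (fun x => \sum_(i <- s) F i x).
Proof.
move=> cF; elim: s => [|i s ih].
  by under eq_fun do rewrite big_nil; exact: cont_cst.
by under eq_fun do rewrite big_cons; exact: contD.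
Qed.

End continuity.

(** * Directional derivatives and calculus along lines *)

Section calculus_rV.
Context {R : realType} {n : nat}.
Local Notation E := 'rV[R]_n.
Local Notation lam := (@lebesgue_measure R).

Lemma rV_normP (x : E) (r : R) : 0 <= r -> (`|x| <= r) <-> (forall i, `|x ord0 i| <= r).
Proof.
move=> r0; rewrite [`|x|]mx_normrE; split=> [h i|h].
  by apply: le_trans h; exact: (le_bigmax _ (fun ij : 'I_1 * 'I_n => `|x ij.1 ij.2|) (ord0, i)).
by apply: bigmax_le => // -[i j] _ /=; rewrite ord1.
Qed.

Lemma compact_ball_rV (p : E) (r : R) : compact [set x : E | `|x - p| <= r].
Proof.
apply: bounded_closed_compact.
  exists (`|p| + r); split; first exact: num_real.
  move=> M hM x /= xr; apply: le_trans (ltW hM).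
  by rewrite -(subrK p x); apply: le_trans (ler_normD _ _) _; rewrite addrC lerD2l.
have cf : continuous (fun x : E => `|x - p|).
  move=> x; exact: (cvg_norm (cvgB cvg_id (cvg_cst p))).
by have := closed_comp (fun x _ => cf x) (@closed_le R r).
Qed.

Lemma continuous_bounded_on (f : E -> R) (K : set E) : compact K -> continuous f ->
  exists M, 0 < M /\ forall x, K x -> `|f x| <= M.
Proof.
move=> cK cf; have := @compact_bounded _ _ _ (continuous_compact (continuous_subspaceT cf) cK).
move=> [B [_ hB]]; exists (`|B| + 1); split; first by rewrite ltr_wpDl.
move=> x Kx; apply: hB; last by exists x.
by apply: le_lt_trans (ler_norm B) _; rewrite ltrDl.
Qed.

(** Only [x] is confined to the compact set, [y] may leave it; hence the near covering argument,
    with balls of half the radius given by continuity. *)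
Lemma uniformly_continuous_on (f : E -> R) (K : set E) : compact K -> continuous f ->
  forall e, 0 < e -> exists2 d, 0 < d & forall x y, K x -> `|x - y| < d -> `|f x - f y| < e.
Proof.
move=> cK cf e e0.
have := (compact_near_coveringP K).1 cK R (0 : R)^'+ (fun d x => forall y, `|x - y| < d -> `|f x - f y| < e).
move=> /(_ _)[].
  move=> x Kx.
  have : \forall z \near x, `|f x - f z| < e / 2.
    by have /cvgrPdist_lt := cf x; apply; lra.
  move=> /nbhs_ballP[r /= r0 hr].
  exists (ball x (r / 2), [set d : R | 0 < d < r / 2]); first split.
  - by apply: nbhsx_ballx; lra.
  - near=> d; apply/andP; split; near: d; [exact: nbhs_right_gt|apply: nbhs_right_lt; lra].
  move=> [z d] /= [xz /andP[d0 dr]] y zy.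
  have h1 : `|f x - f z| < e / 2 by apply: hr; apply: le_ball xz; lra.
  have h2 : `|f x - f y| < e / 2.
    apply: hr; move: xz; rewrite -ball_normE /= => xz.
    by apply: le_lt_trans (ler_distD z _ _) _; lra.
  by apply: le_lt_trans (ler_distD (f x) _ _) _; rewrite (distrC (f z)); lra.
move=> d /= d0 hd; exists (d / 2) => [|x y Kx xy]; first lra.
have h2 : 0 < d / 2 by lra.
apply: (hd (d / 2) _ h2 x Kx y xy) => /=.
by rewrite sub0r normrN gtr0_norm//; lra.
Unshelve. all: by end_near. Qed.

Lemma line_derive (f : E -> R^o) (x v : E) (t : R) : (forall x, derivable f x v) ->
  is_derive t 1 (fun s : R => f (x + s *: v)) ('D_v f (x + t *: v)).
Proof.
move=> df.
have e : (fun h : R => h^-1 *: (((fun s : R => f (x + s *: v) : R) \o shift t) (h *: (1 : R)) - f (x + t *: v))) =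
   (fun h : R => h^-1 *: ((f \o shift (x + t *: v)) (h *: v) - f (x + t *: v))).
  apply/funext => h /=; congr (_ *: (f _ - _)).
  by rewrite [h *: 1]mulr1 scalerDl addrCA.
by apply: DeriveDef; [rewrite /derivable e; exact: df|rewrite /derive e].
Qed.

Lemma line_cont (f : E -> R) (x v : E) : continuous f -> continuous (fun t : R => f (x + t *: v)).
Proof.
move=> cf t; apply: continuous_comp; last exact: cf.
by apply: cvgD; [exact: cvg_cst|apply: cvgZr_tmp; exact: cvg_id].
Qed.

Lemma FTC_path (f df : R -> R) (s : R) : 0 <= s -> (forall t : R, is_derive t 1 f (df t)) -> continuous df ->
  f s - f 0 = \int[lam]_(t in `[0, s]) df t.
Proof.
rewrite le_eqVlt => /predU1P[<- _ _|s0 hf cdf].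
  by rewrite subrr set_itv1 Rintegral_set1.
have cf : continuous f.
  by move=> t; apply: differentiable_continuous; apply/derivable1_diffP.
have := @continuous_FTC2 R df f 0 s s0 (continuous_subspaceT cdf).
rewrite /Rintegral => -> //.
- split; [by move=> t _; exact: (hf t).(ex_derive)|by apply: cvg_at_right_filter; exact: cf|by apply: cvg_at_left_filter; exact: cf].
- by move=> t _; rewrite derive1E; exact: (hf t).(derive_val).
Qed.

Lemma MVT_path (f df : R -> R) (s : R) : 0 < s -> (forall t : R, is_derive t 1 f (df t)) ->
  exists2 c, 0 < c < s & f s - f 0 = df c * s.
Proof.
move=> s0 hf; have [] := @MVT R f df 0 s s0 (fun t _ => hf t).
  apply: continuous_subspaceT => t; apply: differentiable_continuous; apply/derivable1_diffP; exact: (hf t).(ex_derive).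
by move=> c; rewrite/= subr0 => ? ?; exists c.
Qed.

(** [class_C] speaks of directional derivatives only, so additivity in the direction needs a proof.
    The increment along [s *: (v + w)] is the one along [s *: w] followed by the one along [s *: v];
    the mean value theorem evaluates the three increments, and for small [s] continuity of the
    derivatives brings the values back to [x]. *)
Lemma derive_add (f : E -> R^o) (v w x : E) : class_C 1 f -> 'D_(v + w) f x = 'D_v f x + 'D_w f x.
Proof.
move=> [_ df]; have [dv [cv _]] := df v; have [dw [cw _]] := df w; have [dvw [cvw _]] := df (v + w).
apply/eqP; rewrite -subr_eq0 -normr_le0; apply/ler_addgt0Pl => e e0; rewrite addr0.
have near0 (g : E -> R) : continuous g -> exists2 r, 0 < r & forall z, `|z| < r -> `|g x - g (x + z)| < e / 3.
  move=> /(_ x) /cvgrPdist_lt /(_ (e / 3)) h; have {}h := h ltac:(lra).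
  have [r /= r0 hr] := (nbhs_ballP _ _).1 h; exists r => // z zr; apply: hr.
  by rewrite -ball_normE /= opprD addNKr normrN.
have [r1 r10 h1] := near0 _ cv; have [r2 r20 h2] := near0 _ cw; have [r3 r30 h3] := near0 _ cvw.
pose M := `|v| + `|w| + 1; have M0 : 0 < M by rewrite ltr_wpDl// addr_ge0.
pose r := Num.min r1 (Num.min r2 r3).
have r0 : 0 < r by rewrite !lt_min r10 r20 r30.
pose s := r / (2 * M); have s0 : 0 < s by rewrite divr_gt0// mulr_gt0.
have sM : s * M < r.
  have -> : s * M = r / 2 by rewrite /s; field; rewrite gt_eqF.
  lra.
have [rr1 rr2 rr3] : [/\ s * M < r1, s * M < r2 & s * M < r3].
  by split; apply: (lt_le_trans sM); rewrite !ge_min lexx ?orbT.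
have [c1 /andP[c10 c1s] e1] := MVT_path s0 (fun t => line_derive (x + s *: w) t dv).
have [c2 /andP[c20 c2s] e2] := MVT_path s0 (fun t => line_derive x t dw).
have [c3 /andP[c30 c3s] e3] := MVT_path s0 (fun t => line_derive x t dvw).
have sn : s != 0 by rewrite gt_eqF.
have key : 'D_(v + w) f (x + c3 *: (v + w)) = 'D_v f (x + s *: w + c1 *: v) + 'D_w f (x + c2 *: w).
  apply: (mulIf sn); rewrite mulrDl -e1 -e2 -e3 !scale0r !addr0 scalerDr.
  by rewrite [s *: v + _]addrC !addrA subrK.
have bd z a b : 0 < a < s -> 0 <= b <= s -> z = a *: v + b *: w -> `|z| < s * M.
  move=> /andP[a0 as_] /andP[b0 bs] ->; apply: le_lt_trans (ler_normD _ _) _; rewrite !normrZ.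
  rewrite (gtr0_norm a0) (ger0_norm b0) /M !mulrDr mulr1 -[X in X < _]addr0.
  by apply: ler_ltD => //; apply: lerD; apply: ler_wpM2r => //; exact: ltW.
have g1 : `|'D_v f x - 'D_v f (x + s *: w + c1 *: v)| < e / 3.
  rewrite -addrA; apply: h1; apply: lt_trans rr1.
  by apply: (bd _ c1 s); rewrite ?c10 ?(ltW s0)//= ?lexx// addrC.
have g2 : `|'D_w f x - 'D_w f (x + c2 *: w)| < e / 3.
  apply: h2; apply: lt_trans rr2; rewrite normrZ (gtr0_norm c20).
  apply: le_lt_trans (_ : s * `|w| < _); first by rewrite ler_wpM2r// ltW.
  by rewrite ltr_pM2l// /M; have := normr_ge0 v; lra.
have g3 : `|'D_(v + w) f x - 'D_(v + w) f (x + c3 *: (v + w))| < e / 3.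
  apply: h3; apply: lt_trans rr3.
  by apply: (bd _ c3 c3); rewrite ?c30 ?(ltW c30) ?(ltW c3s)//= scalerDr.
rewrite key in g3; move: g1 g2 g3.
set A := 'D_v f x; set B := 'D_w f x; set C := 'D_(v + w) f x.
set A' := 'D_v f _; set B' := 'D_w f _; rewrite !ltr_norml ler_norml; lra.
Qed.

Lemma derive_scale (f : E -> R^o) (c : R) (v x : E) : (forall x, derivable f x v) ->
  'D_(c *: v) f x = c * 'D_v f x.
Proof.
move=> df; have h0 := line_derive x 0 df.
have [_ h] := derive_line c h0; move: h; rewrite scale0r addr0 => <-.
have e : (fun h : R => h^-1 *: (((fun s : R => f (x + s *: v) : R) \o shift 0) (h *: c) - f (x + (0 : R) *: v))) =
   (fun h : R => h^-1 *: ((f \o shift x) (h *: (c *: v)) - f x)).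
  apply/funext => h; congr (_ *: (f _ - f _)); last by rewrite scale0r addr0.
  by rewrite /= /shift/= addr0 [RHS]addrC scalerA.
by rewrite /derive e.
Qed.

Lemma derive_coord (f : E -> R^o) (v x : E) : class_C 1 f ->
  'D_v f x = \sum_i v ord0 i * partial i f x.
Proof.
move=> Cf; have df w : forall x, derivable f x w := (Cf.2 w).1.
rewrite {1}(_ : v = \sum_i v ord0 i *: delta_mx ord0 i); last exact: row_sum_delta.
elim: (index_enum _) => [|i s ih].
  rewrite !big_nil -[RHS](mul0r ('D_0 f x)) -(derive_scale 0 x (df 0)).
  by rewrite scale0r.
by rewrite !big_cons derive_add// derive_scale// ih.
Qed.

End calculus_rV.

Lemma coord_enorm {R : realType} n (x : 'rV[R]_n) i : `|x ord0 i| <= enorm x.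
Proof.
rewrite -sqrtr_sqr ler_wsqrtr// (bigD1 i)//= lerDl.
by apply: sumr_ge0 => j _; exact: sqr_ge0.
Qed.

(** * A covering bound for Hausdorff measure *)

Section hausdorff_bound.
Context {R : realType} {n : nat}.
Local Notation E := 'rV[R]_n.
Implicit Types A : set E.

Lemma enorm_le (x : E) (r : R) : 0 <= r -> `|x| <= r -> enorm x <= n%:R * r.
Proof.
move=> r0 /(rV_normP _ r0) h; rewrite -[leRHS]ger0_norm ?mulr_ge0// -sqrtr_sqr ler_wsqrtr//.
apply: (@le_trans _ _ (\sum_(i < n) r ^+ 2)).
  by apply: ler_sum => i _; rewrite -(real_normK (num_real (x _ _))) lerXn2r.
rewrite sumr_const card_ord exprMn -[leLHS]mulr_natl ler_wpM2r ?sqr_ge0//.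
by rewrite -natrX ler_nat; case: (n) => // k; rewrite -[X in (X <= _)%N]expn1 leq_pexp2l.
Qed.

Lemma diam_le A (r : R) : 0 <= r -> (forall x y, A x -> A y -> enorm (x - y) <= r) -> (diam A <= r%:E)%E.
Proof.
move=> r0 h; apply: ge_ereal_sup => _ [->|[[x y] /= [Ax Ay] <-]]; first by rewrite lee_fin.
by exact: h.
Qed.

Lemma diam_ge0 A : (0 <= diam A)%E.
Proof. by apply: ereal_sup_ubound; left. Qed.

Definition ball_vol (k : nat) : \bar R := leb k [set x | (enorm x <= 1)%R].

Lemma measurable_enorm_ball k : measurable [set x : 'rV[R]_k | enorm x <= 1].
Proof.
apply: measurable_sublevel; rewrite /enorm.
apply: (measurableT_comp (continuous_measurable_fun (@sqrt_continuous R))).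
by apply: measurable_sum => i; mfun.
Qed.

Lemma ball_vol_fin k : ball_vol k \is a fin_num.
Proof.
rewrite ge0_fin_numE//; apply: le_lt_trans (leb_cube k 1); apply: le_measure; rewrite ?inE.
- exact: measurable_enorm_ball.
- exact: leb_cube_measurable.
by move=> x /= h i; apply: (le_trans (coord_enorm x i)).
Qed.

(** [N ^ k] pieces of diameter at most [C / N] contribute at most a constant times [C ^+ k],
    whatever [N] is. Functions from ['I_k] to ['I_N] index the cells of a grid with [k]
    coordinates. *)
Lemma hausdorff_le k A (C : R) : (0 < k)%N -> 0 <= C ->
  (forall N, (0 < N)%N -> exists F : {ffun 'I_k -> 'I_N} -> set E,
     A `<=` \bigcup_t F t /\ forall t x y, F t x -> F t y -> enorm (x - y) <= C / N%:R) ->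
  (hausdorff k A <= (fine (ball_vol k) * C ^+ k)%:E)%E.
Proof.
move=> k0 C0 h; apply: ge_ereal_sup => _ [delta /= d0 <-].
have [N N0 CN] : exists2 N, (0 < N)%N & C / N%:R <= delta.
  exists (Num.truncn (C / delta)).+1 => //.
  rewrite ler_pdivrMr// mulrC -ler_pdivrMr//; exact/ltW/truncnS_gt.
have [F [AF hF]] := h N N0.
(* The cover must be a sequence: the pieces are enumerated and followed by empty sets, which have
   diameter 0 and contribute nothing because [k] is positive. *)
pose G j : set E := if (insub j : option 'I_#|{ffun 'I_k -> 'I_N}|) is Some i then F (enum_val i) else set0.
have NR : 0 < N%:R :> R by rewrite ltr0n.
have CN0 : 0 <= C / N%:R by rewrite divr_ge0// ltW.
have dG j : (diam (G j) <= (C / N%:R)%:E)%E.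
  by apply: diam_le => // x y; rewrite /G; case: insubP => // i _ _; exact: hF.
apply: le_trans (_ : _ <= \sum_(0 <= j <oo) ball_vol k * (2 ^- k)%:E * diam (G j) ^+ k)%E _.
  apply: ge_ereal_inf; eexists; last exact: lexx.
  exists G => //=; split; last by move=> j; apply: le_trans (dG j) _.
  move=> x /AF[t _ Ft]; exists (enum_rank t) => //=.
  by rewrite /G valK enum_rankK.
have B0 : (0 <= ball_vol k)%E by [].
have t0 j : (0 <= ball_vol k * (2 ^- k)%:E * diam (G j) ^+ k)%E.
  by rewrite !mule_ge0 ?expe_ge0 ?diam_ge0//.
set M := #|{ffun 'I_k -> 'I_N}|.
have ez j : (M <= j)%N -> (ball_vol k * (2 ^- k)%:E * diam (G j) ^+ k = 0)%E.
  move=> Mj; have -> : diam (G j) = 0%E.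
    rewrite /G insubF; last by rewrite ltnNge Mj.
    by apply/eqP; rewrite eq_le diam_ge0 andbT; apply: diam_le.
  by case: (k) k0 => // k' _; rewrite expeS mul0e mule0.
rewrite (nneseries_split_cond 0 M)//= ?add0n.
rewrite [X in (_ + X)%E]eseries0 ?adde0; last by move=> j Mj _; exact: ez.
apply: (@le_trans _ _ (\sum_(0 <= j < M) (fine (ball_vol k) * (C / N%:R) ^+ k)%:E)%E).
  apply: lee_sum => j _; rewrite -[X in (X * _ * _)%E]fineK ?ball_vol_fin//.
  rewrite EFinM; apply: lee_pmul; rewrite ?mule_ge0 ?expe_ge0 ?diam_ge0 ?lee_fin ?fine_ge0//.
    by rewrite ler_piMr ?fine_ge0// invf_le1// exprn_ege1// ler1n.
  rewrite EFin_expe; elim: (k) => [|m ih]; rewrite// !expeS.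
  by apply: lee_pmul => //; rewrite ?expe_ge0 ?diam_ge0.
rewrite sumEFin lee_fin sumr_const_nat subn0 /M card_ffun !card_ord -[leLHS]mulr_natl natrX mulrCA ler_wpM2l ?fine_ge0//.
by rewrite -exprMn mulrCA mulfV ?mulr1// gt_eqF.
Qed.

End hausdorff_bound.

Lemma interval_cell {R : realType} (a u : R) N : (0 < N)%N -> `|u| <= a ->
  exists t : 'I_N, - a + 2 * a / N%:R * t%:R <= u <= - a + 2 * a / N%:R * t.+1%:R.
Proof.
move=> N0; rewrite ler_norml => /andP[ua ub].
have NR : N%:R != 0 :> R by rewrite pnatr_eq0 -lt0n.
have ex : exists k, u <= - a + 2 * a / N%:R * k%:R by exists N; rewrite divfK//; lra.
case: (ex_minnP ex) => k hk mink.
have kN : (k <= N)%N by apply: mink; rewrite divfK//; lra.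
case: k hk mink kN => [|k] hk mink kN.
  exists (Ordinal N0) => /=; rewrite mulr0 addr0 mulr1 ua/=; apply: (le_trans hk).
  rewrite mulr0 lerD2l// mulr_ge0//; lra.
exists (Ordinal kN) => /=; rewrite hk andbT leNgt; apply/negP => /ltW /mink.
by rewrite ltnn.
Qed.

Lemma open_ball_rV {R : realType} {n} (p : 'rV[R]_n) r : open (ball p r).
Proof.
have [r0|r0] := ltP 0 r; first exact: ball_open.
rewrite (_ : ball p r = set0); first exact: open0.
by apply/seteqP; split => // x [r1 _]; move: r0; rewrite leNgt r1.
Qed.

Lemma lipschitz_continuous_rV {R : realType} {n} (h : 'rV[R]_n -> R) K :
  0 <= K -> (forall x y, `|h x - h y| <= K * `|x - y|) -> continuous h.
Proof.
move=> K0 hK z; apply/cvgrPdist_lt; first exact: (nbhs_filter z).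
move=> e e0.
have d0 : 0 < e / (K + 1) by rewrite divr_gt0// ltr_wpDl.
apply: filterS (nbhsx_ballx z _ d0) => w.
rewrite -ball_normE /= ltr_pdivlMr ?ltr_wpDl// => zw.
by apply: le_lt_trans (hK z w) _; apply: le_lt_trans zw; rewrite mulrC ler_wpM2l// lerDl.
Qed.

(** * Lipschitz charts and the surface measure of small boundary pieces *)

Section charts.
Context {R : realType} {n : nat}.
Local Notation E := 'rV[R]_n.
Variables (Om : set E) (sigma : {measure set E -> \bar R}).
Hypotheses (n1 : (1 < n)%N) (Om_open : open Om) (hsigma : surface_measure Om sigma).

(* [h] is the height above the boundary graph, [e] the vertical direction. *)
Definition chart (p : E) (r : R) (h : E -> R) (e : E) (K C : R) : Prop :=
  [/\ 0 < r, 0 <= K, forall x y, `|h x - h y| <= K * `|x - y|,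
      forall x s, h (x + s *: e) = h x + s &
      forall x, ball p r x -> (Om x <-> 0 < h x)] /\
  forall y d, 0 < d ->
    (sigma [set x | [/\ bdry Om x, ball p r x & (`|x - y| <= d)%R]] <= (C * d ^+ n.-1)%:E)%E.

Let bdry_closed : closed (bdry Om).
Proof. by apply: closedI; [exact: closed_closure|apply: open_closedC; exact: open_interior]. Qed.

Lemma measurable_bdry : measurable (bdry Om).
Proof. exact: closed_measurable_rV bdry_closed. Qed.

Lemma bdry_notin x : bdry Om x -> ~ Om x.
Proof. by move=> [_ h] Ox; apply: h; rewrite (interior_id Om).1. Qed.

Lemma measurable_piece p r y d : measurable [set x : E | [/\ bdry Om x, ball p r x & `|x - y| <= d]].
Proof.
rewrite (_ : [set x | _] = bdry Om `&` ball p r `&` [set x : E | `|x - y| <= d]).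
  apply: measurableI; first apply: measurableI; first exact: measurable_bdry.
    by apply: open_measurable_rV; exact: open_ball_rV.
  by apply: closed_measurable_rV; apply: compact_closed => //; exact: compact_ball_rV.
by apply/seteqP; split => x [] => [? ? ?|[? ?] ?].
Qed.

(** A boundary point is a limit of points of [Om], so its height cannot be negative; a positive
    height would put it in [Om], which is open and does not meet its boundary. *)
Lemma bdry_level p r (h : E -> R) K : 0 <= K -> (forall x y, `|h x - h y| <= K * `|x - y|) ->
  (forall x, ball p r x -> (Om x <-> 0 < h x)) ->
  forall x, bdry Om x -> ball p r x -> h x = 0.
Proof.
move=> K0 hK hO x bx px.
have hc : continuous h by exact: lipschitz_continuous_rV hK.
have [hx|hx|->//] := ltgtP (h x) 0.
  have nb : nbhs x (ball p r) by apply: open_nbhs_nbhs; split => //; exact: open_ball_rV.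
  have nh : nbhs x [set z | h z < 0] by have /cvgr_lt := hc x; apply.
  have [z [Oz [pz hz]]] := bx.1 _ (filterI nb nh).
  by move/(hO z pz): Oz; rewrite ltNge (ltW hz).
by case: (bdry_notin bx); apply/(hO x px).
Qed.

(** Within distance [d] of a point the boundary is a Lipschitz graph over a cube of side
    proportional to [d] in the [n.-1] tangential variables. A grid on that cube lifts to pieces of
    comparable diameter, which gives the bound [C * d ^+ n.-1] on the surface measure. *)
Lemma lipschitz_charts : lipschitz_boundary Om -> forall p, bdry Om p ->
  exists r h e K C, chart p r h e K C.
Proof.
move=> lip p bp; have [P [i [g [r [r0 OO lg hO]]]]] := lip p bp.
have [k k0 gk] : exists2 k, 0 <= k & forall a b, `|g a - g b| <= k * `|a - b|.
  move: lg => [M [_ hM]]; exists (`|M| + 1); first by rewrite addr_ge0.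
  move=> a b; have M1 : M < `|M| + 1 by rewrite (le_lt_trans (ler_norm M))// ltrDl.
  by have := hM _ M1 (a, b) (conj I I).
(* [B] dominates all row and column sums of [P], hence the norms of [P] and of its transpose as
   operators for the maximum norm. *)
pose B : R := \sum_k \sum_j `|P k j| + 1.
have B0 : 0 < B by rewrite ltr_wpDl//; apply: sumr_ge0 => ? _; apply: sumr_ge0.
have entry a b : `|P a b| <= B.
  rewrite /B (bigD1 a)//= (bigD1 b)//= -!addrA lerDl !addr_ge0 ?sumr_ge0// => ? _.
  exact: sumr_ge0.
have colB (M : 'M[R]_n) : (forall j, \sum_k `|M k j| <= B) -> forall x : E, `|x *m M| <= B * `|x|.
  move=> hM x; apply/rV_normP; first by rewrite mulr_ge0// ltW.
  move=> j; rewrite mxE; apply: le_trans (ler_norm_sum _ _ _) _.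
  apply: (@le_trans _ _ (\sum_k `|M k j| * `|x|)); last by rewrite -mulr_suml ler_wpM2r.
  apply: ler_sum => l _; rewrite normrM mulrC ler_wpM2l//.
  by have /(rV_normP _ (normr_ge0 x)) := lexx `|x|.
have OB (x : E) : `|x *m P| <= B * `|x|.
  apply: colB => j; rewrite /B exchange_big/= [X in _ <= X + _](bigD1 j)//= -addrA lerDl addr_ge0//.
  by apply: sumr_ge0 => ? _; apply: sumr_ge0.
have OTB (x : E) : `|x *m P^T| <= B * `|x|.
  apply: colB => j; under eq_bigr do rewrite mxE.
  rewrite /B [X in _ <= X + _](bigD1 j)//= -addrA lerDl addr_ge0//.
  by apply: sumr_ge0 => ? _; apply: sumr_ge0.
have cO (x y : E) : `|col' i (x *m P) - col' i (y *m P)| <= `|x *m P - y *m P|.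
  apply/rV_normP => // j; rewrite !mxE.
  have /(rV_normP _ (normr_ge0 _)) := lexx `|x *m P - y *m P|; move=> /(_ (lift i j)).
  by rewrite !mxE.
pose h (x : E) := (x *m P) ord0 i - g (col' i (x *m P)).
pose e : E := delta_mx ord0 i *m P^T.
have hK x y : `|h x - h y| <= (B + k * B) * `|x - y|.
  have xy : `|x *m P - y *m P| <= B * `|x - y| by rewrite -mulmxBl.
  rewrite /h mulrDl -mulrA.
  have -> a b c d : a - b - (c - d) = (a - c) - (b - d) :> R by ring.
  apply: le_trans (ler_normB _ _) _; apply: lerD.
    apply: le_trans xy; have /(rV_normP _ (normr_ge0 _)) := lexx `|x *m P - y *m P|.
    by move=> /(_ i); rewrite !mxE.
  apply: le_trans (gk _ _) _; rewrite ler_wpM2l//; exact: le_trans (cO x y) xy.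
have he x s : h (x + s *: e) = h x + s.
  rewrite /h; have -> : (x + s *: e) *m P = x *m P + s *: delta_mx ord0 i.
    by rewrite mulmxDl -scalemxAl /e -mulmxA (mulmx1C OO) mulmx1.
  have -> : col' i (x *m P + s *: delta_mx ord0 i) = col' i (x *m P).
    by apply/rowP => j; rewrite !mxE [lift i j == i]eq_sym (negbTE (neq_lift i j)) mulr0 addr0.
  by rewrite !mxE !eqxx mulr1; ring.
have hOm x : ball p r x -> (Om x <-> 0 < h x).
  by rewrite /h subr_gt0; exact: hO.
exists r, h, e, (B + k * B), (fine (ball_vol (n.-1) : \bar R) * (n%:R * (B * (1 + k)) * (2 * B)) ^+ n.-1).
have Bge0 : 0 <= B := ltW B0.
have K0 : 0 <= B + k * B by rewrite addr_ge0 ?mulr_ge0.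
split => // y d d0.
rewrite hsigma; last exact: measurable_piece.
rewrite setIidl; last by move=> x [].
rewrite -mulrA -exprMn.
have C0 : 0 <= n%:R * (B * (1 + k)) * (2 * B) * d.
  apply: mulr_ge0 (ltW d0); apply: mulr_ge0; last exact: mulr_ge0.
  by apply: mulr_ge0; [exact: ler0n|apply: mulr_ge0 => //; exact: addr_ge0].
apply: hausdorff_le => //; first by rewrite -subn1 subn_gt0.
move=> N N0; have NR : 0 < N%:R :> R by rewrite ltr0n.
pose a := B * d.
pose z (x : E) := col' i (x *m P) - col' i (y *m P).
(* Cells of a grid in the tangential coordinates. Since the height vanishes on the boundary, the
   remaining coordinate is a Lipschitz function of these. *)
exists (fun t : {ffun 'I_n.-1 -> 'I_N} => [set x | [/\ bdry Om x, ball p r x, `|x - y| <= d &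
  forall j, - a + 2 * a / N%:R * (t j)%:R <= z x ord0 j <= - a + 2 * a / N%:R * (t j).+1%:R]]).
split=> [x [bx px xy]|t x x' [bx px xy hx] [bx' px' xy' hx']].
  have za j : `|z x ord0 j| <= a.
    have : `|z x| <= a.
      apply: le_trans (cO x y) _; rewrite -mulmxBl; apply: le_trans (OB _) _.
      by rewrite ler_wpM2l// ltW.
    by move=> /(rV_normP _ _); apply; rewrite mulr_ge0// ltW.
  pose t := [ffun j => projT1 (cid (interval_cell N0 (za j)))].
  exists t => //=; split => // j; rewrite ffunE; exact: projT2 (cid (interval_cell N0 (za j))).
have s0 : 0 <= 2 * a / N%:R by rewrite ?mulr_ge0// ltW.
have zz : `|col' i (x *m P) - col' i (x' *m P)| <= 2 * a / N%:R.
  have -> : col' i (x *m P) - col' i (x' *m P) = z x - z x' by rewrite /z opprB addrA subrK.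
  apply/rV_normP => // j; have /andP[h1 h2] := hx j; have /andP[h3 h4] := hx' j.
  rewrite [(z x - z x') _ _]mxE [(- z x') _ _]mxE; have nt : (t j).+1%:R = (t j)%:R + 1 :> R by rewrite natr1.
  move: h1 h2 h3 h4; rewrite nt.
  set q := 2 * a / _; set u := z x _ _; set u' := z x' _ _; move: (_%:R) => T h1 h2 h3 h4.
  by rewrite ler_norml; lra.
have lev := bdry_level K0 hK hOm.
have hx0 := lev _ bx px; have hx0' := lev _ bx' px'.
have zi : `|(x *m P) ord0 i - (x' *m P) ord0 i| <= k * (2 * a / N%:R).
  have -> : (x *m P) ord0 i - (x' *m P) ord0 i = g (col' i (x *m P)) - g (col' i (x' *m P)).
    by move: hx0 hx0'; rewrite /h; lra.
  by apply: le_trans (gk _ _) _; rewrite ler_wpM2l.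
have zz' : `|x *m P - x' *m P| <= (1 + k) * (2 * a / N%:R).
  apply/rV_normP => [|j]; first by rewrite mulr_ge0// addr_ge0.
  case: (unliftP i j) => [j' ->|->].
    have /(rV_normP _ s0) := zz => /(_ j'); rewrite !mxE => /le_trans; apply.
    by rewrite ler_peMl// lerDl.
  by move: zi; rewrite !mxE => /le_trans; apply; rewrite ler_wpM2r// lerDr.
have xx' : `|x - x'| <= B * ((1 + k) * (2 * a / N%:R)).
  have -> : x - x' = (x *m P - x' *m P) *m P^T by rewrite -mulmxBl -mulmxA OO mulmx1.
  by apply: le_trans (OTB _) _; rewrite ler_wpM2l// ltW.
apply: le_trans (enorm_le _ xx') _.
  by apply: mulr_ge0 Bge0 _; apply: mulr_ge0 s0; exact: addr_ge0.
by apply: eqW; rewrite /a; field; rewrite gt_eqF.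
Qed.

End charts.

Lemma finite_ball_cover {R : realType} {n} (K : set 'rV[R]_n) (rho : 'rV[R]_n -> R) :
  compact K -> (forall p, K p -> 0 < rho p) ->
  exists s : seq 'rV[R]_n, (forall p, p \in s -> K p) /\ forall x, K x -> exists2 p, p \in s & ball p (rho p) x.
Proof.
move=> cK rK; have := cK; rewrite compact_cover => /(_ _ K (fun p => ball p (rho p))).
case=> [p _|x Kx|D DK Dc]; first exact: open_ball_rV.
  by exists x => //; apply: ballxx; exact: rK.
exists (finmap.enum_fset D); split=> [p pD|x /Dc[p /= pD px]]; first exact/set_mem/DK.
by exists p.
Qed.

Lemma integral_cover_le {R : realType} {d} {X : measurableType d} {I : eqType} (m : {measure set X -> \bar R})
    (A : set X) (B : I -> set X) (s : seq I) (F : X -> \bar R) :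
  measurable A -> (forall p, measurable (B p)) -> measurable_fun A F -> (forall x, 0 <= F x)%E ->
  (forall x, A x -> exists2 p, p \in s & B p x) ->
  (\int[m]_(x in A) F x <= \sum_(p <- s) \int[m]_(x in A `&` B p) F x)%E.
Proof.
move=> mA mB; elim: s A mA => [|p s ih] A mA mF F0 cov.
  rewrite big_nil (_ : A = set0) ?integral_set0//.
  by apply/seteqP; split => // x /cov[].
rewrite big_cons (_ : (\int[m]_(x in A) F x = \int[m]_(x in A `&` B p) F x + \int[m]_(x in A `\` B p) F x)%E).
  apply: leeD => //; apply: le_trans (ih (A `\` B p) _ _ F0 _) _.
  - exact: measurableD.
  - by apply: measurable_funS mF => //.
  - move=> x [Ax nB]; have [q] := cov x Ax; rewrite inE => /orP[/eqP -> //|qs Bq].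
    by exists q.
  - apply: lee_sum => q _; apply: ge0_subset_integral => //.
    + by apply: measurableI => //; exact: measurableD.
    + exact: measurableI.
    + by apply: measurable_funS mF => //.
    + by apply: setSI.
have AE : A `&` B p `|` A `\` B p = A.
  apply/seteqP; split=> [x [[]|[]]//|x Ax].
  by have [?|?] := pselect (B p x); [left|right].
rewrite -ge0_integral_setU ?AE//; [exact: measurableI|exact: measurableD|].
by apply/disj_setPS => x [[_ ?] [_ ?]].
Qed.

(** * A trace inequality for the surface measure *)

Section trace_inequality.
Context {R : realType} {n : nat}.
Local Notation E := 'rV[R]_n.
Local Notation RR := (measurableTypeR R).
Local Notation lam := (@lebesgue_measure R).
Variables (Om : set E) (sigma : {measure set E -> \bar R}).
Hypotheses (n1 : (1 < n)%N) (Om_open : open Om) (Om_bounded : bounded_set Om)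
  (Om_lip : lipschitz_boundary Om) (hsigma : surface_measure Om sigma).

Let mbdry : measurable (bdry Om). Proof. exact: measurable_bdry. Qed.
Let mOm : measurable Om. Proof. exact: open_measurable_rV. Qed.

Lemma compact_bdry : compact (bdry Om).
Proof.
apply: bounded_closed_compact.
  move: Om_bounded => [M [_ hM]]; exists (`|M| + 1); split; first exact: num_real.
  move=> B hB x [cx _]; have M1 : M < `|M| + 1 by rewrite (le_lt_trans (ler_norm M))// ltrDl.
  have d0 : 0 < B - (`|M| + 1) by rewrite subr_gt0.
  have [y [Oy]] := cx _ (nbhsx_ballx x _ d0); rewrite -ball_normE /= => xy.
  have := hM _ M1 y Oy => /= y1; rewrite -(subrK y x).
  by apply: le_trans (ler_normD _ _) _; lra.
by apply: closedI; [exact: closed_closure|apply: open_closedC; exact: open_interior].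
Qed.

(** The radius has to be a function of the point for the finite cover; off the boundary its value is
    a default. The covering balls take a quarter of it, which leaves room for moving off the
    boundary. *)
Definition chart_at p := if pselect (bdry Om p) is left bp then
  projT1 (cid (lipschitz_charts n1 Om_open hsigma Om_lip bp)) else 1.

Lemma chart_atP p : bdry Om p -> exists h e K C, chart Om sigma p (chart_at p) h e K C.
Proof.
move=> bp; rewrite /chart_at; case: pselect => // bp'.
exact: projT2 (cid (lipschitz_charts n1 Om_open hsigma Om_lip bp')).
Qed.

Lemma bdry_cover : exists s : seq E, (forall p, p \in s -> bdry Om p) /\
  forall x, bdry Om x -> exists2 p, p \in s & ball p (chart_at p / 4) x.
Proof.
apply: (finite_ball_cover (rho := fun p => chart_at p / 4) compact_bdry).
by move=> p /chart_atP[h [e [K [C [[r0 _ _ _ _] _]]]]]; rewrite divr_gt0.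
Qed.

Lemma sigma_fin : (sigma setT < +oo)%E.
Proof.
have [s [sb sc]] := bdry_cover.
have -> : sigma setT = sigma (bdry Om) by rewrite !hsigma// setTI setIid.
have -> : sigma (bdry Om) = (\int[sigma]_(x in bdry Om) 1)%E by rewrite integral_cst// mul1e.
have mB q : measurable (ball q (chart_at q / 4)) by apply: open_measurable_rV; exact: open_ball_rV.
apply: le_lt_trans (integral_cover_le sigma mbdry mB (measurable_cst 1%E) (fun _ => lee01) sc) _.
rewrite big_seq; apply: lte_sum_pinfty => p /sb /chart_atP[h [e [K [C [[r0 _ _ _ _] hC]]]]].
have mI : measurable (bdry Om `&` ball p (chart_at p / 4)).
  by apply: measurableI => //.
rewrite integral_cst// mul1e; apply: le_lt_trans (le_lt_trans (hC p _ r0) (ltry _)).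
apply: le_measure; rewrite ?inE//; first exact: measurable_piece.
move=> x [bx px]; split => //; first by apply: le_ball px; lra.
by move: px; rewrite -ball_normE /= distrC => /ltW; lra.
Qed.

Lemma sigma_sigma_finite : sigma_finite setT sigma.
Proof. by exists (fun=> setT); [rewrite bigcup_const|move=> _; split => //; exact: sigma_fin]. Qed.

Lemma measurable_move (e : E) : measurable_fun setT (fun q : E * RR => q.1 + q.2 *: e).
Proof.
apply: measurable_fun_coordP => i; under eq_fun do rewrite !mxE.
apply: measurable_funD; first mfun.
mfun.
Qed.

Section local_trace.
Variables (p : E) (r : R) (h : E -> R) (e : E) (K C : R).
Hypothesis ch : chart Om sigma p r h e K C.
Variables F G : E -> R.
Hypotheses (cF : continuous F) (cG : continuous G) (F0 : forall x, 0 <= F x) (G0 : forall x, 0 <= G x).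
Hypothesis FG : forall x s, 0 <= s -> F x <= F (x + s *: e) + \int[lam]_(t in `[0, s]) G (x + t *: e).

(** Along [e] a shift by at most [s0] moves a point by at most [r / 4], so points of the ball of
    radius [r / 2] stay inside the chart. *)
Let s0 : R := r / (4 * (`|e| + 1)).
Let H x := s0^-1 * F x + G x.
Let r0 : 0 < r. Proof. by case: ch.1. Qed.
Let K0 : 0 <= K. Proof. by case: ch.1. Qed.
Let hK x y : `|h x - h y| <= K * `|x - y|. Proof. by case: ch.1. Qed.
Let he x s : h (x + s *: e) = h x + s. Proof. by case: ch.1. Qed.
Let hO x : ball p r x -> (Om x <-> 0 < h x). Proof. by have [[_ _ _ _ ho] _] := ch; exact: ho. Qed.
Let e1 : 0 < `|e| + 1. Proof. by []. Qed.
Let s00 : 0 < s0. Proof. by rewrite// mulr_gt0. Qed.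
Let cH : continuous H.
Proof. by apply: contD => //; apply: contM => //; exact: cont_cst. Qed.
Let H0 x : 0 <= H x. Proof. by rewrite addr_ge0// mulr_ge0// invr_ge0 ltW. Qed.
Let hc : continuous h. Proof. exact: lipschitz_continuous_rV hK. Qed.

Let strip (eta : R) : set E := ball p (r / 2) `&` [set y | 0 < h y] `&` [set y | h y <= eta].

Let mstrip eta : measurable (strip eta).
Proof.
apply: measurableI; first apply: measurableI.
- by apply: open_measurable_rV; exact: open_ball_rV.
- by apply: open_measurable_rV; apply: (open_comp _ (@open_gt R 0)) => x _.
- by apply: measurable_sublevel; mfun.
Qed.

Let line_int (f : E -> R) x (D : set R) : continuous f -> compact D -> lam.-integrable D (fun t => (f (x + t *: e))%:E).
Proof.
move=> cf cD; apply: continuous_compact_integrable => //.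
by apply: continuous_subspaceT; exact: line_cont.
Qed.

(** Average the growth hypothesis [FG] over shifts in [[0, s0]]; the weight [s0^-1] in [H] comes
    from this average. *)
Lemma lift_bound y : F y <= \int[lam]_(s in `[0, s0]) H (y + s *: e).
Proof.
have cI : compact `[(0 : R), s0] by exact: segment_compact.
have mI : measurable (`[(0 : R), s0]%classic : set RR) by [].
have iF := line_int y cF cI; have iG := line_int y cG cI.
rewrite /H RintegralD//; last by apply: eq_integrable (integrableZl mI s0^-1 iF).
rewrite RintegralZl//.
set I := \int[_]_(t in _) G _.
have fI : fine (lam `[0, s0]) = s0.
  by rewrite /= lebesgue_measure_itv/= lte_fin s00 -EFinB subr0.
have : s0 * (F y - I) <= \int[lam]_(s in `[0, s0]) F (y + s *: e).
  have -> : s0 * (F y - I) = \int[lam]_(s in `[0, s0]) (F y - I) by rewrite Rintegral_cst// fI mulrC.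
  apply: le_Rintegral => //.
    by apply: continuous_compact_integrable => //; exact: cont_cst.
  move=> s; rewrite /= in_itv/= => /andP[s1 s2].
  rewrite lerBlDr; apply: le_trans (FG y s1) _; rewrite lerD2l.
  rewrite /I fine_le ?integrable_fin_num ?line_int//; try exact: segment_compact.
  apply: ge0_subset_integral => //.
  - by apply/measurable_EFinP; apply: measurable_funTS; apply: continuous_measurable_fun; exact: line_cont.
  - by move=> t _; rewrite lee_fin.
  - by move=> t /=; rewrite !in_itv/= => /andP[-> /le_trans]; apply.
rewrite -ler_pdivlMl// => hh; rewrite -lerBlDr; apply: le_trans hh _.
by [].
Qed.

(** Spread [F y] along the segment above [y] and exchange integrals. The height grows at unit speed
    along [e], so a given point of [Om] is reached from the strip only by shifts in an interval of
    length [eta]. *)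
Lemma strip_le eta : 0 < eta ->
  (\int[leb n]_(y in strip eta) (F y)%:E <= eta%:E * \int[leb n]_(y in Om) (H y)%:E)%E.
Proof.
move=> eta0; pose T := strip eta.
have mT : measurable T := mstrip eta.
have mH : measurable_fun setT H := continuous_measurable_rV cH.
(* [Phi] is written in terms of the starting point and [Psi] in terms of the end point; for each
   shift [s] translation invariance exchanges them. *)
pose Phi (q : E * RR) : \bar R := (\1_T q.1 * \1_(`[0, s0]%classic : set RR) q.2 * H (q.1 + q.2 *: e))%:E.
pose Psi (q : E * RR) : \bar R := (\1_T (q.1 - q.2 *: e) * \1_(`[0, s0]%classic : set RR) q.2 * H q.1)%:E.
have m1T : measurable_fun setT (\1_T : E -> R) by [].
have m1I : measurable_fun setT (\1_(`[0, s0]%classic : set RR) : RR -> R) by [].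
have mPhi : measurable_fun setT Phi.
  apply/measurable_EFinP; apply: measurable_funM; last exact: (measurableT_comp mH (measurable_move e)).
  apply: measurable_funM; first mfun.
  mfun.
have mPsi : measurable_fun setT Psi.
  apply/measurable_EFinP; apply: measurable_funM; last mfun.
  apply: measurable_funM; last mfun.
  have := measurableT_comp m1T (measurable_move (- e)).
  by apply: eq_measurable_fun => q _; rewrite /= scalerN.
have P0 q : (0 <= Phi q)%E by rewrite lee_fin !mulr_ge0.
have Q0 q : (0 <= Psi q)%E by rewrite lee_fin !mulr_ge0.
have sf := leb_sigma_finite (R := R) n.
have tx (f : E * RR -> \bar R) : measurable_fun setT f -> (forall q, 0 <= f q)%E ->
   (\int[(leb n \x lam)%E]_q f q = \int[leb n]_x \int[lam]_y f (x, y))%E.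
  by move=> mf f0; rewrite -setXTT (tonelli_x lam sf)// setXTT.
have ty (f : E * RR -> \bar R) : measurable_fun setT f -> (forall q, 0 <= f q)%E ->
   (\int[(leb n \x lam)%E]_q f q = \int[lam]_y \int[leb n]_x f (x, y))%E.
  by move=> mf f0; rewrite -setXTT (tonelli_y lam sf)// setXTT.
apply: (@le_trans _ _ (\int[leb n]_x \int[lam]_s Phi (x, s))%E).
  rewrite integral_mkcond; apply: ge0_le_integral => //.
  - by move=> y _; rewrite patchE; case: ifP => // _; rewrite lee_fin.
  - apply/(measurable_restrictT _ mT); apply: measurable_funTS; mfun.
  - by apply: (@tonelli_measurable_x _ _ _ _ _ _ setT setT) => //; rewrite setXTT.
  move=> y _; rewrite patchE; case: ifPn => yT; last by apply: integral_ge0.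
  apply: le_trans (_ : _ <= (\int[lam]_(s in `[0, s0]) H (y + s *: e))%:E)%E _; first by rewrite lee_fin lift_bound.
  rewrite fineK; last by apply: integrable_fin_num => //; apply: (line_int y cH); exact: segment_compact.
  rewrite integral_mkcond; apply: eqW; apply: eq_integral => s _.
  by rewrite patchE /Phi /= !indicE yT; case: ifP => _; rewrite ?mul1r ?mul0r.
rewrite -tx// ty//.
have -> : (\int[lam]_s \int[leb n]_x Phi (x, s) = \int[lam]_s \int[leb n]_x Psi (x, s))%E.
  apply: eq_integral => s _; rewrite -[RHS](leb_int_shift (s *: e)); last 2 first.
  - by apply: (@measurable_ysec _ _ _ _ setT setT measurableT measurableT _ _ Psi) => //; rewrite setXTT.
  - by [].
  by apply: eq_integral => x _; rewrite /Psi /= addrK.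
rewrite -ty// tx// -ge0_integralZl_EFin//; last 3 first.
- by move=> y _; rewrite lee_fin.
- mfun.
- exact: ltW.
rewrite [leRHS]integral_mkcond; apply: ge0_le_integral => //.
- by move=> y _; exact: integral_ge0.
- by apply: (@tonelli_measurable_x _ _ _ _ _ _ setT setT) => //; rewrite setXTT.
- apply/(measurable_restrictT _ mOm); apply: measurable_funeM; mfun.
move=> y _; rewrite patchE; case: ifPn => yO.
  pose J : set RR := `[h y - eta, h y]%classic.
  have mJ : measurable_fun setT (\1_J : RR -> R) by apply: measurable_indic; exact: measurable_itv.
  apply: (@le_trans _ _ (\int[lam]_s (H y * \1_J s)%:E)%E).
    apply: ge0_le_integral => //.
    - by apply: (@measurable_xsec _ _ _ _ setT setT measurableT measurableT _ _ Psi) => //; rewrite setXTT.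
    - mfun.
    move=> s _; rewrite lee_fin mulrC ler_wpM2l//.
    rewrite !indicE; case: (boolP (_ \in T)) => [/set_mem[[_ /= h1] /= h2]|_]; last by rewrite mul0r.
    rewrite -scaleNr !he in h1 h2.
    rewrite (mem_set (_ : J s)); first by case: (_ \in _); rewrite ?mulr1 ?mulr0.
    by rewrite /J /= in_itv/=; lra.
  under eq_integral do rewrite EFinM.
  rewrite ge0_integralZl_EFin//; last mfun.
  rewrite integral_indic ?setIT; [|mfun|exact: measurable_itv]; rewrite muleC lee_wpmul2r ?lee_fin//.
  have jl : (h y - eta < h y)%R by lra.
  by rewrite /J /= lebesgue_measure_itv/= lte_fin jl lee_fin; lra.
rewrite (eq_integral (cst 0%E)) ?integral0// => s _; rewrite /Psi /= !indicE.
case: (boolP (_ \in T)) => [/set_mem[[h1 /= h2] _]|_]; last by rewrite !mul0r.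
case: (boolP (s \in _)) => [/set_mem|_]; last by rewrite mulr0 mul0r.
rewrite /= in_itv/= => /andP[s1 s2]; exfalso; move/negP: yO; apply; rewrite inE.
rewrite -scaleNr he in h2; apply/hO; last by lra.
move: h1; rewrite -ball_normE /= => h1.
have -> : p - y = (p - (y - s *: e)) - s *: e by rewrite opprB addrA addrAC addrK.
apply: le_lt_trans (ler_normB _ _) _; rewrite normrZ (ger0_norm s1).
have : s * `|e| <= s0 * (`|e| + 1) by apply: ler_pM => //; rewrite lerDl.
have -> : s0 * (`|e| + 1) = r / 4 by rewrite /s0; field.
have := r0; lra.
Qed.

(** Replace [F x] by the values of [F] on a cube of radius [d] around [x + w], which lies in the
    strip; uniform continuity pays for this with [om]. After exchanging integrals, a point of the
    strip is seen from boundary points within one cube of radius [d], of measure at most a constant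
    times [d ^+ n.-1]. The strip supplies one more factor [d], and these powers cancel against the
    volume of the cubes. *)
Lemma local_trace_eps om : 0 < om ->
  (\int[sigma]_(x in bdry Om `&` ball p (r / 4)) (F x)%:E <=
   (`|C| * (2 * K + 1))%:E * \int[leb n]_(y in Om) (H y)%:E + om%:E * sigma setT)%E.
Proof.
move=> om0; pose S := bdry Om `&` ball p (r / 4).
have mS : measurable S by apply: measurableI => //; apply: open_measurable_rV; exact: open_ball_rV.
have K1 : 0 < K + 1 by rewrite ltr_wpDl.
pose L := 1 + (K + 1) * `|e|.
have L1 : 1 <= L by rewrite lerDl mulr_ge0// ltW.
have [d0 d00 Fd] := uniformly_continuous_on (@compact_ball_rV R n p r) cF om0.
pose d := Num.min d0 (r / 4) / (2 * L).
have L0 : 0 < L by exact: lt_le_trans L1.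
have d0' : 0 < d by rewrite divr_gt0// ?mulr_gt0// lt_min d00 divr_gt0.
have dL : d * L = Num.min d0 (r / 4) / 2 by rewrite /d; field; rewrite gt_eqF.
have dL1 : d * L < d0.
  have : Num.min d0 (r / 4) <= d0 by rewrite ge_min lexx.
  by lra.
have dL2 : d * L < r / 4.
  have : Num.min d0 (r / 4) <= r / 4 by rewrite ge_min lexx orbT.
  by move: r0; lra.
(* The height is [K]-Lipschitz, so lifting by [(K + 1) * d] keeps a cube of radius [d] between the
   heights [d] and [(2 * K + 1) * d]. *)
pose w : E := ((K + 1) * d) *: e.
pose B (x y : E) := `|y - x - w| <= d.
have Bd x y : B x y -> `|y - x| <= d * L.
  rewrite /B => hb; rewrite -(subrK w (y - x)); apply: le_trans (ler_normD _ _) _.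
  have -> : `|w| = (K + 1) * d * `|e| by rewrite normrZ ger0_norm// mulr_ge0// ltW.
  by rewrite /L; lra.
have Bstrip x y : S x -> B x y -> strip ((2 * K + 1) * d) y.
  move=> [bx px] hb.
  have hx : h x = 0.
    apply: (bdry_level Om_open K0 hK hO) bx _.
    by apply: le_ball px; have := r0; lra.
  have hy : `|h y - (K + 1) * d| <= K * d.
    have -> : (K + 1) * d = h (x + w) by rewrite he hx add0r.
    apply: le_trans (hK _ _) _; rewrite ler_wpM2l//.
    by rewrite opprD addrA.
  have Kd : 0 <= K * d by rewrite mulr_ge0// ltW.
  move: hy; rewrite ler_distl => /andP[hy1 hy2].
  split; first split => /=.
  - move: px; rewrite -ball_normE /= => px.
    have -> : p - y = p - x - (y - x) by rewrite opprB addrA subrK.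
    apply: le_lt_trans (ler_normB _ _) _; have := Bd _ _ hb; lra.
  - by lra.
  - by move=> /=; lra.
pose eta := (2 * K + 1) * d.
have eta0 : 0 < eta by rewrite mulr_gt0// ltr_wpDl// mulr_ge0.
pose c := (2 * d) ^+ n.
have c0 : 0 < c by rewrite exprn_gt0// mulr_gt0.
have mT : measurable (strip eta) := mstrip eta.
have mF : measurable_fun setT F := continuous_measurable_rV cF.
have vol x : leb n [set y | B x y] = c%:E.
  rewrite -(leb_cube_eq n (ltW d0')).
  have mc : measurable [set y : E | forall i, (`|y ord0 i| <= d)%R] by exact: leb_cube_measurable.
  have -> : [set y | B x y] = [set y | forall i, `|(y - (x + w)) ord0 i| <= d].
    by apply/seteqP; split => y /=; rewrite /B -addrA -opprD; move/(rV_normP _ (ltW d0')).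
  have mc' : measurable [set y : E | forall i, `|(y - (x + w)) ord0 i| <= d].
    by have := measurable_shift (- (x + w)) measurableT mc; rewrite setTI.
  have i1 (A : set E) (mA : measurable A) : (\int[leb n]_y (\1_A y)%:E = leb n A)%E.
    by rewrite integral_indic// setIT.
  rewrite -(i1 _ mc') -(i1 _ mc) -[RHS](leb_int_shift (- (x + w))).
  - by [].
  - mfun.
  - by [].
have mB : measurable [set z : E * E | B z.1 z.2].
  have -> : [set z : E * E | B z.1 z.2] = (fun z : E * E => z.2 - z.1 - w) @^-1` [set x : E | forall i, `|x ord0 i| <= d].
    by apply/seteqP; split => z /=; move/(rV_normP _ (ltW d0')).
  rewrite -[X in measurable X]setTI.
  suff : measurable_fun setT (fun z : E * E => z.2 - z.1 - w) by apply => //; exact: leb_cube_measurable.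
  apply: measurable_fun_coordP => i; under eq_fun do rewrite !mxE.
  apply: measurable_funB; last mfun.
  apply: measurable_funB; first mfun.
  mfun.
have ss := sigma_sigma_finite.
pose lebn := pack_sigma_finite (leb_sigma_finite (R := R) n).
pose Th (q : E * E) : \bar R := (\1_[set z : E * E | B z.1 z.2] q * F q.2)%:E.
have mTh : measurable_fun (S `*` strip eta) Th.
  apply: measurable_funTS; apply/measurable_EFinP; apply: measurable_funM; first mfun.
  mfun.
have Th0 q : (0 <= Th q)%E by rewrite lee_fin mulr_ge0.
have key x : S x -> (c%:E * (F x)%:E <= \int[leb n]_(y in strip eta) Th (x, y) + om%:E * c%:E)%E.
  move=> Sx.
  have mBx : measurable [set y | B x y].
    have -> : [set y | B x y] = [set y | [set z : E * E | B z.1 z.2] (x, y)] by [].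
    by rewrite -[X in measurable X]setTI; exact: (measurable_funTS (pair1_measurable x)).
  have -> : (\int[leb n]_(y in strip eta) Th (x, y) = \int[leb n]_(y in [set y | B x y]) (F y)%:E)%E.
    have sB : [set y | B x y] = strip eta `&` [set y | B x y].
      by apply/seteqP; split=> [y By|y []//]; split => //; exact: Bstrip Sx By.
    transitivity (\int[leb n]_(y in strip eta `&` [set y | B x y]) (F y)%:E)%E; last by rewrite -sB.
    rewrite [RHS]integral_mkcondr; apply: eq_integral => y _.
    rewrite /Th /= patchE; case: ifPn => hy.
      by rewrite indicE mem_set ?mul1r//; exact: set_mem hy.
    by rewrite indicE memNset ?mul0r// => hB; move/negP: hy; apply; apply/mem_set.
  rewrite -(vol x) -(integral_cst _ mBx om%:E) muleC -(integral_cst _ mBx (F x)%:E) /cst.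
  rewrite -ge0_integralD//; try solve [by move=> y _; rewrite lee_fin | by move=> y _; rewrite ltW
    | mfun| mfun].
  apply: ge0_le_integral => //; try solve [by move=> y _; rewrite lee_fin | by move=> y _; rewrite -EFinD lee_fin addr_ge0// ltW
    | by apply: emeasurable_funD; [mfun|mfun]
    | mfun].
  move=> y By; rewrite lee_fin.
  have : `|F x - F y| < om.
    apply: Fd; last by rewrite distrC (le_lt_trans (Bd _ _ By)).
    by have [_] := Sx; rewrite -ball_normE /= distrC => /ltW; have := r0; lra.
  by rewrite ltr_norml => /andP[_]; lra.
rewrite -(@lee_pmul2l _ c%:E)//.
rewrite -ge0_integralZl_EFin//; try solve [by move=> y _; rewrite lee_fin
  | mfun| exact: ltW].
have oc0 : (0 <= om%:E * c%:E)%E by rewrite mule_ge0// ltW.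
apply: (@le_trans _ _ (\int[sigma]_(x in S) (\int[lebn]_(y in strip eta) Th (x, y) + om%:E * c%:E))%E).
  apply: ge0_le_integral => //; try solve [by move=> y _; rewrite mule_ge0// lee_fin// ltW
    | apply: measurable_funeM; mfun| apply: emeasurable_funD; [exact: (tonelli_measurable_x lebn mS mT)|mfun]
    | by move=> y _; apply: adde_ge0 => //; exact: integral_ge0].
rewrite ge0_integralD//; try solve [by move=> x _; exact: integral_ge0
  | exact: (tonelli_measurable_x lebn mS mT) | mfun].
rewrite integral_cst// -(tonelli_x lebn ss)//.
rewrite (tonelli_y lebn ss)//.
rewrite ge0_muleDr; last 2 first.
- by rewrite mule_ge0 ?lee_fin ?mulr_ge0 ?addr_ge0 ?mulr_ge0//; apply: integral_ge0 => y _; rewrite lee_fin.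
- by rewrite mule_ge0// ltW.
apply: leeD; last first.
  rewrite muleA [(c%:E * _)%E]muleC; apply: lee_wpmul2l => //.
  by apply: le_measure; rewrite ?inE.
have C0 : (0 <= `|C| * d ^+ n.-1)%R by rewrite mulr_ge0// exprn_ge0// ltW.
apply: (@le_trans _ _ ((`|C| * d ^+ n.-1)%:E * \int[leb n]_(y in strip eta) (F y)%:E)%E).
  rewrite -ge0_integralZl_EFin//; try solve [by move=> y _; rewrite lee_fin
    | mfun].
  apply: ge0_le_integral => //; try solve [by move=> y _; exact: integral_ge0
    | exact: (tonelli_measurable_y ss mS mT)
    | apply: measurable_funeM; mfun| by move=> y _; rewrite mulr_ge0].
  move=> y _; rewrite /Th /=.
  under eq_integral do rewrite EFinM muleC.
  have mBy : measurable [set x | B x y].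
    have -> : [set x | B x y] = [set x | [set z : E * E | B z.1 z.2] (x, y)] by [].
    by rewrite -[X in measurable X]setTI; exact: (measurable_funTS (pair2_measurable y)).
  have i1 x : \1_[set z : E * E | B z.1 z.2] (x, y) = \1_[set x | B x y] x :> R.
    by [].
  rewrite ge0_integralZl_EFin//; last first.
    apply/measurable_EFinP; apply: measurable_funTS.
    by exact: measurable_indic.
  rewrite muleC; apply: lee_wpmul2r; first by rewrite lee_fin.
  have -> : (\int[sigma]_(x in S) (\1_[set z : E * E | B z.1 z.2] (x, y))%:E = sigma ([set x | B x y] `&` S))%E.
    rewrite -integral_indic//.
  apply: (@le_trans _ _ (C * d ^+ n.-1)%:E); last first.
    by rewrite lee_fin ler_wpM2r ?ler_norm// exprn_ge0// ltW.
  apply: le_trans (ch.2 (y - w) d d0'); apply: le_measure; rewrite ?inE.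
  - exact: measurableI.
  - exact: measurable_piece.
  move=> x [Bx [bx px]]; split => //; first by apply: le_ball px; have := r0; lra.
  by rewrite -opprB normrN addrAC.
apply: le_trans (lee_wpmul2l _ (strip_le eta0)) _; first by rewrite lee_fin.
rewrite muleA -EFinM muleA -EFinM; apply: lee_wpmul2r.
  by apply: integral_ge0 => y _; rewrite lee_fin.
have -> : `|C| * d ^+ n.-1 * eta = d ^+ n * (`|C| * (2 * K + 1)).
  by rewrite /eta -[in RHS](ltn_predK n1) exprS; ring.
rewrite lee_fin ler_wpM2r//; first by rewrite mulr_ge0// addr_ge0// mulr_ge0.
by rewrite /c [(2 * d) ^+ n]exprMn ler_peMl ?exprn_ge0 ?(ltW d0')// exprn_ege1// ler1n.
Qed.

End local_trace.

(** An integrated gradient bound: [G] controls the change of [F] along segments in every direction,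
    as required for moving off the boundary in any chart. *)
Definition line_bounded (F G : E -> R) :=
  [/\ continuous F, continuous G, forall x, 0 <= F x, forall x, 0 <= G x &
  forall x v s, 0 <= s -> F x <= F (x + s *: v) + \int[lam]_(t in `[0, s]) (`|v| * G (x + t *: v))].

Lemma trace_local p : bdry Om p -> exists2 c, 0 <= c & forall F G, line_bounded F G ->
  (\int[sigma]_(x in bdry Om `&` ball p (chart_at p / 4)) (F x)%:E <=
   c%:E * \int[leb n]_(y in Om) (F y + G y)%:E)%E.
Proof.
move=> bp; have [h [e [K [C ch]]]] := chart_atP bp.
have [r0 K0 _ _ _] := ch.1.
pose s0 := chart_at p / (4 * (`|e| + 1)).
pose D := s0^-1 + `|e|.
have s00 : 0 <= s0^-1 by rewrite invr_ge0 ?ltW// mulr_gt0//.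
have D0 : 0 <= D by rewrite addr_ge0.
have k0 : 0 <= `|C| * (2 * K + 1) by rewrite mulr_ge0// addr_ge0// mulr_ge0.
exists (`|C| * (2 * K + 1) * D) => [|F G [cF cG F0 G0 FG]]; first exact: mulr_ge0.
have cG' : continuous (fun x => `|e| * G x) by apply: contM => //; exact: cont_cst.
have G0' x : 0 <= `|e| * G x by rewrite mulr_ge0.
have mF : measurable_fun setT F := continuous_measurable_rV cF.
have mG : measurable_fun setT G := continuous_measurable_rV cG.
apply: le_trans (_ : _ <= (`|C| * (2 * K + 1))%:E * \int[leb n]_(y in Om) (s0^-1 * F y + `|e| * G y)%:E)%E _.
  (* The constant in [local_trace_eps] does not depend on [om] and the surface measure is finite, so
     the error term can be made smaller than any [eps]. *)
  apply/lee_addgt0Pr => eps eps0.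
  have sf : sigma setT \is a fin_num by rewrite ge0_fin_numE// sigma_fin.
  pose S := fine (sigma setT) + 1.
  have S0 : 0 < S by rewrite ltr_wpDl//.
  have om0 : 0 < eps / S by rewrite divr_gt0.
  apply: le_trans (local_trace_eps ch cF cG' F0 G0' (FG ^~ e) om0) _.
  apply: leeD => //; rewrite -(fineK sf) lee_fin mulrAC ler_pdivrMr// ler_pM2l//.
  by rewrite /S lerDl.
rewrite [(`|C| * (2 * K + 1) * D)%:E]EFinM -muleA; apply: lee_wpmul2l; first by rewrite lee_fin.
rewrite -ge0_integralZl_EFin//; try solve [by move=> y _; rewrite lee_fin addr_ge0
  | mfun].
apply: ge0_le_integral => //; try solve [by move=> y _; rewrite lee_fin addr_ge0// mulr_ge0
  | mfun| apply: measurable_funeM; mfun].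
move=> y _; rewrite lee_fin /D mulrDr; apply: lerD; rewrite ler_wpM2r// ?lerDl ?lerDr//.
Qed.

Lemma trace_W11 : exists2 c, 0 <= c & forall F G, line_bounded F G ->
  (\int[sigma]_(x in bdry Om) (F x)%:E <= c%:E * \int[leb n]_(y in Om) (F y + G y)%:E)%E.
Proof.
have [s [sb sc]] := bdry_cover.
have [c c0 hc] : exists2 c, 0 <= c & forall F G, line_bounded F G ->
  (\sum_(p <- s) \int[sigma]_(x in bdry Om `&` ball p (chart_at p / 4)) (F x)%:E <=
   c%:E * \int[leb n]_(y in Om) (F y + G y)%:E)%E.
  elim: s sb {sc} => [|p s ih] sb.
    by exists 0 => // F G _; rewrite big_nil mul0e.
  have [c1 c10 h1] := trace_local (sb p (mem_head _ _)).
  have [|c2 c20 h2] := ih; first by move=> q qs; apply: sb; rewrite inE qs orbT.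
  exists (c1 + c2) => [|F G FG]; first exact: addr_ge0.
  rewrite big_cons EFinD ge0_muleDl//.
  by apply: leeD; [exact: h1|exact: h2].
exists c => // F G FG; apply: le_trans (hc F G FG); have [cF _ F0 _ _] := FG.
apply: integral_cover_le => //.
- by move=> p; apply: open_measurable_rV; exact: open_ball_rV.
- by apply: measurable_funTS; mfun.
Qed.

End trace_inequality.

Lemma is_derive_eps {R : realType} {V : normedModType R} (f : V -> R^o) (x v : V) (d : R) :
  (forall e, 0 < e -> exists2 r, 0 < r & forall h : R, `|h| < r -> `|f (h *: v + x) - f x - h * d| <= e * `|h|) ->
  is_derive x v f d.
Proof.
move=> hyp.
have hc : (fun h : R => h^-1 *: (f (h *: v + x) - f x)) @ 0^' --> (d : R^o).
  apply/cvgrPdist_le => e e0; have [r r0 hr] := hyp e e0.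
  near=> h; have h0 : h != 0 by near: h; exact: nbhs_dnbhs_neq.
  rewrite (_ : d - h^-1 *: (f (h *: v + x) - f x) = - (h^-1 * (f (h *: v + x) - f x - h * d))); last first.
    by rewrite -[_ *: _]/(_ * _) [in RHS]mulrBr mulKf// opprB.
  rewrite normrN normrM normfV.
  rewrite ler_pdivrMl ?normr_gt0// [leRHS]mulrC; apply: hr.
  near: h; exists r => //= h /=; by rewrite sub0r normrN.
split; first by apply/cvg_ex; exists d.
exact: cvg_lim hc.
Unshelve. all: by end_near. Qed.

Definition domain {R : realType} {n : nat} (Om : set 'rV[R]_n) (sigma : {measure set 'rV[R]_n -> \bar R}) : Prop :=
  [/\ (1 < n)%N, open Om, bounded_set Om, lipschitz_boundary Om & surface_measure Om sigma].

Lemma bounded_L2 {R : realType} {d} {X : measurableType d} (m : {measure set X -> \bar R}) D (f : X -> R) (M : R) : measurable D -> (m D < +oo)%E ->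
  measurable_fun D f -> (forall x, D x -> `|f x| <= M) -> L2 m D f.
Proof.
move=> mD fD mf hM; apply: (@le_L2 _ _ _ m D mD f (cst `|M|)) => //.
  apply: L2_intble; first exact: measurable_cst.
  by have := @integrable_cst_fin _ _ _ m D (`|M| ^+ 2) mD fD.
by apply: nearW => x Dx; rewrite /= normr_id (le_trans (hM x Dx))// ler_norm.
Qed.

Lemma sq_subrr {R : realType} {d} {X : measurableType d} (m : {measure set X -> \bar R}) D (f : X -> R) : measurable D ->
  sqnorm m D (fun x => f x - f x) = 0.
Proof.
move=> mD; rewrite (@eq_sq _ _ _ m D _ (fun _ => 0 * 0)) => [|x _]; last by rewrite subrr mulr0.
by rewrite (sqZ mD 0 (L2_0 m mD)) expr0n mul0r.
Qed.

Lemma Rintegral_shift {R : realType} {n : nat} (z : 'rV[R]_n) (f : 'rV[R]_n -> R) : measurable_fun setT f ->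
  \int[leb n]_x f (x + z) = \int[leb n]_x f x.
Proof.
move=> mf; have mf' : measurable_fun setT (EFin \o f) by exact/measurable_EFinP.
congr fine.
rewrite (integralE (leb n) setT (fun x => (f (x + z))%:E)) (integralE (leb n) setT (fun x => (f x)%:E)).
congr (_ - _)%E.
  rewrite -(leb_int_shift z (measurable_funepos mf')); last by move=> x.
  apply: eq_integral => x _.
  by rewrite !funeposE.
rewrite -(leb_int_shift z (measurable_funeneg mf')); last by move=> x.
apply: eq_integral => x _.
by rewrite !funenegE.
Qed.

Lemma cont_shift {R : realType} {n : nat} (f : 'rV[R]_n -> R) (z : 'rV[R]_n) : continuous f -> continuous (fun x : 'rV[R]_n => f (x + z)).
Proof.
move=> cf x; apply: (@continuous_comp _ _ _ (fun x : 'rV[R]_n => x + z) f); last exact: cf.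
exact: (cvgD cvg_id (cvg_cst z)).
Qed.

(** * Mollification with kernels centred off the origin *)

Section mollification.
Context {R : realType} {n : nat}.
Local Notation E := 'rV[R]_n.

(** A normalised [plateau]. The centre [a] is free because near the boundary the kernel has to sit
    inside a cone, so that averages only look into the domain. *)
Lemma kernel_exists (a : E) (r : R) : 0 < r -> exists k : E -> R^o, [/\ smooth k, forall z, 0 <= k z,
  (\int[leb n]_z (k z)%:E = 1)%E, exists M, forall z, k z <= M & forall z, k z != 0 -> `|z - a| <= r].
Proof.
move=> r0; pose P := plateau a (r / 2).
have r2 : 0 < r / 2 by rewrite divr_gt0.
have sP : smooth P := smooth_plateau a (r / 2).
have mP : measurable_fun setT P by apply: continuous_measurable_rV; exact: smooth_continuous.
have Psupp z : P z != 0 -> `|z - a| <= r.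
  move=> Pz; apply/(rV_normP _ (ltW r0)) => i; rewrite !mxE leNgt; apply/negP => h.
  move/eqP: Pz; apply; apply: plateau0 => //; exists i; rewrite mulrC divfK//; exact: ltW.
have cube (s : R) : 0 <= s -> measurable [set z : E | `|z - a| <= s] /\ leb n [set z : E | `|z - a| <= s] = ((2 * s) ^+ n)%:E.
  move=> s0; pose C := [set x : E | forall i, `|x ord0 i| <= s].
  have mC : measurable C by exact: leb_cube_measurable.
  have -> : [set z : E | `|z - a| <= s] = (fun x : E => x + - a) @^-1` C.
    by apply/seteqP; split => z /= /(rV_normP _ s0).
  have mC' : measurable ((fun x : E => x + - a) @^-1` C).
    by have := measurable_shift (- a) measurableT mC; rewrite setTI.
  split => //; rewrite -(leb_cube_eq n s0) -/C.
  have i1 (A : set E) (mA : measurable A) : (\int[leb n]_y (\1_A y)%:E = leb n A)%E.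
    by rewrite integral_indic// setIT.
  rewrite -(i1 _ mC') -(i1 _ mC) -[RHS](leb_int_shift (- a)).
  - by [].
  - mfun.
  - by [].
pose N := (\int[leb n]_z (P z)%:E)%E.
have N0 : (0 < N)%E.
  have [mS vS] := cube (r / 2) (ltW r2).
  apply: (@lt_le_trans _ _ (leb n [set z : E | `|z - a| <= r / 2])); first by rewrite vS lte_fin exprn_gt0// mulr_gt0.
  rewrite -[leLHS]mul1e -integral_cst// [leLHS]integral_mkcond; apply: ge0_le_integral => //.
  - by move=> z _; rewrite patchE; case: ifP.
  - by apply/(measurable_restrictT _ mS).
  - mfun.
  move=> z _; rewrite patchE; case: ifPn => [/set_mem /= /(rV_normP _ (ltW r2)) h|_]; last by rewrite lee_fin plateau_ge0.
  by rewrite /P plateau1// => i; have := h i; rewrite !mxE.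
have Nf : N \is a fin_num.
  have [mS vS] := cube r (ltW r0).
  rewrite ge0_fin_numE ?(ltW N0)//; apply: (@le_lt_trans _ _ (leb n [set z : E | `|z - a| <= r])); last by rewrite vS ltry.
  rewrite -[leRHS]mul1e -integral_cst// [leRHS]integral_mkcond; apply: ge0_le_integral => //.
  - by move=> z _; rewrite lee_fin plateau_ge0.
  - mfun.
  - by apply/(measurable_restrictT _ mS).
  move=> z _; rewrite patchE; case: ifPn => [_|/negP nz]; first by rewrite lee_fin plateau_le1.
  by case: (eqVneq (P z) 0) => [->//|/Psupp h]; case: nz; rewrite inE.
have F0 : 0 < fine N by rewrite fine_gt0// N0/= -ge0_fin_numE// ltW.
exists (fun z => (fine N)^-1 * P z); split.
- exact: smoothZ.
- by move=> z; rewrite mulr_ge0 ?plateau_ge0// invr_ge0 ltW.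
- under eq_integral do rewrite EFinM.
  rewrite ge0_integralZl_EFin//; [|by move=> z _; rewrite lee_fin plateau_ge0|mfun|by rewrite invr_ge0 ltW].
  by rewrite -/N -(fineK Nf) -EFinM mulVf// gt_eqF.
- by exists (fine N)^-1 => z; rewrite ler_piMr ?plateau_le1// invr_ge0 ltW.
- by move=> z; rewrite mulf_eq0 negb_or => /andP[_ /Psupp].
Qed.

Section jensen.
Variables (k W : E -> R) (P : set E) (eta Mk : R).
Hypotheses (mk : measurable_fun setT k) (k0 : forall z, 0 <= k z) (k1 : (\int[leb n]_z (k z)%:E = 1)%E) (kM : forall z, k z <= Mk).
Hypotheses (LW : L2 (leb n) setT W) (mP : measurable P).

Let L2sqrtk : L2 (leb n) setT (fun z => Num.sqrt (k z)).
Proof.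
apply: L2_lty; first exact: (measurableT_comp (continuous_measurable_fun (@sqrt_continuous R)) mk).
by under eq_integral do rewrite sqr_sqrtr//; rewrite k1 ltry.
Qed.

Let shiftL2 x : L2 (leb n) setT (fun z => W (x + z)).
Proof.
have mW := L2_meas LW; have mWx : measurable_fun setT (fun z => W (x + z)).
  have ms : measurable_fun setT (fun z : E => x + z) by under eq_fun do rewrite addrC; exact: measurable_shift.
  mfun.
apply: L2_lty => //; under eq_integral do rewrite addrC.
rewrite (leb_int_shift x (f := fun z => (W z ^+ 2)%:E)); last 2 first.
- mfun.
- by move=> z; rewrite lee_fin sqr_ge0.
by rewrite (esq measurableT LW) ltry.
Qed.

Let Mk0 : 0 <= Mk. Proof. by apply: le_trans (k0 0) (kM 0). Qed.

Let L2diff x : L2 (leb n) setT (fun z => Num.sqrt (k z) * (W (x + z) - W x)).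
Proof.
apply: (L2_eq measurableT (f := fun z => Num.sqrt (k z) * W (x + z) - W x * Num.sqrt (k z))) => [z _|]; first by ring.
apply: (L2B measurableT) (L2Z measurableT _ L2sqrtk).
apply: (L2_bM measurableT) (shiftL2 x); split; first mfun.
exists (Num.sqrt Mk); apply: nearW => z _; rewrite ger0_norm// ler_wsqrtr//.
Qed.

(** Cauchy-Schwarz with the weight split into two factors [Num.sqrt (k z)], the first of which has
    norm 1. *)
Lemma jensen_pointwise x :
  (((\int[leb n]_z (k z * W (x + z)) - W x) ^+ 2)%:E <= \int[leb n]_z (k z * (W (x + z) - W x) ^+ 2)%:E)%E.
Proof.
have Lk : L2 (leb n) setT k.
  apply: (L2_eq measurableT (f := fun z => Num.sqrt (k z) * Num.sqrt (k z))) => [z _|]; first by rewrite -expr2 sqr_sqrtr.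
  apply: (L2_bM measurableT) L2sqrtk; split; first mfun.
  exists (Num.sqrt Mk); apply: nearW => z _; rewrite ger0_norm// ler_wsqrtr//.
have ik : (leb n).-integrable setT (EFin \o k).
  by have := L2M measurableT L2sqrtk L2sqrtk; apply: eq_integrable => // z _; rewrite /= -expr2 sqr_sqrtr.
have rk : \int[leb n]_z k z = 1 by rewrite /Rintegral k1.
have -> : \int[leb n]_z (k z * W (x + z)) - W x = inner (leb n) setT (fun z => Num.sqrt (k z)) (fun z => Num.sqrt (k z) * (W (x + z) - W x)).
  rewrite -[X in _ - X](mulr1) -rk -RintegralZl// -RintegralB//; last 2 first.
  - exact: (L2M measurableT Lk (shiftL2 x)).
  - exact: (integrableZl measurableT (W x) ik).
  by apply: eq_Rintegral => z _; rewrite mulrA -expr2 sqr_sqrtr//; ring.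
have -> : (\int[leb n]_z (k z * (W (x + z) - W x) ^+ 2)%:E = (sqnorm (leb n) setT (fun z => (Num.sqrt (k z) * (W (x + z) - W x))%R))%:E)%E.
  by rewrite -(esq measurableT (L2diff x)); apply: eq_integral => z _; rewrite exprMn sqr_sqrtr.
apply: le_trans (ip_sq measurableT L2sqrtk (L2diff x)) _.
rewrite [X in X * _](_ : _ = 1) ?mul1r// -rk /sqnorm.
by apply: eq_Rintegral => z _; rewrite sqr_sqrtr.
Qed.

Hypothesis mJ : measurable_fun P (fun x => \int[leb n]_z (k z * W (x + z))).
Hypothesis keta : forall z, k z != 0 -> (\int[leb n]_(x in P) ((W (x + z) - W x) ^+ 2)%:E <= eta%:E)%E.

(** Integrating the pointwise bound over [P] and exchanging integrals leaves translation errors for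
    shifts in the support of the kernel, averaged with total weight 1. *)
Lemma jensen : 0 <= eta -> (\int[leb n]_(x in P) ((\int[leb n]_z (k z * W (x + z)) - W x) ^+ 2)%:E <= eta%:E)%E.
Proof.
move=> eta0; have mW := L2_meas LW.
pose lebn := pack_sigma_finite (leb_sigma_finite (R := R) n).
have sf := leb_sigma_finite (R := R) n.
pose Th (q : E * E) : \bar R := (k q.2 * (W (q.1 + q.2) - W q.1) ^+ 2)%:E.
have mTh : measurable_fun (P `*` setT) Th.
  apply: measurable_funTS; apply/measurable_EFinP; apply: measurable_funM; first mfun.
  apply: measurable_funX; apply: measurable_funB; last mfun.
  apply: (measurableT_comp mW); apply: measurable_fun_coordP => i; under eq_fun do rewrite mxE.
  by apply: measurable_funD; [mfun|mfun].
have Th0 q : (0 <= Th q)%E by rewrite lee_fin mulr_ge0// sqr_ge0.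
apply: (@le_trans _ _ (\int[leb n]_(x in P) \int[lebn]_z Th (x, z))%E).
  apply: ge0_le_integral => //.
  - by move=> x _; rewrite lee_fin sqr_ge0.
  - mfun.
  - exact: (tonelli_measurable_x lebn mP measurableT).
  - by move=> x _; exact: jensen_pointwise.
rewrite -(tonelli_x lebn sf)// (tonelli_y lebn sf)//.
apply: (@le_trans _ _ (\int[leb n]_z (eta%:E * (k z)%:E))%E).
  apply: ge0_le_integral => //.
  - by move=> z _; exact: integral_ge0.
  - exact: (tonelli_measurable_y sf mP measurableT).
  - by apply: measurable_funeM; mfun.
  move=> z _; rewrite /Th /=; have [kz|kz] := eqVneq (k z) 0.
    by under eq_integral do rewrite kz mul0r; rewrite integral0 kz mule0.
  under eq_integral do rewrite EFinM.
  rewrite ge0_integralZl_EFin//; last 2 first.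
  - by move=> x _; rewrite lee_fin sqr_ge0.
  - apply/measurable_EFinP; apply: measurable_funTS; apply: measurable_funX; apply: measurable_funB => //.
    exact: (measurableT_comp mW (measurable_shift z)).
  by rewrite muleC lee_wpmul2r ?lee_fin//; exact: keta.
rewrite ge0_integralZl_EFin//; [by rewrite k1 mule1|by move=> z _; rewrite lee_fin|mfun].
Qed.

End jensen.

Section convolution.
Variable Om : set E.
Hypotheses (mO : measurable Om) (fO : (leb n Om < +oo)%E).
Variable (M : R).
Hypothesis OM : forall x, Om x -> `|x| <= M.
Variable w : E -> R.
Hypothesis Lw : L2 (leb n) Om w.

(** The kernel is evaluated at [y - x]: the value at [x] averages [w] over [x + z] with [z] in the
    support of [k], and every derivative brings a factor -1. *)
Definition mollify (k : E -> R) (x : E) : R := \int[leb n]_(y in Om) (w y * k (y - x)).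

Let iw : (leb n).-integrable Om (EFin \o w).
Proof.
have L1 : L2 (leb n) Om (fun _ => 1) by apply: (bounded_L2 (M := 1)) => // *; rewrite normr1.
by have := L2M mO Lw L1; apply: eq_integrable => // x _; rewrite /= mulr1.
Qed.

Let A := \int[leb n]_(y in Om) `|w y|.

Let A0 : 0 <= A. Proof. by apply: Rintegral_ge0. Qed.

Let iwk (k : E -> R) x : continuous k -> (leb n).-integrable Om (fun y => (w y * k (y - x))%:E).
Proof.
move=> ck; have ckx : continuous (fun y : E => k (y - x)) by exact: cont_shift.
have [N [N0 hN]] := continuous_bounded_on (@compact_ball_rV R n 0 M) ckx.
apply: (L2M mO Lw); apply: (bounded_L2 (M := N)) => //; first by apply: measurable_funTS; exact: continuous_measurable_rV.
by move=> y /OM yM; apply: hN; rewrite /= subr0.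
Qed.

Let int_bound (h : E -> R) e : 0 <= e -> (leb n).-integrable Om (fun y => (w y * h y)%:E) ->
  (forall y, Om y -> `|h y| <= e) -> `|\int[leb n]_(y in Om) (w y * h y)| <= A * e.
Proof.
move=> e0 ih he; apply: le_trans (le_normr_Rintegral _ _) _ => //.
rewrite mulrC /A -RintegralZl//; last by move/integrable_norm: iw.
apply: le_Rintegral => //.
- by move/integrable_norm: ih.
- by move/integrable_norm: iw => /(integrableZl mO e).
by move=> y Oy; rewrite normrM mulrC ler_wpM2r// he.
Qed.

Lemma mollify_continuous (k : E -> R) : continuous k -> continuous (mollify k).
Proof.
move=> ck x; apply/cvgrPdist_lt; first exact: (nbhs_filter x).
move=> e e0; have e1 : 0 < e / (A + 1) by rewrite divr_gt0// ltr_wpDl.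
have [d d0 hd] := uniformly_continuous_on (@compact_ball_rV R n 0 (M + `|x|)) ck e1.
apply: filterS (nbhsx_ballx x d d0) => z; rewrite -ball_normE /= => xz.
rewrite -RintegralB//; [|exact: iwk|exact: iwk].
under eq_Rintegral do rewrite -mulrBr.
apply: (@le_lt_trans _ _ (A * (e / (A + 1)))); last first.
  by rewrite mulrA mulrAC -[ltRHS]mul1r ltr_pM2r// ltr_pdivrMr ?mul1r ?ltrDl// ltr_wpDl.
apply: int_bound => //; first exact: ltW.
  have := integrableB mO (iwk x ck) (iwk z ck); apply: eq_integrable => // y _ /=.
  by rewrite mulrBr.
move=> y Oy; apply: ltW; apply: hd.
  by rewrite /= subr0; apply: le_trans (ler_normB _ _) _; rewrite lerD2r OM.
by have -> : y - x - (y - z) = z - x by [rewrite opprB addrC addrA subrK]; rewrite distrC.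
Qed.

(** Differentiation under the integral: by the mean value theorem the remainder is an oscillation of
    ['D_v k], uniformly small because [Om] is bounded. *)
Lemma mollify_derive (k : E -> R^o) v x : class_C 1 k -> is_derive x v (mollify k : E -> R^o) (mollify (fun z => -1 * 'D_v k z) x).
Proof.
move=> Ck; have ck := Ck.1; have [dk [cdk _]] := Ck.2 v.
apply: is_derive_eps => e e0.
have e1 : 0 < e / (A + 1) by rewrite divr_gt0// ltr_wpDl.
have [d d0 hd] := uniformly_continuous_on (@compact_ball_rV R n 0 (M + `|x|)) cdk e1.
exists (d / (`|v| + 1)); first by rewrite divr_gt0.
move=> h; rewrite ltr_pdivlMr// => hh.
have cdk' : continuous (fun z => -1 * 'D_v k z) by apply: contM => //; exact: cont_cst.
have i1 := iwk (h *: v + x) ck; have i2 := iwk x ck.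
have i3 := integrableZl mO h (iwk x cdk').
rewrite -RintegralB// -RintegralZl//; last exact: (iwk x cdk').
rewrite -RintegralB//; last by have := integrableB mO i1 i2.
have E1 y : w y * k (y - (h *: v + x)) - w y * k (y - x) - h * (w y * (-1 * 'D_v k (y - x))) =
    w y * (k (y - (h *: v + x)) - k (y - x) + h * 'D_v k (y - x)) by ring.
under eq_Rintegral do rewrite E1.
apply: (@le_trans _ _ (A * (e / (A + 1) * `|h|))); last first.
  rewrite mulrA ler_wpM2r// mulrA mulrAC -[leRHS]mul1r ler_wpM2r ?(ltW e0)// ler_pdivrMr ?mul1r ?lerDl//.
  by rewrite ltr_wpDl.
apply: int_bound; first by rewrite mulr_ge0// ltW.
  have := integrableB mO (integrableB mO i1 i2) i3; apply: eq_integrable => // y _ /=.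
  by rewrite -E1.
move=> y Oy; pose z := y - x.
have dm : forall x, derivable k x (- h *: v) := (class_C_deriv (- h *: v) Ck).1.
have [c /andP[c0 c1]] := MVT_path ltr01 (fun t => line_derive z t dm).
rewrite scale0r addr0 mulr1 scale1r derive_scale// => hc.
have -> : y - (h *: v + x) = z + - h *: v by rewrite opprD addrCA scaleNr /z addrC.
rewrite hc mulNr addrC -mulrBr normrM mulrC ler_wpM2r// ltW//; apply: hd.
  by rewrite /= subr0; apply: le_trans (ler_normB _ _) _; rewrite lerD2r OM.
rewrite opprD addNKr normrN normrZ gtr0_norm// normrZ normrN.
apply: le_lt_trans hh; apply: (@le_trans _ _ (`|h| * `|v|)); first by rewrite ler_piMl// ltW.
by rewrite ler_wpM2l// lerDl.
Qed.

Lemma mollify_smooth (k : E -> R^o) : smooth k -> smooth (mollify k : E -> R^o).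
Proof.
move=> sk m; elim: m k sk => [|m ih] k sk; first by split => //; apply: mollify_continuous; exact: smooth_continuous.
split; first by apply: mollify_continuous; exact: smooth_continuous.
split=> [x|]; first by have [] := mollify_derive v x (sk 1%N).
rewrite (_ : 'D_v _ = mollify (fun z => -1 * 'D_v k z)).
  by apply: ih; apply: smoothZ; exact: smooth_deriv.
by apply/funext => x; have [_] := mollify_derive v x (sk 1%N).
Qed.

Lemma mollify_partial (k : E -> R^o) i x : smooth k -> partial i (mollify k : E -> R^o) x = mollify (fun z => -1 * partial i k z) x.
Proof. by move=> sk; have [_] := mollify_derive (delta_mx ord0 i) x (sk 1%N). Qed.

Lemma mollify_shift (k : E -> R) x : measurable_fun setT k ->
  mollify k x = \int[leb n]_z (k z * (w \_ Om) (x + z)).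
Proof.
move=> mk; rewrite /mollify Rintegral_mkcond.
have mW : measurable_fun setT (w \_ Om) by apply/(measurable_restrictT _ mO); mfun.
have -> : (fun y => w y * k (y - x)) \_ Om = (fun y => k (y - x) * (w \_ Om) y).
  by apply/funext => y; rewrite !patchE; case: ifP => _; rewrite ?mulr0// mulrC.
rewrite -(Rintegral_shift x); last first.
  by apply: measurable_funM => //; exact: (measurableT_comp mk (measurable_shift (- x))).
by apply: eq_Rintegral => z _; rewrite addrK addrC.
Qed.

End convolution.
End mollification.

Import HBNNSimple.

(** * Almost everywhere identities and measurability of derivatives *)

Section measure_space.
Context {R : realType} {d} {X : measurableType d} (m : {measure set X -> \bar R}).

Lemma ae_le_Rintegral D (f g : X -> R) :
  measurable D -> m.-integrable D (EFin \o f) -> m.-integrable D (EFin \o g) ->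
  (\forall x \ae m, D x -> f x <= g x) -> \int[m]_(x in D) f x <= \int[m]_(x in D) g x.
Proof.
move=> mD jf jg /ae_ge0P[N [mN N0 hN]].
rewrite /Rintegral (negligible_integral mN mD jf N0) (negligible_integral mN mD jg N0).
have mDN : measurable (D `\` N) by exact: measurableD.
have jf' := integrableS mD mDN (@subDsetl _ _ _) jf; have jg' := integrableS mD mDN (@subDsetl _ _ _) jg.
apply: le_Rintegral => // x [Dx Nx]; exact: hN.
Qed.

Lemma intble_bM D (b f : X -> R) (M : R) :
  measurable D -> measurable_fun D b -> (forall x, D x -> `|b x| <= M) -> m.-integrable D (fun x => (f x)%:E) ->
  m.-integrable D (fun x => (f x * b x)%:E).
Proof.
move=> mD mb bM jf; have mf : measurable_fun D f by apply/measurable_EFinP; exact: (measurable_int _ jf).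
apply: (le_intble mD (g := fun x => `|M| * `|f x|)) => [|x Dx|].
- mfun.
- by rewrite normrM mulrC ler_wpM2r// (le_trans (bM x Dx))// ler_norm.
by apply: intbleZ => //; exact: (integrable_norm jf).
Qed.

Lemma ip_ae D (f g h : X -> R) :
  measurable D -> L2 m D f -> L2 m D g -> L2 m D h -> (\forall x \ae m, D x -> g x = f x) -> inner m D f h = inner m D g h.
Proof.
move=> mD Lf Lg Lh fg; apply/eqP; rewrite eq_le; apply/andP.
by split; apply: (ae_le_Rintegral mD (L2M mD _ Lh) (L2M mD _ Lh)) => //; apply: filterS fg => x h' /h' ->.
Qed.

Lemma sq_ae D (f g : X -> R) :
  measurable D -> L2 m D f -> L2 m D g -> (\forall x \ae m, D x -> g x = f x) -> sqnorm m D f = sqnorm m D g.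
Proof.
by move=> mD Lf Lg fg; apply/eqP; rewrite eq_le; apply/andP; split; apply: le_sq => //; apply: filterS fg => x h /h ->.
Qed.

Lemma ae_and (P Q : X -> Prop) :
  (\forall x \ae m, P x) -> (\forall x \ae m, Q x) -> \forall x \ae m, P x /\ Q x.
Proof. exact: filterI. Qed.

Lemma ae_imp (P Q : X -> Prop) :
  (\forall x \ae m, P x) -> (forall x, P x -> Q x) -> \forall x \ae m, Q x.
Proof. by move=> h PQ; exact: filterS h. Qed.

Lemma Rint_sum D (K : Type) (s : seq K) (F : K -> X -> R) :
  measurable D -> (forall k, m.-integrable D (fun x => (F k x)%:E)) ->
  \int[m]_(x in D) (\sum_(k <- s) F k x) = \sum_(k <- s) \int[m]_(x in D) F k x.
Proof.
move=> mD jF; elim: s => [|k s IH].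
  by rewrite big_nil; under eq_Rintegral do rewrite big_nil; rewrite /Rintegral integral0.
rewrite big_cons -IH -(RintegralD mD (jF k) (intble_sum mD s jF)).
by apply: eq_Rintegral => x _; rewrite big_cons.
Qed.

Lemma Rint_subset (B D : set X) (f : X -> R) :
  measurable B -> measurable D -> B `<=` D -> m.-integrable D (EFin \o f) -> (forall x, D x -> 0 <= f x) ->
  \int[m]_(x in B) f x <= \int[m]_(x in D) f x.
Proof.
move=> mB mD BD jf f0; have jB := integrableS mD mB BD jf.
rewrite -lee_fin !fineK ?(integrable_fin_num mD jf) ?(integrable_fin_num mB jB)//.
by apply: ge0_subset_integral => //; exact: (measurable_int _ jf).
Qed.

Lemma Linfty_sq D (b : X -> R) : measurable D -> Linfty m D b ->
  exists2 C, 0 <= C & forall f, L2 m D f -> sqnorm m D (fun q => b q * f q) <= C * sqnorm m D f.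
Proof.
move=> mD Lb; have [mb [M hM]] := Lb; exists (M ^+ 2) => [|f Lf]; first exact: sqr_ge0.
rewrite -(sqZ mD M Lf); apply: (le_sq mD (L2_bM mD Lb Lf) (L2Z mD M Lf)); apply: filterS hM => q h Qq.
by rewrite !normrM ler_wpM2r// (le_trans (h Qq))// ler_norm.
Qed.

(* [F] need not be measurable: its integral is still a supremum over simple functions below it. *)
Lemma integral_ae0 (F G : X -> \bar R) N : measurable N -> m N = 0%E -> (forall x, (0 <= F x)%E) -> (forall x, (0 <= G x)%E) ->
  measurable_fun setT G -> (forall x, ~ N x -> F x = G x) -> (\int[m]_x F x = \int[m]_x G x)%E.
Proof.
move=> mN N0 F0 G0 mG FG; apply/eqP; rewrite eq_le; apply/andP; split.
  rewrite (ge0_integralTE _ F0); apply/ge_ereal_sup => _ [h /= hF <-].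
  rewrite -integralT_nnsfun; apply: ae_ge0_le_integral => //.
  - by move=> x _; exact: fun_ge0.
  - by apply/measurable_EFinP.
  by exists N; split=> // x /= nP; apply: contrapT => nN; apply: nP => _; rewrite -FG.
have mC : measurable (~` N) by exact: measurableC.
have mGN : measurable_fun setT (G \_ (~` N)) by apply/(measurable_restrictT _ mC); mfun.
have GN0 x : (0 <= (G \_ (~` N)) x)%E by rewrite patchE; case: ifP.
have -> : (\int[m]_x G x = \int[m]_x (G \_ (~` N)) x)%E.
  apply: ae_eq_integral => //; exists N; split=> // x /= nP; apply: contrapT => nN; apply: nP => _.
  by rewrite patchE mem_set.
rewrite (ge0_integralTE _ F0) (ge0_integralTE _ GN0); apply: ereal_sup_le => _ [h /= hG <-].
exists h => //= x; apply: le_trans (hG x) _; rewrite patchE.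
by case: ifPn => // /set_mem nN; rewrite FG.
Qed.

Lemma Rintegral_ae (D : set X) (f g : X -> R) : measurable D -> measurable_fun D g -> (\forall x \ae m, D x -> f x = g x) ->
  \int[m]_(x in D) f x = \int[m]_(x in D) g x.
Proof.
move=> mD mg /ae_ge0P[N [mN N0 hN]]; congr fine.
have mg' : measurable_fun D (EFin \o g) by mfun.
have fg x : ~ N x -> D x -> (f x)%:E = (g x)%:E by move=> nN Dx; rewrite (hN x Dx nN).
rewrite (integralE m D (EFin \o f)) (integralE m D (EFin \o g)); congr (_ - _)%E; rewrite integral_mkcond [RHS]integral_mkcond.
  apply: (integral_ae0 mN N0) => [x|x||x nN]; rewrite ?patchE; try by case: ifP.
    by apply/(measurable_restrictT _ mD); exact: measurable_funepos.
  by case: ifPn => // /set_mem Dx; rewrite !funeposE /= (hN x Dx nN).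
apply: (integral_ae0 mN N0) => [x|x||x nN]; rewrite ?patchE; try by case: ifP.
  by apply/(measurable_restrictT _ mD); exact: measurable_funeneg.
by case: ifPn => // /set_mem Dx; rewrite !funenegE /= (hN x Dx nN).
Qed.

(** Rounding [w] down to a multiple of [1 / k.+1] leaves countably many values, for each of which
    measurability in [x] applies; continuity in the second variable gives the limit. *)
Lemma comp_measurable D (f : X -> R -> R) (w : X -> R) : measurable D -> (forall y, measurable_fun D (f ^~ y)) ->
  (forall x, D x -> continuous (f x)) -> measurable_fun D w -> measurable_fun D (fun x => f x (w x)).
Proof.
move=> mD mf cf mw; pose fl k x : R := (Num.floor (k.+1%:R * w x))%:~R / k.+1%:R.
apply: (@measurable_fun_cvg _ _ _ _ (fun k x => f x (fl k x))) => [k|x Dx].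
  move=> _ Y mY.
  have -> : D `&` (fun x => f x (fl k x)) @^-1` Y = \bigcup_(j in [set: int])
      ((D `&` w @^-1` `[j%:~R / k.+1%:R, (j + 1)%:~R / k.+1%:R[%classic) `&` (D `&` f ^~ (j%:~R / k.+1%:R) @^-1` Y)).
    apply/seteqP; split=> [x [Dx Yx]|x [j _ [[Dx /= wj] [_ fj]]]].
      exists (Num.floor (k.+1%:R * w x)) => //; split; split=> //=.
      by have := floor_itv (k.+1%:R * w x); rewrite in_itv/= ler_pdivrMr// ltr_pdivlMr// mulrC.
    rewrite /= /fl (_ : Num.floor _ = j)//; apply: floor_def; move: wj.
    by rewrite in_itv/= ler_pdivrMr// ltr_pdivlMr// mulrC.
  apply: countable_bigcupT_measurable => [|j]; first exact: countableP.
  by apply: measurableI; [apply: mw => //; mfun|exact: mf].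
have : fl k x @[k --> \oo] --> w x.
  apply/cvgrPdist_le => e e0; exists (Num.truncn e^-1) => // k /= hk.
  have /andP[h1 h2] := floor_itv (k.+1%:R * w x); rewrite intrD in h2.
  have h3 : k.+1%:R^-1 <= e.
    rewrite invf_ple ?posrE//; apply: ltW; apply: lt_le_trans (truncnS_gt _) _; rewrite ler_nat//.
  have h4 : fl k x <= w x by rewrite /fl ler_pdivrMr// [leRHS]mulrC.
  have h5 : w x < fl k x + k.+1%:R^-1 by rewrite /fl -[X in _ + X]mul1r -mulrDl ltr_pdivlMr// mulrC.
  by rewrite ger0_norm ?subr_ge0//; apply: le_trans h3; rewrite lerBlDl ltW.
by move=> h; apply: (continuous_cvg _ _ h); exact: cf.
Qed.

Lemma dy_measurable D (f : X -> R -> R) : measurable D -> (forall y, measurable_fun D (f ^~ y)) ->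
  (forall x y, D x -> derivable (f x : R -> R^o) y 1) -> forall y, measurable_fun D (dy f ^~ y).
Proof.
move=> mD mf df y; pose h (k : nat) : R := k.+1%:R^-1.
apply: (@measurable_fun_cvg _ _ _ _ (fun k x => (h k)^-1 * (f x (h k + y) - f x y))) => [k|x Dx].
  by apply: measurable_funM; [mfun|apply: measurable_funB; exact: mf].
rewrite /dy derive1E; have := df x y Dx; rewrite /derive => /cvg_ex[l hl].
rewrite (cvg_lim _ hl)//; apply/cvgrPdist_lt => e e0; move/cvgrPdist_lt: hl => /(_ e e0) [d' /= d0 hd].
have [N hN] := near_cvg0_lt d0 (@cvg_harmonic R); exists N => // k /= Nk.
have hk0 : h k != 0 by rewrite invr_neq0//.
have := hd (h k); rewrite /= sub0r normrN => /(_ (hN k Nk) hk0).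
by rewrite -[h k *: 1]/(h k * 1) mulr1.
Qed.

(** Differentiability holds for almost every [x] only, and [derive1] is uncontrolled elsewhere. The
    composed derivatives are therefore replaced by measurable representatives, equal to 0 off the
    good set. *)
Lemma caratheodory_dy D (f : X -> R -> R) (w : X -> R) : measurable D -> caratheodory m D f ->
  (\forall x \ae m, D x -> class_C 2 (f x : R -> R^o)) -> measurable_fun D w ->
  exists g1 g2, [/\ measurable_fun D g1, measurable_fun D g2, \forall x \ae m, D x -> g1 x = dy f x (w x) &
    \forall x \ae m, D x -> g2 x = dyy f x (w x)].
Proof.
move=> mD [mf _] /ae_ge0P[N [mN N0 hN]] mw; pose D' := D `\` N; have mD' : measurable D' by exact: measurableD.
have sD : D' `<=` D by move=> x [].
have mf' y : measurable_fun D' (f ^~ y) by exact: (measurable_funS mD sD (mf y)).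
have C2 x : D' x -> [/\ forall y, derivable (f x : R -> R^o) y 1, forall y, derivable (dy f x : R -> R^o) y 1,
    continuous (dy f x) & continuous (dyy f x)].
  move=> [Dx nN]; have [_ /(_ 1) [h1 [h2 /(_ 1) [h3 h4]]]] := hN x Dx nN.
  have e1 : dy f x = 'D_1 (f x : R -> R^o) by apply/funext => y; rewrite /dy derive1E.
  have e2 : dyy f x = 'D_1 (dy f x : R -> R^o) by apply/funext => y; rewrite /dyy /dy derive1E.
  split; [exact: h1|by move=> y; rewrite e1; exact: h3|by rewrite e1|by rewrite e2 e1; case: h4].
have m1 := dy_measurable mD' mf' (fun x y Dx => let: And4 h _ _ _ := C2 x Dx in h y).
have m2 := dy_measurable mD' m1 (fun x y Dx => let: And4 _ h _ _ := C2 x Dx in h y).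
have mw' := measurable_funS mD sD mw.
have ext (g : X -> R) : measurable_fun D' g -> measurable_fun D (g \_ D') /\ \forall x \ae m, D x -> (g \_ D') x = g x.
  move=> mg; split; first by apply: measurable_funTS; apply/(measurable_restrictT _ mD').
  exists N; split=> // x /= nP; apply: contrapT => nN; apply: nP => Dx; by rewrite patchE mem_set.
have [a1 b1] := ext _ (comp_measurable mD' m1 (fun x Dx => let: And4 _ _ h _ := C2 x Dx in h) mw').
have [a2 b2] := ext _ (comp_measurable mD' m2 (fun x Dx => let: And4 _ _ _ h := C2 x Dx in h) mw').
by do 2!eexists; split; [exact: a1|exact: a2|exact: b1|exact: b2].
Qed.

Lemma wip_expand D (w f f' g g' : X -> R) k : measurable D -> Linfty m D w ->
  L2 m D f -> L2 m D f' -> L2 m D g -> L2 m D g' ->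
  inner m D (fun x => w x * (k * f x + f' x)) (fun x => k * g x + g' x) = k ^+ 2 * inner m D (fun x => w x * f x) g +
    k * (inner m D (fun x => w x * f x) g' + inner m D (fun x => w x * f' x) g) + inner m D (fun x => w x * f' x) g'.
Proof.
move=> mD Lw h1 h2 h3 h4; have l1 := L2_bM mD Lw h1; have l2 := L2_bM mD Lw h2; have l3 := L2Z mD k h3.
have e1 : inner m D (fun x => w x * (k * f x + f' x)) (fun x => k * g x + g' x) =
    inner m D (fun x => k * (w x * f x) + w x * f' x) (fun x => k * g x + g' x).
  by apply: eq_ip => x _; ring.
rewrite e1 (ipDl mD (L2Z mD k l1) l2 (L2D mD l3 h4)) !(ipDr mD l3 h4) ?(ipZl mD k l1)//; try exact: (L2Z mD k l1).
by rewrite !(ipZr mD k h3)//; ring.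
Qed.

Lemma young_weight D (w : X -> R) : measurable D -> Linfty m D w ->
  exists2 C, 0 < C & forall e f g, 0 < e -> L2 m D f -> L2 m D g -> `|inner m D (fun x => w x * f x) g| <= e * C * sqnorm m D f + e^-1 * sqnorm m D g.
Proof.
move=> mD Lw; have [C C0 hC] := Linfty_sq mD Lw; exists (C + 1) => [|e f g e0 Lf Lg]; first by rewrite ltr_wpDl.
have h1 := ip_young mD e0 (L2_bM mD Lw Lf) Lg; have h2 := ler_wpM2l (ltW e0) (hC f Lf).
have h3 := mulr_ge0 (ltW e0) (sq_ge0 m D f); have := normr_ge0 (inner m D (fun x => w x * f x) g).
rewrite (_ : e * (C + 1) * _ = e * (C * sqnorm m D f) + e * sqnorm m D f); last by ring.
have h4 : 0 <= e^-1 * sqnorm m D g by rewrite mulr_ge0 ?sq_ge0// invr_ge0 ltW.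
by lra.
Qed.

Lemma Linfty_subM D (f g h : X -> R) : measurable D ->
  Linfty m D f -> Linfty m D g -> Linfty m D h -> Linfty m D (fun x => f x - g x * h x).
Proof.
move=> mD [mf [F hF]] [mg [G hG]] [mh [H hH]]; split; first mfun.
exists (F + G * H); apply: filterS3 hF hG hH => x hF hG hH Dx; apply: le_trans (ler_normB _ _) _.
by apply: lerD; [exact: hF|rewrite normrM; apply: ler_pM => //; [exact: hG|exact: hH]].
Qed.

(** Where [|s|] exceeds [t j], all [v k] with [k >= j] vanish, so the norm of [w] there is at most
    that of [v k - w], hence 0. Countably many such sets exhaust the set where [s] does not
    vanish. *)
Lemma vanishing_closed D (s : X -> R) (v : nat -> X -> R) w :
  measurable D -> measurable_fun D s -> (forall k, L2 m D (v k)) -> L2 m D w ->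
  (forall k, \forall x \ae m, D x -> k.+1%:R^-1 < `|s x| -> v k x = 0) -> sqnorm m D (fun x => v k x - w x) @[k --> \oo] --> 0 ->
  \forall x \ae m, D x -> 0 < `|s x| -> w x = 0.
Proof.
move=> mD ms Lv Lw hv vw; pose t (k : nat) : R := k.+1%:R^-1.
have key j : \forall x \ae m, D x -> t j < `|s x| -> w x = 0.
  pose Dj := D `&` (fun x => `|s x|) @^-1` `]t j, +oo[%classic.
  have mDj : measurable Dj by apply: (measurableT_comp (@normr_measurable R setT) ms) => //.
  have Lj : Linfty m D (\1_Dj : X -> R).
    split; first mfun.
    exists 1; apply: aeW => x _; rewrite indicE; case: (_ \in _); rewrite ?normr1 ?normr0//.
  have Lg := L2_bM mD Lj Lw; have g0 : sqnorm m D (fun x => \1_Dj x * w x) = 0.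
    apply/eqP; rewrite eq_le sq_ge0 andbT; apply/ler_addgt0Pr => e e0; rewrite add0r.
    have [N hN] := near_cvg0_lt e0 vw; have := hN (maxn N j) (leq_maxl _ _); rewrite ger0_norm ?sq_ge0// => /ltW; apply: le_trans.
    apply: (le_sq mD Lg (L2B mD (Lv _) Lw)); apply: filterS (hv (maxn N j)) => x h Dx; rewrite indicE.
    have [xD|_] := boolP (x \in Dj); last by rewrite mul0r normr0.
    move: xD; rewrite inE => -[_ /=]; rewrite in_itv/= andbT => tx; rewrite mul1r h ?sub0r ?normrN//.
    by apply: le_lt_trans tx; rewrite lef_pV2 ?posrE// ler_nat ltnS leq_maxr.
  apply: filterS (sq0_ae mD Lg g0) => x h Dx tx; move: (h Dx); rewrite indicE mem_set ?mul1r//.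
  by split=> //=; rewrite in_itv/= tx.
apply: filterS (ae_foralln key) => x h Dx s0.
have [k hk] := near_cvg0_lt s0 (@cvg_harmonic R); apply: (h k Dx); have := hk k (leqnn k).
by rewrite ger0_norm.
Qed.

End measure_space.

(** * Approximate evaluation at a point of time *)

Section bumps.
Context {R : realType}.
Local Notation RR := (measurableTypeR R).
Local Notation lam := (@lebesgue_measure R).
Variable (T : R).
Hypothesis T0 : 0 < T.
Local Notation I := (`]0, T[%classic : set RR).

Lemma mI : measurable I. Proof. by []. Qed.

Lemma I_fin : (lam I < +oo)%E.
Proof. by rewrite lebesgue_measure_itv/= lte_fin T0 ltry. Qed.

Lemma ae_itv (P : R -> Prop) : (\forall t \ae lam, t \in `]0, T[ -> P t) -> \forall t \ae lam, I t -> P t.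
Proof.
move=> [N [mN N0 hN]]; exists N; split => // t /= nP; exact: It.
Qed.

(** The derivative of [ramp]: an approximate delta just to the right of [s], living on an interval
    of length [m^-1]. *)
Definition bump (m s t : R) : R := m * (hump_mass^-1 * hump (m * (t - s))).
Definition ramp (m s t : R) : R := step (m * (t - s)).

Lemma is_derive_ramp m s (t : R) : is_derive t 1 (ramp m s) (bump m s t).
Proof.
have h : is_derive t 1 (fun t : R => m * (t - s)) m.
  apply: is_derive_eps => e e0; exists 1 => // h _; rewrite (_ : _ - _ - _ = 0) ?normr0 ?mulr_ge0 ?(ltW e0)//.
  by rewrite -[h *: _]/(h * 1); ring.
rewrite /bump mulrC; exact: (@is_derive1_comp R step (fun t : R => m * (t - s)) t _ _ (is_derive_step _) h).
Qed.

Lemma smooth_ramp m s : smooth (ramp m s : R -> R^o).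
Proof.
move=> k; apply: (@class_C_affine _ _ _ _ _ (fun t : R => m * (t - s) : R) (fun t : R => m * t : R)); last exact: smooth_step.
- by move=> t; apply: cvgM; [exact: cvg_cst|apply: cvgB; [exact: cvg_id|exact: cvg_cst]].
- by move=> h v x; rewrite /GRing.scale/=; ring.
Qed.

Lemma bump_cont m s : continuous (bump m s).
Proof.
have cA : continuous (fun t : R => m * (t - s)).
  by move=> t; apply: cvgM; [exact: cvg_cst|apply: cvgB; [exact: cvg_id|exact: cvg_cst]].
move=> t; apply: cvgM; first exact: cvg_cst.
apply: cvgM; first exact: cvg_cst.
by apply: (@continuous_comp _ _ _ (fun t : R => m * (t - s)) hump); [exact: cA|exact: (smooth_continuous smooth_hump)].
Qed.

Lemma bump_ge0 m s t : 0 <= m -> 0 <= bump m s t.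
Proof. by move=> m0; rewrite mulr_ge0// mulr_ge0 ?hump_ge0// invr_ge0 ltW// hump_mass_gt0. Qed.

Lemma bump_out m s t : 0 < m -> m^-1 <= `|t - s| -> bump m s t = 0.
Proof.
move=> m0 h; rewrite /bump hump_out ?mulr0//; apply/negP => /andP[h1 h2].
have ts : 0 < t - s by rewrite pmulr_rgt0 in h1.
by move: h; rewrite gtr0_norm// -ltr_pdivlMl// in h2 *; rewrite mulr1 in h2; rewrite leNgt h2.
Qed.

Lemma bump_intble m s (f : R -> R) : lam.-integrable I (fun t => (f t)%:E) -> lam.-integrable I (fun t => (f t * bump m s t)%:E).
Proof.
have [M [M0 hM]] : exists M, 0 < M /\ forall t, t \in `[0, T] -> `|bump m s t| <= M.
  have cf : {within `[0, T], continuous (bump m s)} by apply: continuous_subspaceT; exact: bump_cont.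
  have := @compact_bounded _ _ _ (continuous_compact cf (@segment_compact _ 0 T)) => -[M [_ hM]].
  exists (`|M| + 1); split => [|t tT]; first by rewrite ltr_wpDl.
  by apply: (hM (`|M| + 1)); [rewrite (le_lt_trans (ler_norm M))// ltrDl|exists t].
apply: (intble_bM (M := M)) mI _ _ => [|t]; first by apply: measurable_funTS; apply: continuous_measurable_fun; exact: bump_cont.
by rewrite/=/= => /andP[t0 tT]; apply: hM; rewrite in_itv/= !ltW.
Qed.

Lemma bump_mass m s : 0 < m -> 0 <= s -> s + m^-1 < T -> \int[lam]_(t in I) bump m s t = 1.
Proof.
move=> m0 s0 sT; have mb : measurable_fun setT (bump m s : RR -> RR).
  by apply: continuous_measurable_fun; exact: bump_cont.
have ib : lam.-integrable (`[0, T]%classic : set RR) (EFin \o bump m s).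
  apply: continuous_compact_integrable; first exact: segment_compact.
  by apply: continuous_subspaceT; exact: bump_cont.
rewrite Rintegral_itv_obnd_cbnd ?Rintegral_itv_bndo_bndc; last 2 first.
- apply: (integrableS _ _ _ ib); [mfun|mfun|].
  by move=> x; rewrite /= !in_itv/= => /andP[-> /ltW ->].
- apply: (integrableS _ _ _ ib); [mfun|mfun|].
  by move=> x; rewrite /= !in_itv/= => /andP[/ltW -> /ltW ->].
rewrite -(FTC_path (ltW T0) (is_derive_ramp m s) (@bump_cont m s)) /ramp.
rewrite step_ge1 ?step_le0 ?subr0// ?sub0r ?mulrN ?oppr_le0 ?mulr_ge0 ?(ltW m0)//.
by rewrite -ler_pdivrMl//; lra.
Qed.

Lemma bump_avg m s (f : R -> R) c e : 0 < m -> 0 <= s -> s + m^-1 < T -> lam.-integrable I (fun t => (f t)%:E) ->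
  (\forall t \ae lam, I t -> `|t - s| < m^-1 -> `|f t - c| <= e) -> `|\int[lam]_(t in I) (f t * bump m s t) - c| <= e.
Proof.
move=> m0 s0 sT jf hf; have i1 (k : R) : lam.-integrable I (fun t => (k * bump m s t)%:E).
  by apply: (bump_intble m s (f := fun _ => k)); apply: integrable_cst_fin; [exact: mI|exact: I_fin].
have b1 := bump_mass m0 s0 sT.
have ib : lam.-integrable I (fun t => (bump m s t)%:E) by apply: eq_integrable (i1 1) => // t _; rewrite mul1r.
have ifb := bump_intble m s jf.
have -> : \int[lam]_(t in I) (f t * bump m s t) - c = \int[lam]_(t in I) (f t * bump m s t - c * bump m s t).
  by rewrite (RintegralB mI ifb (i1 c)) (RintegralZl c mI ib) b1 mulr1.
have id := intbleB mI ifb (i1 c).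
apply: le_trans (le_normr_Rintegral mI id) _.
rewrite -[leRHS]mulr1 -b1 -(RintegralZl e mI ib).
apply: (ae_le_Rintegral mI (integrable_norm id) (i1 e)); apply: filterS hf => t h It.
rewrite /= -mulrBl normrM (ger0_norm (bump_ge0 _ _ (ltW m0))).
have [tm|tm] := ltP `|t - s| m^-1; first by rewrite ler_wpM2r ?bump_ge0 ?(ltW m0)// h.
by rewrite (bump_out m0 tm) !mulr0.
Qed.

Lemma test_ramps m s t : 0 < m -> 0 < s -> s < t -> t + m^-1 < T -> test_function I (fun r => ramp m s r - ramp m t r : R^o).
Proof.
move=> m0 s0 st tT; split; first by apply: smoothB; exact: smooth_ramp.
exists `[s, t + m^-1]%classic; split; first exact: segment_compact.
  by move=> r; rewrite /= !in_itv/= => /andP[r1 r2]; rewrite (lt_le_trans s0 r1) (le_lt_trans r2 tT).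
move=> r nr; rewrite /ramp; have [rs|rs] := leP r s.
  by rewrite !step_le0 ?subrr// mulr_ge0_le0 ?(ltW m0)//; lra.
rewrite !step_ge1 ?subrr//; rewrite -ler_pdivrMl// mulr1 leNgt; apply/negP => h; apply: nr; rewrite /= in_itv/= (ltW rs)/=.
  by lra.
by lra.
Qed.

Lemma L2_tensor {d} {X : measurableType d} (m : {measure set X -> \bar R}) D (w : X -> R) (th : RR -> R) M :
  measurable D -> sigma_finite setT m -> L2 m D w -> measurable_fun I th -> (forall t, I t -> `|th t| <= M) ->
  L2 (m \x lam)%E (D `*` I) (fun q => w q.1 * th q.2).
Proof.
move=> mD sm Lw mth hth; have mDI : measurable (D `*` I) by exact: measurableX.
have m1 : measurable_fun (D `*` I) (fun q => w q.1 * th q.2).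
  apply: measurable_funM.
    apply: (measurable_comp mD _ (L2_meas Lw)); last mfun.
    by move=> _ [q [? _] <-].
  apply: (measurable_comp mI _ mth); last mfun.
  by move=> _ [q [_ ?] <-].
apply: L2_lty => //; rewrite (tonelli_y lam sm mD mI); last 2 first.
- mfun.
- by move=> q _; rewrite lee_fin sqr_ge0.
apply: (@le_lt_trans _ _ (\int[lam]_(t in I) (M ^+ 2 * sqnorm m D w)%:E)%E); last first.
  by rewrite integral_cst//= lebesgue_measure_itv/= lte_fin T0 ltry.
apply: ge0_le_integral => //.
- by move=> t _; apply: integral_ge0 => x _; rewrite lee_fin sqr_ge0.
- apply: (tonelli_measurable_y sm mD mI (F := fun q => ((w q.1 * th q.2) ^+ 2)%:E)); first mfun.
  by move=> q _; rewrite lee_fin sqr_ge0.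
move=> t It /=; rewrite EFinM -(esq mD Lw) -ge0_integralZl_EFin//; last 3 first.
- by move=> x _; rewrite lee_fin sqr_ge0.
- mfun.
- exact: sqr_ge0.
apply: ge0_le_integral => //.
- by move=> x _; rewrite lee_fin sqr_ge0.
- apply/measurable_EFinP; apply: measurable_funX; apply: measurable_funM; last mfun.
  mfun.
- by apply: measurable_funeM; mfun.
move=> x _; rewrite lee_fin exprMn mulrC ler_wpM2r ?sqr_ge0// -[leLHS]real_normK ?num_real//.
have := hth t It => h; rewrite ler_sqr//; exact: le_trans h.
Qed.

End bumps.

Lemma arith3 {R : realFieldType} (a b c g x y e : R) : `|a - x| <= e / 3 -> `|b - y| <= e / 3 -> `|- (a - b) - g| <= e / 3 ->
  `|y - x - g| <= e.
Proof. by rewrite !ler_norml => /andP[? ?] /andP[? ?] /andP[? ?]; lra. Qed.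

Lemma young2 {R : realFieldType} (k a b : R) : 0 < k -> a * b <= k / 2 * a ^+ 2 + k^-1 / 2 * b ^+ 2.
Proof.
move=> k0; have h : 0 <= k^-1 / 2 * (k * a - b) ^+ 2 by rewrite mulr_ge0 ?sqr_ge0// divr_ge0// invr_ge0 ltW.
rewrite -subr_ge0 (_ : _ - _ = k^-1 / 2 * (k * a - b) ^+ 2)//; field.
by rewrite gt_eqF.
Qed.

Lemma preserves_Rintegral {R : realType} {d} {X : measurableType d} (m : {measure set X -> \bar R}) (s : X -> X) (f : X -> R) :
  preserves m s -> measurable_fun setT f -> \int[m]_x f (s x) = \int[m]_x f x.
Proof.
move=> [ms hs] mf; have mf' : measurable_fun setT (EFin \o f) by exact/measurable_EFinP.
congr fine.
rewrite (integralE m setT (fun x => (f (s x))%:E)) (integralE m setT (fun x => (f x)%:E)).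
congr (_ - _)%E.
  rewrite -(hs _ (measurable_funepos mf')); last by move=> x.
  by apply: eq_integral => x _; rewrite !funeposE.
rewrite -(hs _ (measurable_funeneg mf')); last by move=> x.
by apply: eq_integral => x _; rewrite !funenegE.
Qed.

(** * Oscillation in time of a pairing *)

Section oscillation.
Context {R : realType} {d} {X : measurableType d}.
Local Notation RR := (measurableTypeR R).
Local Notation lam := (@lebesgue_measure R).
Variable m : {measure set X -> \bar R}.
Hypothesis sm : sigma_finite setT m.
Local Notation mu := (m \x lam)%E.

(** Convergence is known along sequences of shifts; a failure of the uniform statement would produce
    a sequence tending to 0 that violates it. The identity serves as the map in space. *)
Lemma time_translation (F : X * RR -> R) (e : R) : L2 mu setT F -> 0 < e ->
  exists2 h0, 0 < h0 & forall r, `|r| <= h0 -> sqnorm mu setT (fun q : X * RR => F (q.1, q.2 + r) - F q) <= e.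
Proof.
move=> LF e0; apply: contrapT => no.
have hyp k : exists r : R, `|r| <= 2^-1 ^+ k /\ e < sqnorm mu setT (fun q : X * RR => F (q.1, q.2 + r) - F q).
  apply: contrapT => nr; apply: no; exists (2^-1 ^+ k); first by rewrite exprn_gt0.
  by move=> r rk; rewrite leNgt; apply/negP => h; apply: nr; exists r.
have [r hr] := choice hyp.
have r0 : r k @[k --> \oo] --> (0 : R).
  apply/norm_cvg0P; apply: (squeeze_cvgr _ (cvg_cst 0) (_ : (2^-1 : R) ^+ k @[k --> \oo] --> 0)).
    by apply: nearW => k; rewrite normr_ge0/=; have [] := hr k.
  by apply: cvg_expr; rewrite ger0_norm// invf_lt1// ltr1n.
have id1 : approx_id m (fun _ x => x).
  split=> [k|G LG]; first by split.
  by under eq_fun do rewrite (sq_subrr _ _ measurableT); exact: cvg_cst.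
have [_ /(_ F LF) c0] := approx_id_prod sm id1 (approx_id_lam r0).
have [N hN] := near_cvg0_lt e0 c0.
have [_] := hr N; have := hN N (leqnn N); rewrite ltr_norml => /andP[_ h1] h2.
suff h3 : sqnorm mu setT (fun q : X * RR => F (q.1, q.2 + r N) - F q) < e by have := lt_trans h2 h3; rewrite ltxx.
by [].
Qed.

(** Bounds the change of the pairing of [F] with [G] at time [t] when only the time of [F] is moved
    by [r]. *)
Definition osc (F G : X * RR -> R) (t r : RR) : \bar R := (\int[m]_x (`|F (x, t + r)%R - F (x, t)| * `|G (x, t)|)%:E)%E.

Lemma osc_ge0 F G t r : (0 <= osc F G t r)%E.
Proof. by apply: integral_ge0 => x _. Qed.

Section measurability.
Variables F G : X * RR -> R.
Hypotheses (mF : measurable_fun setT F) (mG : measurable_fun setT G).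

Let m3 : measurable_fun setT (fun q : X * (RR * RR) => (`|F (q.1, q.2.1 + q.2.2) - F (q.1, q.2.1)| * `|G (q.1, q.2.1)|)%:E).
Proof.
have p1 : measurable_fun setT (fun q : X * (RR * RR) => q.2.1) by mfun.
have p2 : measurable_fun setT (fun q : X * (RR * RR) => q.2.2) by mfun.
have p3 : measurable_fun setT (fun q : X * (RR * RR) => (q.1, q.2.1)) by apply/measurable_fun_pair => /=.
have p4 : measurable_fun setT (fun q : X * (RR * RR) => (q.1, q.2.1 + q.2.2)).
  by apply/measurable_fun_pair => /=; [mfun|mfun].
apply/measurable_EFinP; apply: measurable_funM.
  apply: (measurableT_comp (@normr_measurable R setT)).
  mfun.
mfun.
Qed.

Lemma measurable_osc : measurable_fun setT (fun q : RR * RR => osc F G q.1 q.2).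
Proof.
have := tonelli_measurable_y sm measurableT measurableT
  (F := fun q : X * (RR * RR) => (`|F (q.1, q.2.1 + q.2.2) - F (q.1, q.2.1)| * `|G (q.1, q.2.1)|)%:E).
by rewrite setXTT; apply => // q _.
Qed.

End measurability.

Lemma osc_small F G (e : R) : L2 mu setT F -> L2 mu setT G -> 0 < e -> exists2 h0, 0 < h0 &
  forall h, 0 < h -> h <= h0 -> (\int[lam]_t \int[lam]_(r in `](- h)%R, 0%R]) osc F G t r <= (e * h)%:E)%E.
Proof.
move=> LF LG e0; have G0 := sq_ge0 mu setT G.
(* With this weight, and a translation error at most [e / k], each of the two terms of Young's
   inequality is at most [e / 2]. *)
pose k := (sqnorm mu setT G + 1) / e.
have k0 : 0 < k by rewrite divr_gt0// ltr_wpDl.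
have [h0 h00 hF] := time_translation LF (divr_gt0 e0 k0).
exists h0 => // h hp hh0; have mJ : measurable (`](- h)%R, 0%R]%classic : set RR) by exact: measurable_itv.
have mF := L2_meas LF; have mG := L2_meas LG.
have mo := measurable_osc mF mG.
have slam := sigma_finiteT (@lebesgue_measure R).
have mo' : measurable_fun (setT `*` `](- h)%R, 0%R]%classic) (fun q : RR * RR => osc F G q.1 q.2) by mfun.
rewrite -(@tonelli_x _ _ _ _ _ lam lam slam setT _ measurableT mJ (fun q => osc F G q.1 q.2))//; last by move=> q _; exact: osc_ge0.
rewrite (@tonelli_y _ _ _ _ _ lam lam slam setT _ measurableT mJ (fun q => osc F G q.1 q.2))//; last by move=> q _; exact: osc_ge0.
apply: (@le_trans _ _ (\int[lam]_(r in `](- h)%R, 0%R]) e%:E)%E); last first.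
  have jl : - h < 0 by rewrite oppr_lt0.
  by rewrite integral_cst//= lebesgue_measure_itv/= lte_fin jl -EFinB sub0r opprK.
apply: ge0_le_integral => //.
- by move=> r _; apply: integral_ge0 => t _; exact: osc_ge0.
- by apply: (@tonelli_measurable_y _ _ _ _ _ lam slam setT _ measurableT mJ (fun q => osc F G q.1 q.2)) => // q _; exact: osc_ge0.
move=> r; rewrite /= in_itv/= => /andP[r1 r2]; rewrite /osc.
have rh : `|r| <= h0 by rewrite ler0_norm//; lra.
have shm : measurable_fun setT (fun q : X * RR => (q.1, q.2 + r)).
  by apply/measurable_fun_pair => /=; [mfun|mfun].
have md : measurable_fun setT (fun q : X * RR => F (q.1, q.2 + r) - F q) by mfun.
have mp : measurable_fun setT (fun q : X * RR => (`|F (q.1, q.2 + r) - F q| * `|G q|)%:E) by mfun.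
have -> : (\int[lam]_t \int[m]_x (`|F (x, t + r)%R - F (x, t)| * `|G (x, t)|)%:E = \int[mu]_q (`|F (q.1, (q.2 + r)%R) - F q| * `|G q|)%:E)%E.
  by rewrite -setXTT (tonelli_y lam sm measurableT)// ?setXTT// => q _.
have Ld : L2 mu setT (fun q : X * RR => F (q.1, q.2 + r) - F q).
  apply: (L2B measurableT _ LF); apply: (preserves_L2 (s := fun q : X * RR => (q.1, q.2 + r)) _ LF).1.
  split => // f mf f0; rewrite -setXTT (tonelli_y lam sm measurableT)//; last by rewrite setXTT; mfun.
  rewrite (tonelli_y lam sm measurableT measurableT)//; last by rewrite setXTT.
  rewrite -[RHS](lebesgue_int_shift r)//.
  - by apply: (tonelli_measurable_y sm measurableT measurableT) => //; rewrite setXTT.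
  - by move=> t; exact: integral_ge0.
have c1 : 0 <= k / 2 by rewrite divr_ge0// ltW.
have c2 : 0 <= k^-1 / 2 by rewrite divr_ge0// invr_ge0 ltW.
apply: (@le_trans _ _ (\int[mu]_q ((k / 2 * (F (q.1, (q.2 + r)%R) - F q) ^+ 2)%:E + (k^-1 / 2 * G q ^+ 2)%:E))%E).
  have ms : measurable_fun setT (fun q : X * RR => ((k / 2 * (F (q.1, (q.2 + r)%R) - F q) ^+ 2)%:E + (k^-1 / 2 * G q ^+ 2)%:E)%E).
    by apply: emeasurable_funD; apply/measurable_EFinP; apply: measurable_funM => //; exact: measurable_funX.
  apply: ge0_le_integral => //.
  move=> q _; rewrite lee_fin -(real_normK (num_real (_ - _))) -(real_normK (num_real (G q))).
  exact: young2.
rewrite ge0_integralD//; try solve [by move=> q _; rewrite lee_fin mulr_ge0// sqr_ge0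
  | mfun].
under eq_integral do rewrite EFinM; under [X in (_ + X)%E]eq_integral do rewrite EFinM.
rewrite !ge0_integralZl_EFin//; try solve [by move=> q _; rewrite lee_fin sqr_ge0
  | mfun].
rewrite (esq measurableT Ld) (esq measurableT LG) lee_fin.
have h1 : k / 2 * sqnorm mu setT (fun q : X * RR => F (q.1, q.2 + r) - F q) <= e / 2.
  apply: le_trans (ler_wpM2l c1 (hF r rh)) _; apply: eqW; field.
  by rewrite gt_eqF.
have h2 : k^-1 / 2 * sqnorm mu setT G <= e / 2.
  rewrite /k invf_div mulrAC ler_pM2r// mulrAC ler_pdivrMr ?ltr_wpDl// ler_pM2l// lerDl //.
by lra.
Qed.

End oscillation.

Lemma Rint_le_ge0 {R : realType} {d} {X : measurableType d} (m : {measure set X -> \bar R}) D (f : X -> R) (g : X -> \bar R) :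
  measurable D -> m.-integrable D (EFin \o f) -> measurable_fun D g -> (forall x, D x -> (0 <= g x)%E) ->
  (\forall x \ae m, D x -> ((f x)%:E <= g x)%E) -> ((\int[m]_(x in D) f x)%:E <= \int[m]_(x in D) g x)%E.
Proof.
move=> mD jf mg g0 fg; have mf : measurable_fun D f by apply/measurable_EFinP; exact: (measurable_int _ jf).
have mM : measurable_fun D (fun x => Num.max (f x) 0) by apply: measurable_maxr => //.
have jM : m.-integrable D (fun x => (Num.max (f x) 0)%:E).
  apply: (le_intble mD mM (g := fun x => `|f x|)) (integrable_norm jf) => x _.
  by rewrite ger0_norm ?le_max ?lexx ?orbT// ge_max ler_norm normr_ge0.
apply: (@le_trans _ _ (\int[m]_(x in D) Num.max (f x) 0)%:E).
  by apply: le_Rintegral => // x _; rewrite le_max lexx.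
rewrite fineK ?(integrable_fin_num mD jM)//.
apply: ae_ge0_le_integral => //.
- by move=> x _; rewrite lee_fin le_max lexx orbT.
- mfun.
- by apply: filterS fg => x h Dx; rewrite maxEle; case: ifP => _; [exact: g0|exact: h].
Qed.

(** * Energy inequalities from a dual time derivative, and a Gronwall lemma *)

Section half_open.
Context {R : realType}.
Local Notation RR := (measurableTypeR R).
Local Notation lam := (@lebesgue_measure R).
Local Notation J a b := (`]a%R, b%R]%classic : set RR).

Lemma mJ a b : measurable (J a b). Proof. by []. Qed.

Lemma J_cst a b (c : R) : a <= b -> \int[lam]_(t in J a b) c = c * (b - a).
Proof.
move=> ab; rewrite /Rintegral integral_cst//= lebesgue_measure_itv/= lte_fin.
case: ltP => h; first by rewrite -EFinM.
by rewrite mule0 (_ : b - a = 0) ?mulr0//; apply/eqP; rewrite subr_eq0 eq_le h ab.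
Qed.

Lemma J_intble a b (f : R -> R) : continuous f -> lam.-integrable (J a b) (EFin \o f).
Proof.
move=> cf; have h : lam.-integrable (`[a, b]%classic : set RR) (EFin \o f).
  apply: continuous_compact_integrable; first exact: segment_compact.
  exact: continuous_subspaceT.
apply: (integrableS _ _ _ h); [mfun|mfun|].
by move=> x; rewrite /= !in_itv/= => /andP[/ltW -> ->].
Qed.

Lemma J_shift a b h (f : R -> R) : continuous f -> \int[lam]_(t in J a b) f (t - h) = \int[lam]_(t in J (a - h) (b - h)) f t.
Proof.
move=> cf; rewrite Rintegral_mkcond [RHS]Rintegral_mkcond.
transitivity (\int[lam]_t (f \_ (J (a - h) (b - h))) (t - h)); last first.
  apply: (preserves_Rintegral (preserves_lam (- h))).
  by apply/(measurable_restrictT _ (mJ _ _)); apply: measurable_funTS; mfun.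
apply: eq_Rintegral => t _; congr (if _ then _ else _).
by apply/idP/idP; rewrite !inE /= !in_itv/= => /andP[? ?]; lra.
Qed.

Lemma J_cat a b c (f : R -> R) : continuous f -> a <= b -> b <= c ->
  \int[lam]_(t in J a c) f t = \int[lam]_(t in J a b) f t + \int[lam]_(t in J b c) f t.
Proof.
move=> cf ab bc; have e : J a b `|` J b c = J a c.
  apply/seteqP; split=> t; rewrite /= !in_itv/=.
    by move=> [|] /andP[h1 h2]; apply/andP; split=> //; [exact: le_trans bc|exact: le_lt_trans h1].
  by move=> /andP[h1 h2]; have [tb|tb] := leP t b; [left|right]; apply/andP.
rewrite -e; apply: Rintegral_setU; rewrite ?e; [exact: mJ|exact: mJ|exact: J_intble|].
apply/disj_setPS => t [] /=; rewrite !in_itv/= => /andP[_ h1] /andP[h2 _].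
by move: h1; rewrite leNgt h2.
Qed.

(** The integral of [f r - f (r - h)] telescopes to the difference of the integrals over the two
    windows of length [h] that end at [t] and at [s]. *)
Lemma difference_quotient (f : R -> R) s t h e : continuous f -> 0 < h -> s <= t ->
  (forall r, s - h <= r -> r <= s -> f r <= f s + e) -> (forall r, t - h <= r -> r <= t -> f t - e <= f r) ->
  h * (f t - f s - 2 * e) <= \int[lam]_(r in J s t) (f r - f (r - h)).
Proof.
move=> cf h0 st fs ft.
have cfh : continuous (fun r => f (r - h)).
  move=> r; apply: (@continuous_comp _ _ _ (fun r : R => r - h) f); last exact: cf.
  by apply: cvgB; [exact: cvg_id|exact: cvg_cst].
rewrite (RintegralB (mJ s t) (J_intble s t cf) (J_intble s t cfh)) J_shift//.
have e1 := @J_cat (s - h) s t f cf; have e2 := @J_cat (s - h) (t - h) t f cf.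
have {}e1 := e1 (ltac:(lra)) st; have {}e2 := e2 (ltac:(lra)) (ltac:(lra)); rewrite e1 in e2.
have c1 : continuous (fun _ : R => f s + e) by move=> ?; exact: cvg_cst.
have c2 : continuous (fun _ : R => f t - e) by move=> ?; exact: cvg_cst.
have b1 : \int[lam]_(r in J (s - h) s) f r <= (f s + e) * (s - (s - h)).
  rewrite -J_cst; last by lra.
  by apply: le_Rintegral; [exact: mJ|exact: J_intble|exact: J_intble|]; move=> r; rewrite/=/= => /andP[/ltW]; exact: fs.
have b2 : (f t - e) * (t - (t - h)) <= \int[lam]_(r in J (t - h) t) f r.
  rewrite -J_cst; last by lra.
  by apply: le_Rintegral; [exact: mJ|exact: J_intble|exact: J_intble|]; move=> r; rewrite/=/= => /andP[/ltW]; exact: ft.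
move: b1 b2 e2; move: (\int[lam]_(r in _) _) (\int[lam]_(r in _) _) (\int[lam]_(r in _) _) (\int[lam]_(r in _) _) => x1 x2 x3 x4.
rewrite !subKr; move: (f s) (f t) => a b; rewrite [h * _](_ : _ = (b - e) * h - (a + e) * h); last by ring.
by lra.
Qed.

Section osc_bound.
Variable T : R.
Hypothesis T0 : 0 < T.
Local Notation I := (`]0, T[%classic : set RR).

(* Replaces continuity in time of the integrand: the excess of [B r t] over [B t t] is small on average over
   short windows [t - h < r <= t]. *)
Definition osc_bound (B : R -> R -> R) := exists W : RR -> RR -> \bar R,
  [/\ measurable_fun setT (fun q : RR * RR => W q.1 q.2), forall t r, (0 <= W t r)%E,
    forall e, 0 < e -> exists2 h0, 0 < h0 & forall h, 0 < h -> h <= h0 ->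
      (\int[lam]_t \int[lam]_(r in J (- h) 0) W t r <= (e * h)%:E)%E &
    \forall t \ae lam, I t -> \forall r \ae lam, I r -> ((B r t - B t t)%:E <= W t (r - t)%R)%E].

Lemma measurable_osc_int (W : RR -> RR -> \bar R) h : measurable_fun setT (fun q : RR * RR => W q.1 q.2) ->
  (forall t r, (0 <= W t r)%E) -> measurable_fun setT (fun t => \int[lam]_(r in J (- h) 0) W t r)%E.
Proof.
move=> mO O0; apply: (tonelli_measurable_x lam measurableT (mJ _ _) (F := fun q => W q.1 q.2)) => //.
mfun.
Qed.

Lemma osc_boundD B1 B2 : osc_bound B1 -> osc_bound B2 -> osc_bound (fun r t => B1 r t + B2 r t).
Proof.
move=> [W1 [m1 p1 s1 h1]] [W2 [m2 p2 s2 h2]]; exists (fun t r => W1 t r + W2 t r)%E; split.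
- exact: emeasurable_funD.
- by move=> t r; rewrite adde_ge0.
- move=> e e0; have e2 : 0 < e / 2 by rewrite divr_gt0.
  have [a a0 ha] := s1 _ e2; have [b b0 hb] := s2 _ e2; exists (Num.min a b); first by rewrite lt_min a0.
  move=> h h0; rewrite le_min => /andP[hA hB].
  have mO (W : RR -> RR -> \bar R) (mO : measurable_fun setT (fun q : RR * RR => W q.1 q.2)) t : measurable_fun (J (- h) 0) (W t).
    by apply: measurable_funTS; exact: (measurableT_comp mO (measurable_pair1 t)).
  under eq_integral do rewrite (ge0_integralD _ (mJ _ _) (fun r _ => p1 _ r) (mO _ m1 _) (fun r _ => p2 _ r) (mO _ m2 _)).
  rewrite ge0_integralD//; last 4 first.
  + by move=> t _; apply: integral_ge0 => r _.
  + exact: measurable_osc_int.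
  + by move=> t _; apply: integral_ge0 => r _.
  + exact: measurable_osc_int.
  by apply: le_trans (leeD (ha h h0 hA) (hb h h0 hB)) _; rewrite lee_fin -mulrDl -splitr.
apply: filterS2 h1 h2 => t h1 h2 It; apply: filterS2 (h1 It) (h2 It) => r {}h1 {}h2 Ir.
by apply: le_trans (leeD (h1 Ir) (h2 Ir)); rewrite lee_fin; lra.
Qed.

Lemma osc_bound_sum (K : Type) (s : seq K) (B : K -> R -> R -> R) : (forall k, osc_bound (B k)) ->
  osc_bound (fun r t => \sum_(k <- s) B k r t).
Proof.
move=> hB; elim: s => [|k s IH].
  exists (fun _ _ => 0%E); split=> //.
  - move=> e e0; exists 1 => // h h0 _; under eq_integral do rewrite integral0.
    by rewrite integral0 lee_fin mulr_ge0// ltW.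
  - by apply: nearW => t _; apply: nearW => r _; rewrite !big_nil.
have := osc_boundD (hB k) IH; congr osc_bound; apply/funext => r; apply/funext => t.
by rewrite big_cons.
Qed.

(** The witness is [osc] for [F] and [G] extended by 0, so that translates in time are defined
    everywhere. *)
Lemma osc_bound_ip {d} {X : measurableType d} (m : {measure set X -> \bar R}) D (F G : X * RR -> R) :
  sigma_finite setT m -> measurable D -> L2 (m \x lam)%E (D `*` I) F -> L2 (m \x lam)%E (D `*` I) G ->
  osc_bound (fun r t => inner m D (fun x => F (x, r)) (fun x => G (x, t))).
Proof.
move=> sm mD LF LG; have mIT := mI T; have mDI : measurable (D `*` I) by exact: measurableX.
have ext (H : X * RR -> R) : L2 (m \x lam)%E (D `*` I) H -> L2 (m \x lam)%E setT (H \_ (D `*` I)).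
  move=> LH; apply: L2_lty; first by apply/(measurable_restrictT _ mDI); mfun.
  rewrite (_ : (\int[_]_x _ = \int[(m \x lam)%E]_(q in D `*` I) (H q ^+ 2)%:E)%E) ; first by rewrite (esq mDI LH) ltry.
  rewrite [RHS]integral_mkcond; apply: eq_integral => q _; rewrite !patchE.
  by case: ifP => // _; rewrite expr0n.
have LF' := ext _ LF; have LG' := ext _ LG; set F' := F \_ _ in LF'; set G' := G \_ _ in LG'.
have F'E x t : D x -> I t -> F' (x, t) = F (x, t) by move=> Dx It; rewrite /F' patchE mem_set.
have G'E x t : D x -> I t -> G' (x, t) = G (x, t) by move=> Dx It; rewrite /G' patchE mem_set.
exists (osc m F' G'); split.
- exact: (measurable_osc sm (L2_meas LF') (L2_meas LG')).
- by exact: osc_ge0.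
- by move=> e e0; exact: (osc_small sm LF' LG').
apply: filterS2 (L2_slice sm mD mIT LF) (L2_slice sm mD mIT LG) => t LFt LGt It.
have {}LFt := LFt It; have {}LGt := LGt It.
apply: filterS (L2_slice sm mD mIT LF) => r LFr Ir; have {}LFr := LFr Ir.
have Lb := L2B mD LFr LFt; rewrite -(ipBl mD LFr LFt LGt).
have jp := L2M mD Lb LGt; have jn := integrable_norm jp.
apply: (@le_trans _ _ (\int[m]_(x in D) `|(F (x, r) - F (x, t)) * G (x, t)|)%:E).
  by apply: le_Rintegral => // x _; exact: ler_norm.
rewrite fineK ?(integrable_fin_num mD jn)// integral_mkcond /osc.
apply: ge0_le_integral => //.
- by move=> x _; rewrite patchE; case: ifP.
- by apply/(measurable_restrictT _ mD); mfun.
- apply/measurable_EFinP; apply: measurable_funM; apply: (measurableT_comp (@normr_measurable R setT)).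
    by apply: measurable_funB; exact: (measurableT_comp (L2_meas LF') (measurable_pair2 _)).
  exact: (measurableT_comp (L2_meas LG') (measurable_pair2 _)).
move=> x _; rewrite patchE; case: ifPn => [/set_mem Dx|_]; last by rewrite lee_fin.
by rewrite subrKC F'E// F'E// G'E// normrM.
Qed.

(* Averaging the inequality over the starting time [x] in ]r - h, r] avoids regularizing the state in time. *)
Lemma energy_abstract (f : R -> R) (B D : R -> R -> R) s t : continuous f -> osc_bound B ->
  lam.-integrable I (fun r => (B r r)%:E) ->
  (\forall r \ae lam, I r -> [/\ lam.-integrable I (fun x => (D r x)%:E),
     forall x, 0 < x -> x < r -> f r - f x <= 2 * \int[lam]_(y in J x r) D r y &
     \forall x \ae lam, I x -> D r x = B x r]) ->
  0 < s -> s < t -> t < T -> f t - f s <= 2 * \int[lam]_(r in J s t) B r r.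
Proof.
move=> cf [W [mO O0 Os OB]] jB hD s0 st tT; apply/ler_addgt0Pr => e e0.
have e4 : 0 < e / 4 by rewrite divr_gt0.
have [h1 h10 H1] := Os _ e4.
have near x : exists2 d, 0 < d & forall r, `|r - x| < d -> `|f r - f x| <= e / 4.
  have /cvgrPdist_le /(_ _ e4) [d /= d0 hd] := cf x; exists d => // r; rewrite distrC => /hd.
  by rewrite distrC.
have [ds ds0 Hs] := near s; have [dt dt0 Ht] := near t.
pose h := Num.min (Num.min h1 (s / 2)) (Num.min (ds / 2) (dt / 2)).
have h0 : 0 < h by rewrite !lt_min h10 !divr_gt0.
have [hh1 hs hds hdt] : [/\ h <= h1, h < s, h < ds & h < dt].
  have : h <= Num.min (Num.min h1 (s / 2)) (Num.min (ds / 2) (dt / 2)) by [].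
  by rewrite !le_min => /andP[/andP[a1 a2] /andP[a3 a4]]; split=> //; lra.
have {H1} := H1 h h0 hh1; set OO := (fun t => \int[lam]_(r in J (- h) 0) W t r)%E => H1.
have mOO : measurable_fun setT OO by exact: measurable_osc_int.
have OO0 r : (0 <= OO r)%E by apply: integral_ge0.
have cfh : continuous (fun r => f (r - h)).
  move=> r; apply: (@continuous_comp _ _ _ (fun r : R => r - h) f); last exact: cf.
  by apply: cvgB; [exact: cvg_id|exact: cvg_cst].
have JI x y : 0 < x -> y < T -> J x y `<=` I.
  by move=> x0 yT r; rewrite /= !in_itv/= => /andP[r1 r2]; rewrite (lt_trans x0 r1) (le_lt_trans r2 yT).
have jJ x y g : 0 < x -> y < T -> lam.-integrable I (EFin \o g) -> lam.-integrable (J x y) (EFin \o g).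
  by move=> x0 yT; apply: integrableS; [exact: mI|exact: mJ|exact: JI].
have jf := intbleB (mJ s t) (J_intble s t cf) (J_intble s t cfh).
have jB' := intbleZ (mJ s t) (2 * h) (jJ _ _ _ s0 tT jB).
(* Over []r - h, r]] the increment is bounded by the integral of [D r]. Freezing the first argument
   of [B] at [r] turns this into [2 * h * B r r], at the cost of [2 * OO r]. *)
have step1 : \forall r \ae lam, J s t r -> ((f r - f (r - h) - 2 * h * B r r)%:E <= 2%:E * OO r)%E.
  apply: filterS2 hD OB => r hD OB Jr; have Ir := JI _ _ s0 tT _ Jr.
  move: Jr; rewrite /= in_itv/= => /andP[sr rt].
  have [jD fD DB] := hD Ir; have {}OB := OB Ir.
  have rh0 : 0 < r - h by lra.
  have rT : r < T by exact: le_lt_trans tT.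
  have jDr := jJ _ _ _ rh0 rT jD.
  have cB : continuous (fun _ : R => B r r) by move=> ?; exact: cvg_cst.
  have jc := J_intble (r - h) r cB.
  have mOr : measurable_fun setT (W r) by exact: (measurableT_comp mO (measurable_pair1 r)).
  have mOs : measurable_fun setT (fun x : RR => W r (x - r)) by mfun.
  have : ((\int[lam]_(x in J (r - h) r) (D r x - B r r))%:E <= OO r)%E.
    have -> : (OO r = \int[lam]_(x in J (r - h) r) W r (x - r)%R)%E.
      rewrite /OO integral_mkcond [RHS]integral_mkcond -(lebesgue_int_shift (- r)); last 2 first.
      - by apply/(measurable_restrictT _ (mJ _ _)); mfun.
      - by move=> x; rewrite patchE; case: ifP.
      apply: eq_integral => x _; congr (if _ then _ else _).
      by clear -x h r; apply/idP/idP; rewrite !inE /= !in_itv/= => /andP[? ?]; apply/andP; split; lra.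
    apply: Rint_le_ge0; [exact: mJ|exact: (intbleB (mJ _ _) jDr jc)|mfun|by []|].
    apply: filterS2 DB OB => x DB OB Jx; have Ix := JI _ _ rh0 rT _ Jx.
    by rewrite (DB Ix); exact: OB.
  rewrite (RintegralB (mJ _ _) jDr jc) J_cst; last by lra.
  have := fD (r - h) rh0; move: (OO r) (OO0 r) => [q| |]//; last by move=> _ _ _; rewrite gt0_muley// leey.
  rewrite -EFinM !lee_fin; move: (\int[lam]_(x in _) _) => q' _ h2 h3.
  have {}h2 := h2 (ltac:(lra)); move: h3; rewrite opprB addrCA subrr addr0 => h3.
  by move: h2 h3; rewrite -mulrA [h * _]mulrC; move: (B r r * h) => p; lra.
have jl := intbleB (mJ s t) jf jB'.
have st' : s <= t by exact: ltW.
have H2 : \int[lam]_(r in J s t) (f r - f (r - h) - 2 * h * B r r) <= 2 * (e / 4 * h).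
  rewrite -lee_fin; apply: le_trans (Rint_le_ge0 (mJ s t) jl _ _ step1) _.
  - by apply: measurable_funeM; mfun.
  - by move=> r _; rewrite mule_ge0//.
  rewrite ge0_integralZl_EFin//; try solve [exact: mJ|mfun].
  rewrite EFinM lee_pmul2l//; apply: le_trans H1.
  by apply: ge0_subset_integral => //.
rewrite (RintegralB (mJ s t) jf jB') (RintegralZl _ (mJ s t) (jJ _ _ _ s0 tT jB)) in H2.
have H3 : h * (f t - f s - 2 * (e / 4)) <= \int[lam]_(r in J s t) (f r - f (r - h)).
  apply: difference_quotient => // r r1 r2.
    have /Hs : `|r - s| < ds by clear -hds r1 r2; rewrite ler0_norm//; lra.
    by rewrite ler_norml => /andP[_]; lra.
  have /Ht : `|r - t| < dt by clear -hdt r1 r2; rewrite ler0_norm//; lra.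
  by rewrite ler_norml => /andP[]; lra.
rewrite -(ler_pM2l h0); move: H2 H3; move: (\int[lam]_(r in _) _) (\int[lam]_(r in _) _) => x1 x2.
have -> : 2 * (e / 4 * h) = h * e / 2 by field.
have -> : h * (f t - f s - 2 * (e / 4)) = h * (f t - f s) - h * e / 2 by field.
have -> : h * (2 * x1 + e) = 2 * h * x1 + h * e by ring.
by lra.
Qed.

End osc_bound.
End half_open.

Lemma cont_le_closed {R : realType} (f : R -> R) a b y : continuous f -> a < b ->
  (forall x, a < x -> x < b -> f x <= y) -> forall x, a <= x -> x <= b -> f x <= y.
Proof.
move=> cf ab h x ax xb; apply/ler_addgt0Pr => e e0.
have /cvgrPdist_le /(_ _ e0) [d /= d0 hd] := cf x.
pose k := Num.min (d / 2) ((b - a) / 4).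
have k0 : 0 < k by rewrite lt_min !divr_gt0 ?subr_gt0.
have [kd kb] : k < d /\ k <= (b - a) / 4.
  have : k <= k by []. rewrite le_min => /andP[h1 h2]; lra.
pose x' := if x <= (a + b) / 2 then x + k else x - k.
have [h1 h2 h3] : [/\ a < x', x' < b & `|x - x'| < d].
  rewrite /x'; case: ifP => hx.
    by split; [lra|lra|rewrite opprD addNKr normrN ger0_norm ?ltW].
  move/negbT: hx; rewrite -ltNge => hx; split; [lra|lra|].
  by rewrite opprB addrC subrK ger0_norm ?ltW.
by have := hd _ h3; have := h _ h1 h2; rewrite ler_norml => q /andP[]; lra.
Qed.

Lemma ae_fst {R : realType} {d1 d2} {X : measurableType d1} {Y : measurableType d2} (m1 : {measure set X -> \bar R})
  (m2 : {sigma_finite_measure set Y -> \bar R}) (A : set X) (B : set Y) (P : X -> Prop) :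
  (\forall x \ae m1, A x -> P x) -> \forall q \ae (m1 \x m2)%E, (A `*` B) q -> P q.1.
Proof.
move=> /ae_ge0P[N [mN N0 hN]]; exists (N `*` setT); split; first exact: measurableX.
  by rewrite product_measure1E//= N0 mul0e.
move=> q /= nP; split=> //; apply: contrapT => nN; apply: nP => -[Aq Bq]; exact: hN.
Qed.

(** The weight [expR (- (2 * k * t))] makes the integral term at most half of the weighted maximum,
    which is then absorbed at the point [c] where that maximum is attained. *)
Lemma gronwall {R : realType} (f : R -> R) (T k M : R) : 0 < T -> 0 < k -> 0 <= M -> continuous f ->
  (forall t, 0 <= f t) -> f 0 = 0 ->
  (forall s t, 0 < s -> s < t -> t < T -> f t <= f s + k * (\int[lebesgue_measure]_(r in (`]s, t]%classic : set (measurableTypeR R))) f r) + M) ->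
  forall t, 0 <= t -> t <= T -> f t <= 2 * M * expR (2 * k * T).
Proof.
move=> T0 k0 M0 cf f0 f00 hf.
have ce (x : R) : continuous (fun t : R => expR (2 * k * (t - x))).
  move=> t; apply: (@continuous_comp _ _ _ (fun t : R => 2 * k * (t - x)) (@expR R)); last exact: continuous_expR.
  by apply: cvgM; [exact: cvg_cst|apply: cvgB; [exact: cvg_id|exact: cvg_cst]].
have cg : continuous (fun t : R => expR (- (2 * k * t)) * f t).
  move=> t; apply: cvgM; last exact: cf.
  apply: (@continuous_comp _ _ _ (fun t : R => - (2 * k * t)) (@expR R)); last exact: continuous_expR.
  by apply: cvgN; apply: cvgM; [exact: cvg_cst|exact: cvg_id].
have [c] := EVT_max (ltW T0) (continuous_subspaceT cg).
rewrite in_itv/= => /andP[c0 cT] hc.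
have fc t : 0 <= t -> t <= T -> f t <= expR (2 * k * (t - c)) * f c.
  move=> t0 tT; have := hc t; rewrite in_itv/= t0 tT => /(_ isT) h.
  rewrite -(ler_pM2l (expR_gt0 (- (2 * k * t)))) mulrA -expRD (_ : _ + _ = - (2 * k * c))//; ring.
(* The starting time is sent to 0, where [f] vanishes; both this and the extension to the closed
   interval use continuity. *)
have key t : 0 <= t -> t <= T -> f t - expR (2 * k * (t - c)) * f c / 2 <= M.
  apply: (@cont_le_closed _ (fun t => f t - expR (2 * k * (t - c)) * f c / 2) 0 T) => //.
    apply: contB => //; move=> t'; apply: cvgM; last exact: cvg_cst.
    by apply: cvgM; [exact: ce|exact: cvg_cst].
  move=> {}t t0 tT; rewrite lerBlDl -subr_le0 -f00 -lerN2.
  apply: (@cont_le_closed _ (fun s => - f s) 0 t) => //; [by move=> s; apply: cvgN; exact: cf| |exact: ltW].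
  move=> s s0 st; rewrite lerN2 lerBlDr; set Y := _ / 2.
  rewrite [_ + (Y + M)]addrA; apply: le_trans (hf s t s0 st tT) _; rewrite lerD2r lerD2l /Y.
  have jf := J_intble s t cf.
  have cE : continuous (fun r : R => expR (2 * k * (r - c)) * f c).
    by move=> r; apply: cvgM; [exact: ce|exact: cvg_cst].
  have step1 : \int[lebesgue_measure]_(r in (`]s, t]%classic : set (measurableTypeR R))) f r <=
      \int[lebesgue_measure]_(r in (`]s, t]%classic : set (measurableTypeR R))) (expR (2 * k * (r - c)) * f c).
    apply: le_Rintegral; [exact: mJ|by []|exact: J_intble|].
    move=> r; rewrite /= in_itv/= => /andP[r1 r2]; apply: fc; lra.
  have hd (r : R) : is_derive r 1 (fun r : R => expR (2 * k * (r - c)) * (f c / (2 * k))) (expR (2 * k * (r - c)) * f c).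
    have h : is_derive r 1 (fun t : R => 2 * k * (t - c)) (2 * k).
      apply: is_derive_eps => e e0; exists 1 => // h _; rewrite (_ : _ - _ - _ = 0) ?normr0 ?mulr_ge0 ?(ltW e0)//.
      by rewrite -[h *: _]/(h * _); ring.
    have h2 := @is_derive1_comp R expR (fun t : R => 2 * k * (t - c)) r _ _ (is_derive_expR _) h.
    have h3 := is_deriveM h2 (is_derive_cst (f c / (2 * k)) r 1).
    by apply: (is_derive_eq h3); rewrite /GRing.scale/=; field; rewrite gt_eqF.
  have e1 := J_cat cE (ltW s0) (ltW st); have e2 := FTC_path (ltW t0) hd cE.
  rewrite -Rintegral_itv_obnd_cbnd ?e1 in e2; last exact: J_intble.
  have J0 : 0 <= \int[lebesgue_measure]_(r in (`]0, s]%classic : set (measurableTypeR R))) (expR (2 * k * (r - c)) * f c).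
    by apply: Rintegral_ge0 => r _; rewrite mulr_ge0.
  apply: (@le_trans _ _ (k * (expR (2 * k * (t - c)) * (f c / (2 * k))))); last first.
    by apply: eqW; field; rewrite gt_eqF.
  rewrite ler_pM2l//; apply: le_trans step1 _.
  have := mulr_ge0 (expR_ge0 (2 * k * (0 - c))) (divr_ge0 (f0 c) (mulr_ge0 (ler0n R 2) (ltW k0))).
  by move: J0 e2; lra.
have Mc : f c <= 2 * M.
  by have := key c c0 cT; rewrite subrr mulr0 expR0; lra.
move=> t t0 tT; apply: le_trans (fc t t0 tT) _; rewrite mulrC.
apply: ler_pM; rewrite// ler_expR ler_pM2l ?mulr_gt0//; lra.
Qed.

Lemma sqr_sum_le {R : realFieldType} (K : Type) (s : seq K) (a : K -> R) : (\sum_(k <- s) a k) ^+ 2 <= 2 ^+ size s * \sum_(k <- s) a k ^+ 2.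
Proof.
elim: s => [|k s IH]; first by rewrite !big_nil expr0n mulr0.
rewrite !big_cons /=; move: IH; move: (\sum_(_ <- _) _) (\sum_(_ <- _) _) => y x IH.
have p1 : 1 <= 2 ^+ size s :> R by rewrite exprn_ege1// ler1n.
have h := ler_wpM2r (sqr_ge0 (a k)) p1; have h2 := sqr_ge0 (a k - x).
rewrite (_ : 2 ^+ (size s).+1 * _ = 2 * (2 ^+ size s * a k ^+ 2) + 2 * (2 ^+ size s * y)); last by rewrite exprS; ring.
by lra.
Qed.

Lemma sqr3_le {R : realFieldType} (x y w : R) : (x + y + w) ^+ 2 <= 3 * (x ^+ 2 + y ^+ 2 + w ^+ 2).
Proof.
rewrite -subr_ge0 (_ : _ - _ = (x - y) ^+ 2 + (y - w) ^+ 2 + (x - w) ^+ 2); last by ring.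
by rewrite !addr_ge0 ?sqr_ge0.
Qed.

(** The node [T * (i.+1 / N.+1)] lies in the cell number [i] of [N] equal cells and stays strictly
    between 0 and [T]. *)
Lemma grid_near {R : realType} (T r : R) N : 0 < T -> 0 < r < T -> (0 < N)%N ->
  exists2 i, (i < N)%N & `|r - T * (i.+1%:R / N.+1%:R)| <= T / N%:R.
Proof.
move=> T0 /andP[r0 rT] N0; have m0 : 0 < N%:R :> R by rewrite ltr0n.
have x0 : 0 <= r * N%:R / T by rewrite divr_ge0 ?mulr_ge0 ?ltW.
have iN : (Num.truncn (r * N%:R / T) < N)%N by rewrite truncn_lt_nat// ltr_pdivrMr// mulrC ltr_pM2l.
exists (Num.truncn (r * N%:R / T)) => //; have := truncn_itv x0; move: iN; move: (Num.truncn _) => i iN.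
have : i%:R <= N%:R :> R by rewrite ler_nat ltnW.
rewrite -!natr1; move: (i%:R : R) (N%:R : R) (ler0n R i) m0 => k m k0 m0 km.
have m1 : 0 < m + 1 by rewrite addr_gt0.
pose h := T / m; have h0 : 0 < h by rewrite divr_gt0.
rewrite -/h (_ : T = h * m); last by rewrite /h divfK ?gt_eqF.
rewrite (_ : r * m / (h * m) = r / h); last by field; rewrite !gt_eqF.
move=> /andP[]; rewrite ler_pdivlMr// ltr_pdivrMr// => g1 g2.
have g3 : k * h <= h * m * ((k + 1) / (m + 1)).
  rewrite mulrA ler_pdivlMr// -subr_ge0 (_ : _ - _ = h * (m - k)); last by ring.
  by rewrite mulr_ge0 ?subr_ge0// ltW.
have g4 : h * m * ((k + 1) / (m + 1)) <= (k + 1) * h.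
  rewrite mulrA ler_pdivrMr// -subr_ge0 (_ : _ - _ = h * (k + 1)); last by ring.
  by rewrite mulr_ge0 ?addr_ge0// ltW.
by move: g1 g2 g3 g4; rewrite [(k + 1) * h]mulrDl mul1r; rewrite ler_norml; lra.
Qed.

Section pairing.
Context {R : realType} {d} {X : measurableType d} (m : {measure set X -> \bar R}) (D : set X) (T : R).
Local Notation RR := (measurableTypeR R).
Local Notation lam := (@lebesgue_measure R).
Local Notation I := (`]0, T[%classic : set RR).
Local Notation J a b := (`]a%R, b%R]%classic : set RR).
Hypotheses (mD : measurable D) (sm : sigma_finite setT m) (T0 : 0 < T).

Lemma slice_pairing_L2 (F : X * RR -> R) w : L2 (m \x lam)%E (D `*` I) F -> L2 m D w ->
  L2 lam I (fun r => inner m D (fun x => F (x, r)) w) /\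
  sqnorm lam I (fun r => inner m D (fun x => F (x, r)) w) <= sqnorm (m \x lam)%E (D `*` I) F * sqnorm m D w.
Proof.
move=> LF Lw; have mIT := mI T.
have Lt : L2 (m \x lam)%E (D `*` I) (fun q => w q.1 * (fun _ : RR => 1 : R) q.2).
  by apply: (L2_tensor (th := fun _ => 1) (M := 1) T0 mD sm Lw) => [|t _]; [mfun|rewrite normr1].
have mf : measurable_fun I (fun r => inner m D (fun x => F (x, r)) w).
  have := measurable_int _ (ip_slice_intble sm mD mIT LF Lt); move/measurable_EFinP; apply: eq_measurable_fun => t _.
  by apply: eq_ip => x _; rewrite mulr1.
have jN := sq_slice_intble sm mD mIT LF; have jN' := intbleZ mIT (sqnorm m D w) jN.
have hb : \forall r \ae lam, I r -> inner m D (fun x => F (x, r)) w ^+ 2 <= sqnorm m D w * sqnorm m D (fun x => F (x, r)).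
  by apply: (ae_imp (m := lam) (L2_slice sm mD mIT LF)) => r h Ir; rewrite mulrC; exact: (ip_sq mD (h Ir) Lw).
have Lf : L2 lam I (fun r => inner m D (fun x => F (x, r)) w).
  apply: L2_lty => //; apply: (@le_lt_trans _ _ (\int[lam]_(r in I) (sqnorm m D w * sqnorm m D (fun x => F (x, r)))%:E)%E).
    apply: ae_ge0_le_integral => //.
    - by move=> r _; rewrite lee_fin sqr_ge0.
    - mfun.
    - by move=> r _; rewrite lee_fin mulr_ge0// sq_ge0.
    - exact: (measurable_int _ jN').
  rewrite -ge0_fin_numE; first exact: (integrable_fin_num mIT jN').
  by apply: integral_ge0 => r _; rewrite lee_fin mulr_ge0// sq_ge0.
split=> //; rewrite mulrC (sq_slice sm mD mIT LF) -(RintegralZl _ mIT jN).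
by apply: (ae_le_Rintegral mIT _ jN' hb); have [] := Lf.
Qed.

Lemma J_int_sq (f : RR -> R) s t : L2 lam I f -> 0 < s -> s < t -> t < T ->
  (\int[lam]_(r in J s t) f r) ^+ 2 <= (t - s) * sqnorm lam I f.
Proof.
move=> Lf s0 st tT; have JI : J s t `<=` I.
  by move=> r; rewrite /= !in_itv/= => /andP[r1 r2]; rewrite (lt_trans s0 r1) (le_lt_trans r2 tT).
have [mf jf] := Lf; have LJ : L2 lam (J s t) f.
  by split; [exact: (measurable_funS (mI T) JI mf)|exact: (integrableS (mI T) (mJ s t) JI jf)].
have L1 : L2 lam (J s t) (fun _ => 1).
  apply: (bounded_L2 (M := 1) (mJ s t)) => // [|r _]; last by rewrite normr1.
  by rewrite /= lebesgue_measure_itv/= lte_fin st ltry.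
have := ip_sq (mJ s t) LJ L1.
have -> : inner lam (J s t) f (fun _ => 1) = \int[lam]_(r in J s t) f r by apply: eq_Rintegral => r _; rewrite mulr1.
have -> : sqnorm lam (J s t) (fun _ => 1) = t - s.
  by rewrite /sqnorm expr1n J_cst ?(ltW st)// mul1r.
move=> h; apply: le_trans h _; rewrite mulrC ler_wpM2l ?subr_ge0 ?(ltW st)//.
by apply: Rint_subset; [exact: mJ|exact: mI|exact: JI|exact: jf|move=> r _; exact: sqr_ge0].
Qed.

End pairing.

Lemma cvg_sum_seq {R : realType} (K : Type) (s : seq K) (f : nat -> K -> R) l : (forall j, f k j @[k --> \oo] --> l j) ->
  \sum_(j <- s) f k j @[k --> \oo] --> \sum_(j <- s) l j.
Proof.
move=> h; elim: s => [|j s IH]; first by under eq_fun do rewrite big_nil; rewrite big_nil; exact: cvg_cst.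
by under eq_fun do rewrite big_cons; rewrite big_cons; apply: cvgD => //.
Qed.

Section pair3.
Context {R : realType} {d1 d2} {X1 : measurableType d1} {X2 : measurableType d2}.
Variables (m1 : {measure set X1 -> \bar R}) (m2 : {measure set X2 -> \bar R}) (D1 : set X1) (D2 : set X2) (n : nat).
Hypotheses (mD1 : measurable D1) (mD2 : measurable D2).

(** The common shape of the weak forms: flux against gradient, lower-order term against value,
    boundary term against trace. It is used both for a time slice and on the space-time sets. *)
Definition pair3 (F G : 'I_n -> X1 -> R) (F0 G0 : X1 -> R) (F1 G1 : X2 -> R) : R :=
  \sum_j inner m1 D1 (F j) (G j) + inner m1 D1 F0 G0 + inner m2 D2 F1 G1.

Lemma pair3_lin k F F' G F0 F0' G0 F1 F1' G1 : (forall j, L2 m1 D1 (F j)) -> (forall j, L2 m1 D1 (F' j)) -> (forall j, L2 m1 D1 (G j)) ->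
  L2 m1 D1 F0 -> L2 m1 D1 F0' -> L2 m1 D1 G0 -> L2 m2 D2 F1 -> L2 m2 D2 F1' -> L2 m2 D2 G1 ->
  pair3 (fun j x => k * F j x + F' j x) G (fun x => k * F0 x + F0' x) G0 (fun x => k * F1 x + F1' x) G1 =
  k * pair3 F G F0 G0 F1 G1 + pair3 F' G F0' G0 F1' G1.
Proof.
move=> h1 h2 h3 h4 h5 h6 h7 h8 h9; rewrite /pair3.
rewrite (ipDl mD1 (L2Z mD1 k h4) h5 h6) (ipZl mD1 k h4 h6) (ipDl mD2 (L2Z mD2 k h7) h8 h9) (ipZl mD2 k h7 h9).
rewrite (eq_bigr (fun j => k * inner m1 D1 (F j) (G j) + inner m1 D1 (F' j) (G j))); last first.
  by move=> j _; rewrite (ipDl mD1 (L2Z mD1 k (h1 j)) (h2 j) (h3 j)) (ipZl mD1 k (h1 j) (h3 j)).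
by rewrite big_split -mulr_sumr /=; ring.
Qed.

Lemma pair3_cvg (F : nat -> 'I_n -> X1 -> R) (F' G : 'I_n -> X1 -> R) (F0 : nat -> X1 -> R) F0' G0 (F1 : nat -> X2 -> R) F1' G1 :
  (forall k j, L2 m1 D1 (F k j)) -> (forall j, L2 m1 D1 (F' j)) -> (forall j, L2 m1 D1 (G j)) ->
  (forall k, L2 m1 D1 (F0 k)) -> L2 m1 D1 F0' -> L2 m1 D1 G0 -> (forall k, L2 m2 D2 (F1 k)) -> L2 m2 D2 F1' -> L2 m2 D2 G1 ->
  (forall j, sqnorm m1 D1 (fun x => F k j x - F' j x) @[k --> \oo] --> 0) ->
  sqnorm m1 D1 (fun x => F0 k x - F0' x) @[k --> \oo] --> 0 -> sqnorm m2 D2 (fun x => F1 k x - F1' x) @[k --> \oo] --> 0 ->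
  pair3 (F k) G (F0 k) G0 (F1 k) G1 @[k --> \oo] --> pair3 F' G F0' G0 F1' G1.
Proof.
move=> h1 h2 h3 h4 h5 h6 h7 h8 h9 c1 c2 c3; apply: cvgD; first apply: cvgD.
- apply: cvg_sum_seq => j; apply: (ip_cvg mD1 (fun k => h1 k j) (fun _ => h3 j) (h2 j) (h3 j) (c1 j)).
  by under eq_fun do rewrite (sq_subrr _ _ mD1); exact: cvg_cst.
- apply: (ip_cvg mD1 h4 (fun _ => h6) h5 h6 c2).
  by under eq_fun do rewrite (sq_subrr _ _ mD1); exact: cvg_cst.
apply: (ip_cvg mD2 h7 (fun _ => h9) h8 h9 c3).
by under eq_fun do rewrite (sq_subrr _ _ mD2); exact: cvg_cst.
Qed.

End pair3.

Lemma pairing_tensor {R : realType} {d} {X : measurableType d} (m : {measure set X -> \bar R}) (D : set X) (T : R)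
    (F : X * measurableTypeR R -> R) g (h : measurableTypeR R -> R) (M : R) (I := (`]0, T[%classic : set (measurableTypeR R))) (lam := @lebesgue_measure R) :
  0 < T -> measurable D -> sigma_finite setT m -> L2 (m \x lam)%E (D `*` I) F -> L2 m D g -> measurable_fun I h -> (forall t, I t -> `|h t| <= M) ->
  lam.-integrable I (fun r => (inner m D (fun x => F (x, r)) g * h r)%:E) /\
  \int[lam]_(r in I) (inner m D (fun x => F (x, r)) g * h r) = inner (m \x lam)%E (D `*` I) F (fun q => g q.1 * h q.2).
Proof.
move=> T0 mD sm LF Lg mh bh; have mIT : measurable I := mI T; have [Lp _] := slice_pairing_L2 mD sm T0 LF Lg.
have Lh : L2 lam I h by exact: (bounded_L2 (M := M) mIT (I_fin T0)).
have jA := L2M mIT Lp Lh; have jB := ip_slice_intble sm mD mIT LF (L2_tensor T0 mD sm Lg mh bh).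
split=> //; rewrite (ip_slice sm mD mIT LF (L2_tensor T0 mD sm Lg mh bh)).
have hh : \forall r \ae lam, I r -> inner m D (fun x => F (x, r)) g * h r = inner m D (fun x => F (x, r)) (fun x => g x * h r).
  apply: (ae_imp (m := lam) (L2_slice sm mD mIT LF)) => r hr Ir; rewrite mulrC -(ipZr mD (h r) Lg (hr Ir)).
  by apply: eq_ip => x _; rewrite [h r * _]mulrC.
by apply/eqP; rewrite eq_le; apply/andP; split; apply: (ae_le_Rintegral mIT) => //; apply: (ae_imp (m := lam) hh) => r hr /hr ->.
Qed.

Lemma cvg0_geo {R : realType} (f : nat -> R) (C : R) : (forall k, 0 <= f k <= C * 8^-1 ^+ k) -> f k @[k --> \oo] --> 0.
Proof.
move=> h; apply: (squeeze_cvgr _ (cvg_cst 0) (cvg_geo C (_ : `|8^-1| < 1))); first exact: nearW.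
by rewrite ger0_norm// invf_lt1// ltr1n.
Qed.

(** The integrals over time of the squared slice distances decay geometrically, so
    [summable_ae_cvg0] applies to the whole sequence. *)
Lemma slice_cvg {R : realType} {d} {X : measurableType d} (m : {measure set X -> \bar R}) (D : set X) (T C : R)
    (lam := @lebesgue_measure R) (I := (`]0, T[%classic : set (measurableTypeR R))) (F : nat -> X * measurableTypeR R -> R) G :
  measurable D -> sigma_finite setT m -> 0 <= C -> (forall k, L2 (m \x lam)%E (D `*` I) (F k)) -> L2 (m \x lam)%E (D `*` I) G ->
  (forall k, sqnorm (m \x lam)%E (D `*` I) (fun q => F k q - G q) <= C * 8^-1 ^+ k) ->
  \forall r \ae lam, I r -> sqnorm m D (fun x => F k (x, r) - G (x, r)) @[k --> \oo] --> 0.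
Proof.
move=> mD sm C0 LF LG hF; have mIT : measurable I := mI T; have mQ := measurableX mD mIT.
have Ld k := L2B mQ (LF k) LG; pose h k (r : measurableTypeR R) := sqnorm m D (fun x => F k (x, r) - G (x, r)).
have jh k : lam.-integrable I (fun r => (h k r)%:E) := sq_slice_intble sm mD mIT (Ld k).
have q8 : 0 <= (8^-1 : R) < 1 by apply/andP; split; lra.
apply: (summable_ae_cvg0 (C := C) mIT (fun k => _ : measurable_fun I (h k)) (fun k r => sq_ge0 _ _ _) q8) => k.
  by apply/measurable_EFinP; exact: measurable_int (jh k).
by rewrite -[leLHS]fineK ?(integrable_fin_num mIT)// lee_fin -/(Rintegral _ _ _) -(sq_slice sm mD mIT (Ld k)).
Qed.

Lemma le_2D {R : realFieldType} (x a b e : R) : x <= 2 * a + 2 * b -> a <= e / 4 -> b <= e / 4 -> x <= e.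
Proof. by lra. Qed.

Lemma translation_small {R : realType} {n} {I : finType} (F : I -> 'rV[R]_n -> R) (eta : R) :
  (forall j, L2 (leb n) setT (F j)) -> 0 < eta ->
  exists2 d, 0 < d & forall z, `|z| <= d -> forall j, sqnorm (leb n) setT (fun x => F j (x + z) - F j x) <= eta.
Proof.
move=> LF eta0; apply: contrapT => no.
have h k : exists z : 'rV[R]_n, `|z| <= 2^-1 ^+ k /\ eta < \sum_j sqnorm (leb n) setT (fun x => F j (x + z) - F j x).
  apply: contrapT => nz; apply: no; exists (2^-1 ^+ k); first by rewrite exprn_gt0.
  move=> z zk j; rewrite leNgt; apply/negP => zj; apply: nz; exists z; split => //.
  by apply: (lt_le_trans zj); rewrite (bigD1 j)//= lerDl sumr_ge0// => i _; exact: sq_ge0.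
have [z hz] := choice h.
have z0 i : z k ord0 i @[k --> \oo] --> (0 : R).
  apply/norm_cvg0P; apply: (squeeze_cvgr _ (cvg_cst 0) (_ : (2^-1 : R) ^+ k @[k --> \oo] --> 0)).
    apply: nearW => k; rewrite normr_ge0/=; have [zk _] := hz k.
    by have /(rV_normP _ (exprn_ge0 _ (ltW _))) := zk; apply.
  by apply: cvg_expr; rewrite ger0_norm// invf_lt1// ltr1n.
have c0 : \sum_j sqnorm (leb n) setT (fun x => F j (x + z k) - F j x) @[k --> \oo] --> (0 : R).
  elim: (index_enum I) => [|j r ih]; first by under eq_fun do rewrite big_nil; exact: cvg_cst.
  have [_ /(_ _ (LF j)) h1] := approx_id_leb z0; rewrite (_ : (fun k => _) = (fun k => sqnorm (leb n) setT (fun x => F j (x + z k) - F j x) +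
    \sum_(j <- r) sqnorm (leb n) setT (fun x => F j (x + z k) - F j x))); last first.
    by apply/funext => k; rewrite big_cons.
  by have := cvgD h1 ih; rewrite addr0; exact.
have [N hN] := near_cvg0_lt eta0 c0.
have [_] := hz N; have := hN N (leqnn N); rewrite ltr_norml => /andP[_ h1] /lt_trans /(_ h1).
by rewrite ltxx.
Qed.

Lemma le_sum_mem {R : numDomainType} {I : eqType} (s : seq I) (F : I -> R) q : (forall i, 0 <= F i) -> q \in s ->
  F q <= \sum_(i <- s) F i.
Proof.
move=> F0; elim: s => // a s ih; rewrite inE big_cons => /predU1P[->|/ih h]; first by rewrite lerDl sumr_ge0.
by apply: le_trans h _; rewrite lerDr.
Qed.

(** * Sobolev functions and traces on a Lipschitz domain *)

Section evolution.
Context {R : realType} {n : nat}.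
Local Notation E := 'rV[R]_n.
Local Notation RR := (measurableTypeR R).
Local Notation lam := (@lebesgue_measure R).
Variables (Om : set E) (sigma : {measure set E -> \bar R}).
Hypothesis dom : domain Om sigma.
Local Notation L2O := (L2 (leb n) Om).
Local Notation L2S := (L2 sigma (bdry Om)).
Local Notation nrm := (sqnorm (leb n) Om).
Local Notation bsq := (sqnorm sigma (bdry Om)).

Lemma mOm : measurable Om. Proof. by case: dom => _ o _ _ _; exact: open_measurable_rV. Qed.

Lemma mbd : measurable (bdry Om). Proof. exact: measurable_bdry. Qed.

Lemma closure_bound : exists M, 0 < M /\ forall x, closure Om x -> `|x| <= M.
Proof.
case: dom => _ _ [M [_ hM]] _ _.
exists (`|M| + 2); split=> [|x cx]; first by rewrite ltr_wpDl.
have M1 : M < `|M| + 1 by rewrite (le_lt_trans (ler_norm M))// ltrDl.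
have [y [Oy]] := cx _ (nbhsx_ballx x 1 ltr01); rewrite -ball_normE /= => xy.
have := hM _ M1 y Oy => /= y1; rewrite -(subrK y x).
by apply: le_trans (ler_normD _ _) _; lra.
Qed.

Lemma closure_compact : compact (closure Om).
Proof.
have [M [M0 hM]] := closure_bound; apply: bounded_closed_compact; last exact: closed_closure.
by exists M; split => [|y My x cx]; [exact: num_real|exact: le_trans (hM x cx) (ltW My)].
Qed.

Lemma Om_fin : (leb n Om < +oo)%E.
Proof.
have [M [M0 hM]] := closure_bound; apply: le_lt_trans (leb_cube n M).
apply: le_measure; rewrite ?inE; [exact: mOm|exact: leb_cube_measurable|].
by move=> x /subset_closure /hM /(rV_normP _ (ltW M0)).
Qed.

Lemma bdry_fin : (sigma (bdry Om) < +oo)%E.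
Proof.
case: dom => n1 o b l s; apply: le_lt_trans (sigma_fin n1 o b l s).
by apply: le_measure; rewrite ?inE//; exact: mbd.
Qed.

Lemma continuous_bounded_closure (f : E -> R) : continuous f ->
  exists M, 0 < M /\ forall x, closure Om x -> `|f x| <= M.
Proof.
move=> cf; have [M [M0 hM]] := closure_bound.
have [N [N0 hN]] := continuous_bounded_on (@compact_ball_rV R n 0 M) cf.
by exists N; split => // x /hM xM; apply: hN; rewrite /= subr0.
Qed.

Lemma cont_L2 (f : E -> R) : continuous f -> L2O f.
Proof.
move=> cf; have [M [_ hM]] := continuous_bounded_closure cf.
apply: (bounded_L2 (M := M) mOm Om_fin); first by apply: measurable_funTS; mfun.
by move=> x /subset_closure; exact: hM.
Qed.

Lemma cont_L2S (f : E -> R) : continuous f -> L2S f.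
Proof.
move=> cf; have [M [_ hM]] := continuous_bounded_closure cf.
apply: (bounded_L2 (M := M) mbd bdry_fin); first by apply: measurable_funTS; mfun.
by move=> x [cx _]; exact: hM.
Qed.

Definition gsq (Dw : 'I_n -> E -> R) : R := \sum_i nrm (Dw i).
Definition h1sq (w : E -> R) (Dw : 'I_n -> E -> R) : R := nrm w + gsq Dw.
Definition L2H (w : E -> R) (Dw : 'I_n -> E -> R) : Prop := L2O w /\ forall i, L2O (Dw i).

Lemma gsq_ge0 Dw : 0 <= gsq Dw. Proof. by apply: sumr_ge0 => i _; exact: sq_ge0. Qed.

Lemma h1sq_ge0 w Dw : 0 <= h1sq w Dw. Proof. by rewrite addr_ge0 ?sq_ge0 ?gsq_ge0. Qed.

Lemma H1_L2H w Dw : H1 Om w Dw -> L2H w Dw. Proof. by case. Qed.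

Lemma gsqD_le Dv Dw : (forall i, L2O (Dv i)) -> (forall i, L2O (Dw i)) ->
  gsq (fun i x => Dv i x + Dw i x) <= 2 * gsq Dv + 2 * gsq Dw.
Proof.
by move=> h1 h2; rewrite !mulr_sumr -big_split; apply: ler_sum => i _; exact: (sqD_le mOm (h1 i) (h2 i)).
Qed.

Lemma h1sqD_le v Dv w Dw : L2H v Dv -> L2H w Dw ->
  h1sq (fun x => v x + w x) (fun i x => Dv i x + Dw i x) <= 2 * h1sq v Dv + 2 * h1sq w Dw.
Proof.
move=> [h1 h2] [h3 h4]; have := gsqD_le h2 h4; have := sqD_le mOm h1 h3.
by rewrite /h1sq; lra.
Qed.

Lemma h1sqZ c w Dw : L2H w Dw -> h1sq (fun x => c * w x) (fun i x => c * Dw i x) = c ^+ 2 * h1sq w Dw.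
Proof.
move=> [h1 h2]; rewrite /h1sq /gsq mulrDr mulr_sumr (sqZ mOm)//; congr (_ + _).
by apply: eq_bigr => i _; rewrite (sqZ mOm).
Qed.

Lemma h1sqBC v Dv w Dw : h1sq (fun x => v x - w x) (fun i x => Dv i x - Dw i x) =
  h1sq (fun x => w x - v x) (fun i x => Dw i x - Dv i x).
Proof. by rewrite /h1sq sqBC; congr (_ + _); apply: eq_bigr => i _; rewrite sqBC. Qed.

Lemma L2HD v Dv w Dw : L2H v Dv -> L2H w Dw -> L2H (fun x => v x + w x) (fun i x => Dv i x + Dw i x).
Proof. by move=> [a h] [b k]; split=> [|i]; [exact: (L2D mOm a b)|exact: (L2D mOm (h i) (k i))]. Qed.

Lemma L2HZ c w Dw : L2H w Dw -> L2H (fun x => c * w x) (fun i x => c * Dw i x).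
Proof. by move=> [? h]; split=> [|i]; apply: L2Z mOm _ _ _. Qed.

Lemma L2HB v Dv w Dw : L2H v Dv -> L2H w Dw -> L2H (fun x => v x - w x) (fun i x => Dv i x - Dw i x).
Proof. by move=> [a h] [b k]; split=> [|i]; [exact: (L2B mOm a b)|exact: (L2B mOm (h i) (k i))]. Qed.

Lemma h1sq_triangle u Du v Dv w Dw : L2H u Du -> L2H v Dv -> L2H w Dw ->
  h1sq (fun x => u x - w x) (fun i x => Du i x - Dw i x) <=
  2 * h1sq (fun x => u x - v x) (fun i x => Du i x - Dv i x) + 2 * h1sq (fun x => v x - w x) (fun i x => Dv i x - Dw i x).
Proof.
move=> hu hv hw; apply: le_trans (h1sqD_le (L2HB hu hv) (L2HB hv hw)).
apply: eqW; rewrite /h1sq /gsq; congr (_ + _).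
  by apply: eq_sq => x _; ring.
by apply: eq_bigr => i _; apply: eq_sq => x _; ring.
Qed.

Lemma smooth_partial f i : smooth f -> smooth (partial i f : E -> R^o).
Proof. by apply: smooth_deriv. Qed.

Lemma smooth_L2H f : smooth f -> L2H f (partial^~ f).
Proof.
move=> sf; split=> [|i]; apply: cont_L2; first exact: smooth_continuous.
by apply: smooth_continuous; exact: smooth_partial.
Qed.

Lemma esq_sum (g : 'I_n -> E -> R) : (forall i, L2O (g i)) ->
  (\int[leb n]_(x in Om) (\sum_i g i x ^+ 2)%:E = (gsq g)%:E)%E.
Proof.
move=> Lg; under eq_integral do rewrite -sumEFin.
rewrite ge0_integral_sum; [|exact: mOm|by move=> i; mfun|by move=> i x _; rewrite lee_fin sqr_ge0].
by rewrite -sumEFin; apply: eq_bigr => i _; rewrite (esq mOm).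
Qed.

(** The condition on [q] holds for the identity, which gives the trace inequality, and for the
    excess over a level, which gives upper bounds for traces. *)
Lemma smooth_line_bounded (q : R -> R) (f : E -> R^o) : continuous q ->
  (forall s : R, is_derive s 1 (fun s : R => q s ^+ 2) (2 * q s)) -> smooth f ->
  line_bounded (fun x => q (f x) ^+ 2) (fun x => 2 * `|q (f x)| * \sum_i `|partial i f x|).
Proof.
move=> cq dq sf; have cf := smooth_continuous sf.
have cqf : continuous (fun x => q (f x)) by move=> x; apply: continuous_comp; [exact: cf|exact: cq].
have cS : continuous (fun x => \sum_i `|partial i f x|).
  by apply: cont_sum => i; apply: cont_norm; apply: smooth_continuous; exact: smooth_partial.
have cG : continuous (fun x => 2 * `|q (f x)| * \sum_i `|partial i f x|).
  by apply: contM => //; apply: contM; [exact: cont_cst|exact: cont_norm].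
split => //.
- by apply: contM.
- by move=> x; exact: sqr_ge0.
- by move=> x; rewrite !mulr_ge0// sumr_ge0.
move=> x v s s0.
have cDv : continuous ('D_v f) by apply: smooth_continuous; exact: smooth_deriv.
pose df t := 2 * q (f (x + t *: v)) * 'D_v f (x + t *: v).
have cdf : continuous df.
  apply: (@line_cont _ _ (fun y => 2 * q (f y) * 'D_v f y)).
  by apply: contM => //; apply: contM => //; exact: cont_cst.
have dF (t : R) : is_derive t 1 (fun t : R => q (f (x + t *: v)) ^+ 2) (df t).
  have h1 := line_derive x t (class_C_deriv v (sf 1%N)).1.
  have := is_derive1_comp (dq (f (x + t *: v))) h1.
  by [].
have := FTC_path s0 dF cdf; rewrite scale0r addr0 => hF.
rewrite -lerBlDl -opprB hF -mulN1r -RintegralZl//; last first.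
  by apply: continuous_compact_integrable; [exact: segment_compact|exact: continuous_subspaceT].
apply: le_Rintegral => //.
- apply: continuous_compact_integrable; first exact: segment_compact.
  by apply: continuous_subspaceT; apply: contM => //; exact: cont_cst.
- apply: continuous_compact_integrable; first exact: segment_compact.
  apply: continuous_subspaceT; apply: contM; first exact: cont_cst.
  exact: (@line_cont _ _ (fun y => 2 * `|q (f y)| * \sum_i `|partial i f y|) x v cG).
move=> t _; rewrite mulN1r; apply: le_trans (ler_norm _) _.
rewrite normrN /df !normrM (ger0_norm (ler0n _ 2)) mulrCA ler_wpM2l////.
rewrite (derive_coord _ _ (sf 1%N)); apply: le_trans (ler_norm_sum _ _ _) _.
rewrite mulr_sumr; apply: ler_sum => i _; rewrite normrM ler_wpM2r//.
by have /(rV_normP _ (normr_ge0 v)) := lexx `|v|.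
Qed.

(** [trace_W11] for the square, followed by Young's inequality with a free parameter: a large [a]
    makes the gradient part small at the expense of the L2 part. *)
Lemma trace_smooth_le : exists2 c, 0 <= c & forall (q : R -> R) (f : E -> R^o) a, continuous q ->
  (forall s : R, is_derive s 1 (fun s : R => q s ^+ 2) (2 * q s)) -> smooth f -> 0 < a ->
  bsq (fun x => q (f x)) <= c * ((1 + n%:R * a) * nrm (fun x => q (f x)) + a^-1 * gsq (partial^~ f)).
Proof.
have [n1 o b l s] := dom; have [c c0 hc] := trace_W11 n1 o b l s.
exists c => // q f a cq dq sf a0.
have lb := smooth_line_bounded cq dq sf.
have cqf : continuous (fun x => q (f x)).
  by move=> x; apply: continuous_comp; [exact: (smooth_continuous sf)|exact: cq].
have Lq := cont_L2 cqf; have [_ Lp] := smooth_L2H sf.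
have a1 : 0 <= 1 + n%:R * a by rewrite addr_ge0// mulr_ge0// ltW.
have a2 : 0 <= a^-1 by rewrite invr_ge0 ltW.
have := hc _ _ lb; rewrite (esq mbd (cont_L2S cqf)) => h.
rewrite -lee_fin; apply: (le_trans h); rewrite EFinM; apply: lee_wpmul2l; first by rewrite lee_fin.
rewrite EFinD !EFinM -(esq mOm Lq) -(esq_sum Lp).
have m1 : measurable_fun Om (fun x => q (f x) ^+ 2) by mfun.
have m2 : measurable_fun Om (fun x => \sum_i partial i f x ^+ 2).
  by apply: measurable_sum => i; apply: measurable_funX; exact: (L2_meas (Lp i)).
have p2 x : 0 <= \sum_i partial i f x ^+ 2 by apply: sumr_ge0 => i _; exact: sqr_ge0.
have mO := mOm.
rewrite -!ge0_integralZl_EFin//; try solve [by move=> x _; rewrite lee_fin ?sqr_ge0 | mfun].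
rewrite -ge0_integralD//; try solve [by move=> x _; rewrite lee_fin mulr_ge0// sqr_ge0
  | by apply: measurable_funeM; mfun].
have [cF cG F0 G0 _] := lb.
apply: ge0_le_integral => //; try solve [by move=> x _; rewrite lee_fin addr_ge0
  | by move=> x _; rewrite// -EFinM lee_fin mulr_ge0// sqr_ge0
  | by apply/measurable_EFinP; apply: measurable_funTS; apply: continuous_measurable_rV; exact: contD
  | by apply: emeasurable_funD; apply: measurable_funeM; mfun].
move=> x _; rewrite lee_fin.
have -> : (1 + n%:R * a) * q (f x) ^+ 2 = q (f x) ^+ 2 + n%:R * a * q (f x) ^+ 2 by ring.
rewrite -addrA lerD2l.
rewrite [_ * q (f x) ^+ 2](_ : _ = \sum_(i < n) a * q (f x) ^+ 2); last first.
  by rewrite sumr_const card_ord -[RHS]mulr_natl mulrA.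
rewrite !mulr_sumr -big_split; apply: ler_sum => i _ /=.
have := sqr_ge0 (a * `|q (f x)| - `|partial i f x|).
rewrite -(real_normK (num_real (q _))) -(real_normK (num_real (partial _ _ _))).
move: `|_| `|_| => u v uv; rewrite -(ler_pM2l a0) mulrDr mulVKf ?gt_eqF//.
by lra.
Qed.

Lemma trace_ofP w Dw tw : trace_of Om sigma w Dw tw <-> L2S tw /\ forall e, 0 < e -> exists f, [/\ smooth f,
  h1sq (fun x => f x - w x) (fun i x => partial i f x - Dw i x) <= e & bsq (fun x => f x - tw x) <= e].
Proof.
split=> -[Lt].
  move=> [f [sf h1 h2]]; split => // e e0.
  have e1 : 0 < Num.sqrt e by rewrite sqrtr_gt0.
  have [N1 hN1] := near_cvg0_lt e1 h1.
  have h3 : bsq (fun x => f k x - tw x) @[k --> \oo] --> 0.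
    move: h2; under eq_fun => k do rewrite (esq mbd (L2B mbd (cont_L2S (smooth_continuous (sf k))) Lt)).
    by move=> /fine_cvgP[].
  have [N2 hN2] := near_cvg0_lt e0 h3.
  exists (f (maxn N1 N2)); split => //; last by apply: ltW; apply: le_lt_trans (hN2 _ (leq_maxr _ _)); exact: ler_norm.
  have := hN1 _ (leq_maxl N1 N2); rewrite ger0_norm ?sqrtr_ge0// ltr_sqrt// => /ltW; exact.
move=> h; split => //.
have /choice[f hf] : forall k, exists f : E -> R^o, [/\ smooth f,
    h1sq (fun x => f x - w x) (fun i x => partial i f x - Dw i x) <= 2^-1 ^+ k & bsq (fun x => f x - tw x) <= 2^-1 ^+ k].
  by move=> k; apply: h.
have g0 : (2^-1 : R) ^+ k @[k --> \oo] --> 0 by apply: cvg_expr; rewrite ger0_norm// invf_lt1// ltr1n.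
exists f; split=> [k||]; first by case: (hf k).
  rewrite -[X in _ --> X]sqrtr0; apply: (@cvg_comp _ _ _ (fun k => h1sq (fun x => f k x - w x) (fun i x => partial i (f k) x - Dw i x)) Num.sqrt); last exact: sqrt_continuous.
  apply: squeeze_cvgr (cvg_cst 0) g0; apply: nearW => k; rewrite h1sq_ge0/=; by case: (hf k).
under eq_fun => k do rewrite (esq mbd (L2B mbd (cont_L2S (smooth_continuous (let: And3 h _ _ := hf k in h))) Lt)).
apply: cvg_EFin; first exact: nearW.
apply: squeeze_cvgr (cvg_cst 0) g0; apply: nearW => k /=; rewrite sq_ge0/=; by case: (hf k).
Qed.

Lemma trace_L2 w Dw tw : trace_of Om sigma w Dw tw -> L2S tw. Proof. by case. Qed.

Lemma trace_sub w Dw tw e : L2H w Dw -> trace_of Om sigma w Dw tw -> 0 < e -> exists f, [/\ smooth f, L2H f (partial^~ f),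
  h1sq (fun x => f x - w x) (fun i x => partial i f x - Dw i x) <= e & bsq (fun x => f x - tw x) <= e].
Proof.
move=> hw /trace_ofP[Lt h] e0; have [f [sf h1 h2]] := h _ e0.
by exists f; split => //; exact: smooth_L2H.
Qed.

Lemma trace_smooth (f : E -> R^o) : smooth f -> trace_of Om sigma f (partial^~ f) f.
Proof.
move=> sf; apply/trace_ofP; split; first by apply: cont_L2S; exact: smooth_continuous.
move=> e e0; exists f; split => //.
  rewrite /h1sq /gsq (sq_subrr _ _ mOm) add0r big1 ?ltW// => i _; exact: (sq_subrr _ _ mOm).
by rewrite (sq_subrr _ _ mbd) ltW.
Qed.

Lemma trace_closed w Dw tw : L2H w Dw -> L2S tw ->
  (forall e, 0 < e -> exists w' Dw' tw', [/\ L2H w' Dw', trace_of Om sigma w' Dw' tw',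
    h1sq (fun x => w' x - w x) (fun i x => Dw' i x - Dw i x) <= e & bsq (fun x => tw' x - tw x) <= e]) ->
  trace_of Om sigma w Dw tw.
Proof.
move=> hw ht h; apply/trace_ofP; split => // e e0.
have e4 : 0 < e / 4 by rewrite divr_gt0.
have [w' [Dw' [tw' [hw' ht' h1 h2]]]] := h _ e4.
have [f [sf hf h3 h4]] := trace_sub hw' ht' e4.
exists f; split => //; first by apply: le_trans (h1sq_triangle hf hw' hw) _; lra.
have Lf : L2S f by apply: cont_L2S; exact: smooth_continuous.
have Lt' := trace_L2 ht'.
have := sqD_le mbd (L2B mbd Lf Lt') (L2B mbd Lt' ht).
rewrite (@eq_sq _ _ _ _ _ _ (fun x => f x - tw x)) => [|x _]; last by rewrite addrA subrK.
by lra.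
Qed.

Let arith1 (k d e X Y Z : R) : 0 <= k -> Y <= d -> Z <= d -> 2 * (k * d) + 2 * d = e ->
  X <= 2 * (k * Y) + 2 * Z -> X <= e.
Proof. by move=> k0 Yd Zd <- /le_trans; apply; apply: lerD; rewrite ler_wpM2l// ler_wpM2l. Qed.

Lemma trace_lin c v Dv tv w Dw tw : L2H v Dv -> L2H w Dw -> trace_of Om sigma v Dv tv -> trace_of Om sigma w Dw tw ->
  trace_of Om sigma (fun x => c * v x + w x) (fun i x => c * Dv i x + Dw i x) (fun x => c * tv x + tw x).
Proof.
move=> hv hw tv' tw'; have Lv := trace_L2 tv'; have Lw := trace_L2 tw'.
apply/trace_ofP; split=> [|e e0]; first exact: (L2D mbd (L2Z mbd c Lv) Lw).
pose d := e / (2 * c ^+ 2 + 2).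
have c2 : 0 < 2 * c ^+ 2 + 2 by rewrite ltr_wpDl// mulr_ge0// sqr_ge0.
have d0 : 0 < d by rewrite divr_gt0.
have de : 2 * (c ^+ 2 * d) + 2 * d = e by rewrite /d; field; rewrite gt_eqF.
have [f [sf hf f1 f2]] := trace_sub hv tv' d0; have [g [sg hg g1 g2]] := trace_sub hw tw' d0.
have Cf : class_C 1 f := sf 1%N.
have Cg : class_C 1 g := sg 1%N.
exists (fun x => c * f x + g x); split; first by apply: smoothD => //; exact: smoothZ.
  have pE i x : partial i (fun x => c * f x + g x : R^o) x = c * partial i f x + partial i g x.
    rewrite /partial deriveD; last 2 first.
    - by have [+ _] := class_C_deriv (delta_mx ord0 i) (class_CZ c Cf).
    - by have [+ _] := class_C_deriv (delta_mx ord0 i) Cg.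
    rewrite (_ : (fun x => c * f x) = c \*: (f : E -> R^o)) ?deriveZ//.
    by have [+ _] := class_C_deriv (delta_mx ord0 i) Cf.
  have := h1sqD_le (L2HZ c (L2HB hf hv)) (L2HB hg hw).
  rewrite (h1sqZ c (L2HB hf hv)).
  have -> : h1sq (fun x => c * (f x - v x) + (g x - w x)) (fun i x => c * (partial i f x - Dv i x) + (partial i g x - Dw i x)) =
      h1sq (fun x => c * f x + g x - (c * v x + w x)) (fun i x => partial i (fun x => c * f x + g x : R^o) x - (c * Dv i x + Dw i x)).
    rewrite /h1sq /gsq; congr (_ + _); first by apply: eq_sq => x _; ring.
    by apply: eq_bigr => i _; apply: eq_sq => x _; rewrite pE; ring.
  exact: arith1 (sqr_ge0 c) f1 g1 de.
have Lf : L2S f by apply: cont_L2S; exact: smooth_continuous.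
have Lg : L2S g by apply: cont_L2S; exact: smooth_continuous.
have := sqD_le mbd (L2Z mbd c (L2B mbd Lf Lv)) (L2B mbd Lg Lw).
rewrite (sqZ mbd c (L2B mbd Lf Lv)).
rewrite (@eq_sq _ _ _ _ _ _ (fun x => c * f x + g x - (c * tv x + tw x))) => [|x _]; last by ring.
exact: arith1 (sqr_ge0 c) f2 g2 de.
Qed.

Lemma is_derive_id2 (s : R) : is_derive s 1 (fun s : R => s ^+ 2) (2 * s).
Proof.
apply: is_derive_eps => e e0; exists e => // h he; rewrite -[h *: _]/(h * 1) mulr1.
rewrite (_ : _ - _ = h ^+ 2); last by ring.
by rewrite normrM ler_wpM2r// ltW.
Qed.

Let arith2 (c A a2 bt bf del nf nw nd gf gw gd d : R) : 0 <= c -> 0 <= A -> 0 <= a2 ->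
  bt <= 2 * bf + 2 * del -> bf <= c * (A * nf + a2 * gf) -> nf <= 2 * nw + 2 * nd -> gf <= 2 * gw + 2 * gd ->
  nd <= d -> gd <= d -> del <= d -> bt <= 4 * c * (A * nw + a2 * gw) + d * (4 * c * (A + a2) + 2).
Proof.
move=> c0 A0 a0 h1 h2 h3 h4 h5 h6 h7.
have k1 : A * nf <= A * (2 * nw + 2 * d) by rewrite ler_wpM2l//; lra.
have k2 : a2 * gf <= a2 * (2 * gw + 2 * d) by rewrite ler_wpM2l//; lra.
have := ler_wpM2l c0 (lerD k1 k2); move: h1 h2 h7.
lra.
Qed.

Lemma trace_eps : exists2 c, 0 <= c & forall a w Dw tw, 0 < a -> L2H w Dw -> trace_of Om sigma w Dw tw ->
  bsq tw <= c * ((1 + n%:R * a) * nrm w + a^-1 * gsq Dw).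
Proof.
have [c c0 hc] := trace_smooth_le; exists (4 * c) => [|a w Dw tw a0 hw ht]; first exact: mulr_ge0.
have a1 : 0 <= 1 + n%:R * a by rewrite addr_ge0// mulr_ge0// ltW.
have a2 : 0 <= a^-1 by rewrite invr_ge0 ltW.
have Lt := trace_L2 ht.
pose B := 4 * c * (1 + n%:R * a + a^-1) + 2.
have B0 : 0 < B by apply: ltr_wpDl => //; apply: mulr_ge0; [exact: mulr_ge0|exact: addr_ge0].
apply/ler_addgt0Pr => e e0; have d0 : 0 < e / B by rewrite divr_gt0.
have [f [sf hf f1 f2]] := trace_sub hw ht d0.
have Lf : L2S f by apply: cont_L2S; exact: smooth_continuous.
have b1 : bsq tw <= 2 * bsq f + 2 * bsq (fun x => f x - tw x).
  have := sqB_le mbd Lf (L2B mbd Lf Lt).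
  by rewrite (@eq_sq _ _ _ _ _ _ tw) => [//|x _]; rewrite opprB addrC subrK.
have h2 := hc id f a (fun x => cvg_id) is_derive_id2 sf a0.
have n1 : nrm f <= 2 * nrm w + 2 * nrm (fun x => f x - w x).
  have := sqD_le mOm hw.1 (L2B mOm hf.1 hw.1).
  by rewrite (@eq_sq _ _ _ _ _ _ f) => [//|x _]; rewrite addrC subrK.
have g1 : gsq (partial^~ f) <= 2 * gsq Dw + 2 * gsq (fun i x => partial i f x - Dw i x).
  have := gsqD_le hw.2 (fun i => L2B mOm (hf.2 i) (hw.2 i)).
  rewrite /gsq [in X in X -> _](eq_bigr (fun i => nrm (partial i f))) => [//|i _].
  by apply: eq_sq => x _; rewrite addrC subrK.
have nd : nrm (fun x => f x - w x) <= e / B by apply: le_trans f1; rewrite lerDl gsq_ge0.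
have gd : gsq (fun i x => partial i f x - Dw i x) <= e / B by apply: le_trans f1; rewrite lerDr sq_ge0.
apply: le_trans (arith2 c0 a1 a2 b1 h2 n1 g1 nd gd f2) _.
by rewrite divfK ?gt_eqF.
Qed.

Let mO : measurable Om := mOm.
Let mB : measurable (bdry Om). Proof. exact: mbd. Qed.

(** A truncation whose square has the derivative [2 * excess M s], also at the kink, as
    [smooth_line_bounded] demands. *)
Let excess (M s : R) : R := Num.max (s - M) 0.

Let excess_lip M s t : `|excess M s - excess M t| <= `|s - t|.
Proof. by rewrite /excess; case: (leP (s - M) 0) => h1; case: (leP (t - M) 0) => h2; rewrite ler_norml; case: (ger0P (s - t)) => h3; lra. Qed.

Let excess_le M s t : t <= M -> `|excess M s| <= `|s - t|.
Proof. by move=> tM; have := excess_lip M s t; rewrite {2}/excess max_r ?subr0// subr_le0. Qed.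

Let excess_cont M : continuous (excess M).
Proof.
move=> s; apply/cvgrPdist_lt => e e0; apply: filterS (nbhsx_ballx s e e0) => t.
by apply: le_lt_trans.
Qed.

Let excess_derive M (s : R) : is_derive s 1 (fun s : R => excess M s ^+ 2) (2 * excess M s).
Proof.
apply: is_derive_eps => e e0; exists e => // h he; rewrite -[h *: _]/(h * 1) mulr1.
apply: (@le_trans _ _ (h ^+ 2)); last by rewrite -real_normK ?num_real// ler_wpM2r// ltW.
rewrite /excess; case: (leP (h + s - M) 0) => h1; case: (leP (s - M) 0) => h2.
- by rewrite !expr2 !mulr0 !subr0 normr0 sqr_ge0.
- rewrite ler_norml; nra.
- rewrite ler_norml; nra.
- by rewrite (_ : _ - _ = h ^+ 2) ?ger0_norm ?sqr_ge0//; ring.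
Qed.

(** Apply the trace inequality to the excess of a smooth approximant [f]. Its L2 norm is small
    because [w <= M], its gradient is merely bounded. Hence [a] is first taken large to suppress the
    gradient term, and then the approximation error [d] small against [1 + n%:R * a]. *)
Lemma trace_le M w Dw tw : L2H w Dw -> trace_of Om sigma w Dw tw ->
  (\forall x \ae leb n, Om x -> w x <= M) -> \forall x \ae sigma, bdry Om x -> tw x <= M.
Proof.
move=> hw ht wM; have Lt := trace_L2 ht; have [c c0 hc] := trace_smooth_le.
have mq : measurable_fun setT (excess M : RR -> RR) by apply: continuous_measurable_fun.
have Lq : L2S (fun x => excess M (tw x)).
  apply: (le_L2 mB) (L2B mB Lt (bounded_L2 (M := `|M|) mB (bdry_fin) (measurable_cst M) (fun _ _ => lexx _))) _.
    mfun.
  by apply: nearW => x _ /=; exact: excess_le.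
suff h e : 0 < e -> bsq (fun x => excess M (tw x)) <= e.
  have h0 : bsq (fun x => excess M (tw x)) = 0.
    by apply/eqP; rewrite eq_le sq_ge0 andbT; apply/ler_addgt0Pr => e e0; rewrite add0r h.
  apply: filterS (sq0_ae mB Lq h0) => x h1 bx; have := h1 bx.
  by rewrite /excess; case: (leP (tw x - M) 0) => h2; lra.
move=> e0; pose G := 2 * gsq Dw + 2.
have G0 : 0 < G by rewrite ltr_wpDl// mulr_ge0// gsq_ge0.
have c1 : 0 < c + 1 by rewrite ltr_wpDl.
pose a := 6 * (c + 1) * G / e.
have a0 : 0 < a by rewrite divr_gt0// !mulr_gt0.
have cG : (c + 1) * (a^-1 * G) = e / 6 by rewrite /a; field; rewrite !gt_eqF.
have A1 : 1 <= 1 + n%:R * a by rewrite lerDl mulr_ge0// ltW.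
have A0 : 0 < 1 + n%:R * a by apply: lt_le_trans A1.
pose d := Num.min 1 (e / (6 * (c + 1) * (1 + n%:R * a))).
have d0 : 0 < d by rewrite lt_min ltr01 divr_gt0// !mulr_gt0.
have d1 : d <= 1 by rewrite ge_min lexx.
have d2 : (c + 1) * ((1 + n%:R * a) * d) <= e / 6.
  apply: le_trans (_ : _ <= (c + 1) * ((1 + n%:R * a) * (e / (6 * (c + 1) * (1 + n%:R * a))))) _.
    by rewrite !ler_wpM2l ?(ltW c1) ?(ltW A0)// ge_min lexx orbT.
  by apply: eqW; field; rewrite !gt_eqF.
have [f [sf hf f1 f2]] := trace_sub hw ht d0.
have cf := smooth_continuous sf.
have cqf : continuous (fun x => excess M (f x)) by move=> x; apply: continuous_comp; [exact: cf|exact: excess_cont].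
have Lqf := cont_L2 cqf; have LqfS := cont_L2S cqf.
have LfS := cont_L2S cf.
have b1 : bsq (fun x => excess M (tw x)) <= 2 * bsq (fun x => excess M (f x)) + 2 * d.
  have Ld := L2B mB LqfS Lq.
  have := sqB_le mB LqfS Ld.
  rewrite (@eq_sq _ _ _ _ _ _ (fun x => excess M (tw x))) => [|x _]; last by rewrite opprB addrC subrK.
  have : bsq (fun x => excess M (f x) - excess M (tw x)) <= d.
    apply: le_trans f2; apply: (le_sq mB Ld (L2B mB LfS Lt)).
    by apply: nearW => x _.
  by lra.
have b2 : nrm (fun x => excess M (f x)) <= d.
  have nd : nrm (fun x => f x - w x) <= d by apply: le_trans f1; rewrite lerDl gsq_ge0.
  apply: le_trans nd; apply: (le_sq mO Lqf (L2B mO hf.1 hw.1)).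
  by apply: filterS wM => x h /h; exact: excess_le.
have b3 : gsq (partial^~ f) <= G.
  have := gsqD_le hw.2 (fun i => L2B mO (hf.2 i) (hw.2 i)).
  have -> : gsq (fun i x => Dw i x + (partial i f x - Dw i x)) = gsq (partial^~ f).
    by apply: eq_bigr => i _; apply: eq_sq => x _; rewrite addrC subrK.
  have : gsq (fun i x => partial i f x - Dw i x) <= d by apply: le_trans f1; rewrite lerDr sq_ge0.
  by rewrite /G; lra.
have b4 := hc (excess M) f a (@excess_cont M) (excess_derive M) sf a0.
have b5 : bsq (fun x => excess M (f x)) <= e / 6 + e / 6.
  apply: (le_trans b4); apply: (@le_trans _ _ ((c + 1) * ((1 + n%:R * a) * d) + (c + 1) * (a^-1 * G))); last by rewrite cG lerD2r.
  rewrite -mulrDr; apply: ler_pM => //; first by rewrite addr_ge0 ?mulr_ge0 ?sq_ge0 ?gsq_ge0 ?invr_ge0 ?(ltW A0) ?(ltW a0).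
    by rewrite lerDl.
  by apply: lerD; rewrite ler_wpM2l ?(ltW A0)// invr_ge0 ltW.
have b6 : d <= e / 6.
  apply: le_trans d2; rewrite mulrA ler_peMl ?(ltW d0)// -[leLHS]mulr1; apply: ler_pM => //.
  by rewrite lerDr.
by lra.
Qed.

Lemma trace_bounded M w Dw tw : L2H w Dw -> trace_of Om sigma w Dw tw ->
  (\forall x \ae leb n, Om x -> `|w x| <= M) -> \forall x \ae sigma, bdry Om x -> `|tw x| <= M.
Proof.
move=> hw ht wM.
have h1 : \forall x \ae sigma, bdry Om x -> tw x <= M.
  by apply: trace_le ht _ => //; apply: filterS wM => x h /h; rewrite ler_norml => /andP[].
have s0 : smooth (fun _ : E => 0 : R^o) := smooth_cst _ _.
have ht' := trace_lin (-1) hw (smooth_L2H s0) ht (trace_smooth s0).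
have hw' := L2HD (L2HZ (-1) hw) (smooth_L2H s0).
have h2 : \forall x \ae sigma, bdry Om x -> -1 * tw x + 0 <= M.
  by apply: trace_le ht' _ => //; apply: filterS wM => x h /h; rewrite ler_norml mulN1r addr0 lerNl => /andP[].
apply: filterS2 h1 h2 => x h1 h2 bx; rewrite ler_norml h1// andbT lerNl.
by have := h2 bx; rewrite mulN1r addr0.
Qed.

(** * Weak derivatives: products, smooth functions, closedness *)

Lemma partial_out (f : E -> R^o) (K : set E) i x : closed K -> (forall y, ~ K y -> f y = 0) -> ~ K x -> partial i f x = 0.
Proof.
move=> cK f0 Kx; have nK : \forall y \near x, f y = 0.
  have : nbhs x (~` K) by apply: open_nbhs_nbhs; split => //; exact: closed_openC.
  by apply: filterS => y; exact: f0.
have nK' : \forall y \near x, (fun _ => 0 : R^o) y = f y by apply: filterS nK.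
by have [_] := near_eq_is_derive nK' (is_derive_cst (0 : R^o) x (delta_mx ord0 i : E)).
Qed.

(** By translation invariance the integral of a difference quotient vanishes, and the quotients
    converge uniformly to the derivative. *)
Lemma test_int_partial f i : test_function Om f -> \int[leb n]_(x in Om) partial i f x = 0.
Proof.
move=> [sf [K [cK KO f0]]].
have Kc : closed K by apply: compact_closed => //.
have [M [M0 hM]] := closure_bound.
pose e : E := delta_mx ord0 i.
have e1 : `|e| <= 1.
  apply/(rV_normP _ ler01) => j; rewrite mxE /=; by case: eqP; rewrite ?normr1 ?normr0.
(* A ball large enough to contain the support of [f] after shifts by at most 1, so that all
   integrals may be taken over one bounded set. *)
pose B := [set x : E | `|x| <= M + 1].
have cB : compact B by rewrite /B; have := @compact_ball_rV R n 0 (M + 1); under eq_set do rewrite subr0.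
have mB' : measurable B by apply: closed_measurable_rV; apply: compact_closed => //.
have fB : (leb n B < +oo)%E.
  apply: le_lt_trans (leb_cube n (M + 1)); apply: le_measure; rewrite ?inE//; first exact: leb_cube_measurable.
  by move=> x /(rV_normP _ (ltW (ltr_pwDr ltr01 (ltW M0)))).
have KB x : K x -> `|x| <= M by move=> /KO /subset_closure; exact: hM.
have g0 x : ~ K x -> partial i f x = 0 by exact: partial_out.
have cg : continuous (partial i f) by apply: smooth_continuous; exact: smooth_partial.
have cf := smooth_continuous sf.
have mf := continuous_measurable_rV cf; have mg := continuous_measurable_rV cg.
have intB (h : E -> R) : continuous h -> (leb n).-integrable B (EFin \o h).
  move=> ch; have [N [N0 hN]] := continuous_bounded_on cB ch.
  apply: (@measurable_bounded_integrable _ _ _ _ h) => //; first by apply: measurable_funTS; mfun.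
  by exists N; split => [|y Ny x Bx]; [exact: num_real|exact: le_trans (hN x Bx) (ltW Ny)].
have toT (D : set E) (h : E -> R) : (forall x, ~ D x -> h x = 0) -> \int[leb n]_(x in D) h x = \int[leb n]_x h x.
  move=> h0; rewrite Rintegral_mkcond; congr (Rintegral _ _ _); apply/funext => x.
  by rewrite patchE; case: ifPn => // /negP xD; rewrite h0// => Dx; apply: xD; rewrite inE.
rewrite (toT Om); last by move=> x nO; apply: g0 => /KO.
rewrite -(toT B); last by move=> x nB; apply: g0 => /KB xM; apply: nB; rewrite /B /=; lra.
apply/eqP; rewrite -normr_le0; apply/ler_addgt0Pr => eps eps0; rewrite add0r.
pose V := fine (leb n B) + 1.
have V0 : 0 < V by rewrite ltr_wpDl//.
have om0 : 0 < eps / V by rewrite divr_gt0.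
have [d0 d00 hd] := uniformly_continuous_on cB cg om0.
pose h := Num.min d0 1 / 2.
have h0 : 0 < h by rewrite divr_gt0// lt_min d00 ltr01.
have hd0 : h < d0 by rewrite /h; have : Num.min d0 1 <= d0 by [rewrite ge_min lexx]; lra.
have h1 : h < 1 by rewrite /h; have : Num.min d0 1 <= 1 by [rewrite ge_min lexx orbT]; lra.
have nK x t : ~ B x -> 0 <= t -> t <= 1 -> ~ K (x + t *: e).
  move=> nB t0 t1 /KB xK; apply: nB; rewrite /B /=.
  rewrite -[x](addrK (t *: e)); apply: le_trans (ler_normB _ _) _; apply: lerD => //.
  by rewrite normrZ ger0_norm//; apply: mulr_ile1.
have cs : continuous (fun x : E => f (x + h *: e)) by exact: cont_shift.
have sh0 : \int[leb n]_(x in B) (f (x + h *: e) - f x) = 0.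
  rewrite RintegralB//; [|exact: intB|exact: intB].
  rewrite (toT B (fun x => f (x + h *: e))) => [|x nB]; last by apply: f0; apply: nK => //; exact: ltW.
  rewrite (toT B f) => [|x nB]; last by rewrite -[x]addr0 -(scale0r e); apply: f0; exact: nK.
  by rewrite Rintegral_shift// subrr.
have -> : \int[leb n]_(x in B) partial i f x = \int[leb n]_(x in B) (partial i f x - h^-1 * (f (x + h *: e) - f x)).
  rewrite RintegralB//; [|exact: intB|by apply: intB; apply: contM; [exact: cont_cst|exact: contB]].
  by rewrite RintegralZl//; [rewrite sh0 mulr0 subr0|by apply: intB; exact: contB].
apply: (@le_trans _ _ (\int[leb n]_(x in B) (eps / V))); last first.
  rewrite Rintegral_cst// mulrAC ler_pdivrMr// ler_pM2l// /V lerDl //.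
have cI : continuous (fun x => partial i f x - h^-1 * (f (x + h *: e) - f x)).
  by apply: contB => //; apply: contM; [exact: cont_cst|exact: contB].
apply: le_trans (le_normr_Rintegral _ _) _ => //; first exact: intB.
apply: le_Rintegral => //.
- by apply: intB; exact: cont_norm.
- by apply: intB; exact: cont_cst.
move=> x Bx.
have [c /andP[c0 ch]] := MVT_path h0 (fun t => line_derive x t (class_C_deriv e (sf 1%N)).1).
rewrite scale0r addr0 => ->; rewrite [_ * h]mulrC mulKf ?gt_eqF//; apply: ltW; apply: hd => //.
rewrite opprD addNKr normrN normrZ gtr0_norm//; apply: le_lt_trans (lt_trans ch hd0).
by rewrite ler_piMr// ltW.
Qed.

Lemma partialM (f g : E -> R^o) i x : class_C 1 f -> class_C 1 g ->
  partial i (fun x => f x * g x : R^o) x = f x * partial i g x + g x * partial i f x.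
Proof.
move=> Cf Cg; rewrite /partial deriveM//.
- by have [+ _] := class_C_deriv (delta_mx ord0 i) Cf.
- by have [+ _] := class_C_deriv (delta_mx ord0 i) Cg.
Qed.

Lemma test_functionM (f g : E -> R^o) : smooth f -> test_function Om g -> test_function Om (fun x => f x * g x : R^o).
Proof.
move=> sf [sg [K [cK KO g0]]]; split; first exact: smoothM.
by exists K; split => // x /g0 ->; rewrite mulr0.
Qed.

Lemma test_L2 (f : E -> R^o) : test_function Om f -> L2O f.
Proof. by move=> [sf _]; apply: (cont_L2); exact: smooth_continuous. Qed.

Lemma cont_Linfty (f : E -> R) : continuous f -> Linfty (leb n) Om f.
Proof.
move=> cf; split; first by apply: measurable_funTS; mfun.
have [M [_ hM]] := continuous_bounded_closure cf; exists M; apply: nearW => x /subset_closure; exact: hM.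
Qed.

Lemma H1M (f : E -> R^o) w Dw : smooth f -> H1 Om w Dw ->
  H1 Om (fun x => f x * w x) (fun i x => f x * Dw i x + partial i f x * w x).
Proof.
move=> sf [Lw LD hw]; have cf := smooth_continuous sf.
have cp i : continuous (partial i f) by apply: smooth_continuous; exact: smooth_partial.
have L1 := L2_bM mO (cont_Linfty cf) Lw.
have L3 i := L2_bM mO (cont_Linfty cf) (LD i).
have L4 i := L2_bM mO (cont_Linfty (cp i)) Lw.
split=> // [i|g i tg]; first exact: (L2D mO (L3 i) (L4 i)).
have sg := tg.1; have := hw _ i (test_functionM sf tg).
have Lg := test_L2 tg.
have Lpg : L2O (partial i g) by apply: (cont_L2); apply: smooth_continuous; exact: smooth_partial.
have -> : \int[leb n]_(x in Om) (w x * partial i (fun x => f x * g x : R^o) x) =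
   \int[leb n]_(x in Om) (f x * w x * partial i g x) + \int[leb n]_(x in Om) (partial i f x * w x * g x).
  rewrite -RintegralD//; [|exact: (L2M mO L1 Lpg)|exact: (L2M mO (L4 i) Lg)].
  by apply: eq_Rintegral => x _; rewrite (partialM _ _ (sf 1%N) (sg 1%N)); ring.
have -> : \int[leb n]_(x in Om) (Dw i x * (f x * g x)) = \int[leb n]_(x in Om) (f x * Dw i x * g x).
  by apply: eq_Rintegral => x _; ring.
have -> : \int[leb n]_(x in Om) ((f x * Dw i x + partial i f x * w x) * g x) =
    \int[leb n]_(x in Om) (f x * Dw i x * g x) + \int[leb n]_(x in Om) (partial i f x * w x * g x).
  rewrite -RintegralD//; [|exact: (L2M mO (L3 i) Lg)|exact: (L2M mO (L4 i) Lg)].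
  by apply: eq_Rintegral => x _; ring.
by lra.
Qed.

(** The product rule [H1M] applied to the constant 1, for which the weak formula is
    [test_int_partial]. *)
Lemma smooth_H1 (f : E -> R^o) : smooth f -> H1 Om f (partial^~ f).
Proof.
move=> sf.
have h1 : H1 Om (fun _ => 1) (fun _ _ => 0).
  split; [by apply: (cont_L2); exact: cont_cst|by move=> i; exact: (L2_0 _ mO)|move=> g i tg].
  under eq_Rintegral do rewrite mul1r.
  rewrite test_int_partial//; under eq_Rintegral do rewrite mul0r.
  by rewrite Rintegral_cst// mul0r oppr0.
have := H1M sf h1; congr (H1 Om _ _); first by apply/funext => x; rewrite mulr1.
by apply/funext => i; apply/funext => x; rewrite mulr0 add0r mulr1.
Qed.

Lemma H1_lin c v Dv w Dw : H1 Om v Dv -> H1 Om w Dw -> H1 Om (fun x => c * v x + w x) (fun i x => c * Dv i x + Dw i x).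
Proof.
move=> [Lv LDv hv] [Lw LDw hw]; split=> [|i|g i tg]; [exact: (L2D mO (L2Z mO c Lv) Lw)|exact: (L2D mO (L2Z mO c (LDv i)) (LDw i))|].
have Lg := test_L2 tg.
have Lpg : L2O (partial i g) by apply: (cont_L2); apply: smooth_continuous; exact: (smooth_partial _ tg.1).
have e1 : inner (leb n) Om (fun x => c * v x + w x) (partial i g) = c * inner (leb n) Om v (partial i g) + inner (leb n) Om w (partial i g).
  by rewrite (ipDl mO (L2Z mO c Lv) Lw Lpg) (ipZl mO c Lv Lpg).
have e2 : inner (leb n) Om (fun x => c * Dv i x + Dw i x) g = c * inner (leb n) Om (Dv i) g + inner (leb n) Om (Dw i) g.
  by rewrite (ipDl mO (L2Z mO c (LDv i)) (LDw i) Lg) (ipZl mO c (LDv i) Lg).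
by move: e1 e2; rewrite /inner hv// hw// => -> ->; ring.
Qed.

Lemma H1_closed w Dw : L2H w Dw -> (forall e, 0 < e -> exists w' Dw', H1 Om w' Dw' /\
   h1sq (fun x => w' x - w x) (fun i x => Dw' i x - Dw i x) <= e) -> H1 Om w Dw.
Proof.
move=> [Lw LD] h; split => // g i tg; have Lg := test_L2 tg.
have Lpg : L2O (partial i g) by apply: (cont_L2); apply: smooth_continuous; exact: (smooth_partial _ tg.1).
apply/eqP; rewrite -subr_eq0 opprK -normr_le0; apply/ler_addgt0Pr => e e0; rewrite add0r.
rewrite -[\int[_]_(_ in _) _]/(inner (leb n) Om w (partial i g)) -[X in _ + X]/(inner (leb n) Om (Dw i) g).
pose B := nrm (partial i g) + nrm g + 1.
have B0 : 0 < B by rewrite ltr_wpDl// addr_ge0// sq_ge0.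
have d0 : 0 < e ^+ 2 / (4 * B) by rewrite divr_gt0// mulr_gt0.
have [w' [Dw' [[Lw' LD' hw'] hd]]] := h _ d0.
have n1 : nrm (fun x => w' x - w x) <= e ^+ 2 / (4 * B) by apply: le_trans hd; rewrite lerDl gsq_ge0.
have n2 : nrm (fun x => Dw' i x - Dw i x) <= e ^+ 2 / (4 * B).
  apply: le_trans hd; rewrite /h1sq /gsq (bigD1 i)//= addrCA lerDl addr_ge0 ?sq_ge0// sumr_ge0// => j _; exact: sq_ge0.
have bnd u g' : L2O u -> L2O g' -> nrm u <= e ^+ 2 / (4 * B) -> nrm g' <= B -> `|inner (leb n) Om u g'| <= e / 2.
  move=> Lu Lg' hu hg'; have := ip_sq mO Lu Lg' => /le_trans /(_ (ler_pM (sq_ge0 _ _ _) (sq_ge0 _ _ _) hu hg')).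
  rewrite (_ : e ^+ 2 / (4 * B) * B = (e / 2) ^+ 2); last by field; rewrite gt_eqF.
  by rewrite -(real_normK (num_real (inner _ _ _ _))) ler_sqr ?nnegrE// divr_ge0// ltW.
have k1 : `|inner (leb n) Om (fun x => w' x - w x) (partial i g)| <= e / 2.
  by apply: bnd => //; [exact: (L2B mO)|rewrite /B -addrA lerDl addr_ge0 ?sq_ge0].
have k2 : `|inner (leb n) Om (fun x => Dw' i x - Dw i x) g| <= e / 2.
  by apply: bnd => //; [exact: (L2B mO)|rewrite /B addrAC lerDr addr_ge0 ?sq_ge0].
move: k1 k2; rewrite (ipBl mO Lw' Lw Lpg) (ipBl mO (LD' i) (LD i) Lg).
have : inner (leb n) Om w' (partial i g) = - inner (leb n) Om (Dw' i) g by exact: hw'.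
move: (inner _ _ w' _) (inner _ _ w _) (inner _ _ (Dw' i) _) (inner _ _ (Dw i) _) => a b c d' ->.
by rewrite !ler_norml => /andP[x1 x2] /andP[x3 x4]; lra.
Qed.

(** * Density of smooth functions and existence of traces *)

Definition cone (p : E) (r : R) (e : E) (c s0 : R) : Prop :=
  [/\ 0 < r, 0 < c, 0 < s0 & forall x, Om x -> ball p r x -> forall s z, 0 < s -> s <= s0 ->
    `|z - s *: e| <= c * s -> Om (x + z)].

(** A uniform interior cone condition. At an interior point the direction is 0 and the cone a ball.
    At a boundary point the direction is the vertical of a chart: leaving the axis by [c * s] loses
    at most [K * c * s], which is less than the height [s] gained. *)
Lemma cone_at p : closure Om p -> exists r e c s0, cone p r e c s0.
Proof.
case: dom => n1 o b l hs cp; have [Op|nO] := pselect (Om p).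
  have /nbhs_ballP[r /= r0 hr] : nbhs p Om by exact: open_nbhs_nbhs.
  have r2 : 0 < r / 2 by rewrite divr_gt0.
  exists (r / 2), 0, 1, (r / 2); split => // x Ox px s z s0 sr; rewrite scaler0 subr0 mul1r => zs.
  apply: hr; move: px; rewrite -ball_normE /= opprD addrA => px.
  by apply: le_lt_trans (ler_normB _ _) _; lra.
have bp : bdry Om p by split => //; rewrite ((interior_id Om).1 o).
have [r [h [e [K [C [[r0 K0 hK he hO] _]]]]]] := lipschitz_charts n1 o hs l bp.
have K1 : 0 < K + 1 by rewrite ltr_wpDl.
have c0 : 0 < (K + 1)^-1 by rewrite invr_gt0.
have ec : 0 < `|e| + (K + 1)^-1 by rewrite ltr_wpDl.
exists (r / 2), e, (K + 1)^-1, (r / 2 / (`|e| + (K + 1)^-1)); split; rewrite ?divr_gt0//.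
move=> x Ox px s z s0; rewrite ler_pdivlMr// => ss zs.
have px' : ball p r x by apply: le_ball px; lra.
have hx : 0 < h x by apply/hO.
apply/hO.
  move: px; rewrite -ball_normE /= opprD addrA => px; apply: le_lt_trans (ler_normB _ _) _.
  suff : `|z| <= r / 2 by lra.
  apply: le_trans ss; rewrite -(subrK (s *: e) z) addrC; apply: le_trans (ler_normD _ _) _.
  by rewrite normrZ gtr0_norm// mulrDr lerD2l mulrC.
have := hK (x + s *: e) (x + z); rewrite he opprD addrACA subrr add0r -normrN opprB => h1.
have h2 : K * `|z - s *: e| < s.
  apply: le_lt_trans (ler_wpM2l K0 zs) _; rewrite mulrA -[ltRHS]mul1r ltr_pM2r// ltr_pdivrMr// mul1r.
  by rewrite ltrDl.
by move: (le_lt_trans h1 h2); rewrite ltr_norml => /andP[_]; lra.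
Qed.

Lemma cone_radius : exists rad : E -> R, forall p, closure Om p -> exists e c s0, cone p (rad p) e c s0.
Proof.
exists (fun p => if pselect (closure Om p) is left cp then projT1 (cid (cone_at cp)) else 1) => p cp.
by case: pselect => // cp'; exact: projT2 (cid (cone_at cp')).
Qed.

Lemma cone_kernel (e : E) c s0 m : 0 < c -> 0 < s0 -> 0 < m -> exists s (k : E -> R^o),
  [/\ 0 < s, s <= s0 & forall z, `|z - s *: e| <= c * s -> `|z| <= m] /\
  [/\ smooth k, forall z, 0 <= k z, (\int[leb n]_z (k z)%:E = 1)%E, exists M, forall z, k z <= M &
    forall z, k z != 0 -> `|z - s *: e| <= c * s].
Proof.
move=> c0 s00 m0; have ec : 0 < `|e| + c by rewrite ltr_wpDl.
pose s := Num.min s0 (m / (`|e| + c)); have ss : 0 < s by rewrite lt_min s00 divr_gt0.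
have [k hk] := kernel_exists (s *: e) (mulr_gt0 c0 ss); exists s, k; split=> //; split=> //; first by rewrite ge_min lexx.
move=> z h; have sm : s * (`|e| + c) <= m by rewrite -ler_pdivlMr// ge_min lexx orbT.
apply: le_trans sm; rewrite -(subrK (s *: e) z) addrC; apply: le_trans (ler_normD _ _) _.
by rewrite normrZ gtr0_norm// mulrDr lerD2l mulrC.
Qed.

Lemma partial_shift (k : E -> R^o) (x : E) i y : partial i (fun y => k (y - x) : R^o) y = partial i k (y - x).
Proof.
have h : (fun h : R => h^-1 *: (((fun y => k (y - x) : R^o) \o shift y) (h *: (delta_mx ord0 i : E)) - k (y - x))) =
  (fun h => h^-1 *: ((k \o shift (y - x)) (h *: (delta_mx ord0 i : E)) - k (y - x))).
  by apply/funext => h /=; rewrite addrA.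
by rewrite /partial /derive h.
Qed.

Lemma smooth_shift (k : E -> R^o) (x : E) : smooth k -> smooth (fun y => k (y - x) : R^o).
Proof.
move=> sk m; apply: (@class_C_affine _ _ _ _ _ (fun y : E => y - x) id) => //.
  by move=> y; exact: (cvgB cvg_id (cvg_cst x)).
by move=> h v y; rewrite addrA.
Qed.

Definition approximable (w : E -> R) (Dw : 'I_n -> E -> R) := forall e, 0 < e ->
  exists f : E -> R^o, smooth f /\ h1sq (fun x => f x - w x) (fun i x => partial i f x - Dw i x) <= e.

Lemma restrict_L2 w : L2O w -> L2 (leb n) setT (w \_ Om).
Proof.
move=> Lw; apply: L2_lty; first by apply/(measurable_restrictT _ mO); mfun.
have -> : (\int[leb n]_x ((w \_ Om) x ^+ 2)%:E = \int[leb n]_(x in Om) (w x ^+ 2)%:E)%E.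
  rewrite [RHS]integral_mkcond; apply: eq_integral => x _; rewrite !patchE; case: ifP => // _.
  by rewrite expr0n.
by rewrite (esq mO Lw) ltry.
Qed.

(** Mollify with a kernel supported in the cone. For [x] in the ball the translated kernel is a test
    function on [Om], so derivatives fall on [w]. For the other [x] in [Om] the kernel only sees
    points at distance at least [rho] from [p], where [w] and [Dw] vanish. Hence the commutation
    with derivatives holds on all of [Om]. *)
Lemma local_approx p r e c s0 rho w Dw : cone p r e c s0 -> rho < r -> H1 Om w Dw ->
  (forall x, Om x -> rho <= `|p - x| -> w x = 0 /\ forall i, Dw i x = 0) -> approximable w Dw.
Proof.
move=> [r0 c0 s00 hc] rr hw supp eps eps0; have [Lw LD ibp] := hw.
pose F (j : option 'I_n) : E -> R := if j is Some i then Dw i \_ Om else w \_ Om.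
have LF j : L2 (leb n) setT (F j) by case: j => [i|]; exact: restrict_L2.
(* One share of [eps] for the function and one for each partial derivative. *)
pose eta := eps / n.+1%:R.
have eta0 : 0 < eta by rewrite divr_gt0.
have [d d0 hd] := translation_small LF eta0.
pose m := Num.min d (r - rho).
have m0 : 0 < m by rewrite lt_min d0 subr_gt0.
have [s [k [[ss sle kz] [sk k0 k1 [Mk kM] ksupp]]]] := cone_kernel e c0 s00 m0.
have mk : measurable_fun setT k by apply: continuous_measurable_rV; exact: smooth_continuous.
pose S := [set z : E | `|z - s *: e| <= c * s].
have cS : closed S by apply: compact_closed; [exact: norm_hausdorff|exact: compact_ball_rV].
have kS z : ~ S z -> k z = 0 by move=> nS; apply/eqP/negPn/negP => /ksupp.
have [M [M0 hM]] := closure_bound.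
have OM x : Om x -> `|x| <= M by move/subset_closure; exact: hM.
have fO := Om_fin.
have sc (u : E -> R) : L2O u -> smooth (mollify Om u k : E -> R^o) by move=> Lu; exact: (mollify_smooth mO fO OM Lu sk).
have jen u : L2O u -> (forall z, `|z| <= d -> sqnorm (leb n) setT (fun x => (u \_ Om) (x + z) - (u \_ Om) x) <= eta) ->
    nrm (fun x => mollify Om u k x - u x) <= eta.
  move=> Lu hu; have LU := restrict_L2 Lu.
  have cc := smooth_continuous (sc u Lu).
  have Lc : L2O (fun x => mollify Om u k x - u x) by apply: (L2B mO _ Lu); exact: (cont_L2 cc).
  rewrite -lee_fin -(esq mO Lc).
  have := jensen mk k0 k1 kM LU mO (eta := eta).
  have cE x : \int[leb n]_z (k z * (u \_ Om) (x + z)) = mollify Om u k x by rewrite -(mollify_shift mO Lu).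
  under [X in measurable_fun _ X -> _]eq_fun do rewrite cE.
  under [X in _ -> _ -> _ -> (X <= _)%E]eq_integral do rewrite cE.
  move=> /(_ _ _ _) j; apply: le_trans (j _ _ (ltW eta0)).
  - apply: eqW; apply: eq_integral => x xO; by rewrite patchE xO.
  - mfun.
  move=> z kz0; have zd : `|z| <= d by apply: le_trans (kz _ (ksupp _ kz0)) _; rewrite ge_min lexx.
  have Lz : L2 (leb n) setT (fun x => (u \_ Om) (x + z) - (u \_ Om) x).
    have pz : preserves (leb n) (fun x => x + z) by split; [exact: measurable_shift|exact: leb_int_shift].
    exact: (L2B measurableT (preserves_L2 pz LU).1 LU).
  apply: le_trans (_ : _ <= \int[leb n]_x (((u \_ Om) (x + z) - (u \_ Om) x) ^+ 2)%:E)%E _; last by rewrite (esq measurableT Lz) lee_fin hu.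
  apply: ge0_subset_integral => //; last by move=> x _; rewrite lee_fin sqr_ge0.
  mfun.
have pE i x : Om x -> partial i (mollify Om w k : E -> R^o) x = mollify Om (Dw i) k x.
  move=> Ox; rewrite (mollify_partial mO fO OM Lw i x sk) /mollify.
  have [px|px] := pselect (ball p r x).
    have tk : test_function Om (fun y => k (y - x) : R^o).
      split; first exact: smooth_shift.
      exists [set y | `|y - (x + s *: e)| <= c * s]; split.
      - exact: compact_ball_rV.
      - move=> y /= hy; rewrite -(subrK x y) addrC; apply: (hc x Ox px s) => //.
        by rewrite -addrA -opprD.
      - by move=> y nS; apply: kS => hS; move: hS; rewrite /S /= -addrA -opprD.
    have -> : \int[leb n]_(y in Om) (w y * (-1 * partial i k (y - x))) =
        -1 * \int[leb n]_(y in Om) (w y * partial i (fun y => k (y - x) : R^o) y).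
      have Lt : L2O (partial i (fun y => k (y - x) : R^o)).
        by apply: (cont_L2); apply: smooth_continuous; exact: (smooth_partial _ tk.1).
      rewrite -[RHS](RintegralZl (-1) mO (L2M mO Lw Lt)); apply: eq_Rintegral => y _.
      by rewrite partial_shift mulN1r mulrN mulN1r.
    by rewrite (ibp _ i tk) mulN1r opprK.
  have z0 (u : E -> R) (g : E -> R) : (forall y, Om y -> rho <= `|p - y| -> u y = 0) -> (forall z, ~ S z -> g z = 0) ->
      \int[leb n]_(y in Om) (u y * g (y - x)) = 0.
    move=> u0 g0; transitivity (\int[leb n]_(y in Om) (0 : R)); last by rewrite Rintegral_cst// mul0r.
    apply: eq_Rintegral => y /set_mem Oy.
    have [Sy|nS] := pselect (S (y - x)); last by rewrite g0// mulr0.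
    rewrite u0 ?mul0r//; have := kz _ Sy => yx.
    have : r <= `|p - x| by rewrite leNgt; apply/negP => h; apply: px; rewrite -ball_normE.
    have -> : p - x = (p - y) + (y - x) by rewrite addrA subrK.
    move=> /le_trans /(_ (ler_normD _ _)); have : m <= r - rho by rewrite ge_min lexx orbT.
    lra.
  rewrite (z0 (Dw i) k)//; last by move=> y Oy /(supp y Oy)[].
  apply: (z0 w (fun z => -1 * partial i k z)) => [y Oy /(supp y Oy)[]//|z nS].
  by rewrite (partial_out _ cS kS nS) mulr0.
exists (mollify Om w k); split; first exact: sc.
rewrite /h1sq; have -> : eps = eta + \sum_(i < n) eta.
  by rewrite sumr_const card_ord -mulrS -mulr_natr divfK.
apply: lerD; first by apply: jen => // z zd; have := hd z zd None.
apply: ler_sum => i _; rewrite (@eq_sq _ _ _ _ _ _ (fun x => mollify Om (Dw i) k x - Dw i x)); last by move=> x Ox; rewrite pE.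
by apply: jen => // z zd; have := hd z zd (Some i).
Qed.

(** A partition of unity peeled off one ball at a time. The induction on the cover concerns
    functions that vanish outside the remaining balls: each step splits [w] into [X * w], treated by
    [local_approx], and [(1 - X) * w], which vanishes on the ball removed. *)
Lemma H1_density w Dw : H1 Om w Dw -> approximable w Dw.
Proof.
have cK := closure_compact.
have [rad radP] := cone_radius.
have rad0 p : closure Om p -> 0 < rad p / 4 by move=> /radP[e [c [s0 [r0 _ _ _]]]]; rewrite divr_gt0.
have [s [sc scov]] := finite_ball_cover cK rad0.
have {scov} : forall x, Om x -> (forall p, p \in s -> ~ ball p (rad p / 4) x) -> w x = 0 /\ forall i, Dw i x = 0.
  by move=> x /subset_closure /scov[p ps px] /(_ p ps).
elim: s sc w Dw => [|p s ih] sc w Dw supp hw.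
  move=> e e0; exists (fun _ => 0); split; first exact: smooth_cst.
  have z i x : partial i (fun _ : E => 0 : R^o) x = 0 by rewrite /partial derive_cst.
  rewrite (_ : h1sq _ _ = 0) ?ltW// /h1sq /gsq (@eq_sq _ _ _ _ _ _ (fun x => 0 - 0)) ?(sq_subrr _ (fun _ => 0) mO).
    rewrite add0r big1// => i _; rewrite (@eq_sq _ _ _ _ _ _ (fun x => 0 - 0)) ?(sq_subrr _ (fun _ => 0) mO)// => x Ox.
    by rewrite z (supp x Ox _).2.
  by move=> x Ox; rewrite (supp x Ox _).1.
have cp : closure Om p by apply: sc; rewrite inE eqxx.
have [e [c [s0 hc]]] := radP p cp; have [r0 _ _ _] := hc.
pose X := plateau p (rad p / 4).
have sX : smooth X by exact: smooth_plateau.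
have sY : smooth (fun x => 1 - X x : R^o) by apply: smoothB => //; exact: smooth_cst.
have r4 : 0 < rad p / 4 by rewrite divr_gt0.
have X0 x : rad p / 2 < `|p - x| -> X x = 0.
  move=> h; apply: plateau0 => //; apply: contrapT => no; move: h; rewrite ltNge; apply/negP/negPn.
  have r2 : 0 <= rad p / 2 by rewrite divr_ge0// ltW.
  apply/(rV_normP _ r2) => i; rewrite !mxE leNgt; apply/negP => h; apply: no; exists i.
  by rewrite distrC; lra.
have X1 x : ball p (rad p / 4) x -> X x = 1.
  rewrite -ball_normE /= => /ltW /(rV_normP _ (ltW r4)) h; apply: plateau1 => // i.
  by have := h i; rewrite !mxE distrC.
have hX := H1M sX hw; have hY := H1M sY hw.
have aX : approximable (fun x => X x * w x) (fun i x => X x * Dw i x + partial i X x * w x).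
  (* The cutoff and its derivatives vanish beyond [rad p / 2], so this radius keeps a margin on both
     sides. *)
  apply: (local_approx (rho := 3 * rad p / 4) hc _ hX); first by lra.
  move=> x Ox xp; have Xx : X x = 0 by apply: X0; lra.
  rewrite Xx mul0r; split => // i; rewrite mul0r add0r (@partial_out X [set y | `|y - p| <= rad p / 2]) ?mul0r//.
  - by apply: compact_closed; [exact: norm_hausdorff|exact: compact_ball_rV].
  - by move=> y /= /negP; rewrite -ltNge distrC; exact: X0.
  - by move=> /=; rewrite distrC => h; lra.
have aY : approximable (fun x => (1 - X x) * w x) (fun i x => (1 - X x) * Dw i x + partial i (fun x => 1 - X x : R^o) x * w x).
  apply: ih hY => [q qs|x Ox nb]; first by apply: sc; rewrite inE qs orbT.
  have [px|px] := pselect (ball p (rad p / 4) x).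
    rewrite X1// subrr mul0r; split => // i; rewrite mul0r add0r.
    rewrite (@partial_out (fun x => 1 - X x : R^o) (~` ball p (rad p / 4))) ?mul0r//.
    - by apply: open_closedC; exact: open_ball_rV.
    - by move=> y /contrapT /X1 ->; rewrite subrr.
  have nq q : q \in p :: s -> ~ ball q (rad q / 4) x by rewrite inE => /orP[/eqP ->//|]; exact: nb.
  by have [-> wD] := supp x Ox nq; rewrite !mulr0; split => // i; rewrite wD !mulr0 addr0.
move=> eps eps0; have e4 : 0 < eps / 4 by rewrite divr_gt0.
have [f [sf hf]] := aX _ e4; have [g [sg hg]] := aY _ e4.
exists (fun x => f x + g x); split; first exact: smoothD.
have Lf := smooth_L2H sf; have Lg := smooth_L2H sg.
have := h1sqD_le (L2HB Lf (H1_L2H hX)) (L2HB Lg (H1_L2H hY)).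
have pD (a b : E -> R^o) i x : smooth a -> smooth b -> partial i (fun x => a x + b x : R^o) x = partial i a x + partial i b x.
  move=> sa sb; rewrite /partial deriveD//.
  - by have [+ _] := class_C_deriv (delta_mx ord0 i) (sa 1%N).
  - by have [+ _] := class_C_deriv (delta_mx ord0 i) (sb 1%N).
have XY i x : partial i X x + partial i (fun x => 1 - X x : R^o) x = 0.
  rewrite -pD// (_ : (fun x => _) = (fun=> 1)); first by rewrite /partial derive_cst.
  by apply/funext => y; rewrite addrC subrK.
have -> : h1sq (fun x => f x - X x * w x + (g x - (1 - X x) * w x))
    (fun i x => partial i f x - (X x * Dw i x + partial i X x * w x) +
      (partial i g x - ((1 - X x) * Dw i x + partial i (fun x => 1 - X x : R^o) x * w x))) =
    h1sq (fun x => f x + g x - w x) (fun i x => partial i (fun x => f x + g x : R^o) x - Dw i x).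
  rewrite /h1sq /gsq; congr (_ + _); first by apply: eq_sq => x _; ring.
  apply: eq_bigr => i _; apply: eq_sq => x _; rewrite pD//.
  have -> : partial i (fun x => 1 - X x : R^o) x = - partial i X x by apply/eqP; rewrite -addr_eq0 addrC XY.
  by ring.
by move=> h; exact: (le_2D h hf hg).
Qed.

Lemma trace_exists w Dw : H1 Om w Dw -> exists tw, trace_of Om sigma w Dw tw.
Proof.
move=> hw; have Lw := H1_L2H hw; have [c c0 hc] := trace_eps.
(* With this constant, [trace_eps] turns approximation errors [8^-1 ^+ k / B] into boundary
   increments of at most [8^-1 ^+ k], the rate required by [L2_complete]. *)
pose B : R := 4 * c * (1 + n%:R) + 1.
have B0 : 0 < B by apply: ltr_wpDl => //; apply: mulr_ge0; [exact: mulr_ge0|exact: addr_ge0].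
have q0 k : 0 < (8^-1 : R) ^+ k by [].
have /choice[f hf] : forall k, exists f : E -> R^o, smooth f /\ h1sq (fun x => f x - w x) (fun i x => partial i f x - Dw i x) <= 8^-1 ^+ k / B.
  by move=> k; apply: H1_density => //; rewrite divr_gt0.
have Lf k := smooth_L2H (hf k).1.
have LfS k : L2S (f k) by apply: (cont_L2S); exact: smooth_continuous (hf k).1.
have fast k : bsq (fun x => f k.+1 x - f k x) <= 8^-1 ^+ k.
  have ht := trace_lin (-1) (Lf k) (Lf k.+1) (trace_smooth (hf k).1) (trace_smooth (hf k.+1).1).
  have Ld := L2HD (L2HZ (-1) (Lf k)) (Lf k.+1).
  rewrite (@eq_sq _ _ _ _ _ _ (fun x => -1 * f k x + f k.+1 x)) => [|x _]; last by ring.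
  apply: le_trans (hc 1 _ _ _ ltr01 Ld ht) _; rewrite invr1 mul1r mulr1.
  have h1 := h1sq_triangle (Lf k.+1) Lw (Lf k); rewrite [in X in _ + 2 * X]h1sqBC in h1.
  have hk1 : (8^-1 : R) ^+ k.+1 / B <= 8^-1 ^+ k / B.
    by rewrite ler_pM2r ?invr_gt0// exprS ler_piMl ?(ltW (q0 k))// invf_le1// ler1n.
  have h2 : h1sq (fun x => -1 * f k x + f k.+1 x) (fun i x => -1 * partial i (f k) x + partial i (f k.+1) x) <= 4 * (8^-1 ^+ k / B).
    have -> : h1sq (fun x => -1 * f k x + f k.+1 x) (fun i x => -1 * partial i (f k) x + partial i (f k.+1) x) =
      h1sq (fun x => f k.+1 x - f k x) (fun i x => partial i (f k.+1) x - partial i (f k) x).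
      rewrite /h1sq /gsq; congr (_ + _); first by apply: eq_sq => x _; ring.
      by apply: eq_bigr => i _; apply: eq_sq => x _; ring.
    apply: (le_2D h1); rewrite mulrC mulKf//; [exact: le_trans (hf k.+1).2 hk1|exact: (hf k).2].
  apply: (@le_trans _ _ (c * ((1 + n%:R) * (4 * (8^-1 ^+ k / B))))).
    rewrite ler_wpM2l//; apply: le_trans (ler_wpM2l _ h2); last exact: addr_ge0.
    by rewrite mulrDr lerD2l ler_peMl ?gsq_ge0// lerDl.
  rewrite (_ : c * _ = 8^-1 ^+ k * ((4 * c * (1 + n%:R)) / B)); last by ring.
  by rewrite ler_piMr ?(ltW (q0 k))// ler_pdivrMr// mul1r /B lerDl.
have [t [Lt _ ht _]] := L2_complete mB LfS fast.
exists t; apply/(trace_ofP); split => // e e0.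
have e1 : 0 < Num.min e (e * B) / 4 by rewrite divr_gt0// lt_min e0 mulr_gt0.
have q1 : `|8^-1 : R| < 1 by rewrite ger0_norm// invf_lt1// ltr1n.
have [N hN] := near_cvg0_lt e1 (cvg_geo 1 q1).
have := hN _ (leqnn N); rewrite mul1r ger0_norm ?(ltW (q0 N))// => h1.
have m1 : Num.min e (e * B) <= e by rewrite ge_min lexx.
have m2 : Num.min e (e * B) <= e * B by rewrite ge_min lexx orbT.
exists (f N); split; first exact: (hf N).1.
  apply: le_trans (hf N).2 _; rewrite ler_pdivrMr//; lra.
by apply: le_trans (ht N) _; lra.
Qed.

(** * The Ehrling inequality *)

Lemma increment_sq (w : E -> R^o) x z : smooth w ->
  (((w (x + z) - w x) ^+ 2)%:E <= \int[lam]_(t in `[0%R, 1%R]) (n%:R * `|z| ^+ 2 * \sum_i partial i w (x + t *: z) ^+ 2)%:E)%E.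
Proof.
move=> sw; have cw := smooth_continuous sw.
have cz : continuous ('D_z w) by apply: smooth_continuous; exact: smooth_deriv.
have cp i : continuous (partial i w) by apply: smooth_continuous; exact: smooth_partial.
have mI : measurable (`[(0 : R), 1]%classic : set RR) by [].
have I1 : fine (lam `[(0 : R), 1]) = 1 by rewrite /= lebesgue_measure_itv/= lte_fin ltr01 -EFinB subr0.
have cont_itv (f : R -> R) : continuous f -> {within `[0, 1], continuous f} by exact: continuous_subspaceT.
have int_itv (f : R -> R) : continuous f -> lam.-integrable `[0, 1] (fun t => (f t)%:E).
  by move=> cf; apply: continuous_compact_integrable; [exact: segment_compact|exact: cont_itv].
have L2_itv (f : R -> R) : continuous f -> L2 lam (`[0, 1]%classic : set RR) f.
  move=> cf; apply: L2_intble; first by apply: measurable_funTS; mfun.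
  by apply: (int_itv (fun t => f t ^+ 2)); exact: contM.
have cf : continuous (fun t : R => 'D_z w (x + t *: z)) by exact: (@line_cont _ _ ('D_z w)).
have hF := FTC_path (ler01 : 0 <= 1 :> R) (fun t => line_derive x t (class_C_deriv z (sw 1%N)).1) cf.
rewrite scale1r scale0r addr0 in hF.
have LD := L2_itv _ cf.
have L1 : L2 lam (`[0, 1]%classic : set RR) (fun _ => 1) by apply: L2_itv; exact: cont_cst.
apply: (@le_trans _ _ (sqnorm lam (`[0, 1]%classic : set RR) (fun t => 'D_z w (x + t *: z)))%:E).
  rewrite lee_fin hF; have := ip_sq mI LD L1.
  rewrite [sqnorm _ _ (fun=> 1)](_ : _ = 1) ?mulr1; last by rewrite /sqnorm Rintegral_cst// I1 expr1n mul1r.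
  by apply: le_trans; under [X in _ <= X ^+ 2]eq_Rintegral do rewrite mulr1.
rewrite -(esq mI LD); apply: ge0_le_integral => //.
- by move=> t _; rewrite lee_fin sqr_ge0.
- mfun.
- apply/measurable_EFinP; apply: measurable_funTS; apply: continuous_measurable_fun.
  have cS : continuous (fun y => n%:R * `|z| ^+ 2 * \sum_i partial i w y ^+ 2).
    apply: contM; first exact: cont_cst.
    by apply: cont_sum => i; exact: (contM (cp i) (cp i)).
  exact: (@line_cont _ _ (fun y => n%:R * `|z| ^+ 2 * \sum_i partial i w y ^+ 2) x z cS).
move=> t _; rewrite lee_fin (derive_coord _ _ (sw 1%N)).
apply: (@le_trans _ _ ((\sum_i `|z| * `|partial i w (x + t *: z)|) ^+ 2)).
  rewrite -[leLHS]real_normK ?num_real// ler_sqr ?nnegrE ?sumr_ge0//.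
  apply: le_trans (ler_norm_sum _ _ _) _; apply: ler_sum => i _; rewrite normrM ler_wpM2r//.
  by have /(rV_normP _ (normr_ge0 z)) := lexx `|z|.
rewrite -mulr_sumr exprMn [leRHS](_ : _ = `|z| ^+ 2 * ((\sum_i partial i w (x + t *: z) ^+ 2) * n%:R)); last by ring.
rewrite ler_wpM2l//.
have cs (u : 'I_n -> R) : (\sum_i u i) ^+ 2 <= (\sum_i u i ^+ 2) * n%:R.
  have h0 : 0 <= \sum_i \sum_j (u i - u j) ^+ 2 by apply: sumr_ge0 => i _; apply: sumr_ge0 => j _; exact: sqr_ge0.
  have e1 : \sum_i \sum_j (u i - u j) ^+ 2 = 2 * ((\sum_i u i ^+ 2) * n%:R) - 2 * (\sum_i u i) ^+ 2.
    have -> : \sum_i \sum_j (u i - u j) ^+ 2 = \sum_i \sum_j (u i ^+ 2 + u j ^+ 2 - 2 * u i * u j).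
      by apply: eq_bigr => i _; apply: eq_bigr => j _; ring.
    under eq_bigr do rewrite sumrB big_split/= sumr_const card_ord -mulr_sumr.
    rewrite sumrB big_split/= sumr_const card_ord -!mulr_suml -mulr_sumr expr2 -sumrMnl.
    under eq_bigr do rewrite -mulr_natr.
    by rewrite -mulr_suml; ring.
  by lra.
apply: le_trans (cs _) _; rewrite ler_wpM2r//; apply: ler_sum => i _.
by rewrite real_normK ?num_real.
Qed.

Definition smoothfun := {f : E -> R^o | smooth f}.

(** [Om] need not be convex, but the cone condition is stable under scaling [z] and [s] by the same
    factor, so the whole segment from [x] to [x + z] stays in [Om] and the increment is an integral
    of the gradient. *)
Lemma local_increment p r e c s0 (w : E -> R^o) s z : cone p r e c s0 -> smooth w -> 0 < s -> s <= s0 ->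
  `|z - s *: e| <= c * s ->
  (\int[leb n]_(x in Om `&` ball p r) (((w \_ Om) (x + z) - (w \_ Om) x) ^+ 2)%:E <= (n%:R * `|z| ^+ 2 * gsq (partial^~ w))%:E)%E.
Proof.
move=> [r0 c0 s00 hc] sw ss sle zs; have [Lw Lp] := smooth_L2H sw.
have mP : measurable (Om `&` ball p r) by apply: measurableI => //; apply: open_measurable_rV; exact: open_ball_rV.
have mI : measurable (`[(0 : R), 1]%classic : set RR) by [].
have zO x t : Om x -> ball p r x -> 0 <= t <= 1 -> Om (x + t *: z).
  move=> Ox px /andP[]; rewrite le_eqVlt => /predU1P[<- _|t0 t1]; first by rewrite scale0r addr0.
  apply: (hc x Ox px (t * s)); first exact: mulr_gt0.
    by apply: le_trans sle; rewrite ler_piMl// ltW.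
  by rewrite -scalerA -scalerBr normrZ gtr0_norm// mulrCA ler_wpM2l// ltW.
pose c1 := n%:R * `|z| ^+ 2.
have c10 : 0 <= c1 by rewrite mulr_ge0//.
pose G : E -> R := (fun x => \sum_i partial i w x ^+ 2) \_ Om.
have G0 x : 0 <= G x by rewrite /G patchE; case: ifP => // _; apply: sumr_ge0 => i _; exact: sqr_ge0.
have mG : measurable_fun setT G.
  by apply/(measurable_restrictT _ mO); apply: measurable_sum => i; apply: measurable_funX; exact: (L2_meas (Lp i)).
pose Th (q : E * RR) : \bar R := (c1 * G (q.1 + q.2 *: z))%:E.
have mTh : measurable_fun ((Om `&` ball p r) `*` (`[0, 1]%classic : set RR)) Th.
  apply: measurable_funTS; apply/measurable_EFinP; apply: measurable_funM; first mfun.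
  exact: (measurableT_comp mG (measurable_move z)).
have Th0 q : (0 <= Th q)%E by rewrite lee_fin mulr_ge0.
have sf := leb_sigma_finite (R := R) n.
apply: (@le_trans _ _ (\int[leb n]_(x in Om `&` ball p r) \int[lam]_(t in `[0%R, 1%R]) Th (x, t))%E).
  apply: ge0_le_integral => //.
  - by move=> x _; rewrite lee_fin sqr_ge0.
  - have mW : measurable_fun setT (w \_ Om) by apply/(measurable_restrictT _ mO); mfun.
    apply/measurable_EFinP; apply: measurable_funTS; apply: measurable_funX; apply: measurable_funB => //.
    exact: (measurableT_comp mW (measurable_shift z)).
  - exact: (tonelli_measurable_x lam mP mI).
  move=> x [Ox px]; have xz : Om (x + z) by rewrite -[z]scale1r; apply: zO => //; rewrite ler01 lexx.
  rewrite !patchE (mem_set xz) (mem_set Ox).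
  apply: le_trans (increment_sq x z sw) _; apply: eqW.
  apply: eq_integral => t /set_mem /=; rewrite in_itv/= => tt.
  by rewrite /Th /= /G patchE mem_set//; exact: zO.
rewrite -(tonelli_x lam sf)// (tonelli_y lam sf)//.
apply: (@le_trans _ _ (\int[lam]_(t in `[0%R, 1%R]) (c1 * gsq (partial^~ w))%:E)%E); last first.
  by rewrite integral_cst//= lebesgue_measure_itv/= lte_fin ltr01 -EFinB subr0 mule1.
apply: ge0_le_integral => //.
- by move=> t _; exact: integral_ge0.
- exact: (tonelli_measurable_y sf mP mI).
move=> t _; rewrite /Th /= EFinM -(esq_sum Lp).
under eq_integral do rewrite EFinM.
have mGt : measurable_fun setT (fun x : E => (G (x + t *: z))%:E).
  by apply/measurable_EFinP; exact: (measurableT_comp mG (measurable_shift (t *: z))).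
rewrite ge0_integralZl_EFin//; last 2 first.
- by move=> x _; rewrite lee_fin.
- mfun.
apply: lee_wpmul2l; first by rewrite lee_fin.
apply: (@le_trans _ _ (\int[leb n]_x (G (x + t *: z))%:E)%E).
  by apply: ge0_subset_integral => // x _; rewrite lee_fin.
rewrite (leb_int_shift (t *: z) (f := fun x => (G x)%:E)); last 2 first.
- mfun.
- by [].
rewrite [leRHS]integral_mkcond; apply: eqW; apply: eq_integral => x _.
by rewrite /G !patchE; case: ifP.
Qed.

(** Compare [w] with its mollification [J]; by [local_increment] the error is small with [m]. The
    values of [J] are pairings of [w] with translates of one kernel, and finitely many of these
    approximate all others uniformly on [Om]: they are the functionals. *)
Lemma local_ehrling p r e c s0 eps : cone p r e c s0 -> 0 < eps ->
  exists (S : seq smoothfun) (C : R), 0 <= C /\ forall w : E -> R^o, smooth w ->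
    sqnorm (leb n) (Om `&` ball p r) w <= eps * h1sq w (partial^~ w) + C * \sum_(f <- S) inner (leb n) Om w (sval f) ^+ 2.
Proof.
move=> hc eps0; have [r0 c0 s00 _] := hc.
(* [m] and, below, [om] are tuned so that the mollification error and the replacement of translates
   by those of the net cost at most [eps / 2] each. *)
pose m := Num.min 1 (eps / (4 * n.+1%:R)).
have m0 : 0 < m by rewrite lt_min ltr01// mulr_gt0.
have m2 : 2 * (n%:R * m ^+ 2) <= eps / 2.
  have m1 : m <= 1 by rewrite ge_min lexx.
  have me : m <= eps / (4 * n.+1%:R) by rewrite ge_min lexx orbT.
  have : n%:R * m ^+ 2 <= n.+1%:R * (eps / (4 * n.+1%:R)).
    apply: ler_pM; rewrite ?sqr_ge0// ?ler_nat//; apply: le_trans me.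
    by rewrite ler_piMl// ltW.
  have -> : n.+1%:R * (eps / (4 * n.+1%:R)) = eps / 4.
    have : n.+1%:R != 0 :> R by [].
    by move: (n.+1%:R : R) => N N0; field.
  by lra.
have [s [k [[ss sle kz] [sk k0 k1 [Mk kM] ksupp]]]] := cone_kernel e c0 s00 m0.
have ck := smooth_continuous sk.
have mk : measurable_fun setT k by mfun.
have [M [M0 hM]] := closure_bound.
have OM x : Om x -> `|x| <= M by move/subset_closure; exact: hM.
pose V := fine (leb n Om) + 1.
have V1 : 0 < V by rewrite ltr_wpDl//.
have fV : (leb n Om <= V%:E)%E by rewrite -[leLHS]fineK ?ge0_fin_numE// ?(Om_fin)// lee_fin lerDl.
pose om := Num.min 1 (eps / (8 * V ^+ 2)).
have om0 : 0 < om by rewrite lt_min ltr01 divr_gt0// mulr_gt0// exprn_gt0.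
have om2 : 4 * V * (om ^+ 2 * V) <= eps / 2.
  have o1 : om <= 1 by rewrite ge_min lexx.
  have oe : om <= eps / (8 * V ^+ 2) by rewrite ge_min lexx orbT.
  have oo : om ^+ 2 <= eps / (8 * V ^+ 2) by apply: le_trans oe; rewrite ler_piMl// ltW.
  have := ler_wpM2l (_ : 0 <= 4 * V * V) oo; rewrite !mulr_ge0 ?(ltW V1)// => /(_ isT).
  have -> : 4 * V * V * (eps / (8 * V ^+ 2)) = eps / 2 by field; rewrite gt_eqF.
  by rewrite [4 * V * (_ * V)](_ : _ = 4 * V * V * om ^+ 2)//; ring.
have [d d0 hd] := uniformly_continuous_on (@compact_ball_rV R n 0 (M + M)) ck om0.
have cK := closure_compact.
have [T [Tc Tcov]] := finite_ball_cover cK (fun p (_ : closure Om p) => d0).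
pose eta x : smoothfun := exist _ (fun y => k (y - x) : R^o) (smooth_shift x sk).
exists [seq eta x | x <- T], (4 * V); split; first by rewrite mulr_ge0// ltW.
move=> w sw; have Lw2 := smooth_L2H sw; have [Lw Lp] := Lw2; have cw := smooth_continuous sw.
pose P := Om `&` ball p r.
have mP : measurable P by apply: measurableI => //; apply: open_measurable_rV; exact: open_ball_rV.
have PO : P `<=` Om by exact: subIsetl.
have LP f : L2O f -> L2 (leb n) P f.
  move=> Lf; split; first by apply: measurable_funS (L2_meas Lf).
  exact: (integrableS mO mP PO Lf.2).
pose J := mollify Om w k.
have cJ : continuous J by exact: (mollify_continuous mO (Om_fin) OM Lw ck).
have LJ : L2O J by exact: (cont_L2 cJ).
set B := \sum_(f <- _) _.
have B0 : 0 <= B by apply: sumr_ge0 => f _; exact: sqr_ge0.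
have h1 : sqnorm (leb n) P (fun x => J x - w x) <= n%:R * m ^+ 2 * gsq (partial^~ w).
  rewrite -lee_fin -(esq mP (LP _ (L2B mO LJ Lw))).
  have LU := restrict_L2 Lw.
  have cE x : \int[leb n]_z (k z * (w \_ Om) (x + z)) = J x by rewrite -(mollify_shift mO Lw).
  have := @jensen _ _ k (w \_ Om) P (n%:R * m ^+ 2 * gsq (partial^~ w)) Mk mk k0 k1 kM LU mP.
  under [X in measurable_fun _ X -> _]eq_fun do rewrite cE.
  under [X in _ -> _ -> _ -> (X <= _)%E]eq_integral do rewrite cE.
  move=> j; apply: le_trans (j _ _ _).
  - apply: eqW; apply: eq_integral => x /set_mem[Ox _].
    by rewrite patchE mem_set.
  - mfun.
  - move=> z kz0; apply: le_trans (local_increment hc sw ss sle (ksupp z kz0)) _.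
    rewrite lee_fin ler_wpM2r ?gsq_ge0// ler_wpM2l// ler_sqr ?nnegrE ?(ltW m0)//.
    exact: kz _ (ksupp z kz0).
  - by apply: mulr_ge0; [apply: mulr_ge0; [exact: ler0n|exact: sqr_ge0]|exact: gsq_ge0].
have h2 x : Om x -> J x ^+ 2 <= 2 * (nrm w * (om ^+ 2 * V)) + 2 * B.
  move=> Ox; have [q qT qx] := Tcov _ (subset_closure Ox).
  have cks y : continuous (fun z : E => k (z - y)) by exact: cont_shift.
  have L1 y : L2O (fun z => k (z - y)) by exact: (cont_L2 (cks y)).
  have e1 : J x = inner (leb n) Om w (sval (eta q)) + inner (leb n) Om w (fun y => k (y - x) - k (y - q)).
    by rewrite (ipBr mO (L1 x) (L1 q) Lw) addrC subrK.
  have n1 : nrm (fun y => k (y - x) - k (y - q)) <= om ^+ 2 * V.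
    have Ld := L2B mO (L1 x) (L1 q); rewrite -lee_fin -(esq mO Ld) EFinM.
    apply: (@le_trans _ _ (\int[leb n]_(y in Om) (om ^+ 2)%:E)%E); last by rewrite integral_cst//; apply: lee_wpmul2l; rewrite ?lee_fin ?sqr_ge0.
    apply: ge0_le_integral => //.
    - by move=> y _; rewrite lee_fin sqr_ge0.
    - mfun.
    move=> y Oy; rewrite lee_fin -[leLHS]real_normK ?num_real// ler_sqr ?nnegrE ?(ltW om0)// ltW//; apply: hd.
      by rewrite /= subr0; apply: le_trans (ler_normB _ _) _; apply: lerD; exact: OM.
    have -> : y - x - (y - q) = q - x by rewrite opprB addrC addrA subrK.
    by move: qx; rewrite -ball_normE.
  have n2 := ip_sq mO Lw (L2B mO (L1 x) (L1 q)).
  have n3 : inner (leb n) Om w (sval (eta q)) ^+ 2 <= B.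
    by rewrite /B big_map; apply: (le_sum_mem (F := fun x => inner (leb n) Om w (sval (eta x)) ^+ 2)) qT => x'; exact: sqr_ge0.
  rewrite e1; have n4 := le_trans n2 (ler_wpM2l (sq_ge0 _ _ _) n1).
  move: n3 n4; move: (inner _ _ _ _) (inner _ _ _ _) => a b n3 n4.
  have := sqr_ge0 (a - b); lra.
have h3 : sqnorm (leb n) P J <= V * (2 * (nrm w * (om ^+ 2 * V)) + 2 * B).
  set D := 2 * _ + _; have D0 : 0 <= D.
    by apply: addr_ge0; apply: mulr_ge0 => //; apply: mulr_ge0; [exact: sq_ge0|apply: mulr_ge0; [exact: sqr_ge0|exact: ltW]].
  rewrite -lee_fin -(esq mP (LP _ LJ)) mulrC EFinM.
  apply: (@le_trans _ _ (\int[leb n]_(y in P) D%:E)%E).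
    apply: ge0_le_integral => //.
    - by move=> y _; rewrite lee_fin sqr_ge0.
    - by apply/measurable_EFinP; apply: measurable_funX; exact: (L2_meas (LP _ LJ)).
    by move=> y [Oy _]; rewrite lee_fin h2.
  rewrite integral_cst//; apply: lee_wpmul2l; first by rewrite lee_fin.
  by apply: le_trans fV; apply: le_measure; rewrite ?inE.
have h4 : sqnorm (leb n) P w <= 2 * sqnorm (leb n) P J + 2 * sqnorm (leb n) P (fun x => J x - w x).
  have := sqB_le mP (LP _ LJ) (LP _ (L2B mO LJ Lw)).
  by rewrite (@eq_sq _ _ _ _ _ _ w) => [//|x _]; rewrite opprB addrC subrK.
have g0 := gsq_ge0 (partial^~ w); have w0 := sq_ge0 (leb n) Om w.
have i1 := ler_wpM2r g0 m2; have i2 := ler_wpM2r w0 om2.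
rewrite /h1sq; move: h1 h3 h4 i1 i2 g0 w0; rewrite -/P.
move: (sqnorm _ P _) (sqnorm _ P _) (sqnorm _ P _) (gsq _) (nrm w) => X Y Z g N.
set a := n%:R * m ^+ 2; set b := om ^+ 2 * V; move=> h1 h3 h4 i1 i2 g0 w0.
have e1 : 2 * Y <= V * (4 * (N * b)) + 4 * V * B by move: h3; lra.
have e2 : 2 * Z <= 2 * a * g by move: h1; lra.
have e3 : V * (4 * (N * b)) <= eps / 2 * N by move: i2; rewrite [4 * V * b * N](_ : _ = V * (4 * (N * b)))//; ring.
have e4 : eps * (N + g) = eps / 2 * N + eps / 2 * g + eps / 2 * (N + g) by field.
have e5 : 0 <= eps / 2 * (N + g) by rewrite mulr_ge0 ?divr_ge0 ?(ltW eps0)// addr_ge0.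
by lra.
Qed.

Lemma ehrling eps : 0 < eps -> exists (S : seq smoothfun) (C : R), 0 <= C /\ forall w Dw, H1 Om w Dw ->
  nrm w <= eps * h1sq w Dw + C * \sum_(f <- S) inner (leb n) Om w (sval f) ^+ 2.
Proof.
move=> eps0.
have cK := closure_compact.
have [rad radP] := cone_radius.
have rad0 p : closure Om p -> 0 < rad p by move=> /radP[e [c [s0 [r0 _ _ _]]]].
have [s [sc scov]] := finite_ball_cover cK rad0.
have sq0 (w : E -> R) (S : seq smoothfun) : 0 <= \sum_(f <- S) inner (leb n) Om w (sval f) ^+ 2.
  by apply: sumr_ge0 => f _; exact: sqr_ge0.
(* Passing from smooth functions to [H1] doubles the bound twice; [eps / 8] here and [4 * C] at the
   end absorb this. *)
have [S [C [C0 hS]]] : exists (S : seq smoothfun) (C : R), 0 <= C /\ forall w : E -> R^o, smooth w ->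
    \sum_(p <- s) sqnorm (leb n) (Om `&` ball p (rad p)) w <= eps / 8 * h1sq w (partial^~ w) +
    C * \sum_(f <- S) inner (leb n) Om w (sval f) ^+ 2.
  have : 0 < eps / 8 by rewrite divr_gt0.
  elim: s sc {scov} (eps / 8) => [|p s ih] sc e e0.
    by exists [::], 0; split => // w _; rewrite !big_nil mulr0 addr0 mulr_ge0 ?(ltW e0)// h1sq_ge0.
  have e2 : 0 < e / 2 by rewrite divr_gt0.
  have [e' [c [s0 hc]]] := radP p (sc p (mem_head _ _)).
  have [S1 [C1 [C10 h1]]] := local_ehrling hc e2.
  have [|S2 [C2 [C20 h2]]] := ih _ _ e2; first by move=> q qs; apply: sc; rewrite inE qs orbT.
  exists (S1 ++ S2), (C1 + C2); split => [|w sw]; first exact: addr_ge0.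
  rewrite big_cons big_cat/=; have k1 := h1 w sw; have k2 := h2 w sw.
  have := mulr_ge0 C10 (sq0 w S2); have := mulr_ge0 C20 (sq0 w S1).
  move: k1 k2; move: (\sum_(f <- S1) _) (\sum_(f <- S2) _) (sqnorm _ _ _) (\sum_(q <- s) _) (h1sq _) => *.
  by lra.
have smoothE (w : E -> R^o) : smooth w -> nrm w <= eps / 8 * h1sq w (partial^~ w) + C * \sum_(f <- S) inner (leb n) Om w (sval f) ^+ 2.
  move=> sw; apply: le_trans (hS w sw); have [Lw _] := smooth_L2H sw.
  have mBp p : measurable (ball p (rad p)) by apply: open_measurable_rV; exact: open_ball_rV.
  have mF : measurable_fun Om (fun x => (w x ^+ 2)%:E) by mfun.
  rewrite -lee_fin -(esq mO Lw) -sumEFin.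
  apply: le_trans (integral_cover_le (s := s) (leb n) mO mBp mF _ _) _.
  - by move=> x; rewrite lee_fin sqr_ge0.
  - by move=> x /subset_closure /scov.
  apply: lee_sum => p _; rewrite esq//; first exact: measurableI.
  split; first by apply: measurable_funS (L2_meas Lw) => //.
  exact: (integrableS mO (measurableI _ _ mO (mBp p)) (@subIsetl _ _ _) Lw.2).
exists S, (4 * C); split=> [|w Dw hw]; first exact: mulr_ge0.
have Lw := H1_L2H hw; pose N := \sum_(f <- S) nrm (sval f).
have N0 : 0 <= N by apply: sumr_ge0 => f _; exact: sq_ge0.
pose B := eps / 2 + 4 * C * N + 2.
have B0 : 0 < B by apply: ltr_wpDl => //; apply: addr_ge0; [rewrite divr_ge0// ltW|rewrite !mulr_ge0].
apply/ler_addgt0Pr => t t0; have d0 : 0 < t / B by rewrite divr_gt0.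
have [f [sf hf]] := H1_density hw d0; have Lf := smooth_L2H sf.
have Ld := L2HB Lf Lw.
have nd : nrm (fun x => f x - w x) <= t / B by apply: le_trans hf; rewrite lerDl gsq_ge0.
have k1 := smoothE f sf.
have k2 : nrm w <= 2 * nrm f + 2 * nrm (fun x => f x - w x).
  by have := sqB_le mO Lf.1 Ld.1; rewrite (@eq_sq _ _ _ _ _ _ w) => [//|x _]; rewrite opprB addrC subrK.
have k3 : h1sq f (partial^~ f) <= 2 * h1sq w Dw + 2 * h1sq (fun x => f x - w x) (fun i x => partial i f x - Dw i x).
  have := h1sqD_le Lw Ld; congr (_ <= _); rewrite /h1sq /gsq; congr (_ + _).
    by apply: eq_sq => x _; rewrite addrC subrK.
  by apply: eq_bigr => i _; apply: eq_sq => x _; rewrite addrC subrK.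
have k4 : \sum_(g <- S) inner (leb n) Om f (sval g) ^+ 2 <= 2 * (\sum_(g <- S) inner (leb n) Om w (sval g) ^+ 2) + 2 * (t / B * N).
  rewrite /N !mulr_sumr -big_split; apply: ler_sum => g _ /=.
  have Lg : L2O (sval g) by apply: (cont_L2); exact: smooth_continuous (svalP g).
  have e1 := ipBl mO Lf.1 Lw.1 Lg.
  have e2 := le_trans (ip_sq mO Ld.1 Lg) (ler_wpM2r (sq_ge0 _ _ _) nd).
  move: e2; rewrite e1; move: (inner _ _ f _) (inner _ _ w _) => a b.
  have := sqr_ge0 (a - 2 * b); lra.
have k5 := ler_wpM2l C0 k4; have k6 := ler_wpM2l (ltW (divr_gt0 eps0 (ltr0n R 8))) k3.
have tB : B * (t / B) = t by rewrite mulrCA mulfV ?mulr1// gt_eqF.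
have k8 := ler_wpM2l (ltW (divr_gt0 eps0 (ltr0n R 8))) hf.
have k7 : 0 <= eps / 2 * h1sq w Dw by rewrite mulr_ge0 ?h1sq_ge0// divr_ge0// ltW.
move: k1 k2 k5 k6 k7 k8 nd tB; rewrite /B.
move: (h1sq _) (h1sq _) (h1sq _) (nrm _) (nrm _) (nrm _) (\sum_(g <- S) _) (\sum_(g <- S) _) (t / _) => *.
lra.
Qed.

(** * Trajectories: integrated time derivative and pointwise bounds *)

Variable (T : R).
Hypothesis T0 : 0 < T.
Local Notation I := (`]0, T[%classic : set RR).
Local Notation ipO := (inner (leb n) Om).
Local Notation lamQ := (leb n \x lam)%E.
Local Notation lamS := (sigma \x lam)%E.
Local Notation Q := (Om `*` I).
Local Notation Sig := (bdry Om `*` I).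
Local Notation aeI := (ae_and (m := lam)).
Local Notation aeS := (ae_imp (m := lam)).
Let mIT : measurable I := mI T.
Let sO := leb_sigma_finite (R := R) n.

Lemma sigma_sf : sigma_finite setT sigma.
Proof. by case: dom => n1 o b l s; exact: (sigma_sigma_finite n1 o b l s). Qed.

Section one_trajectory.
Variable z : @trajectory R n.
Hypothesis zW : in_W Om sigma T z.

Lemma at_L2 t : 0 <= t <= T -> L2O (at_time z t).
Proof. by have [_ _ _ [h _ _]] := zW; apply: h. Qed.

Lemma at_cont t0 e : 0 <= t0 <= T -> 0 < e -> exists2 d, 0 < d &
  forall t, 0 <= t <= T -> `|t - t0| < d -> nrm (fun x => at_time z t x - at_time z t0 x) <= e.
Proof.
move=> tT e0; have [_ _ _ [_ _ h]] := zW; have := h t0; rewrite/= => /(_ tT).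
move=> /cvgrPdist_le /(_ e e0); rewrite near_withinE => -[d /= d0 hd]; exists d => // t tT' td.
have := hd t; rewrite /= distrC in td; move=> /(_ td); rewrite/= => /(_ tT').
by rewrite sub0r normrN ger0_norm// sq_ge0.
Qed.

Lemma value_L2 : L2 lamQ Q (value z). Proof. by have [[]] := zW. Qed.

Lemma grad_L2 i : L2 lamQ Q (grad z i). Proof. by have [[]] := zW. Qed.

Lemma trace_L2S : L2 lamS Sig (trace z). Proof. by have [_ _ []] := zW. Qed.

Lemma slice_H1 : \forall t \ae lam, I t -> H1 Om (fun x => value z (x, t)) (fun i x => grad z i (x, t)).
Proof. by have [[_ _ h] _ _ _] := zW. Qed.

Lemma slice_trace : \forall t \ae lam, I t ->
  trace_of Om sigma (fun x => value z (x, t)) (fun i x => grad z i (x, t)) (fun x => trace z (x, t)).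
Proof. by have [_ _ [_ h] _] := zW. Qed.

Lemma slice_at : \forall t \ae lam, I t -> \forall x \ae leb n, Om x -> at_time z t x = value z (x, t).
Proof. by have [_ _ _ [_ h _]] := zW. Qed.

Lemma pairing_cont w t0 e : L2O w -> 0 <= t0 <= T -> 0 < e -> exists2 d, 0 < d &
  forall t, 0 <= t <= T -> `|t - t0| < d -> `|ipO (at_time z t) w - ipO (at_time z t0) w| <= e.
Proof.
move=> Lw tT e0; have w0 := sq_ge0 (leb n) Om w.
have w1 : 0 < nrm w + 1 by rewrite ltr_wpDl.
have e1 : 0 < e ^+ 2 / (nrm w + 1) by rewrite divr_gt0// exprn_gt0.
have [d d0 hd] := at_cont tT e1; exists d => // t tT' td.
have L1 := L2B mO (at_L2 tT') (at_L2 tT).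
rewrite -(ipBl mO (at_L2 tT') (at_L2 tT) Lw) -ler_sqr ?nnegrE ?(ltW e0)// real_normK ?num_real//.
apply: le_trans (ip_sq mO L1 Lw) _; apply: le_trans (ler_wpM2r w0 (hd t tT' td)) _.
by rewrite mulrAC ler_pdivrMr// ler_wpM2l ?sqr_ge0// lerDl.
Qed.

Lemma pairing_intble w : L2O w -> lam.-integrable I (fun t => (ipO (fun x => value z (x, t)) w)%:E).
Proof.
move=> Lw; have Lt : L2 lamQ Q (fun q => w q.1 * (fun _ : RR => 1 : R) q.2).
  by apply: (L2_tensor (th := fun _ => 1) (M := 1) T0 mO sO Lw) => [|t _]; [mfun|rewrite normr1].
have := ip_slice_intble sO mO mIT value_L2 Lt; apply: eq_integrable => // t _.
by congr EFin; apply: eq_ip => x _; rewrite mulr1.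
Qed.

Lemma dt_L2 w Dw : H1 Om w Dw -> L2 lam I (fun t => dt z t w).
Proof.
move=> hw; have [_ [hm [k Lk hk] _] _ _] := zW.
apply: (le_L2 mIT (hm w Dw hw) (L2Z mIT (H1norm Om w Dw) Lk)).
apply: filterS (ae_itv hk) => t h It; have [_ /(_ w Dw hw)] := h It.
by rewrite mulrC => /le_trans; apply; exact: ler_norm.
Qed.

Lemma dt_intble w Dw : H1 Om w Dw -> lam.-integrable I (fun t => (dt z t w)%:E).
Proof.
move=> /dt_L2 Ld; have L1 : L2 lam I (fun _ => 1) by apply: (bounded_L2 (M := 1) mIT (I_fin T0)) => // t _; rewrite normr1.
by have := L2M mIT Ld L1; apply: eq_integrable => // t _; rewrite mulr1.
Qed.

(** Test the weak time derivative with differences of ramps. Their derivatives are bumps, which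
    average the continuous pairing to its values at [s] and at [t], while the ramps themselves
    converge boundedly to the indicator of []s, t]]. *)
Lemma time_formula w Dw s t : H1 Om w Dw -> 0 < s -> s < t -> t < T ->
  ipO (at_time z t) w - ipO (at_time z s) w = \int[lam]_(r in `]s, t]) dt z r w.
Proof.
move=> hw s0 st tT; have [Lw _ _] := hw.
have sT : 0 <= s <= T by rewrite !ltW// (lt_trans st).
have tT' : 0 <= t <= T by rewrite !ltW// (lt_trans s0).
have jg := dt_intble hw; have jf := pairing_intble Lw.
pose ind (r : RR) : R := \1_(`]s, t]%classic : set RR) r.
have stI : (`]s, t]%classic : set RR) `<=` I.
  by move=> r; rewrite /= !in_itv/= => /andP[r1 r2]; rewrite (lt_trans s0 r1) (le_lt_trans r2 tT).
have mind : measurable_fun setT ind by exact: measurable_indic.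
have ind1 r : `|ind r| <= 1 by rewrite /ind indicE; case: (_ \in _); rewrite ?normr1 ?normr0.
have -> : \int[lam]_(r in `]s, t]) dt z r w = \int[lam]_(r in I) (dt z r w * ind r).
  rewrite [LHS]Rintegral_mkcond [RHS]Rintegral_mkcond; congr (Rintegral _ _ _); apply/funext => r.
  rewrite !patchE /ind indicE; case: ifPn => h; last by case: ifP; rewrite ?mulr0.
  by rewrite mem_set ?mulr1//; apply: stI; exact: set_mem.
apply/eqP; rewrite -subr_eq0 -normr_le0; apply/ler_addgt0Pr => e e0; rewrite add0r.
have e3 : 0 < e / 3 by rewrite divr_gt0.
have [d1 d10 h1] := pairing_cont Lw sT e3; have [d2 d20 h2] := pairing_cont Lw tT' e3.
pose th k (r : RR) : R := ramp k.+1%:R s r - ramp k.+1%:R t r.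
have mth k : measurable_fun setT (th k).
  by apply: continuous_measurable_fun; apply: contB; apply: smooth_continuous; exact: smooth_ramp.
have thb k r : `|th k r - ind r| <= 1.
  have r0 m x : 0 <= ramp m x r <= 1 by rewrite step_ge0 step_le1.
  have tle : ramp k.+1%:R t r <= ramp k.+1%:R s r by apply: step_mono; rewrite ler_wpM2l// lerD2l lerN2 ltW.
  have /andP[a1 a2] := r0 k.+1%:R s; have /andP[a3 a4] := r0 k.+1%:R t.
  by rewrite /th /ind indicE ler_norml; case: (_ \in _) => /=; apply/andP; split; lra.
have lim0 : \int[lam]_(r in I) (`|dt z r w| * `|th k r - ind r|) @[k --> \oo] --> (0 : R).
  have jk k : lam.-integrable I (fun r => (`|dt z r w| * `|th k r - ind r|)%:E).
    apply: (intble_bM (M := 1) mIT) (integrable_norm jg) => [|r _]; last by rewrite normr_id.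
    apply: measurable_funTS; mfun.
  have : (\int[lam]_(r in I) (`|dt z r w| * `|th k r - ind r|)%:E @[k --> \oo] --> 0)%E.
    have hdc := @dominated_cvg0 R _ RR lam I (fun k r => (`|dt z r w| * `|th k r - ind r|)%:E) (fun r => `|dt z r w|%:E) mIT.
    apply: hdc.
    - by move=> k; exact: (measurable_int _ (jk k)).
    - by [].
    - exact: (integrable_norm jg).
    - apply: nearW => r _; apply: cvg_EFin; first exact: nearW.
      have [N hN] : exists N, forall k, (N <= k)%N -> th k r = ind r.
        have [rs|rs] := leP r s.
          exists 0%N => k _; rewrite /th /ramp !step_le0 ?subrr ?/ind ?indicE ?memNset//.
          - by rewrite /= in_itv/= => /andP[]; rewrite ltNge rs.
          - by rewrite mulr_ge0_le0//; lra.
          - by rewrite mulr_ge0_le0//; lra.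
        have arch (x : R) : 0 < x -> exists N, forall k, (N <= k)%N -> 1 <= k.+1%:R * x.
          move=> x0; exists (Num.truncn x^-1).+1 => k Nk; rewrite -ler_pdivrMr// mul1r.
          apply: le_trans (ltW (truncnS_gt _)) _; rewrite ler_nat; exact: leqW.
        have [rt|rt] := leP r t.
          have [|N hN] := arch (r - s); first by rewrite subr_gt0.
          exists N => k /hN h; rewrite /th /ramp step_ge1// step_le0 ?subr0 /ind ?indicE ?mem_set//=.
          - by rewrite in_itv/= rs rt.
          - by rewrite mulr_ge0_le0//; lra.
        have [|N hN] := arch (r - t); first by rewrite subr_gt0.
        exists N => k /hN h; rewrite /th /ramp !step_ge1 ?subrr /ind ?indicE ?memNset//=.
        - by rewrite in_itv/= => /andP[_]; rewrite leNgt rt.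
        - by apply: le_trans h _; rewrite ler_wpM2l// lerD2l lerN2 ltW.
      apply: cvg_near_cst; exists N => // k /= /hN ->; by rewrite subrr normr0 mulr0.
    - by apply: nearW => r k _; rewrite lee_fin ler_piMr.
  by move/fine_cvgP => [].
have [N hN] := near_cvg0_lt e3 lim0.
pose dd := Num.min (Num.min d1 d2) (T - t).
have dd0 : 0 < dd by rewrite !lt_min d10 d20 subr_gt0.
pose k := maxn N (Num.truncn dd^-1).+1.
pose m : R := k.+1%:R.
have m0 : 0 < m by [].
have mdd : m^-1 < dd.
  rewrite invf_plt//; apply: lt_le_trans (truncnS_gt _) _; rewrite ler_nat /k.
  by apply: leqW; exact: leq_maxr.
have [md1 md2 mT] : [/\ m^-1 < d1, m^-1 < d2 & m^-1 < T - t] by move: mdd; rewrite !lt_min => /andP[/andP[]].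
have [_ [_ _ hdist] _ _] := zW.
have tm : t + m^-1 < T by rewrite addrC -ltrBrDr.
have := hdist _ w Dw (test_ramps m0 s0 st tm) hw.
have dE r : derive1 (fun r => ramp m s r - ramp m t r : R^o) r = bump m s r - bump m t r.
  have h := is_deriveB (is_derive_ramp m s r) (is_derive_ramp m t r).
  by rewrite derive1E; have [_] := h.
under [X in _ = - X -> _]eq_Rintegral do rewrite dE mulrBr.
rewrite RintegralB//; [|exact: bump_intble|exact: bump_intble].
have rI r : I r -> 0 <= r <= T by rewrite/=/= => /andP[/ltW -> /ltW ->].
have av x dx : 0 < x -> x < T -> x + m^-1 < T -> m^-1 < dx ->
    (forall r, 0 <= r <= T -> `|r - x| < dx -> `|ipO (at_time z r) w - ipO (at_time z x) w| <= e / 3) ->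
    `|\int[lam]_(r in I) (ipO (fun y => value z (y, r)) w * bump m x r) - ipO (at_time z x) w| <= e / 3.
  move=> x0 xT xm mx hx; apply: bump_avg => //; first exact: ltW.
  apply: filterS2 slice_at (L2_slice sO mO mIT value_L2) => r hr hL Ir rx.
  have -> : ipO (fun y => value z (y, r)) w = ipO (at_time z r) w.
    by apply: (ip_ae mO (hL Ir) (at_L2 (rI r Ir)) Lw); apply: filterS (hr Ir) => y h /h.
  apply: hx; last exact: lt_trans mx.
  exact: rI.
have b1 := av s d1 s0 (lt_trans st tT) _ md1 h1; have b2 := av t d2 (lt_trans s0 st) tT tm md2 h2.
have {}b1 : `|\int[lam]_(r in I) (ipO (fun y => value z (y, r)) w * bump m s r) - ipO (at_time z s) w| <= e / 3.
  by apply: b1; apply: lt_trans tm; rewrite ltrD2r.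
have b3 : `|\int[lam]_(r in I) (dt z r w * th k r) - \int[lam]_(r in I) (dt z r w * ind r)| <= e / 3.
  have j1 : lam.-integrable I (fun r => (dt z r w * th k r)%:E).
    apply: (intble_bM (b := th k) (M := 2) mIT (measurable_funTS (mth k)) _ jg).
    by move=> r _; rewrite -[th k r](subrK (ind r)); apply: le_trans (ler_normD _ _) _; have := thb k r; have := ind1 r; lra.
  have j2 : lam.-integrable I (fun r => (dt z r w * ind r)%:E).
    by apply: (intble_bM (b := ind) (M := 1) mIT (measurable_funTS mind) _ jg).
  rewrite -(RintegralB mIT j1 j2); apply: le_trans (le_normr_Rintegral mIT (intbleB mIT j1 j2)) _.
  have := hN k (leq_maxl _ _); rewrite ger0_norm; last by apply: Rintegral_ge0 => r _.
  move/ltW; apply: le_trans; apply: eqW.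
  by apply: eq_Rintegral => r _; rewrite -mulrBr normrM.
move=> eX; rewrite -[\int[lam]_(r in I) (dt z r w * th k r)]/(\int[lam]_(r in I) (dt z r w * (ramp m s r - ramp m t r))) eX in b3.
exact: arith3 b1 b2 b3.
Qed.

End one_trajectory.

Let mS : measurable Sig := measurableX mB mIT.
Let sS := sigma_sf.

Lemma excess_L2 {d} {X : measurableType d} (m : {measure set X -> \bar R}) D (f : X -> R) M : measurable D -> 0 <= M -> L2 m D f ->
  L2 m D (fun x => Num.max (`|f x| - M) 0).
Proof.
move=> mD M0 Lf; have mf := L2_meas Lf; apply: (le_L2 mD) Lf _ => [|].
  apply: measurable_maxr; last mfun.
  mfun.
by apply: nearW => x _; rewrite ger0_norm ?le_max ?lexx ?orbT// ge_max normr_ge0 gerBl M0.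
Qed.

Lemma excess_ae {d} {X : measurableType d} (m : {measure set X -> \bar R}) D (f : X -> R) M : measurable D -> 0 <= M -> L2 m D f ->
  sqnorm m D (fun x => Num.max (`|f x| - M) 0) = 0 -> \forall x \ae m, D x -> `|f x| <= M.
Proof.
move=> mD M0 Lf s0; apply: (ae_imp (m := m) (sq0_ae mD (excess_L2 mD M0 Lf) s0)) => x h Dx.
by have := h Dx; move/eqP; rewrite eq_le ge_max subr_le0 => /andP[/andP[]].
Qed.

(** [trace_bounded] applies slice by slice; integrating the squared excess over time turns this into
    a bound almost everywhere on the lateral boundary. *)
Lemma trace_Linfty z : in_Y Om sigma T z -> Linfty (sigma \x lam)%E (bdry Om `*` I) (trace z).
Proof.
move=> [zW [_ [M hM]]]; have Lt := trace_L2S zW; split; first mfun.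
exists `|M|; have M0 := normr_ge0 M; apply: (excess_ae mS M0 Lt).
rewrite (sq_slice sS mB mIT (excess_L2 mS M0 Lt)).
have h : \forall r \ae lam, I r -> sqnorm sigma (bdry Om) (fun x => Num.max (`|trace z (x, r)| - `|M|) 0) = 0.
  apply: (aeS (aeI (aeI (slice_H1 zW) (slice_trace zW))
    (aeI (ae_slice sO hM) (L2_slice sS mB mIT Lt)))) => r [[h1 h2] [h3 h4]] Ir.
  have hb : \forall x \ae leb n, Om x -> `|value z (x, r)| <= `|M|.
    by apply: (ae_imp (m := leb n) (h3 Ir)) => x hx Ox; apply: le_trans (hx Ox) (ler_norm _).
  have := trace_bounded (H1_L2H (h1 Ir)) (h2 Ir) hb => hb'.
  apply: (proj2 (ae_sq0 mB (L2_meas (excess_L2 mB M0 (h4 Ir))) _)).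
  by apply: (ae_imp (m := sigma) hb') => x hx Bx; apply: max_r; rewrite subr_le0; exact: hx.
rewrite (Rintegral_ae mIT (measurable_cst (0 : R)) h).
by rewrite /Rintegral integral0.
Qed.

(** At a time [r] close to [T], chosen outside a null set, the bound holds; so the excess at [T] is
    at most the distance between the states at [r] and at [T], which is small in norm. *)
Lemma final_bounded z M : in_W Om sigma T z -> 0 <= M -> (\forall q \ae (leb n \x lam)%E, (Om `*` I) q -> `|value z q| <= M) ->
  \forall x \ae leb n, Om x -> `|at_time z T x| <= M.
Proof.
move=> zW M0 hM; have TT : 0 <= T <= T by rewrite lexx ltW.
have LT := at_L2 zW TT; apply: (excess_ae mO M0 LT); apply/eqP; rewrite eq_le sq_ge0 andbT.
apply/ler_addgt0Pr => e e0; rewrite add0r; have [d0 d00 hd] := at_cont zW TT e0.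
have /ae_ge0P[N [mN N0 hN]] : \forall r \ae lam, I r -> (\forall x \ae leb n, Om x -> at_time z r x = value z (x, r)) /\
    (\forall x \ae leb n, Om x -> `|value z (x, r)| <= M).
  by apply: (aeS (aeI (slice_at zW) (ae_slice sO hM))) => r [h1 h2] Ir; split; [exact: h1|exact: h2].
pose a := Num.max 0 (T - d0); have aT : a < T by rewrite gt_max T0 gtrBl.
have [r [ra rT nN]] : exists r, [/\ a < r, r < T & ~ N r].
  apply: contrapT => no; have sub : `]a, T[%classic `<=` N.
    by move=> r; rewrite/=/= => /andP[h1 h2]; apply: contrapT => nN; apply: no; exists r.
  have : (lam `]a, T[%classic <= 0)%E.
    by rewrite -N0; apply: le_measure => //; rewrite inE//.
  by rewrite lebesgue_measure_itv/= lte_fin aT lee_fin subr_le0 leNgt aT.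
move: ra; rewrite gt_max => /andP[r0 rd].
have Ir : I r by rewrite /= in_itv/= r0 rT.
have [h1 h2] := hN r Ir nN; have rT' : 0 <= r <= T by rewrite !ltW.
apply: le_trans (hd r rT' _); last by rewrite ltr0_norm//; lra.
apply: (le_sq mO (excess_L2 mO M0 LT) (L2B mO (at_L2 zW rT') LT)); apply: filterS2 h1 h2 => x h1 h2 Ox.
rewrite ger0_norm ?le_max ?lexx ?orbT// ge_max normr_ge0 andbT h1// distrC.
by have := h2 Ox; have := lerB_dist (at_time z T x) (value z (x, r)); lra.
Qed.

Local Notation J a b := (`]a%R, b%R]%classic : set RR).
Local Notation ipS := (inner sigma (bdry Om)).
Let mQ : measurable Q := measurableX mO mIT.

(** * Energy estimates for the linearized equation *)

Section clamp.
Variable z : @trajectory R n.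
Hypothesis zW : in_W Om sigma T z.

(** Times outside [[0, T]] are moved to the nearer end, which makes [energy] continuous on the whole
    line. *)
Definition clamp (t : R) : R := Num.max 0 (Num.min t T).

Lemma clamp_in t : 0 <= clamp t <= T.
Proof. by rewrite le_max lexx ge_max (ltW T0) ge_min lexx orbT. Qed.

Lemma clamp_id t : 0 <= t -> t <= T -> clamp t = t.
Proof. by move=> t0 tT; rewrite /clamp min_l// max_r. Qed.

Lemma clamp_lip t s : `|clamp t - clamp s| <= `|t - s|.
Proof.
rewrite /clamp !maxEle !minEle; have [h|h] := ger0P (t - s);
  (do ?case: ifPn => //; rewrite -?ltNge => *; rewrite ler_norml; apply/andP; split; move: T0 => *; lra).
Qed.

Definition energy (t : R) : R := nrm (at_time z (clamp t)).

Lemma energy_cont : continuous energy.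
Proof.
move=> t; apply/cvgrPdist_le => e e0; set b := at_time z (clamp t).
have Lb : L2O b by exact: (at_L2 zW (clamp_in t)).
have b0 := sq_ge0 (leb n) Om b; pose k := 2 * (nrm b + 1) / e.
have k0 : 0 < k by rewrite divr_gt0// mulr_gt0// ltr_wpDl.
have k1 : 0 < 1 + k by rewrite addr_gt0.
have [|d d0 hd] := at_cont zW (clamp_in t) (_ : 0 < (e / 2) / (1 + k)); first by rewrite !divr_gt0.
exists d => // s /= sd; have La : L2O (at_time z (clamp s)) by exact: (at_L2 zW (clamp_in s)).
have := hd _ (clamp_in s) (le_lt_trans (clamp_lip s t) _); rewrite distrC => /(_ sd).
rewrite -/b distrC /energy -/b; set a := at_time z (clamp s) => h.
set D := fun x => a x - b x in h.
have Lab := L2B mO La Lb.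
have -> : nrm a = nrm D + 2 * ipO D b + nrm b.
  by rewrite -(sqD mO Lab Lb); apply: eq_sq => x _; rewrite subrK.
rewrite addrK; have hy : 2 * `|ipO D b| <= k * nrm D + k^-1 * nrm b := ip_young mO k0 Lab Lb.
have kb : k^-1 * nrm b <= e / 2.
  rewrite /k invf_div mulrAC ler_pdivrMr ?mulr_gt0 ?ltr_wpDl//.
  rewrite (_ : e / 2 * _ = e * (nrm b + 1)); last by field.
  by rewrite ler_pM2l// lerDl.
have hk : (1 + k) * nrm D <= e / 2 by rewrite mulrC -ler_pdivlMr.
have n0 : 0 <= nrm D := sq_ge0 (leb n) Om D.
apply: le_trans (ler_normD _ _) _; rewrite (ger0_norm n0) normrM (ger0_norm (ler0n R 2)).
by move: hy kb hk; lra.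
Qed.

End clamp.

Variables (A : 'I_n -> 'I_n -> E -> R) (LamA lamA : R) (c u b : E * RR -> R).
Hypotheses (ell : elliptic Om A LamA lamA) (Lc : Linfty lamQ Q c) (Lu : Linfty lamS Sig u) (Lb : Linfty lamS Sig b).
Hypothesis u0 : \forall q \ae lamS, Sig q -> 0 <= u q.

(** The linearized equation with bounded coefficients. In the theorem [c] is a measurable version of
    [dy a] along the state and [b] is the trace of the state. *)
Definition lin_state (v : E * RR -> R) (z : trajectory) : Prop :=
  [/\ in_W Om sigma T z, weak_solution Om sigma T 1 A (fun q => c q * value z q) (fun q => - (u q * trace z q + b q * v q)) z &
    \forall x \ae leb n, Om x -> at_time z 0 x = 0].

Definition flux (z : trajectory) j (q : E * RR) : R := \sum_i - A i j q.1 * grad z i q.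
Definition low (z : @trajectory R n) (q : E * RR) : R := - c q * value z q.
Definition robin (z : @trajectory R n) v (q : E * RR) : R := - (u q * trace z q + b q * v q).

(** What the forms require of a trajectory apart from its time derivative; this also fits limits
    that are not yet known to be trajectories of [W(0,T)]. *)
Definition L2fields (z : trajectory) : Prop :=
  [/\ L2 lamQ Q (value z), forall i : 'I_n, L2 lamQ Q (grad z i) & L2 lamS Sig (trace z)].

Lemma fieldsW z : in_W Om sigma T z -> L2fields z.
Proof. by move=> zW; split; [exact: value_L2 zW|exact: grad_L2 zW|exact: trace_L2S zW]. Qed.

Lemma Linfty_A i j : Linfty lamQ Q (fun q => - A i j q.1).
Proof.
have [hA _ _ _] := ell; have [mA [M hM]] := hA i j; split.
  apply: (measurableT_comp (@oppr_measurable R setT)); apply: (measurable_comp mO _ mA); last mfun.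
  by move=> _ [q [? _] <-].
by exists M; apply: filterS (ae_fst lam I hM) => q h Qq; rewrite normrN; exact: h.
Qed.

Lemma L2_flux z j : L2fields z -> L2 lamQ Q (flux z j).
Proof. by move=> [_ Lg _]; apply: (L2_sum mQ) => i; exact: (L2_bM mQ (Linfty_A i j) (Lg i)). Qed.

Lemma L2_low z : L2fields z -> L2 lamQ Q (low z).
Proof.
move=> [Lz _ _]; apply: (L2_bM mQ) Lz; have [mc [M hM]] := Lc; split.
  mfun.
by exists M; apply: filterS hM => q h Qq; rewrite normrN; exact: h.
Qed.

Lemma L2_robin z v : L2fields z -> L2 lamS Sig v -> L2 lamS Sig (robin z v).
Proof.
move=> [_ _ Lt] Lv; apply: (L2N mS); apply: (L2D mS); first exact: (L2_bM mS Lu Lt).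
exact: (L2_bM mS Lb Lv).
Qed.

(** All terms of the equation except the time derivative, moved to the right-hand side at time [r];
    its body is an instance of [pair3]. *)
Definition wform (z : trajectory) v r (w : E -> R) (Dw : 'I_n -> E -> R) (tw : E -> R) : R :=
  \sum_j ipO (fun x => flux z j (x, r)) (Dw j) + ipO (fun x => low z (x, r)) w + ipS (fun x => robin z v (x, r)) tw.

Lemma flux_form z r w Dw : (forall i, L2O (fun x => grad z i (x, r))) -> (forall j, L2O (fun x => flux z j (x, r))) -> H1 Om w Dw ->
  \sum_j ipO (fun x => flux z j (x, r)) (Dw j) = - \int[leb n]_(x in Om) (\sum_i \sum_j A i j x * grad z i (x, r) * Dw j x).
Proof.
move=> Lg Lf [Lw LD _]; have jF j := L2M mO (Lf j) (LD j).
rewrite -(Rint_sum _ mO jF) -[RHS]mulN1r -RintegralZl//; last first.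
  have := intbleN mO (intble_sum mO (index_enum 'I_n) jF); apply: eq_integrable => // x _ /=.
  rewrite [in RHS]exchange_big -sumrN; congr EFin; apply: eq_bigr => j _; rewrite mulr_suml -sumrN.
  by apply: eq_bigr => i _; rewrite !mulNr opprK.
apply: eq_Rintegral => x _; rewrite exchange_big mulr_sumr; apply: eq_bigr => j _.
by rewrite mulr_suml mulr_sumr; apply: eq_bigr => i _; rewrite mulN1r !mulNr.
Qed.

Lemma flux_slices z : L2fields z -> \forall r \ae lam, I r -> forall j, L2O (fun x => flux z j (x, r)).
Proof.
move=> zW; have h j := L2_slice sO mO mIT (L2_flux j zW).
have : \forall r \ae lam, forall j : 'I_n, I r -> L2O (fun x => flux z j (x, r)).
  exact: filter_forall.
by apply: filterS => r hr Ir j; exact: hr.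
Qed.

Lemma wform_eq z v r w Dw tw : (forall i, L2O (fun x => grad z i (x, r))) -> (forall j, L2O (fun x => flux z j (x, r))) ->
  L2O (fun x => low z (x, r)) -> H1 Om w Dw ->
  wform z v r w Dw tw = - (\int[leb n]_(x in Om) (\sum_i \sum_j A i j x * grad z i (x, r) * Dw j x))
    - \int[leb n]_(x in Om) (c (x, r) * value z (x, r) * w x)
    + \int[sigma]_(x in bdry Om) (- (u (x, r) * trace z (x, r) + b (x, r) * v (x, r)) * tw x).
Proof.
move=> Lg Lf Ll hw; have [Lw _ _] := hw; rewrite /wform (flux_form Lg Lf hw); congr (_ + _ + _).
rewrite -[RHS]mulN1r -RintegralZl//; first by apply: eq_Rintegral => x _; rewrite /low; ring.
have := intbleN mO (L2M mO Ll Lw); apply: eq_integrable => // x _ /=; congr EFin; rewrite /low; ring.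
Qed.

Lemma lin_form v z : lin_state v z -> \forall r \ae lam, I r -> forall w Dw tw, H1 Om w Dw -> trace_of Om sigma w Dw tw ->
  dt z r w = wform z v r w Dw tw.
Proof.
move=> [zW zw _]; have hl := L2_slice sO mO mIT (L2_low (fieldsW zW)).
apply: filterS3 (ae_itv zw) (flux_slices (fieldsW zW)) (filterI hl (slice_H1 zW)) => r h hf [{}hl hz] Ir w Dw tw hw ht.
have [_ Lg _] := hz Ir; have := h Ir w Dw tw hw ht.
rewrite (wform_eq v tw Lg (hf Ir) (hl Ir) hw) mul1r => <-.
by ring.
Qed.

Lemma form_intble v z : L2fields z -> L2 lamS Sig v -> lam.-integrable I
  (fun r => (wform z v r (fun x => value z (x, r)) (fun i x => grad z i (x, r)) (fun x => trace z (x, r)))%:E).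
Proof.
move=> zW Lv; have [zv zg zt] := zW; apply: (intbleD mIT); last exact: (ip_slice_intble sS mB mIT (L2_robin zW Lv) zt).
apply: (intbleD mIT); last exact: (ip_slice_intble sO mO mIT (L2_low zW) zv).
by apply: (intble_sum mIT) => j; exact: (ip_slice_intble sO mO mIT (L2_flux j zW) (zg j)).
Qed.

(** With [f] and [g] the states at the later and the earlier time, [|f|^2 - |g|^2 <= 2 <f - g, f>].
    The right-hand side is the time formula tested with the state at the later time, as
    [energy_abstract] asks. *)
Lemma energy_lin v z s t : L2 lamS Sig v -> lin_state v z -> 0 < s -> s < t -> t < T ->
  energy z t - energy z s <= 2 * \int[lam]_(r in J s t)
    wform z v r (fun x => value z (x, r)) (fun i x => grad z i (x, r)) (fun x => trace z (x, r)).
Proof.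
move=> Lv lz s0 st tT; have [zW zw z0] := lz.
apply: (energy_abstract (T := T) (B := fun r t => wform z v r (fun x => value z (x, t)) (fun i x => grad z i (x, t)) (fun x => trace z (x, t)))
  (D := fun r x => dt z x (fun y => value z (y, r)))) => //.
- exact: energy_cont zW.
- apply: osc_boundD; last exact: (osc_bound_ip sS mB (L2_robin (fieldsW zW) Lv) (trace_L2S zW)).
  apply: osc_boundD; last exact: (osc_bound_ip sO mO (L2_low (fieldsW zW)) (value_L2 zW)).
  by apply: osc_bound_sum => j; exact: (osc_bound_ip sO mO (L2_flux j (fieldsW zW)) (grad_L2 zW j)).
- exact: (form_intble (fieldsW zW) Lv).
apply: filterS3 (slice_H1 zW) (slice_trace zW) (slice_at zW) => r hH ht ha Ir.
have {}hH := hH Ir; have {}ht := ht Ir; have {}ha := ha Ir; have [Lw _ _] := hH.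
have [r0 rT] : 0 < r /\ r < T by move: Ir; rewrite/=/= => /andP.
split; first exact: (dt_intble zW hH).
  move=> x x0 xr; rewrite -(time_formula zW hH x0 xr rT).
  have rI : 0 <= r <= T by rewrite !ltW.
  have xI : 0 <= x <= T by rewrite !ltW// (lt_trans xr).
  have La := at_L2 zW rI; have Lc' := at_L2 zW xI.
  rewrite /energy !clamp_id ?(ltW r0) ?(ltW rT) ?(ltW x0)//; last by rewrite ltW// (lt_trans xr).
  set f := at_time z r in La *; set g := at_time z x in Lc' *.
  have fE k : L2O k -> ipO k (fun y => value z (y, r)) = ipO k f.
    by move=> Lk; rewrite ipC [RHS]ipC; apply/esym; apply: (ip_ae mO La Lw Lk); apply: filterS ha => y h /h.
  rewrite !fE// -sqE; have := sqB mO La Lc'; have := sq_ge0 (leb n) Om (fun y => f y - g y).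
  by rewrite [ipO g f]ipC => h0 h1; lra.
by apply: filterS (lin_form lz) => x h Ix; exact: (h Ix _ _ _ hH ht).
Qed.

(** Ellipticity yields [- 2 * LamA] times the squared gradient, and [u >= 0] gives the Robin term a
    favourable sign. The control term costs a boundary norm of [z], whose gradient part uses up one
    [LamA] by [trace_eps]. *)
Lemma form_bound (de : R) : 0 < de -> exists2 K, 0 < K & forall v z, L2 lamS Sig v -> lin_state v z ->
  \forall r \ae lam, I r -> 2 * wform z v r (fun x => value z (x, r)) (fun i x => grad z i (x, r)) (fun x => trace z (x, r)) <=
    K * nrm (fun x => value z (x, r)) + de * bsq (fun x => v (x, r)) - LamA * gsq (fun i x => grad z i (x, r)).
Proof.
move=> de0; have [hA L0 _ hell] := ell; have [mc [Mc hMc]] := Lc; have [mb [Mb hMb]] := Lb.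
have [ct ct0 ht] := trace_eps.
have Mb1 : 0 < Mb ^+ 2 + 1 by rewrite ltr_wpDl// sqr_ge0.
(* The weight [e] keeps the control below [de]; afterwards [a] is so large that the trace term takes
   at most [LamA] of the gradient. *)
pose e := de / (Mb ^+ 2 + 1); have e0 : 0 < e by rewrite divr_gt0.
have ei : 0 <= e^-1 * ct by rewrite mulr_ge0// invr_ge0 ltW.
pose a := e^-1 * ct / LamA + 1; have a0 : 0 < a by rewrite ltr_wpDl// divr_ge0// ltW.
have ha : e^-1 * ct * a^-1 <= LamA.
  by rewrite ler_pdivrMr// /a mulrDr mulr1 [LamA * _]mulrC divfK ?gt_eqF// lerDl ltW.
have na : 0 <= 1 + n%:R * a by rewrite addr_ge0// mulr_ge0// ltW.
exists (Mc ^+ 2 + 1 + e^-1 * ct * (1 + n%:R * a)).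
  by rewrite ltr_wpDr ?ltr_wpDl ?sqr_ge0// mulr_ge0.
move=> v z Lv [zW zw _]; pose g q := - (b q * v q).
have Lg : L2 lamS Sig g by apply: (L2N mS); exact: (L2_bM mS Lb Lv).
have ae1 := aeI (flux_slices (fieldsW zW)) (aeI (L2_slice sO mO mIT (L2_low (fieldsW zW))) (aeI (slice_H1 zW) (ae_slice sO hMc))).
have ae2 := aeI (L2_slice sS mB mIT (L2_robin (fieldsW zW) Lv)) (aeI (L2_slice sS mB mIT Lg) (aeI (slice_trace zW)
  (aeI (L2_slice sS mB mIT Lv) (aeI (ae_slice sS hMb) (ae_slice sS u0))))).
apply: (aeS (aeI ae1 ae2)) => r [[h1 [h2 [h3 h4]]] [h5 [h6 [h7 [h8 [h9 h10]]]]]] Ir.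
have {}h1 := h1 Ir; have {}h2 := h2 Ir; have {}h3 := h3 Ir; have {}h4 := h4 Ir; have {}h5 := h5 Ir; have {}h6 := h6 Ir.
have {}h7 := h7 Ir; have {}h8 := h8 Ir; have {}h9 := h9 Ir; have {}h10 := h10 Ir.
have [Lw LD _] := h3; have Lt := trace_L2 h7.
have b1 : \sum_j ipO (fun x => flux z j (x, r)) (fun x => grad z j (x, r)) <= - (LamA * gsq (fun i x => grad z i (x, r))).
  rewrite (flux_form LD h1 h3) lerN2 /gsq.
  have jg i : (leb n).-integrable Om (fun x => (grad z i (x, r) ^+ 2)%:E) by have [] := LD i.
  have jF j := L2M mO (h1 j) (LD j).
  rewrite -(Rint_sum _ mO jg) -(RintegralZl _ mO (intble_sum mO _ jg)).
  apply: (ae_le_Rintegral mO (intbleZ mO _ (intble_sum mO _ jg))).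
    have := intbleN mO (intble_sum mO (index_enum 'I_n) jF); apply: eq_integrable => // x _ /=.
    rewrite [in RHS]exchange_big -sumrN; congr EFin; apply: eq_bigr => j _; rewrite mulr_suml -sumrN.
    by apply: eq_bigr => i _; rewrite !mulNr opprK.
  apply: filterS hell => x hx Ox; have /andP[hh _] := hx Ox (\row_i grad z i (x, r)).
  move: hh; rewrite sqr_sqrtr; last by apply: sumr_ge0 => i _; rewrite sqr_ge0.
  rewrite (eq_bigr (fun i => grad z i (x, r) ^+ 2)); last by move=> i _; rewrite mxE.
  move/le_trans; apply; apply: eqW.
  by apply: eq_bigr => i _; apply: eq_bigr => j _; rewrite !mxE.
have b2 : 2 * ipO (fun x => low z (x, r)) (fun x => value z (x, r)) <= (Mc ^+ 2 + 1) * nrm (fun x => value z (x, r)).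
  have := ip_young mO ltr01 h2 Lw; rewrite invr1 !mul1r [(Mc ^+ 2 + 1) * _]mulrDl mul1r.
  have : nrm (fun x => low z (x, r)) <= Mc ^+ 2 * nrm (fun x => value z (x, r)).
    rewrite -(sqZ mO Mc Lw); apply: (le_sq mO h2 (L2Z mO Mc Lw)); apply: filterS h4 => x hx Ox.
    by rewrite !normrM normrN ler_wpM2r// (le_trans (hx Ox))// ler_norm.
  move=> k1 k2; apply: (@le_trans _ _ (2 * `|ipO (fun x => low z (x, r)) (fun x => value z (x, r))|)).
    by rewrite ler_pM2l// ler_norm.
  by apply: le_trans k2 _; rewrite lerD2r.
have b3 : 2 * ipS (fun x => robin z v (x, r)) (fun x => trace z (x, r)) <=
    de * bsq (fun x => v (x, r)) + e^-1 * bsq (fun x => trace z (x, r)).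
  have k1 : ipS (fun x => robin z v (x, r)) (fun x => trace z (x, r)) <= ipS (fun x => g (x, r)) (fun x => trace z (x, r)).
    apply: (ae_le_Rintegral mB (L2M mB h5 Lt) (L2M mB h6 Lt)); apply: filterS h10 => x hx Bx.
    rewrite /robin /g opprD mulrDl gerDr mulNr oppr_le0 -mulrA mulr_ge0 ?sqr_ge0//; exact: hx.
  have k2 := ip_young mB e0 h6 Lt.
  have k3 : bsq (fun x => g (x, r)) <= Mb ^+ 2 * bsq (fun x => v (x, r)).
    rewrite -(sqZ mB Mb h8); apply: (le_sq mB h6 (L2Z mB Mb h8)); apply: filterS h9 => x hx Ox.
    by rewrite /g normrN !normrM ler_wpM2r// (le_trans (hx Ox))// ler_norm.
  have k4 : e * bsq (fun x => g (x, r)) <= de * bsq (fun x => v (x, r)).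
    apply: le_trans (ler_wpM2l (ltW e0) k3) _; rewrite mulrA ler_wpM2r ?sq_ge0//.
    by rewrite /e mulrAC ler_pdivrMr// ler_wpM2l ?(ltW de0)// lerDl.
  apply: (@le_trans _ _ (2 * `|ipS (fun x => g (x, r)) (fun x => trace z (x, r))|)).
    by rewrite ler_pM2l//; apply: le_trans k1 (ler_norm _).
  by apply: le_trans k2 _; rewrite lerD2r.
have b4 := ht a _ _ _ a0 (H1_L2H h3) h7.
have b5 : e^-1 * bsq (fun x => trace z (x, r)) <= e^-1 * ct * (1 + n%:R * a) * nrm (fun x => value z (x, r)) + LamA * gsq (fun i x => grad z i (x, r)).
  apply: le_trans (ler_wpM2l _ b4) _; first by rewrite invr_ge0 ltW.
  by rewrite mulrA mulrDr !mulrA lerD2l ler_wpM2r// gsq_ge0.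
rewrite /wform [(_ + _ + _ * _) * _]mulrDl; move: b1 b2 b3 b5.
move: (\sum_j _) (ipO _ _) (ipS _ _) (LamA * _) (de * _) (e^-1 * bsq _) => x1 x2 x3 x4 x5 x6.
by move: ((Mc ^+ 2 + 1) * _) (e^-1 * ct * _ * _) => x7 x8 *; lra.
Qed.

Local Notation lin := lin_state.

Local Notation G z := (fun r => gsq (fun i x => grad z i (x, r))).

Definition gradsq (z : @trajectory R n) : R := \sum_i sqnorm lamQ Q (grad z i).

Let JI s t : 0 < s -> t < T -> J s t `<=` I.
Proof. by move=> s0 tT r; rewrite /= !in_itv/= => /andP[r1 r2]; rewrite (lt_trans s0 r1) (le_lt_trans r2 tT). Qed.

(** The energy estimates live on []s, t]] with [0 < s < t < T]; monotone convergence along an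
    exhaustion reaches the whole interval. *)
Lemma interior_limit (g : RR -> R) (C : R) : lam.-integrable I (EFin \o g) -> (forall r, I r -> 0 <= g r) ->
  (forall s t, 0 < s -> s < t -> t < T -> \int[lam]_(r in J s t) g r <= C) -> \int[lam]_(r in I) g r <= C.
Proof.
move=> jg g0 h; pose a k : R := T / 3 / k.+1%:R.
have a0 k : 0 < a k by rewrite !divr_gt0.
have aT k : a k <= T / 3.
  by rewrite /a ler_pdivrMr// ler_peMr ?divr_ge0 ?(ltW T0)// ler1n.
pose F k := J (a k) (T - a k).
have FI k : F k `<=` I by apply: JI; [exact: a0|rewrite gtrBl; exact: a0].
have mg k : measurable_fun (F k) (EFin \o g) by apply: (measurable_funS mIT (FI k)); exact: (measurable_int _ jg).
have Fmono : {homo F : i j / (i <= j)%N >-> (i <= j)%O}.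
  move=> i j ij; apply/subsetPset => r; rewrite /F /= !in_itv/= => /andP[r1 r2].
  have aij : a j <= a i by rewrite /a ler_wpM2l ?divr_ge0 ?(ltW T0)// lef_pV2 ?posrE// ler_nat.
  by rewrite (le_lt_trans aij r1) (le_trans r2)// lerD2l lerN2.
have cF := @ge0_nondecreasing_set_cvg_integral _ RR R F (EFin \o g) lam Fmono (fun k => mJ _ _) mg
  (fun k r Fr => ltac:(by rewrite /=; exact: g0 (FI k r Fr))).
have FU : \bigcup_k F k = I.
  apply/seteqP; split=> [r [k _]|r Ir]; first exact: FI.
  have [r0 rT] : 0 < r /\ r < T by move: Ir; rewrite/=/= => /andP.
  pose x := Num.min r (T - r); have x0 : 0 < x by rewrite lt_min r0 subr_gt0.
  pose k := Num.truncn (T / 3 / x); exists k => //.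
  have ax : a k < x.
    rewrite /a ltr_pdivrMr// -ltr_pdivrMl// mulrC; exact: truncnS_gt.
  have : a k < Num.min r (T - r) by [].
  by rewrite lt_min /F /= in_itv/= => /andP[-> h2]; rewrite lerBrDr addrC -lerBrDr ltW.
rewrite FU in cF; rewrite -lee_fin fineK ?(integrable_fin_num mIT jg)//.
rewrite -(cvg_lim _ cF)//; apply: lime_le; first by apply/cvg_ex; eexists; exact: cF.
apply: nearW => k; have jk := integrableS mIT (mJ _ _) (FI k) jg.
rewrite -(fineK (integrable_fin_num (mJ _ _) jk)); apply: h; [exact: a0| |by rewrite gtrBl].
by have := aT k; have := T0; lra.
Qed.

Lemma G_intble z : in_W Om sigma T z -> lam.-integrable I (fun r => (G z r)%:E).
Proof. by move=> zW; apply: (intble_sum mIT) => i; exact: (sq_slice_intble sO mO mIT (grad_L2 zW i)). Qed.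

Lemma gradsqE z : in_W Om sigma T z -> gradsq z = \int[lam]_(r in I) G z r.
Proof.
move=> zW; rewrite /gradsq (Rint_sum _ mIT (fun i => sq_slice_intble sO mO mIT (grad_L2 zW i))).
by apply: eq_bigr => i _; exact: (sq_slice sO mO mIT (grad_L2 zW i)).
Qed.

Lemma energy_int z s t : in_W Om sigma T z -> 0 < s -> t < T ->
  \int[lam]_(r in J s t) nrm (fun x => value z (x, r)) = \int[lam]_(r in J s t) energy z r.
Proof.
move=> zW s0 tT; have j1 := integrableS mIT (mJ s t) (JI s0 tT) (sq_slice_intble sO mO mIT (value_L2 zW)).
have j2 := J_intble s t (energy_cont zW).
have h : \forall r \ae lam, J s t r -> nrm (fun x => value z (x, r)) = energy z r.
  apply: (aeS (aeI (slice_at zW) (L2_slice sO mO mIT (value_L2 zW)))) => r [h1 h2] Jr.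
  have Ir := JI s0 tT Jr; have : 0 <= r <= T by move: Ir; rewrite/=/= => /andP[/ltW -> /ltW ->].
  move=> rT; have [r0 r1] := andP rT; rewrite /energy clamp_id//.
  exact: (sq_ae mO (h2 Ir) (at_L2 zW rT) (h1 Ir)).
apply/eqP; rewrite eq_le; apply/andP; split; apply: (ae_le_Rintegral (mJ s t)) => //.
  by apply: (aeS h) => r hr /hr ->.
by apply: (aeS h) => r hr /hr ->.
Qed.

Lemma energy_ineq (de : R) : 0 < de -> exists2 K, 0 < K & forall v z, L2 lamS Sig v -> lin v z ->
  forall s t, 0 < s -> s < t -> t < T -> energy z t + LamA * \int[lam]_(r in J s t) G z r <=
    energy z s + K * \int[lam]_(r in J s t) nrm (fun x => value z (x, r)) + de * sqnorm lamS Sig v.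
Proof.
move=> de0; have [K K0 hK] := form_bound de0; exists K => // v z Lv lz s t s0 st tT.
have [zW _ _] := lz; have hE := energy_lin Lv lz s0 st tT.
have jJ g : lam.-integrable I (EFin \o g) -> lam.-integrable (J s t) (EFin \o g).
  by apply: integrableS; [exact: mIT|exact: mJ|exact: JI].
have jN := sq_slice_intble sO mO mIT (value_L2 zW); have jV := sq_slice_intble sS mB mIT Lv; have jG := G_intble zW.
have jF := form_intble (fieldsW zW) Lv.
have j1 := intbleD (mJ s t) (intbleZ (mJ s t) K (jJ _ jN)) (intbleZ (mJ s t) de (jJ _ jV)).
have j2 := intbleB (mJ s t) j1 (intbleZ (mJ s t) LamA (jJ _ jG)).
have := ae_le_Rintegral (mJ s t) (intbleZ (mJ s t) 2 (jJ _ jF)) j2.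
rewrite (RintegralZl _ (mJ s t) (jJ _ jF)) (RintegralB (mJ s t) j1 (intbleZ (mJ s t) LamA (jJ _ jG))).
rewrite (RintegralD (mJ s t) (intbleZ (mJ s t) K (jJ _ jN)) (intbleZ (mJ s t) de (jJ _ jV))).
rewrite (RintegralZl _ (mJ s t) (jJ _ jN)) (RintegralZl _ (mJ s t) (jJ _ jV)) (RintegralZl _ (mJ s t) (jJ _ jG)) => hF.
have {}hF := hF (aeS (hK v z Lv lz) (fun r h Jr => h (JI s0 tT Jr))).
have hV : \int[lam]_(r in J s t) bsq (fun x => v (x, r)) <= sqnorm lamS Sig v.
  rewrite (sq_slice sS mB mIT Lv); apply: Rint_subset; [exact: mJ|by []|exact: JI|exact: jV|].
  by move=> r _; exact: sq_ge0.
have := ler_wpM2l (ltW de0) hV; move: hE hF.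
lra.
Qed.

Lemma energy0 v z : lin v z -> energy z 0 = 0.
Proof.
move=> [zW _ h]; rewrite /energy clamp_id ?(ltW T0)//.
have L0 : L2O (at_time z 0) by apply: (at_L2 zW); rewrite lexx ltW.
by have [] := ae_sq0 mO (L2_meas L0) h.
Qed.

(** Gronwall for the energy, after the gradient term has been discarded; the initial energy is 0. *)
Lemma apriori1 : exists2 K, 0 < K & forall v z, L2 lamS Sig v -> lin v z -> sqnorm lamQ Q (value z) <= K * sqnorm lamS Sig v.
Proof.
have [K K0 hK] := energy_ineq ltr01; have L0 : 0 < LamA by have [] := ell.
exists (T * (2 * expR (2 * K * T))); first by rewrite !mulr_gt0// expR_gt0.
move=> v z Lv lz; have [zW _ _] := lz; have V0 := sq_ge0 lamS Sig v.
have hg : forall t, 0 <= t -> t <= T -> energy z t <= 2 * sqnorm lamS Sig v * expR (2 * K * T).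
  apply: gronwall => //; [exact: energy_cont zW|by move=> t; exact: sq_ge0|exact: energy0 lz|].
  move=> s t s0 st tT; rewrite -(energy_int zW s0 tT); have := hK v z Lv lz s t s0 st tT; rewrite mul1r.
  apply: le_trans; rewrite lerDl; apply: mulr_ge0; first exact: ltW.
  by apply: Rintegral_ge0 => r _; exact: gsq_ge0.
rewrite (sq_slice sO mO mIT (value_L2 zW)); apply: interior_limit.
- exact: (sq_slice_intble sO mO mIT (value_L2 zW)).
- by move=> r _; exact: sq_ge0.
move=> s t s0 st tT; rewrite (energy_int zW s0 tT).
have cc : continuous (fun _ : R => 2 * sqnorm lamS Sig v * expR (2 * K * T)) by move=> ?; exact: cvg_cst.
apply: (@le_trans _ _ (\int[lam]_(r in J s t) (2 * sqnorm lamS Sig v * expR (2 * K * T)))).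
  apply: le_Rintegral; [exact: mJ|exact: J_intble (energy_cont zW)|exact: J_intble cc|].
  by move=> r; rewrite /= in_itv/= => /andP[r1 r2]; apply: hg; lra.
rewrite J_cst ?(ltW st)// (_ : T * _ * _ = 2 * sqnorm lamS Sig v * expR (2 * K * T) * T); last by ring.
by rewrite ler_wpM2l ?mulr_ge0//; lra.
Qed.

(** Here the control enters with an arbitrarily small factor [de], at the price of the L2 norm of
    [z]. Once that norm is small by compactness, so are the final value and the trace, and with them
    all terms of the quadratic form but the last. *)
Lemma apriori (de : R) : 0 < de -> exists2 K, 0 < K & forall v z, L2 lamS Sig v -> lin v z ->
  let M := K * sqnorm lamQ Q (value z) + de * sqnorm lamS Sig v in
  [/\ forall t, 0 <= t -> t <= T -> nrm (at_time z t) <= M, gradsq z <= M & sqnorm lamS Sig (trace z) <= M].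
Proof.
move=> de0; have [ct ct0 ht] := trace_eps; have L0 : 0 < LamA by have [] := ell.
(* [C] is the loss in going from the energy to the gradient and from there to the trace; [de] is
   divided by it beforehand. *)
pose C := 1 + (1 + ct) * (2 / LamA).
have C1 : 1 <= C by rewrite lerDl mulr_ge0 ?addr_ge0// divr_ge0// ltW.
have C0 : 0 < C by rewrite (lt_le_trans ltr01).
have [K K0 hK] := energy_ineq (divr_gt0 de0 C0).
exists (C * K + ct * (1 + n%:R)); first by rewrite ltr_wpDr ?mulr_ge0// mulr_gt0.
move=> v z Lv lz M; have [zW _ _] := lz.
have V0 := sq_ge0 lamS Sig v; have Z0 := sq_ge0 lamQ Q (value z).
set V := sqnorm lamS Sig v in M V0 *; set Z := sqnorm lamQ Q (value z) in M Z0 *.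
pose m := K * Z + de / C * V.
have m0 : 0 <= m by apply: addr_ge0; apply: mulr_ge0 => //; [exact: ltW|rewrite ltW// divr_gt0].
have ME : M = C * m + ct * (1 + n%:R) * Z.
  rewrite /M /m; field; by rewrite gt_eqF.
have x0 : 0 <= ct * (1 + n%:R) * Z by rewrite !mulr_ge0.
have mM : m <= M by rewrite ME; apply: le_trans (_ : m <= C * m) _; [rewrite ler_peMl|rewrite lerDl].
have hN s t : 0 < s -> t < T -> \int[lam]_(r in J s t) nrm (fun x => value z (x, r)) <= Z.
  move=> s0 tT; rewrite /Z (sq_slice sO mO mIT (value_L2 zW)); apply: Rint_subset; [exact: mJ|by []|exact: JI| |].
    exact: (sq_slice_intble sO mO mIT (value_L2 zW)).
  by move=> r _; exact: sq_ge0.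
have hE s t : 0 < s -> s < t -> t < T -> energy z t + LamA * \int[lam]_(r in J s t) G z r <= energy z s + m.
  move=> s0 st tT; apply: le_trans (hK v z Lv lz s t s0 st tT) _; rewrite -addrA lerD2l lerD2r ler_pM2l//; exact: hN.
have G0 s t : 0 <= LamA * \int[lam]_(r in J s t) G z r.
  by apply: mulr_ge0; [exact: ltW|apply: Rintegral_ge0 => r _; exact: gsq_ge0].
have cE := energy_cont zW.
have eb : forall t, 0 <= t -> t <= T -> energy z t <= m.
  apply: cont_le_closed => // t t0 tT; rewrite -[leRHS]add0r -(energy0 lz) -lerBlDr -lerN2.
  apply: (@cont_le_closed _ (fun s => - energy z s) 0 t) => //; [by move=> s; apply: cvgN; exact: cE| |exact: ltW].
  by move=> s s0 st; rewrite lerN2 lerBlDr; apply: le_trans (hE s t s0 st tT); rewrite lerDl.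
have gb : gradsq z <= 2 / LamA * m.
  rewrite (gradsqE zW); apply: interior_limit; [exact: G_intble|by move=> r _; exact: gsq_ge0|].
  move=> s t s0 st tT; rewrite mulrAC ler_pdivlMr// mulrC.
  have := hE s t s0 st tT; have := eb s (ltW s0) (ltW (lt_trans st tT)); have := sq_ge0 (leb n) Om (at_time z (clamp t)).
  by rewrite -/(energy z t); lra.
split.
- by move=> t t0 tT; have := eb t t0 tT; rewrite /energy clamp_id// => h; exact: le_trans mM.
- apply: le_trans gb _; rewrite ME; apply: le_trans (_ : _ <= C * m) _; last by rewrite lerDl.
  rewrite ler_wpM2r// /C.
  have : 0 <= 2 / LamA by rewrite divr_ge0// ltW.
  by move: (2 / LamA) => y y0; have := mulr_ge0 ct0 y0; lra.
have -> : sqnorm lamS Sig (trace z) = \int[lam]_(r in I) bsq (fun x => trace z (x, r)) by exact: (sq_slice sS mB mIT (trace_L2S zW)).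
have jN := sq_slice_intble sO mO mIT (value_L2 zW); have jG := G_intble zW.
have j1 := intbleD mIT (intbleZ mIT (ct * (1 + n%:R)) jN) (intbleZ mIT ct jG).
apply: le_trans (ae_le_Rintegral mIT (sq_slice_intble sS mB mIT (trace_L2S zW)) j1 _) _.
  apply: (aeS (aeI (slice_H1 zW) (slice_trace zW))) => r [h1 h2] Ir.
  by have := ht 1 _ _ _ ltr01 (H1_L2H (h1 Ir)) (h2 Ir); rewrite mulr1 invr1 mul1r mulrDr mulrA.
rewrite (RintegralD mIT (intbleZ mIT (ct * (1 + n%:R)) jN) (intbleZ mIT ct jG)) (RintegralZl _ mIT jN) (RintegralZl _ mIT jG).
rewrite -(gradsqE zW) -(sq_slice sO mO mIT (value_L2 zW)) -/Z ME addrC lerD2r.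
apply: le_trans (ler_wpM2l ct0 gb) _; rewrite mulrA ler_wpM2r// /C.
have : 0 <= 2 / LamA by rewrite divr_ge0// ltW.
by lra.
Qed.

Local Notation V v := (sqnorm lamS Sig v).

Lemma total_bound : exists2 C, 0 < C & forall v z, L2 lamS Sig v -> lin v z ->
  [/\ sqnorm lamQ Q (value z) <= C * V v, forall i, sqnorm lamQ Q (grad z i) <= C * V v, sqnorm lamS Sig (trace z) <= C * V v,
    gradsq z <= C * V v & forall t, 0 <= t -> t <= T -> nrm (at_time z t) <= C * V v].
Proof.
have [K1 K10 h1] := apriori1; have [K2 K20 h2] := apriori ltr01.
exists (K1 + (K2 * K1 + 1)); first by rewrite !addr_gt0// mulr_gt0.
move=> v z Lv lz; have a1 := h1 v z Lv lz; have [a2 a3 a4] := h2 v z Lv lz; have V0 := sq_ge0 lamS Sig v.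
have b1 : K1 * V v <= (K1 + (K2 * K1 + 1)) * V v by rewrite ler_wpM2r// lerDl addr_ge0// mulr_ge0// ltW.
have b2 : K2 * sqnorm lamQ Q (value z) + 1 * V v <= (K1 + (K2 * K1 + 1)) * V v.
  rewrite [leRHS]mulrDl [X in _ <= _ + X]mulrDl -[leLHS]add0r lerD ?mulr_ge0 ?(ltW K10)// lerD2r -mulrA ler_pM2l//.
split.
- exact: le_trans b1.
- move=> i; apply: le_trans b2; apply: le_trans a3; rewrite /gradsq (bigD1 i)//= lerDl.
  by apply: sumr_ge0 => j _; exact: sq_ge0.
- exact: le_trans b2.
- exact: le_trans b2.
- by move=> t t0 tT; apply: le_trans b2; exact: a2.
Qed.

(** * Compactness of the map from controls to states *)

Lemma L2_sq_sum (K : Type) (s : seq K) (F : K -> E * RR -> R) : (forall k, L2 lamQ Q (F k)) ->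
  sqnorm lamQ Q (fun q => \sum_(k <- s) F k q) <= 2 ^+ size s * \sum_(k <- s) sqnorm lamQ Q (F k).
Proof.
move=> LF; have jF k : lamQ.-integrable Q (fun q => (F k q ^+ 2)%:E) by have [] := LF k.
rewrite -(Rint_sum s mQ jF) -(RintegralZl _ mQ (intble_sum mQ s jF)).
apply: le_Rintegral => //; [by have [] := L2_sum mQ s LF|exact: (intbleZ mQ _ (intble_sum mQ s jF))|].
by move=> q _; exact: sqr_sum_le.
Qed.

Lemma fields_sq : exists2 C, 0 <= C & forall v z, L2 lamS Sig v -> L2fields z ->
  [/\ forall j, sqnorm lamQ Q (flux z j) <= C * gradsq z, sqnorm lamQ Q (low z) <= C * sqnorm lamQ Q (value z) &
    sqnorm lamS Sig (robin z v) <= C * (sqnorm lamS Sig (trace z) + V v)].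
Proof.
have [Cc Cc0 hc] := Linfty_sq mQ Lc; have [Cu Cu0 hu] := Linfty_sq mS Lu; have [Cb Cb0 hb] := Linfty_sq mS Lb.
have hyp (ij : 'I_n * 'I_n) : exists C : R, 0 <= C /\ forall g, L2 lamQ Q g ->
    sqnorm lamQ Q (fun q => - A ij.1 ij.2 q.1 * g q) <= C * sqnorm lamQ Q g.
  by have [C ? ?] := Linfty_sq mQ (Linfty_A ij.1 ij.2); exists C.
have [CA hA] := choice hyp; pose M := \sum_ij CA ij; pose N : R := 2 ^+ size (index_enum 'I_n).
have M0 : 0 <= M by apply: sumr_ge0 => ij _; have [] := hA ij.
have MA ij : CA ij <= M by rewrite /M (bigD1 ij)//= lerDl; apply: sumr_ge0 => k _; have [] := hA k.
have N0 : 0 <= N by rewrite exprn_ge0.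
have NM : 0 <= N * M by rewrite mulr_ge0.
exists (N * M + Cc + (2 * Cu + 2 * Cb)); first by rewrite !addr_ge0// mulr_ge0.
move=> v z Lv [zv zg zt]; have V0 := sq_ge0 lamS Sig v; have t0 := sq_ge0 lamS Sig (trace z).
split.
- move=> j; apply: le_trans (L2_sq_sum _ (fun i => L2_bM mQ (Linfty_A i j) (zg i))) _.
  have g0 : 0 <= gradsq z by apply: sumr_ge0 => i _; exact: sq_ge0.
  apply: (@le_trans _ _ (N * M * gradsq z)); last by rewrite ler_wpM2r// -addrA lerDl !addr_ge0// mulr_ge0.
  rewrite -mulrA ler_wpM2l// mulr_sumr; apply: ler_sum => i _; have [h3 h4] := hA (i, j).
  by apply: le_trans (h4 _ (zg i)) _; rewrite ler_wpM2r// sq_ge0.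
- rewrite (_ : low z = (fun q => -1 * (c q * value z q))); last by apply/funext => q; rewrite /low mulN1r mulNr.
  rewrite (sqZ mQ _ (L2_bM mQ Lc zv)) sqrrN expr1n mul1r; apply: le_trans (hc _ zv) _; rewrite ler_wpM2r ?sq_ge0//.
  by rewrite -addrA addrCA lerDl !addr_ge0// mulr_ge0.
rewrite (sqN lamS Sig (fun q => u q * trace z q + b q * v q)).
apply: le_trans (sqD_le mS (L2_bM mS Lu zt) (L2_bM mS Lb Lv)) _.
have k1 := hu _ zt; have k2 := hb _ Lv; have k3 := mulr_ge0 NM V0; have k4 := mulr_ge0 NM t0.
have k5 := mulr_ge0 Cu0 V0; have k6 := mulr_ge0 Cb0 t0; have k7 := mulr_ge0 Cc0 V0; have k8 := mulr_ge0 Cc0 t0.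
move: k1 k2 k3 k4 k5 k6 k7 k8; move: (N * M) (sqnorm lamS Sig (trace z)) (V v) => x y w.
move: (sqnorm _ _ _) (sqnorm _ _ _) => p q; rewrite (_ : (x + Cc + (2 * Cu + 2 * Cb)) * (y + w) =
  x * w + x * y + Cc * w + Cc * y + 2 * (Cu * w) + 2 * (Cu * y) + 2 * (Cb * w) + 2 * (Cb * y)); last by ring.
by move: (x * w) (x * y) (Cc * w) (Cc * y) (Cu * w) (Cu * y) (Cb * w) (Cb * y) => *; lra.
Qed.

(** By the equation, the time derivative tested with a fixed smooth function is a sum of pairings of
    flux, lower-order and Robin terms, each square integrable in time. *)
Lemma dt_pairing (f : smoothfun) : exists2 C, 0 <= C & forall v z, L2 lamS Sig v -> lin v z ->
  sqnorm lam I (fun r => dt z r (sval f)) <= C * V v.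
Proof.
have [C0 C00 hC] := total_bound; have [Cf Cf0 hF] := fields_sq.
case: f => f sf /=; have hf := smooth_H1 sf; have ht := trace_smooth sf.
have [Lf LD _] := hf; have Lt := trace_L2 ht; pose N : R := 2 ^+ size (index_enum 'I_n).
exists (3 * (N * (\sum_j Cf * (C0 * nrm (partial j f))) + Cf * C0 * nrm f + Cf * (C0 + 1) * bsq f)).
  have p0 : 0 <= C0 := ltW C00.
  rewrite mulr_ge0// !addr_ge0// ?mulr_ge0 ?sq_ge0 ?addr_ge0 ?exprn_ge0//.
  by apply: sumr_ge0 => j _; apply: mulr_ge0 => //; apply: mulr_ge0 => //; exact: sq_ge0.
move=> v z Lv lz; have [zW _ _] := lz; have [h1 h2 h3 h4 _] := hC v z Lv lz; have V0 := sq_ge0 lamS Sig v.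
have fz := fieldsW zW; have [F1 F2 F3] := hF v z Lv fz.
have P1 j := slice_pairing_L2 mO sO T0 (L2_flux j fz) (LD j).
have [P2 P2'] := slice_pairing_L2 mO sO T0 (L2_low fz) Lf.
have [P3 P3'] := slice_pairing_L2 mB sS T0 (L2_robin fz Lv) Lt.
pose p2 (r : RR) := ipO (fun x => low z (x, r)) f; pose p3 (r : RR) := ipS (fun x => robin z v (x, r)) f.
pose q1 j (r : RR) := ipO (fun x => flux z j (x, r)) (partial j f).
have Lq j : L2 lam I (q1 j) by have [] := P1 j.
have Ls : L2 lam I (fun r => \sum_j q1 j r) by exact: (L2_sum mIT).
have e1 : sqnorm lam I (fun r => dt z r f) = sqnorm lam I (fun r => \sum_j q1 j r + p2 r + p3 r).
  apply: (sq_ae mIT (dt_L2 zW hf) (L2D mIT (L2D mIT Ls P2) P3)).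
  by apply: (aeS (lin_form lz)) => r h Ir; rewrite (h Ir _ _ _ hf ht).
rewrite e1; have s3 : sqnorm lam I (fun r => \sum_j q1 j r + p2 r + p3 r) <=
    3 * (sqnorm lam I (fun r => \sum_j q1 j r) + sqnorm lam I p2 + sqnorm lam I p3).
  have [j1 j2 j3] : [/\ lam.-integrable I (fun r => ((\sum_j q1 j r) ^+ 2)%:E), lam.-integrable I (fun r => (p2 r ^+ 2)%:E)
    & lam.-integrable I (fun r => (p3 r ^+ 2)%:E)] by split; [have [] := Ls|have [] := P2|have [] := P3].
  rewrite -(RintegralD mIT j1 j2) -(RintegralD mIT (intbleD mIT j1 j2) j3) -(RintegralZl _ mIT (intbleD mIT (intbleD mIT j1 j2) j3)).
  apply: le_Rintegral => //; [by have [] := L2D mIT (L2D mIT Ls P2) P3|exact: (intbleZ mIT 3 (intbleD mIT (intbleD mIT j1 j2) j3))|].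
  by move=> r _; exact: sqr3_le.
apply: le_trans s3 _; rewrite -[3 * _ * _]mulrA ler_pM2l// !mulrDl; apply: lerD; first apply: lerD.
- have jq j : lam.-integrable I (fun r => (q1 j r ^+ 2)%:E) by have [] := Lq j.
  apply: (@le_trans _ _ (N * \sum_j sqnorm lam I (q1 j))).
    rewrite -(Rint_sum _ mIT jq) -(RintegralZl _ mIT (intble_sum mIT _ jq)).
    apply: le_Rintegral => //; [by have [] := Ls|exact: (intbleZ mIT _ (intble_sum mIT _ jq))|].
    by move=> r _; exact: sqr_sum_le.
  rewrite -mulrA ler_pM2l ?exprn_gt0// mulr_suml; apply: ler_sum => j _; have [_ hj] := P1 j.
  apply: le_trans hj _; rewrite (_ : _ * _ * V v = Cf * (C0 * V v) * nrm (partial j f)); last by ring.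
  by rewrite ler_wpM2r ?sq_ge0//; apply: le_trans (F1 j) _; exact: ler_wpM2l.
- apply: le_trans P2' _; rewrite [leRHS]mulrAC ler_wpM2r ?sq_ge0// -mulrA.
  by apply: le_trans F2 _; exact: ler_wpM2l.
apply: le_trans P3' _; rewrite [leRHS]mulrAC ler_wpM2r ?sq_ge0// -mulrA.
by apply: le_trans F3 _; apply: ler_wpM2l => //; rewrite mulrDl mul1r lerD2r.
Qed.

Lemma compactness (eps : R) : 0 < eps -> exists (S : seq smoothfun) (ts : seq R) (C : R),
  [/\ forall t, t \in ts -> 0 < t < T, 0 <= C & forall v z, L2 lamS Sig v -> lin v z -> sqnorm lamQ Q (value z) <=
    eps * V v + C * \sum_(f <- S) \sum_(t <- ts) ipO (at_time z t) (sval f) ^+ 2].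
Proof.
move=> e0; have [C0 C00 hC] := total_bound.
(* [C0] bounds both the value and the gradient, so the [H1] part of the Ehrling inequality costs
   [eps / 2] after integration in time. *)
have e1 : 0 < eps / (4 * C0) by rewrite divr_gt0// mulr_gt0.
have [S [C1 [C10 hS]]] := ehrling e1.
have [CD hD] := choice (fun f => let: ex_intro2 C C0 h := dt_pairing f in ex_intro (fun C => 0 <= C /\ forall v z, L2 lamS Sig v -> lin v z ->
  sqnorm lam I (fun r => dt z r (sval f)) <= C * V v) C (conj C0 h)).
pose B := 2 * C1 * T * T * \sum_(f <- S) CD f.
have B0 : 0 <= B by rewrite !mulr_ge0 ?(ltW T0)//; apply: sumr_ge0 => f _; have [] := hD f.
(* The cells are so short that the time increments of all functionals together cost at most
   [eps / 2]. *)
pose N := (Num.truncn (2 * B / eps)).+1.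
have BN : B / N%:R <= eps / 2.
  rewrite ler_pdivrMr// -ler_pdivrMl ?divr_gt0// invf_div mulrC mulrA mulrAC.
  by apply: le_trans (ltW (truncnS_gt _)); rewrite mulrC mulrA.
pose tt (i : nat) : R := T * (i.+1%:R / N.+1%:R).
have tt0 i : (i < N)%N -> 0 < tt i < T.
  rewrite mulr_gt0//= /tt gtr_pMr// ltr_pdivrMr// mul1r ltr_nat ltnS//.
exists S, [seq tt i | i <- iota 0 N], (2 * T * C1); split.
- by move=> t /mapP[i]; rewrite mem_iota => /andP[_ iN] ->; exact: tt0.
- by rewrite !mulr_ge0// ltW.
move=> v z Lv lz; have [zW _ _] := lz; have V0 := sq_ge0 lamS Sig v; have [h1 _ _ h4 _] := hC v z Lv lz.
pose psi (f : smoothfun) (t : R) := ipO (at_time z t) (sval f).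
(* Cauchy-Schwarz in the time formula: the functionals of the state are 1/2-Hoelder continuous in
   time, so each is controlled by its values on the grid. *)
have hosc f s t : 0 < s -> s < t -> t < T -> (psi f t - psi f s) ^+ 2 <= (t - s) * (CD f * V v).
  move=> s0 st tT; have hf := smooth_H1 (svalP f); rewrite (time_formula zW hf s0 st tT).
  apply: le_trans (J_int_sq (dt_L2 zW hf) s0 st tT) _.
  by rewrite ler_pM2l ?subr_gt0//; have [_ h] := hD f; exact: h.
have near r (rT : 0 < r < T) := grid_near T0 rT (ltn0Sn (Num.truncn (2 * B / eps))).
pose P f := \sum_(t <- [seq tt i | i <- iota 0 N]) psi f t ^+ 2.
have psiP f r : 0 < r < T -> psi f r ^+ 2 <= 2 * P f + 2 * (T / N%:R * (CD f * V v)).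
  move=> rT; have [i iN hi] := near r rT; have [CD0 _] := hD f.
  have k0 : 0 <= CD f * V v by rewrite mulr_ge0.
  have d1 : (psi f r - psi f (tt i)) ^+ 2 <= T / N%:R * (CD f * V v).
    have [[r0 r1] [t0 t1]] := (andP rT, andP (tt0 i iN)).
    apply: (@le_trans _ _ (`|r - tt i| * (CD f * V v))); last exact: ler_wpM2r.
    case: (ltgtP r (tt i)) => h.
    - by rewrite -sqrrN opprB distrC gtr0_norm ?subr_gt0//; exact: hosc.
    - by rewrite gtr0_norm ?subr_gt0//; exact: hosc.
    - by rewrite h !subrr normr0 mul0r expr0n.
  have d2 : psi f (tt i) ^+ 2 <= P f.
    rewrite /P big_map -[iota 0 N]/(index_iota 0 N) big_mkord (bigD1 (Ordinal iN))//= lerDl.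
    by apply: sumr_ge0 => j _; exact: sqr_ge0.
  have d3 := sqr_ge0 (psi f r - 2 * psi f (tt i)).
  move: d1 d2; rewrite !sqrrB in d3 *; move: d3; rewrite exprMn; move: (P f) (T / _ * _) => x y.
  rewrite (_ : 2 ^+ 2 = 4); last by ring.
  by rewrite mulrCA; move: (psi f r ^+ 2) (psi f _ ^+ 2) (psi f r * _) => *; lra.
have jN := sq_slice_intble sO mO mIT (value_L2 zW); have jG := G_intble zW.
pose K := C1 * \sum_(f <- S) (2 * P f + 2 * (T / N%:R * (CD f * V v))).
have jK : lam.-integrable I (fun _ : RR => K%:E) by apply: integrable_cst_fin; [exact: mIT|exact: I_fin].
have j1 := intbleZ mIT (eps / (4 * C0)) (intbleD mIT jN jG).
have hb : sqnorm lamQ Q (value z) <= eps / (4 * C0) * (sqnorm lamQ Q (value z) + gradsq z) + K * T.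
  rewrite (gradsqE zW) (sq_slice sO mO mIT (value_L2 zW)) -(RintegralD mIT jN jG) -(RintegralZl _ mIT (intbleD mIT jN jG)).
  have -> : K * T = \int[lam]_(r in I) K.
    by rewrite /Rintegral integral_cst//= lebesgue_measure_itv/= lte_fin T0 -EFinB subr0.
  rewrite -(RintegralD mIT j1 jK); apply: (ae_le_Rintegral mIT jN (intbleD mIT j1 jK)).
  apply: (aeS (aeI (slice_H1 zW) (slice_at zW))) => r [h5 h6] Ir; have {}h5 := h5 Ir.
  have rT : 0 < r < T by [].
  apply: le_trans (hS _ _ h5) _; rewrite lerD2l ler_wpM2l//; apply: ler_sum => f _.
  have [Lw _ _] := h5; have [Lf _ _] := smooth_H1 (svalP f).
  have rT' : 0 <= r <= T by have /andP[? ?] := rT; rewrite !ltW.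
  rewrite (_ : ipO _ _ = psi f r); first exact: psiP.
  by apply/esym; apply: (ip_ae mO (at_L2 zW rT') Lw Lf); apply: (ae_imp (m := leb n) (h6 Ir)) => x hx /hx ->.
apply: le_trans hb _.
have c1 : eps / (4 * C0) * (sqnorm lamQ Q (value z) + gradsq z) <= eps / 2 * V v.
  apply: (@le_trans _ _ (eps / (4 * C0) * (C0 * V v + C0 * V v))).
    by rewrite ler_pM2l// lerD.
  by apply: eqW; field; rewrite gt_eqF.
have c2 : K * T <= eps / 2 * V v + 2 * T * C1 * \sum_(f <- S) P f.
  have -> : K * T = B / N%:R * V v + 2 * T * C1 * \sum_(f <- S) P f.
    rewrite (_ : K = C1 * (2 * (T / N%:R) * V v * \sum_(f <- S) CD f + 2 * \sum_(f <- S) P f)); first by rewrite /B; ring.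
    congr (_ * _); rewrite big_split /= addrC !mulr_sumr; congr (_ + _); apply: eq_bigr => f _; ring.
  by rewrite lerD2r ler_wpM2r.
have -> : eps * V v = eps / 2 * V v + eps / 2 * V v by field.
by rewrite -addrA; exact: lerD.
Qed.

(** * States assembled from fields: combinations and limits *)

Local Notation form := wform.
Local Notation fields := L2fields.

Lemma L2_wform v z w Dw tw : L2 lamS Sig v -> fields z -> L2O w -> (forall j, L2O (Dw j)) -> L2 sigma (bdry Om) tw ->
  L2 lam I (fun r => form z v r w Dw tw).
Proof.
move=> Lv fz Lw LD Lt; apply: (L2D mIT).
  apply: (L2D mIT); last by have [] := slice_pairing_L2 mO sO T0 (L2_low fz) Lw.
  by apply: (L2_sum mIT) => j; have [] := slice_pairing_L2 mO sO T0 (L2_flux j fz) (LD j).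
by have [] := slice_pairing_L2 mB sS T0 (L2_robin fz Lv) Lt.
Qed.

(** The time derivative acts on [w] alone, while the form also takes a gradient and a trace. For the
    form to define a functional of [w], it must not depend on their choice. *)
Definition gradient_independent v z := \forall r \ae lam, I r -> forall w Dw tw Dw' tw', H1 Om w Dw -> trace_of Om sigma w Dw tw ->
  H1 Om w Dw' -> trace_of Om sigma w Dw' tw' -> form z v r w Dw tw = form z v r w Dw' tw'.

(** The equation in a shape that does not mention [dt], stable under linear combinations and
    limits. *)
Definition weak_dt v z := forall (th : RR -> R) w Dw tw, test_function I (th : R -> R^o) -> H1 Om w Dw -> trace_of Om sigma w Dw tw ->
  \int[lam]_(r in I) (form z v r w Dw tw * th r) =
  - \int[lam]_(r in I) (ipO (fun x => value z (x, r)) w * derive1 (th : R -> R^o) r).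

Definition same_fields (z z' : @trajectory R n) :=
  [/\ value z = value z', grad z = grad z', trace z = trace z' & at_time z = at_time z'].

(** [dt] is defined by the form itself at a chosen gradient and trace of each [w];
    [gradient_independent] makes it linear, and Cauchy-Schwarz with [trace_eps] bounds it in the
    dual of [H1]. *)
Lemma make_state v z : L2 lamS Sig v -> fields z ->
  (\forall r \ae lam, I r -> H1 Om (fun x => value z (x, r)) (fun i x => grad z i (x, r))) ->
  (\forall r \ae lam, I r -> trace_of Om sigma (fun x => value z (x, r)) (fun i x => grad z i (x, r)) (fun x => trace z (x, r))) ->
  (forall t, 0 <= t <= T -> L2O (at_time z t)) ->
  (\forall t \ae lam, I t -> \forall x \ae leb n, Om x -> at_time z t x = value z (x, t)) ->
  (forall t0 e, 0 <= t0 <= T -> 0 < e -> exists2 d, 0 < d & forall t, 0 <= t <= T -> `|t - t0| < d ->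
     nrm (fun x => at_time z t x - at_time z t0 x) <= e) ->
  (\forall x \ae leb n, Om x -> at_time z 0 x = 0) -> gradient_independent v z -> weak_dt v z ->
  exists z', lin v z' /\ same_fields z' z.
Proof.
move=> Lv fz hH hT La ha hc h0 hi hd; have [zv zg zt] := fz.
(* A function outside [H1] gets the zero pair, so that the choice is total. *)
have ch w : exists p : ('I_n -> E -> R) * (E -> R), (exists Dw, H1 Om w Dw) -> H1 Om w p.1 /\ trace_of Om sigma w p.1 p.2.
  have [[Dw hw]|nw] := pselect (exists Dw, H1 Om w Dw); last by exists (fun _ _ => 0, fun _ => 0) => /nw.
  by have [tw ht] := trace_exists hw; exists (Dw, tw).
have [p hp] := choice ch.
pose z' := Trajectory (value z) (grad z) (trace z) (at_time z) (fun r w => form z v r w (p w).1 (p w).2).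
exists z'; split=> //; have [ct ct0 htr] := trace_eps.
have C0 : 0 <= ct * (1 + n%:R) + ct by rewrite addr_ge0// mulr_ge0.
(* A bound for the dual norm of the form at time [r]; the boundary term carries the constant of
   [trace_eps] with [a = 1]. *)
pose k (r : RR) := \sum_j Num.sqrt (nrm (fun x => flux z j (x, r))) + Num.sqrt (nrm (fun x => low z (x, r))) +
  Num.sqrt (ct * (1 + n%:R) + ct) * Num.sqrt (bsq (fun x => robin z v (x, r))).
have Lk : L2 lam I k.
  apply: (L2D mIT); last exact: (L2Z mIT _ (sq_slice_L2 sS mB mIT (L2_robin fz Lv))).
  apply: (L2D mIT); last exact: (sq_slice_L2 sO mO mIT (L2_low fz)).
  by apply: (L2_sum mIT) => j; exact: (sq_slice_L2 sO mO mIT (L2_flux j fz)).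
have sl := aeI (flux_slices fz) (aeI (L2_slice sO mO mIT (L2_low fz))
  (aeI (L2_slice sS mB mIT (L2_robin fz Lv)) hi)).
have zW : in_W Om sigma T z'.
  split.
  - by [].
  - split.
    + move=> w Dw hw; have [[Lw LD _] ht] := hp w (ex_intro _ Dw hw).
      by have [] := L2_wform Lv fz Lw LD (trace_L2 ht).
    + exists k => //; apply: (aeS sl) => r [h1 [h2 [h3 h4]]] Ir.
      have {}h1 := h1 Ir; have {}h2 := h2 Ir; have {}h3 := h3 Ir; have {}h4 := h4 Ir; split=> /=.
        move=> w1 Dw1 w2 Dw2 a hw1 hw2; have [g1 t1] := hp w1 (ex_intro _ _ hw1); have [g2 t2] := hp w2 (ex_intro _ _ hw2).
        have g3 := H1_lin a g1 g2; have t3 := trace_lin a (H1_L2H g1) (H1_L2H g2) t1 t2.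
        have [g4 t4] := hp _ (ex_intro _ _ g3); rewrite (h4 _ _ _ _ _ g4 t4 g3 t3).
        have [Lw1 LD1 _] := g1; have [Lw2 LD2 _] := g2.
        rewrite -[LHS]/(pair3 (leb n) sigma Om (bdry Om) _ _ _ _ _ _) /form.
        have sw (F G : 'I_n -> E -> R) F0 G0 F1 G1 : pair3 (leb n) sigma Om (bdry Om) F G F0 G0 F1 G1 = pair3 (leb n) sigma Om (bdry Om) G F G0 F0 G1 F1.
          by rewrite /pair3 [ipO F0 _]ipC [ipS F1 _]ipC; congr (_ + _ + _); apply: eq_bigr => j _; exact: ipC.
        rewrite sw (pair3_lin mO mB a LD1 LD2 h1 Lw1 Lw2 h2 (trace_L2 t1) (trace_L2 t2) h3); congr (_ * _ + _); exact: sw.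
      move=> w Dw hw; have [g1 t1] := hp w (ex_intro _ _ hw); have [tw t2] := trace_exists hw.
      rewrite (h4 _ _ _ _ _ g1 t1 hw t2) /wform; have [Lw LD _] := hw; have Lt := trace_L2 t2.
      have hn : H1norm Om w Dw = Num.sqrt (h1sq w Dw) by [].
      have s1 x : x <= h1sq w Dw -> Num.sqrt x <= H1norm Om w Dw by move=> hx; rewrite hn ler_sqrt// h1sq_ge0.
      have sD j : Num.sqrt (nrm (Dw j)) <= H1norm Om w Dw.
        apply: s1; rewrite /h1sq /gsq (bigD1 j)//= addrCA lerDl addr_ge0 ?sq_ge0//.
        by apply: sumr_ge0 => i _; exact: sq_ge0.
      have sw : Num.sqrt (nrm w) <= H1norm Om w Dw by apply: s1; rewrite lerDl gsq_ge0.
      have st : Num.sqrt (bsq tw) <= Num.sqrt (ct * (1 + n%:R) + ct) * H1norm Om w Dw.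
        rewrite hn -sqrtrM// ler_sqrt ?mulr_ge0 ?h1sq_ge0//.
        have := htr 1 _ _ _ ltr01 (H1_L2H hw) t2; rewrite mulr1 invr1 mul1r => /le_trans; apply.
        rewrite mulrDr mulrA [(_ + ct) * (_ + _)]mulrDr; apply: lerD; last by rewrite ler_wpM2r ?gsq_ge0// lerDr mulr_ge0.
        by rewrite ler_wpM2r ?sq_ge0// lerDl.
      rewrite /k !mulrDl mulr_suml; apply: le_trans (ler_normD _ _) _; apply: lerD; last first.
        apply: le_trans (ip_le mB h3 Lt) _; rewrite [_ * _ * _ _ _]mulrAC [leRHS]mulrC.
        by rewrite ler_wpM2l//.
      apply: le_trans (ler_normD _ _) _; apply: lerD; last first.
        by apply: le_trans (ip_le mO h2 Lw) _; rewrite ler_wpM2l//.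
      apply: le_trans (ler_norm_sum _ _ _) _; apply: ler_sum => j _.
      by apply: le_trans (ip_le mO (h1 j) (LD j)) _; rewrite ler_wpM2l//.
    + move=> th w Dw hth hw; have [g1 t1] := hp w (ex_intro _ _ hw).
      exact: (hd th w _ _ hth g1 t1).
  - by [].
  split=> [t||t0 t0T].
  - by exact: La.
  - by [].
  apply/cvgrPdist_le => e e0; rewrite in_itv/= in t0T; have [d d0 hd'] := hc t0 e t0T e0.
  exists d => // t /= td; rewrite in_itv/= => tT.
  by rewrite sub0r normrN ger0_norm ?sq_ge0//; apply: hd' => //; rewrite distrC.
split=> //; apply: (aeS (aeI sl hH)) => r [[h1 [h2 [h3 h4]]] h5] Ir w Dw tw hw ht.
have [g1 t1] := hp w (ex_intro _ _ hw); have [_ Lg _] := h5 Ir.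
have e1 : dt z' r w = form z v r w Dw tw by exact: (h4 Ir _ _ _ _ _ g1 t1 hw ht).
rewrite e1 (wform_eq _ _ Lg (h1 Ir) (h2 Ir) hw) mul1r /=.
by ring.
Qed.

Lemma lin_independent v z : lin v z -> gradient_independent v z.
Proof.
move=> lz; apply: (aeS (lin_form lz)) => r h Ir w Dw tw Dw' tw' h1 h2 h3 h4.
by rewrite -(h Ir _ _ _ h1 h2) (h Ir _ _ _ h3 h4).
Qed.

Lemma test_bounded (th : RR -> R) : test_function I (th : R -> R^o) -> exists M,
  [/\ measurable_fun I th, forall t, I t -> `|th t| <= M, measurable_fun I (derive1 (th : R -> R^o)) & forall t, I t -> `|derive1 (th : R -> R^o) t| <= M].
Proof.
move=> [sth _]; have c1 : continuous (th : R -> R) by exact: (smooth_continuous sth).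
have c2 : continuous (derive1 (th : R -> R^o) : R -> R).
  have [_ h] := sth 1%N; have [_ [h2 _]] := h 1; rewrite (_ : derive1 _ = 'D_1 (th : R -> R^o))//.
  by apply/funext => t; rewrite derive1E.
have bd (f : R -> R) : continuous f -> exists2 M, 0 <= M & forall t, I t -> `|f t| <= M.
  move=> cf; have cw : {within `[0, T], continuous f} by exact: continuous_subspaceT.
  have := @compact_bounded _ _ _ (continuous_compact cw (@segment_compact _ 0 T)) => -[M [_ hM]].
  exists (`|M| + 1) => [|t]; first by rewrite addr_ge0.
  rewrite /= in_itv/= => /andP[t0 tT]; apply: (hM (`|M| + 1)); first by rewrite (le_lt_trans (ler_norm M))// ltrDl.
  by exists t => //=; rewrite in_itv/= !ltW.
have [M1 M10 h1] := bd _ c1; have [M2 M20 h2] := bd _ c2; exists (M1 + M2); split.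
- by apply: measurable_funTS; mfun.
- by move=> t It; rewrite (le_trans (h1 t It))// lerDl.
- by apply: measurable_funTS; mfun.
- by move=> t It; rewrite (le_trans (h2 t It))// lerDr.
Qed.

Lemma lin_weak_dt v z : L2 lamS Sig v -> lin v z -> weak_dt v z.
Proof.
move=> Lv lz th w Dw tw hth hw ht; have [zW _ _] := lz; have [_ [_ _ hd] _ _] := zW.
rewrite -(hd th w Dw hth hw); have [M [mth bth _ _]] := test_bounded hth.
have [Lw LD _] := hw; have L1 := L2_wform Lv (fieldsW zW) Lw LD (trace_L2 ht).
have Lth : L2 lam I th by apply: (bounded_L2 (M := M) mIT (I_fin T0)) => //.
have h : \forall r \ae lam, I r -> dt z r w = form z v r w Dw tw.
  by apply: (aeS (lin_form lz)) => r h Ir; exact: h.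
by have := ip_ae mIT L1 (dt_L2 zW hw) Lth h.
Qed.

(** Separation of variables turns the integrals over time into inner products on the space-time sets
    against tensor products, where linearity and L2 convergence are at hand. *)
Lemma weak_dtE v z th w Dw tw : L2 lamS Sig v -> fields z -> test_function I (th : R -> R^o) -> H1 Om w Dw -> L2 sigma (bdry Om) tw ->
  (\int[lam]_(r in I) (form z v r w Dw tw * th r) = pair3 lamQ lamS Q Sig (flux z) (fun j q => Dw j q.1 * th q.2)
     (low z) (fun q => w q.1 * th q.2) (robin z v) (fun q => tw q.1 * th q.2)) /\
  (\int[lam]_(r in I) (ipO (fun x => value z (x, r)) w * derive1 (th : R -> R^o) r) =
     inner lamQ Q (value z) (fun q => w q.1 * derive1 (th : R -> R^o) q.2)).
Proof.
move=> Lv fz hth [Lw LD _] Lt; have [M [m1 b1 m2 b2]] := test_bounded hth; have [zv _ _] := fz.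
have [j0 e0] := pairing_tensor T0 mO sO (L2_low fz) Lw m1 b1.
have [j1 e1] := pairing_tensor T0 mB sS (L2_robin fz Lv) Lt m1 b1.
have tj j := pairing_tensor T0 mO sO (L2_flux j fz) (LD j) m1 b1.
split; last by have [] := pairing_tensor T0 mO sO zv Lw m2 b2.
rewrite /pair3 -e0 -e1 (eq_bigr (fun j => \int[lam]_(r in I) (ipO (fun x => flux z j (x, r)) (Dw j) * th r))); last first.
  by move=> j _; have [] := tj j.
have jj j : lam.-integrable I (fun r => (ipO (fun x => flux z j (x, r)) (Dw j) * th r)%:E) by have [] := tj j.
rewrite -(Rint_sum _ mIT jj) -(RintegralD mIT (intble_sum mIT _ jj) j0) -(RintegralD mIT (intbleD mIT (intble_sum mIT _ jj) j0) j1).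
by apply: eq_Rintegral => r _; rewrite !mulrDl mulr_suml.
Qed.

(** The component [dt] is a placeholder: the state obtained from it agrees with it in the sense of
    [same_fields] only. *)
Definition tlin (k : R) (z z' : @trajectory R n) : trajectory :=
  Trajectory (fun q => k * value z q + value z' q) (fun i q => k * grad z i q + grad z' i q) (fun q => k * trace z q + trace z' q)
    (fun t x => k * at_time z t x + at_time z' t x) (fun _ _ => 0).

Lemma fields_tlin k z z' : fields z -> fields z' -> fields (tlin k z z').
Proof.
move=> [h1 h2 h3] [h4 h5 h6]; split; [exact: (L2D mQ (L2Z mQ k h1) h4)| |exact: (L2D mS (L2Z mS k h3) h6)].
by move=> i; exact: (L2D mQ (L2Z mQ k (h2 i)) (h5 i)).
Qed.

Lemma flux_tlin k z z' j q : flux (tlin k z z') j q = k * flux z j q + flux z' j q.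
Proof. by rewrite mulr_sumr -big_split; apply: eq_bigr => i _ /=; ring. Qed.

Lemma low_tlin k z z' q : low (tlin k z z') q = k * low z q + low z' q.
Proof. by rewrite /low /=; ring. Qed.

Lemma robin_tlin k z z' v v' q : robin (tlin k z z') (fun q => k * v q + v' q) q = k * robin z v q + robin z' v' q.
Proof. by rewrite /robin /=; ring. Qed.

Lemma form_slices v z : L2 lamS Sig v -> fields z -> \forall r \ae lam, I r ->
  [/\ forall j, L2O (fun x => flux z j (x, r)), L2O (fun x => low z (x, r)) & L2 sigma (bdry Om) (fun x => robin z v (x, r))].
Proof.
move=> Lv fz; apply: (aeS (aeI (flux_slices fz) (aeI
  (L2_slice sO mO mIT (L2_low fz)) (L2_slice sS mB mIT (L2_robin fz Lv))))) => r [h1 [h2 h3]] Ir.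
by split; [exact: h1|exact: h2|exact: h3].
Qed.

(** New states arise only from given ones: by combinations here, by limits in [limit_state]. Every
    condition of [make_state] is linear in the fields. *)
Lemma lin_comb k v z v' z' : L2 lamS Sig v -> L2 lamS Sig v' -> lin v z -> lin v' z' ->
  exists y, lin (fun q => k * v q + v' q) y /\ same_fields y (tlin k z z').
Proof.
move=> Lv Lv' lz lz'; have [zW _ z0] := lz; have [zW' _ z0'] := lz'; have fz := fieldsW zW; have fz' := fieldsW zW'.
have Lc' := L2D mS (L2Z mS k Lv) Lv'; have fl := fields_tlin k fz fz'.
have fE j : flux (tlin k z z') j = (fun q => k * flux z j q + flux z' j q) by apply/funext => q; exact: flux_tlin.
have lE : low (tlin k z z') = (fun q => k * low z q + low z' q) by apply/funext => q; exact: low_tlin.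
have rE : robin (tlin k z z') (fun q => k * v q + v' q) = (fun q => k * robin z v q + robin z' v' q).
  by apply/funext => q; exact: robin_tlin.
apply: (make_state Lc' fl).
- by apply: (aeS (aeI (slice_H1 zW) (slice_H1 zW'))) => r [h1 h2] Ir; exact: (H1_lin k (h1 Ir) (h2 Ir)).
- apply: (aeS (aeI (aeI (slice_H1 zW) (slice_H1 zW'))
    (aeI (slice_trace zW) (slice_trace zW')))) => r [[h1 h2] [h3 h4]] Ir.
  exact: (trace_lin k (H1_L2H (h1 Ir)) (H1_L2H (h2 Ir)) (h3 Ir) (h4 Ir)).
- by move=> t tT; exact: (L2D mO (L2Z mO k (at_L2 zW tT)) (at_L2 zW' tT)).
- apply: (aeS (aeI (slice_at zW) (slice_at zW'))) => r [h1 h2] Ir.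
  by apply: filterS2 (h1 Ir) (h2 Ir) => x {}h1 {}h2 Ox /=; rewrite h1// h2.
- move=> t0 e tT e0; have k1 : 0 < k ^+ 2 + 1 by rewrite ltr_wpDl ?sqr_ge0.
  have e1 : 0 < e / (4 * (k ^+ 2 + 1)) by rewrite divr_gt0// mulr_gt0.
  have e4 : 0 < e / 4 by rewrite divr_gt0.
  have [d1 d10 h1] := at_cont zW tT e1; have [d2 d20 h2] := at_cont zW' tT e4.
  exists (Num.min d1 d2); first by rewrite lt_min d10.
  move=> t tT'; rewrite lt_min => /andP[/(h1 t tT') {}h1 /(h2 t tT') {}h2] /=.
  have L1 := L2B mO (at_L2 zW tT') (at_L2 zW tT); have L2' := L2B mO (at_L2 zW' tT') (at_L2 zW' tT).
  rewrite (@eq_sq _ _ _ _ _ _ (fun x => k * (at_time z t x - at_time z t0 x) + (at_time z' t x - at_time z' t0 x))); last by move=> x _; ring.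
  apply: le_trans (sqD_le mO (L2Z mO k L1) L2') _; rewrite (sqZ mO k L1).
  have h3 : k ^+ 2 * nrm (fun x => at_time z t x - at_time z t0 x) <= e / 4.
    apply: le_trans (ler_wpM2l (sqr_ge0 k) h1) _; rewrite mulrA ler_pdivrMr ?mulr_gt0//.
    rewrite (_ : e / 4 * _ = e * (k ^+ 2 + 1)); last by field.
    by rewrite mulrC ler_pM2l// lerDl.
  by lra.
- by apply: filterS2 z0 z0' => x h1 h2 Ox /=; rewrite h1// h2// mulr0 addr0.
- apply: (aeS (aeI (aeI (lin_independent lz) (lin_independent lz'))
    (aeI (form_slices Lv fz) (form_slices Lv' fz')))) => r [[i1 i2] [s1 s2]] Ir w Dw tw Dw' tw' h1 t1 h2 t2.
  have [a1 a2 a3] := s1 Ir; have [b1 b2 b3] := s2 Ir.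
  have eqn D t : H1 Om w D -> trace_of Om sigma w D t ->
      form (tlin k z z') (fun q => k * v q + v' q) r w D t = k * form z v r w D t + form z' v' r w D t.
    move=> [Lw LD _] ht; rewrite /wform lE rE; under eq_bigr do rewrite fE.
    exact: (pair3_lin mO mB k a1 b1 LD a2 b2 Lw a3 b3 (trace_L2 ht)).
  by rewrite (eqn _ _ h1 t1) (eqn _ _ h2 t2) (i1 Ir _ _ _ _ _ h1 t1 h2 t2) (i2 Ir _ _ _ _ _ h1 t1 h2 t2).
move=> th w Dw tw hth hw ht; have Lt := trace_L2 ht; have [Lw LD _] := hw; have [M [m1 b1 m2 b2]] := test_bounded hth.
have [-> ->] := weak_dtE Lc' fl hth hw Lt.
have p1 := lin_weak_dt Lv lz hth hw ht; have p2 := lin_weak_dt Lv' lz' hth hw ht.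
have [q1 q2] := weak_dtE Lv fz hth hw Lt; have [q3 q4] := weak_dtE Lv' fz' hth hw Lt.
rewrite q1 q2 in p1; rewrite q3 q4 in p2; rewrite lE rE (_ : flux (tlin k z z') = fun j q => k * flux z j q + flux z' j q); last exact/funext.
have tD j := L2_tensor T0 mO sO (LD j) m1 b1; have tw' := L2_tensor T0 mO sO Lw m1 b1; have tt := L2_tensor T0 mB sS Lt m1 b1.
rewrite (pair3_lin mQ mS k (fun j => L2_flux j fz) (fun j => L2_flux j fz') tD (L2_low fz) (L2_low fz') tw'
  (L2_robin fz Lv) (L2_robin fz' Lv') tt) p1 p2.
have [g1 _ _] := fz; have [g2 _ _] := fz'; have t' := L2_tensor T0 mO sO Lw m2 b2.
by rewrite (ipDl mQ (L2Z mQ k g1) g2 t') (ipZl mQ k g1 t'); ring.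
Qed.

Lemma difference_bound : exists2 C, 0 < C & forall v z v' z', L2 lamS Sig v -> lin v z -> L2 lamS Sig v' -> lin v' z' ->
  let W := C * V (fun q => v' q - v q) in
  [/\ sqnorm lamQ Q (fun q => value z' q - value z q) <= W, forall i, sqnorm lamQ Q (fun q => grad z' i q - grad z i q) <= W,
    sqnorm lamS Sig (fun q => trace z' q - trace z q) <= W &
    forall t, 0 <= t -> t <= T -> nrm (fun x => at_time z' t x - at_time z t x) <= W].
Proof.
have [C C0 hC] := total_bound; exists C => // v z v' z' Lv lz Lv' lz' W.
have [y [ly [e1 e2 e3 e4]]] := lin_comb (-1) Lv Lv' lz lz'.
have [h1 h2 h3 _ h4] := hC _ y (L2D mS (L2Z mS (-1) Lv) Lv') ly.
have hW : C * V (fun q => -1 * v q + v' q) = W by congr (_ * _); apply: eq_sq => q _; ring.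
rewrite e1 e2 e3 e4 hW in h1 h2 h3 h4; split.
- by apply: le_trans h1; apply: eqW; apply: eq_sq => q _ /=; ring.
- by move=> i; apply: le_trans (h2 i); apply: eqW; apply: eq_sq => q _ /=; ring.
- by apply: le_trans h3; apply: eqW; apply: eq_sq => q _ /=; ring.
by move=> t t0 tT; apply: le_trans (h4 t t0 tT); apply: eqW; apply: eq_sq => q _ /=; ring.
Qed.

(* Geometric speed gives convergence of a.e. time slice without extraction; the time derivative of the limit
   is defined through its own weak form. *)
Lemma limit_state : exists2 ka, 0 < ka & forall (v : nat -> E * RR -> R) z, (forall k, L2 lamS Sig (v k)) -> (forall k, lin (v k) (z k)) ->
  (forall k, V (fun q => v k.+1 q - v k q) <= ka * 8^-1 ^+ k) ->
  exists w y, [/\ L2 lamS Sig w, lin w y & V (fun q => v k q - w q) @[k --> \oo] --> 0].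
Proof.
have [C C0 hC] := difference_bound; have [Cf Cf0 hF] := fields_sq.
(* With this factor the controls as well as all fields of the states move by at most [8^-1 ^+ k] at
   step [k]. *)
have ka0 : 0 < (C + 1)^-1 by rewrite invr_gt0 addr_gt0.
exists (C + 1)^-1 => // v z Lv lz hv.
have q0 k : 0 <= (8^-1 : R) ^+ k by [].
have v1 k : V (fun q => v k.+1 q - v k q) <= 8^-1 ^+ k.
  by apply: le_trans (hv k) _; rewrite ler_piMl// invf_le1 ?addr_gt0// lerDr ltW.
have vC k : C * V (fun q => v k.+1 q - v k q) <= 8^-1 ^+ k.
  apply: le_trans (ler_wpM2l (ltW C0) (hv k)) _; rewrite mulrA ler_piMl// ler_pdivrMr ?addr_gt0// mul1r lerDl//.
have fz k : fields (z k) by have [zW _ _] := lz k; exact: fieldsW.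
have zW k : in_W Om sigma T (z k) by have [] := lz k.
have B k := hC _ _ _ _ (Lv k) (lz k) (Lv k.+1) (lz k.+1).
have [w [Lw w0 w1 _]] := L2_complete mS Lv v1.
have [zv [Lzv _ zv1 _]] : exists g, [/\ L2 lamQ Q g, sqnorm lamQ Q (fun q => value (z k) q - g q) @[k --> \oo] --> 0,
    (forall k, sqnorm lamQ Q (fun q => value (z k) q - g q) <= 4 * 8^-1 ^+ k) & \forall x \ae lamQ, Q x -> value (z k) x @[k --> \oo] --> g x].
  by apply: (L2_complete mQ) => k; [have [] := fz k|have [h _ _ _] := B k; apply: le_trans h (vC k)].
have gex i : exists g, L2 lamQ Q g /\ forall k, sqnorm lamQ Q (fun q => grad (z k) i q - g q) <= 4 * 8^-1 ^+ k.
  have [g [h1 _ h2 _]] := @L2_complete _ _ _ lamQ Q mQ (fun k => grad (z k) i) (fun k => ltac:(by have [_ h _] := fz k; exact: h))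
    (fun k => ltac:(by have [_ h _ _] := B k; apply: le_trans (h i) (vC k))).
  by exists g.
have [zg hg] := choice gex.
have [zt [Lzt _ zt1 _]] := @L2_complete _ _ _ lamS Sig mS (fun k => trace (z k)) (fun k => ltac:(by have [_ _ h] := fz k; exact: h))
  (fun k => ltac:(by have [_ _ h _] := B k; apply: le_trans h (vC k))).
(* Unlike the other fields, the representative in time needs a limit at every single time; [clamp]
   provides a time in [[0, T]]. *)
have aex t : exists g, L2O g /\ forall k, nrm (fun x => at_time (z k) (clamp t) x - g x) <= 4 * 8^-1 ^+ k.
  have /andP[t0 tT] := clamp_in t.
  have [g [h1 _ h2 _]] := @L2_complete _ _ _ (leb n) Om mO (fun k => at_time (z k) (clamp t)) (fun k => at_L2 (zW k) (clamp_in t))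
    (fun k => ltac:(by have [_ _ _ h] := B k; apply: le_trans (h _ t0 tT) (vC k))).
  by exists g.
have [za ha] := choice aex; pose y := Trajectory zv zg zt za (fun _ _ => 0).
have La t : L2O (za t) by have [] := ha t.
have fy : fields y by split=> // i; have [] := hg i.
pose K := Cf * (n%:R * 4) + Cf * 4 + Cf * 8.
have K0 : 0 <= K by rewrite !addr_ge0 ?mulr_ge0.
have Kc k : [/\ forall j, sqnorm lamQ Q (fun q => flux (z k) j q - flux y j q) <= K * 8^-1 ^+ k,
    sqnorm lamQ Q (fun q => low (z k) q - low y q) <= K * 8^-1 ^+ k &
    sqnorm lamS Sig (fun q => robin (z k) (v k) q - robin y w q) <= K * 8^-1 ^+ k].
  have [h1 h2 h3] := hF _ _ (L2D mS (L2Z mS (-1) Lw) (Lv k)) (fields_tlin (-1) fy (fz k)).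
  have p := mulr_ge0 Cf0 (q0 k); have pn : 0 <= n%:R * (Cf * 8^-1 ^+ k) by rewrite mulr_ge0.
  have KE : K * 8^-1 ^+ k = 4 * (n%:R * (Cf * 8^-1 ^+ k)) + 12 * (Cf * 8^-1 ^+ k) by rewrite /K; ring.
  split.
  - move=> j; rewrite (@eq_sq _ _ _ _ _ _ (flux (tlin (-1) y (z k)) j)); last by move=> q _; rewrite flux_tlin; ring.
    apply: le_trans (h1 j) _; apply: (@le_trans _ _ (Cf * (\sum_(i < n) 4 * 8^-1 ^+ k))).
      apply: ler_wpM2l => //; apply: ler_sum => i _; have [_ /(_ k)] := hg i; apply: le_trans.
      by apply: eqW; apply: eq_sq => q _ /=; ring.
    rewrite (_ : Cf * _ = 4 * (n%:R * (Cf * 8^-1 ^+ k))); last by rewrite sumr_const card_ord; ring.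
    by rewrite KE; move: p pn; move: (Cf * _) (n%:R * _) => *; lra.
  - rewrite (@eq_sq _ _ _ _ _ _ (low (tlin (-1) y (z k)))); last by move=> q _; rewrite low_tlin; ring.
    apply: le_trans h2 _; rewrite (@eq_sq _ _ _ _ _ _ (fun q => value (z k) q - zv q)); last by move=> q _ /=; ring.
    apply: le_trans (ler_wpM2l Cf0 (zv1 k)) _; rewrite KE mulrCA; move: p pn; move: (Cf * _) (n%:R * _) => *; lra.
  rewrite (@eq_sq _ _ _ _ _ _ (robin (tlin (-1) y (z k)) (fun q => -1 * w q + v k q))); last by move=> q _; rewrite robin_tlin; ring.
  apply: le_trans h3 _; rewrite (@eq_sq _ _ _ _ _ (trace _) (fun q => trace (z k) q - zt q)); last by move=> q _ /=; ring.
  rewrite (@eq_sq _ _ _ _ _ (fun q => -1 * w q + v k q) (fun q => v k q - w q)); last by move=> q _ /=; ring.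
  apply: le_trans (ler_wpM2l Cf0 (lerD (zt1 k) (w1 k))) _; rewrite KE (_ : Cf * (_ + _) = 8 * (Cf * 8^-1 ^+ k)); last by ring.
  by lra.
have Lfl k j := L2_flux j (fz k); have Lfy j := L2_flux j fy.
have Ll k := L2_low (fz k); have Lly := L2_low fy; have Lr k := L2_robin (fz k) (Lv k); have Lry := L2_robin fy Lw.
have sv := slice_cvg mO sO (ler0n R 4) (fun k => ltac:(by have [h _ _] := fz k; exact: h)) Lzv zv1.
have sg : \forall r \ae lam, forall i, I r -> nrm (fun x => grad (z k) i (x, r) - zg i (x, r)) @[k --> \oo] --> 0.
  apply: filter_forall => i; have [h1 h2] := hg i.
  exact: (slice_cvg mO sO (ler0n R 4) (fun k => ltac:(by have [_ h _] := fz k; exact: h)) h1 h2).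
have st := slice_cvg mB sS (ler0n R 4) (fun k => ltac:(by have [_ _ h] := fz k; exact: h)) Lzt zt1.
have hsl : \forall r \ae lam, I r -> L2H (fun x => zv (x, r)) (fun i x => zg i (x, r)) /\ forall k, H1 Om (fun x => value (z k) (x, r)) (fun i x => grad (z k) i (x, r)).
  have g1 : \forall r \ae lam, forall i, I r -> L2O (fun x => zg i (x, r)).
    by apply: filter_forall => i; have [h1 _] := hg i; exact: (L2_slice sO mO mIT h1).
  have g2 := ae_foralln (fun k => slice_H1 (zW k)).
  apply: (aeS (aeI (L2_slice sO mO mIT Lzv) (aeI g1 g2))) => r [h1 [h2 h3]] Ir.
  by split=> [|k]; [split=> [|i]; [exact: h1|exact: h2]|exact: h3].
have hcv : \forall r \ae lam, I r -> h1sq (fun x => value (z k) (x, r) - zv (x, r)) (fun i x => grad (z k) i (x, r) - zg i (x, r)) @[k --> \oo] --> 0.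
  apply: (aeS (aeI sv sg)) => r [h1 h2] Ir; rewrite -[X in _ --> X]addr0; apply: cvgD; first exact: h1.
  rewrite -[X in _ --> X](_ : \sum_(i < n) (0 : R) = 0); last by rewrite big1_eq.
  apply: cvg_sum_seq => i; exact: h2.
have near0 f e : 0 < e -> f k @[k --> \oo] --> (0 : R) -> (forall k, 0 <= f k) -> exists k, f k <= e.
  move=> e0 cf f0; have [N hN] := near_cvg0_lt e0 cf; exists N; have := hN N (leqnn N); rewrite ger0_norm//; exact: ltW.
have geo (e : R) : 0 < e -> exists k, 8^-1 ^+ k <= e.
  by move=> e0; apply: (near0 _ _ e0) => //; apply: (@cvg0_geo _ _ 1) => k; rewrite q0 mul1r lexx.
have zaE t k : 0 <= t -> t <= T -> nrm (fun x => at_time (z k) t x - za t x) <= 4 * 8^-1 ^+ k.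
  by move=> t0 tT; have [_ /(_ k)] := ha t; rewrite clamp_id.
suff [y' [ly _]] : exists y', lin w y' /\ same_fields y' y by exists w, y'.
apply: (make_state Lw fy) => //.
- apply: (aeS (aeI hsl hcv)) => r [h1 h2] Ir; have [h3 h4] := h1 Ir.
  apply: (H1_closed h3) => e e0; have [|k hk] := near0 _ e e0 (h2 Ir); first by move=> k; exact: h1sq_ge0.
  by eexists; eexists; split; [exact: (h4 k)|exact: hk].
- apply: (aeS (aeI (aeI hsl hcv) (aeI (aeI st (L2_slice sS mB mIT Lzt))
    (ae_foralln (fun k => slice_trace (zW k)))))) => r [[h1 h2] [[h5 h6] h7]] Ir; have [h3 h4] := h1 Ir.
  apply: (trace_closed h3 (h6 Ir)) => e e0.
  have hs : h1sq (fun x => value (z k) (x, r) - zv (x, r)) (fun i x => grad (z k) i (x, r) - zg i (x, r)) +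
      bsq (fun x => trace (z k) (x, r) - zt (x, r)) @[k --> \oo] --> (0 : R).
    by rewrite -[X in _ --> X]addr0; apply: cvgD; [exact: (h2 Ir)|exact: (h5 Ir)].
  have [|k hk] := near0 _ e e0 hs; first by move=> k; rewrite addr_ge0 ?h1sq_ge0 ?sq_ge0.
  do 3!eexists; split; [exact: (H1_L2H (h4 k))|exact: (h7 k Ir)| |]; apply: le_trans hk; rewrite ?lerDl ?lerDr ?sq_ge0 ?h1sq_ge0//.
- apply: (aeS (aeI (aeI sv (L2_slice sO mO mIT Lzv)) (aeI
    (ae_foralln (fun k => slice_at (zW k))) hsl))) => r [[h1 h2] [h3 h4]] Ir.
  have [r0 rT] : 0 <= r /\ r <= T by move: Ir; rewrite/=/= => /andP[/ltW ? /ltW ?].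
  have Lz := h2 Ir; have Ld := L2B mO (La r) Lz; have [_ h5] := h4 Ir.
  have d0 : nrm (fun x => za r x - zv (x, r)) = 0.
    apply/eqP; rewrite eq_le sq_ge0 andbT; apply/ler_addgt0Pr => e e0; rewrite add0r.
    have hs : 2 * (4 * 8^-1 ^+ k) + 2 * nrm (fun x => value (z k) (x, r) - zv (x, r)) @[k --> \oo] --> 0.
      rewrite -[X in _ --> X](_ : 2 * 0 + 2 * 0 = 0 :> R); last by ring.
      apply: cvgD; apply: cvgM; [exact: cvg_cst| |exact: cvg_cst|exact: (h1 Ir)].
      by apply: (@cvg0_geo _ _ 4) => k; rewrite lexx mulr_ge0.
    have [|k hk] := near0 _ e e0 hs; first by move=> k; apply: addr_ge0; apply: mulr_ge0; rewrite ?sq_ge0//.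
    apply: le_trans hk; have rT' : 0 <= r <= T by rewrite r0.
    have Lk := at_L2 (zW k) rT'; have [Lzk _ _] := h5 k.
    rewrite (@eq_sq _ _ _ _ _ _ (fun x => (at_time (z k) r x - zv (x, r)) - (at_time (z k) r x - za r x))); last by move=> x _; ring.
    apply: le_trans (sqB_le mO (L2B mO Lk Lz) (L2B mO Lk (La r))) _; rewrite addrC; apply: lerD; first by rewrite ler_pM2l// zaE.
    rewrite ler_pM2l//; apply: eqW; apply: (sq_ae mO (L2B mO Lk Lz) (L2B mO Lzk Lz)).
    by apply: (ae_imp (m := leb n) (h3 k Ir)) => x hx /hx ->.
  by apply: (ae_imp (m := leb n) (sq0_ae mO Ld d0)) => x hx /hx /eqP; rewrite subr_eq0 => /eqP.
(* The increment of the limit is at most four times that of [z k], here [e / 8], plus 24 times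
   [8^-1 ^+ k], here at most [e / 96]. *)
- move=> t0 e /andP[t00 t0T] e0; have [k hk] := geo (e / 96) (divr_gt0 e0 (ltr0n R 96)).
  have [d d0 hd] := at_cont (zW k) (introT andP (conj t00 t0T)) (divr_gt0 e0 (ltr0n R 8)).
  exists d => // t /andP[tt0 ttT] td /=; have tT : 0 <= t <= T by rewrite tt0.
  have := hd t tT td; have a1 := zaE t k tt0 ttT; have a2 := zaE t0 k t00 t0T => a3.
  have Lt := at_L2 (zW k) tT; have Lt0 := at_L2 (zW k) (introT andP (conj t00 t0T)).
  rewrite (@eq_sq _ _ _ _ _ _ (fun x => ((at_time (z k) t x - at_time (z k) t0 x) + (at_time (z k) t0 x - za t0 x)) - (at_time (z k) t x - za t x)));
    last by move=> x _; ring.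
  have b1 := sqB_le mO (L2D mO (L2B mO Lt Lt0) (L2B mO Lt0 (La t0))) (L2B mO Lt (La t)).
  have b2 := sqD_le mO (L2B mO Lt Lt0) (L2B mO Lt0 (La t0)).
  by move: a1 a2 a3 b1 b2 hk; move: (nrm _) (nrm _) (nrm _) (nrm _) (nrm _) (_ ^+ k) => *; lra.
- have [k0 kT] : 0 <= (0 : R) /\ 0 <= T by split=> //; exact: ltW.
  apply: (sq0_ae mO (La 0)); apply/eqP; rewrite eq_le sq_ge0 andbT; apply/ler_addgt0Pr => e e0; rewrite add0r.
  have [k hk] := geo (e / 8) (divr_gt0 e0 (ltr0n R 8)); have L0 := at_L2 (zW k) (introT andP (conj k0 kT));
  have [_ _ z0] := lz k; have [_ s0] := ae_sq0 mO (L2_meas L0) z0.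
  rewrite (@eq_sq _ _ _ _ _ _ (fun x => at_time (z k) 0 x - (at_time (z k) 0 x - za 0 x))); last by move=> x _; ring.
  have := sqB_le mO L0 (L2B mO L0 (La 0)); have := zaE 0 k k0 kT; rewrite s0; move: hk; move: (nrm _) (nrm _) (_ ^+ k) => *; lra.
- have s1 : \forall r \ae lam, forall j, I r -> nrm (fun x => flux (z k) j (x, r) - flux y j (x, r)) @[k --> \oo] --> 0.
    by apply: filter_forall => j; apply: (slice_cvg mO sO K0 (fun k => Lfl k j) (Lfy j)) => k; have [] := Kc k.
  have s2 := slice_cvg mO sO K0 Ll Lly (fun k => ltac:(by have [_ h _] := Kc k; exact: h)).
  have s3 := slice_cvg mB sS K0 Lr Lry (fun k => ltac:(by have [_ _ h] := Kc k; exact: h)).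
  apply: (aeS (aeI (aeI s1 (aeI s2 s3)) (aeI
    (ae_foralln (fun k => lin_independent (lz k))) (aeI (ae_foralln (fun k => form_slices (Lv k) (fz k))) (form_slices Lw fy)))))
    => r [[h1 [h2 h3]] [h4 [h5 h6]]] Ir w' Dw tw Dw' tw' g1 t1 g2 t2.
  have [y1 y2 y3] := h6 Ir.
  have lim D t : H1 Om w' D -> trace_of Om sigma w' D t -> form (z k) (v k) r w' D t @[k --> \oo] --> form y w r w' D t.
    move=> [Lw' LD _] ht; apply: (pair3_cvg mO mB _ y1 LD _ y2 Lw' _ y3 (trace_L2 ht)); try by move=> k; have [] := h5 k Ir.
    - by move=> j; exact: h1.
    - exact: h2.
    - exact: h3.
  apply: (cvg_unique (@norm_hausdorff _ R^o) (lim _ _ g1 t1)); apply: cvg_trans (lim _ _ g2 t2).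
  by apply: near_eq_cvg; apply: nearW => k; rewrite (h4 k Ir _ _ _ _ _ g1 t1 g2 t2).
move=> th w' Dw tw hth hw ht; have Lt := trace_L2 ht; have [Lw' LD _] := hw; have [M [m1 b1 m2 b2]] := test_bounded hth.
have [-> ->] := weak_dtE Lw fy hth hw Lt.
have tD j := L2_tensor T0 mO sO (LD j) m1 b1; have tw' := L2_tensor T0 mO sO Lw' m1 b1; have tt := L2_tensor T0 mB sS Lt m1 b1.
have t' := L2_tensor T0 mO sO Lw' m2 b2.
have f1 j : sqnorm lamQ Q (fun q => flux (z k) j q - flux y j q) @[k --> \oo] --> 0.
  by apply: (@cvg0_geo _ _ K) => k; rewrite sq_ge0; have [h _ _] := Kc k; exact: h.
have f2 : sqnorm lamQ Q (fun q => low (z k) q - low y q) @[k --> \oo] --> 0.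
  by apply: (@cvg0_geo _ _ K) => k; rewrite sq_ge0; have [_ h _] := Kc k.
have f3 : sqnorm lamS Sig (fun q => robin (z k) (v k) q - robin y w q) @[k --> \oo] --> 0.
  by apply: (@cvg0_geo _ _ K) => k; rewrite sq_ge0; have [_ _ h] := Kc k.
have f4 : sqnorm lamQ Q (fun q => value (z k) q - zv q) @[k --> \oo] --> 0.
  by apply: (@cvg0_geo _ _ 4) => k; rewrite sq_ge0 zv1.
have c1 := pair3_cvg mQ mS Lfl Lfy tD Ll Lly tw' Lr Lry tt f1 f2 f3.
have c2 : inner lamQ Q (value (z k)) (fun q => w' q.1 * derive1 (th : R -> R^o) q.2) @[k --> \oo] -->
    inner lamQ Q zv (fun q => w' q.1 * derive1 (th : R -> R^o) q.2).
  apply: (ip_cvg mQ _ (fun _ => t') Lzv t' f4); first by move=> k; have [] := fz k.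
  by under eq_fun do rewrite (sq_subrr _ _ mQ); exact: cvg_cst.
apply: (cvg_unique (@norm_hausdorff _ R^o) c1); apply: cvg_trans (cvgN c2).
apply: near_eq_cvg; apply: nearW => k /=; have p1 := lin_weak_dt (Lv k) (lz k) hth hw ht.
by have [q1 q2] := weak_dtE (Lv k) (fz k) hth hw Lt; rewrite q1 q2 in p1.
Qed.

(** * The quadratic form and its minimizing sequences *)

Variables (K : E * RR -> R) (l2 : E -> R) (ph : E * RR -> R) (kap : R).
Hypotheses (LK : Linfty lamQ Q K) (Ll : Linfty (leb n) Om l2) (Lph : Linfty lamS Sig ph) (kap0 : 0 < kap).

Let TT : 0 <= T <= T. Proof. by rewrite lexx ltW. Qed.

Definition quad (v : E * RR -> R) (z : @trajectory R n) : R := inner lamQ Q (fun q => K q * value z q) (value z) +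
  ipO (fun x => l2 x * at_time z T x) (at_time z T) - 2 * inner lamS Sig (fun q => ph q * v q) (trace z) + kap * V v.

Lemma quad_fields v z z' : same_fields z z' -> quad v z = quad v z'.
Proof. by move=> [e1 _ e2 e3]; rewrite /quad e1 e2 e3. Qed.

(** Along a line of controls the form is a quadratic polynomial in [k]; the later arguments only use
    that some cross coefficient [B] exists. *)
Lemma quad_expand v z v' z' : L2 lamS Sig v -> lin v z -> L2 lamS Sig v' -> lin v' z' ->
  exists B, forall k, quad (fun q => k * v q + v' q) (tlin k z z') = k ^+ 2 * quad v z + k * B + quad v' z'.
Proof.
move=> Lv [zW _ _] Lv' [zW' _ _]; have [h1 _ h2] := fieldsW zW; have [h3 _ h4] := fieldsW zW'.
have h5 := at_L2 zW TT; have h6 := at_L2 zW' TT.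
exists (inner lamQ Q (fun q => K q * value z q) (value z') + inner lamQ Q (fun q => K q * value z' q) (value z) +
  (ipO (fun x => l2 x * at_time z T x) (at_time z' T) + ipO (fun x => l2 x * at_time z' T x) (at_time z T)) -
  2 * (inner lamS Sig (fun q => ph q * v q) (trace z') + inner lamS Sig (fun q => ph q * v' q) (trace z)) + 2 * kap * inner lamS Sig v v').
move=> k; rewrite /quad /=.
rewrite (wip_expand k mQ LK h1 h3 h1 h3) (wip_expand k mO Ll h5 h6 h5 h6) (wip_expand k mS Lph Lv Lv' h2 h4).
by rewrite (sqD mS (L2Z mS k Lv) Lv') (sqZ mS k Lv) (ipZl mS k Lv Lv'); ring.
Qed.

Lemma quad_bound : exists2 C, 0 < C & forall v z, L2 lamS Sig v -> lin v z -> `|quad v z| <= C * V v.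
Proof.
have [C C0 hC] := total_bound; have [C1 C10 y1] := young_weight mQ LK.
have [C2 C20 y2] := young_weight mO Ll; have [C3 C30 y3] := young_weight mS Lph.
exists ((C1 + 1) * C + (C2 + 1) * C + 2 * (C3 + C) + kap); first by rewrite !addr_gt0 ?mulr_gt0// ?addr_gt0.
move=> v z Lv lz; have [zW _ _] := lz; have [h1 _ h2] := fieldsW zW; have h3 := at_L2 zW TT; have V0 := sq_ge0 lamS Sig v.
have [k1 _ k2 _ k3] := hC v z Lv lz; have {}k3 := k3 T (ltW T0) (lexx T).
have q1 := y1 1 _ _ ltr01 h1 h1; have q2 := y2 1 _ _ ltr01 h3 h3; have q3 := y3 1 _ _ ltr01 Lv h2.
rewrite invr1 !mul1r in q1 q2 q3.
rewrite /quad (_ : (_ + kap) * V v = (C1 + 1) * (C * V v) + (C2 + 1) * (C * V v) + 2 * (C3 * V v + C * V v) + kap * V v); last by ring.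
have p1 := ler_wpM2l (ltW (addr_gt0 C10 ltr01)) k1; have p2 := ler_wpM2l (ltW (addr_gt0 C20 ltr01)) k3.
have p4 := mulr_ge0 (ltW kap0) V0; rewrite [(C1 + 1) * _ _ _]mulrDl [(C2 + 1) * _ _ _]mulrDl !mul1r in p1 p2.
apply: le_trans (ler_normD _ _) _; rewrite (ger0_norm p4) lerD2r; apply: le_trans (ler_normD _ _) _; rewrite normrN normrM ger0_norm//.
apply: lerD; last by rewrite ler_pM2l//; apply: le_trans q3 _; rewrite lerD2l.
by apply: le_trans (ler_normD _ _) _; apply: lerD; [exact: le_trans q1 p1|exact: le_trans q2 p2].
Qed.

(* Up to finitely many functionals, the form is coercive: the compactness of [v |-> z] absorbs the three last terms. *)
Lemma garding : exists (S : seq smoothfun) (ts : seq R) (C : R),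
  [/\ forall t, t \in ts -> 0 < t < T, 0 <= C & forall v z, L2 lamS Sig v -> lin v z ->
    kap / 2 * V v <= quad v z + C * \sum_(f <- S) \sum_(t <- ts) ipO (at_time z t) (sval f) ^+ 2].
Proof.
have [C1 C10 y1] := young_weight mQ LK; have [C2 C20 y2] := young_weight mO Ll; have [C3 C30 y3] := young_weight mS Lph.
(* Three losses of [kap / 8] each: the boundary pairing, the a priori bound for final value and
   trace, and the compactness estimate for [Z]. Together they stay below [kap / 2]. *)
pose e := kap / (16 * C3); have e0 : 0 < e by rewrite divr_gt0// mulr_gt0.
pose D := C2 + 1 + 2 * e^-1; have D0 : 0 < D by rewrite !addr_gt0// mulr_gt0// invr_gt0.
have [M M0 hM] := apriori (divr_gt0 kap0 (mulr_gt0 (ltr0n R 8) D0)).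
pose N := C1 + 1 + D * M; have N0 : 0 < N by rewrite !addr_gt0// mulr_gt0.
have [S [ts [C [hts C0 hc]]]] := compactness (divr_gt0 kap0 (mulr_gt0 (ltr0n R 8) N0)).
exists S, ts, (N * C); split=> //; first by rewrite mulr_ge0// ltW.
move=> v z Lv lz; have [zW _ _] := lz; have [h1 _ h2] := fieldsW zW; have h3 := at_L2 zW TT.
have V0 := sq_ge0 lamS Sig v; have {hc} := hc v z Lv lz; have [k3 _ k2] := hM v z Lv lz; have {}k3 := k3 T (ltW T0) (lexx T).
set Z := sqnorm lamQ Q (value z) in k2 k3 *; set W := \sum_(f <- S) _ => hc.
have q1 := y1 1 _ _ ltr01 h1 h1; have q2 := y2 1 _ _ ltr01 h3 h3; have q3 := y3 e _ _ e0 Lv h2; rewrite invr1 !mul1r in q1 q2.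
have p2 := ler_wpM2l (ltW (addr_gt0 C20 ltr01)) k3; rewrite [(C2 + 1) * nrm _]mulrDl mul1r in p2.
have p3 : e * C3 * V v <= kap / 16 * V v.
  by rewrite// /e; apply: eqW; field; rewrite gt_eqF.
have e0' : 0 <= e^-1 by rewrite invr_ge0 ltW.
have p4 := ler_wpM2l e0' k2; have p5 := ler_wpM2l (ltW N0) hc.
have x1 : N * (kap / (8 * N) * V v + C * W) = kap / 8 * V v + N * C * W by field; rewrite gt_eqF.
have x2 : (C2 + 1) * (M * Z + kap / (8 * D) * V v) + 2 * (e^-1 * (M * Z + kap / (8 * D) * V v)) = D * M * Z + kap / 8 * V v.
  rewrite (_ : _ + _ = D * (M * Z + kap / (8 * D) * V v)); last by rewrite /D; ring.
  by field; rewrite gt_eqF.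
have x3 : N * Z = C1 * Z + Z + D * M * Z by rewrite /N; ring.
have kv0 : 0 <= kap / 16 * V v by rewrite mulr_ge0// divr_ge0// ltW.
rewrite x1 x3 in p5; move: q1 q2 q3; rewrite !ler_norml => /andP[q1 _] /andP[q2 _] /andP[_ q3].
rewrite -/Z in q1; rewrite /quad; move: p2 p3 p4 p5 q1 q2 q3 x2 kv0.
rewrite [kap / 2 * _](_ : _ = 8 * (kap / 16 * V v)); last by field.
rewrite [kap * V v](_ : _ = 16 * (kap / 16 * V v)); last by field.
rewrite [kap / 8 * _](_ : _ = 2 * (kap / 16 * V v)); last by field.
move: (inner lamQ _ _ _) (ipO _ _) (inner lamS _ _ _) (N * C * W) (D * M * Z) (kap / 16 * V v) => i1 i2 i3 nc dm kv.
set Y := M * Z + _.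
by move: ((C2 + 1) * Y) (e^-1 * Y) (C1 * Z) (e^-1 * sqnorm lamS Sig (trace z)) (e * C3 * _) (C2 * nrm _) => *; lra.
Qed.

(* [quad + CB V] is a nonnegative form; its value at the limit is bounded through the discriminant. *)
Lemma minimizing_limit (Cone : R -> (E * RR -> R) -> Prop) :
  (forall s v, Cone s v -> L2 lamS Sig v) -> (forall s k v v', Cone s v -> Cone s v' -> Cone s (fun q => k * v q + v' q)) ->
  (forall s s' v, s <= s' -> Cone s v -> Cone s' v) ->
  (forall v w, (forall k, Cone k.+1%:R^-1 (v k)) -> L2 lamS Sig w -> V (fun q => v k q - w q) @[k --> \oo] --> 0 -> Cone 0 w) ->
  (forall v z, Cone 0 v -> lin v z -> V v != 0 -> 0 < quad v z) ->
  exists s nu, [/\ 0 < s, 0 < nu & forall v z, Cone s v -> lin v z -> nu * V v <= quad v z].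
Proof.
move=> CL Clin Cmono Cclosed pos; apply: contrapT => no.
have [CB CB0 hB] := quad_bound; have [S [ts [C [hts C0 hG]]]] := garding.
pose t (k : nat) : R := k.+1%:R^-1; have t0 k : 0 < t k by rewrite invr_gt0.
have tmono k l : (k <= l)%N -> t l <= t k by move=> kl; rewrite lef_pV2 ?posrE// ler_nat.
(* The values of the form on the unit sphere of the cone with threshold [t k]. *)
pose X k := [set x | exists v z, [/\ Cone (t k) v, lin v z, V v = 1 & quad v z = x]].
have scale k v z : Cone (t k) v -> lin v z -> V v != 0 -> X k (quad v z / V v).
  move=> cv lz V0; have Lv := CL _ _ cv; have Vp : 0 < V v by rewrite lt_neqAle eq_sym V0 sq_ge0.
  (* Normalisation by [s] is written as [(s - 1) * v + v], the shape for which [lin_comb] supplies a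
     state. *)
  pose s := (Num.sqrt (V v))^-1; have [y [ly fy]] := lin_comb (s - 1) Lv Lv lz lz.
  have [y' [ly' fy']] := lin_comb (-1) Lv Lv lz lz.
  have [B hq] := quad_expand Lv lz Lv lz.
  have s2 : s ^+ 2 = (V v)^-1 by rewrite exprVn sqr_sqrtr// sq_ge0.
  (* For [k = -1] the combined control is 0, hence so is the form by [quad_bound]; this determines
     the cross coefficient. *)
  have B2 : B = 2 * quad v z.
    have := hB _ _ (L2D mS (L2Z mS (-1) Lv) Lv) ly'; rewrite (@eq_sq _ _ _ _ _ _ (fun q => 0 * v q)); last by move=> q _; ring.
    rewrite (sqZ mS 0 Lv) expr0n mul0r mulr0 normr_le0 (quad_fields _ fy') hq => /eqP; lra.
  exists (fun q => (s - 1) * v q + v q), y; split=> //; first exact: Clin.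
    by rewrite (@eq_sq _ _ _ _ _ _ (fun q => s * v q)) ?(sqZ mS s Lv) ?s2 ?mulVf// => q _; ring.
  by rewrite (quad_fields _ fy) hq B2 -s2; ring.
have Xlb k x : X k x -> - CB <= x.
  move=> [v [z [cv lz V1 <-]]]; have := hB v z (CL _ _ cv) lz; rewrite V1 mulr1 ler_norml => /andP[].
  by [].
(* The assumption that no pair [(tau, nu)] exists, with threshold [t k]: the form takes values below
   every positive [nu] on the unit sphere. *)
have Xsmall k nu : 0 < nu -> exists2 x, X k x & x < nu.
  move=> nu0; apply: contrapT => nx; apply: no; exists (t k), nu; split=> // v z cv lz.
  have [V0|V0] := eqVneq (V v) 0.
    by have := hB v z (CL _ _ cv) lz; rewrite V0 !mulr0 normr_le0 => /eqP ->.
  have Vp : 0 < V v by rewrite lt_neqAle eq_sym V0 sq_ge0.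
  rewrite leNgt; apply/negP => h; apply: nx; exists (quad v z / V v); first exact: scale.
  by rewrite ltr_pdivrMr.
have Xinf k : has_inf (X k).
  by split; [have [x Xx _] := Xsmall k 1 ltr01; exists x|exists (- CB) => x; exact: Xlb].
pose m k := inf (X k).
have m0 k : m k <= 0.
  apply/ler_addgt0Pr => e e0; rewrite add0r; have [x Xx xe] := Xsmall k e e0.
  by apply: le_trans (ltW xe); apply: ge_inf => //; have [] := Xinf k.
have mmono k l : (k <= l)%N -> m k <= m l.
  move=> kl; apply: lb_le_inf; first by have [] := Xinf l.
  move=> x [v [z [cv lz V1 e1]]]; apply: ge_inf; first by have [] := Xinf k.
  by exists v, z; split=> //; apply: Cmono cv; exact: tmono.
(* The infima [m k] increase as the cones shrink and are at most 0, so they approach [M]. *)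
pose M := sup (range m).
have Msup : has_sup (range m) by split; [exists (m 0%N); exists 0%N|exists 0 => _ [k _ <-]].
have mM k : m k <= M by apply: ub_le_sup; [have [] := Msup|exists k].
have hyp k : exists p : (E * RR -> R) * @trajectory R n, [/\ Cone (t k) p.1, lin p.1 p.2, V p.1 = 1 & quad p.1 p.2 < m k + t k].
  by have [x [v [z [cv lz V1 <-]]] h] := inf_adherent (t0 k) (Xinf k); exists (v, z).
have [p hp] := choice hyp.
pose L := [seq (f, r) | f <- S, r <- ts].
have allL : all (fun a => 0 <= a.2 <= T) L.
  rewrite /L; elim: (S) => //= f S' IH; rewrite all_cat IH andbT all_map; apply/allP => r /hts /= /andP[r0 rT].
  by rewrite !ltW.
have hL i : 0 <= (tnth (in_tuple L) i).2 <= T.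
  by rewrite (tnth_nth (tnth (in_tuple L) i)); apply: (all_nthP _ allL); rewrite ltn_ord.
pose ell' (z : @trajectory R n) (i : 'I_(size L)) : R := let a := tnth (in_tuple L) i in ipO (at_time z a.2) (sval a.1).
have hG' v z : L2 lamS Sig v -> lin v z -> kap / 2 * V v <= quad v z + C * \sum_i ell' z i ^+ 2.
  move=> Lv lz; apply: le_trans (hG v z Lv lz) _; rewrite lerD2l ler_wpM2l//; apply: eqW.
  by rewrite /ell' -(big_tnth _ _ _ xpredT (fun a : smoothfun * R => ipO (at_time z a.2) (sval a.1) ^+ 2)) big_allpairs.
pose N : R := (size L)%:R.
have pair k l (e : R) : (k <= l)%N -> 0 < e -> e <= 1 -> M - m k <= e -> t k <= e ->
    (forall i, `|ell' (p l).2 i - ell' (p k).2 i| <= 2 * e) -> V (fun q => (p l).1 q - (p k).1 q) <= 2 / kap * (6 + 4 * C * N) * e.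
  move=> kl e0 e1 hM ht hl; have [ck lk Vk Jk] := hp k; have [cl ll Vl Jl] := hp l.
  have Lk := CL _ _ ck; have Ll' := CL _ _ cl.
  have [y1 [ly1 f1]] := lin_comb (-1) Lk Ll' lk ll.
  have [y2 [ly2 f2]] := lin_comb 1 Lk Ll' lk ll; have [B hq] := quad_expand Lk lk Ll' ll.
  have cs : Cone (t k) (fun q => 1 * (p k).1 q + (p l).1 q) by apply: Clin => //; apply: Cmono cl; exact: tmono.
  set d := V (fun q => (p l).1 q - (p k).1 q).
  have Vd : V (fun q => -1 * (p k).1 q + (p l).1 q) = d by apply: eq_sq => q _; ring.
  have Vs : V (fun q => 1 * (p k).1 q + (p l).1 q) = 4 - d.
    rewrite (@eq_sq _ _ _ _ _ _ (fun q => (p l).1 q + (p k).1 q)); last by move=> q _; ring.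
    by have := sq_parallelogram mS Ll' Lk; rewrite Vk Vl -/d; lra.
  have Js : m k * (4 - d) <= quad (fun q => 1 * (p k).1 q + (p l).1 q) y2.
    rewrite -Vs; have [V0|V0] := eqVneq (V (fun q => 1 * (p k).1 q + (p l).1 q)) 0.
      by have := hB _ _ (CL _ _ cs) ly2; rewrite V0 !mulr0 normr_le0 => /eqP ->.
    have Vp : 0 < V (fun q => 1 * (p k).1 q + (p l).1 q) by rewrite lt_neqAle eq_sym V0 sq_ge0.
    by rewrite -ler_pdivlMr//; apply: ge_inf; [have [] := Xinf k|exact: scale].
  (* Both controls lie in the larger cone, where [m k] bounds the form at their sum from below. By
     the parallelogram law the form at the difference is at most [6 * e + m k * d], and [m k] is at
     most 0. [garding] then turns this into a bound on the distance [d]. *)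
  have Jd : quad (fun q => -1 * (p k).1 q + (p l).1 q) y1 <= 6 * e.
    have d0 : 0 <= d by exact: sq_ge0.
    have md : m k * d <= 0 by rewrite mulr_le0_ge0.
    move: Js; rewrite (quad_fields _ f1) (quad_fields _ f2) !hq mulrBr; have := mM l; have := tmono k l kl.
    by move: hM ht Jk Jl md; move: (m k * d) (m k) (m l) (quad _ _) (quad _ _) => *; lra.
  have hs : C * \sum_i ell' y1 i ^+ 2 <= C * (N * (4 * e)).
    rewrite ler_wpM2l// /N mulr_natl -[X in _ *+ X]card_ord -sumr_const; apply: ler_sum => i _.
    have [_ _ _ ea] := f1; have eE : ell' y1 i = ell' (p l).2 i - ell' (p k).2 i.
      rewrite /ell' ea /=; have rT' := hL i; set a := tnth _ _ in rT' *.
      have [zk _ _] := lk; have [zl _ _] := ll; have La := at_L2 zk rT'; have Lb' := at_L2 zl rT'.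
      have [Lf _ _] := smooth_H1 (svalP a.1).
      by rewrite (ipDl mO (L2Z mO (-1) La) Lb' Lf) (ipZl mO (-1) La Lf); ring.
    rewrite eE -[_ ^+ 2]real_normK ?num_real//; have h := hl i; have h0 := normr_ge0 (ell' (p l).2 i - ell' (p k).2 i).
    apply: (@le_trans _ _ ((2 * e) ^+ 2)); first by rewrite ler_sqr ?nnegrE// mulr_ge0// ltW.
    rewrite (_ : (2 * e) ^+ 2 = 4 * e * e); last by ring.
    by rewrite ler_piMr// mulr_ge0// ltW.
  have := hG' _ _ (L2D mS (L2Z mS (-1) Lk) Ll') ly1; rewrite Vd => h.
  rewrite (_ : 2 / kap * _ * e = (6 * e + C * (N * (4 * e))) / (kap / 2)); last by field; rewrite gt_eqF.
  by rewrite ler_pdivlMr ?divr_gt0// mulrC; apply: le_trans h _; exact: lerD.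
have [ka ka0 hka] := limit_state.
pose x k : 'rV[R]_(size L) := \row_i ell' (p k).2 i.
have [D D0 hD] := total_bound.
pose F i := nrm (sval (tnth (in_tuple L) i).1); pose r := 1 + D * \sum_i F i.
have sF : 0 <= \sum_i F i by apply: sumr_ge0 => i _; exact: sq_ge0.
have r0 : 0 <= r by rewrite addr_ge0// mulr_ge0// ltW.
have xr k : `|x k - 0| <= r.
  rewrite subr0; apply/(rV_normP _ r0) => i; rewrite mxE; have [ck lk Vk _] := hp k; have [zk _ _] := lk.
  have [_ _ _ _ hk] := hD _ _ (CL _ _ ck) lk; have /andP[t1 t2] := hL i; have {hk} := hk _ t1 t2; rewrite Vk mulr1 => hk.
  have [Lf _ _] := smooth_H1 (svalP (tnth (in_tuple L) i).1).
  have h1 := ip_sq mO (at_L2 zk (hL i)) Lf; rewrite -[ipO _ _]/(ell' (p k).2 i) in h1.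
  have h2 : nrm (at_time (p k).2 (tnth (in_tuple L) i).2) * F i <= D * \sum_j F j.
    apply: ler_pM; rewrite ?sq_ge0// /F (bigD1 i)//= lerDl; apply: sumr_ge0 => j _; exact: sq_ge0.
  have h3 := sqr_ge0 (`|ell' (p k).2 i| - 1); move: h1 h2 h3; rewrite -[ell' _ _ ^+ 2]real_normK ?num_real// sqrrB1 /r.
  have h4 := normr_ge0 (ell' (p k).2 i); move: h4; rewrite -/(F i); move: (nrm _ * F i) (D * _) `|_| => a1 a2 a3; rewrite mulr2n; lra.
(* The values of the functionals form a bounded sequence in a space of finite dimension; [xb] is a
   cluster point. *)
have [xb [_ clx]] : [set y : 'rV[R]_(size L) | `|y - 0| <= r] `&` cluster (x @ \oo) !=set0.
  have fx : ProperFilter (x @ \oo) by exact: fmap_proper_filter.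
  by apply: (@compact_ball_rV _ _ 0 r (x @ \oo)); exists 0%N => // k _; exact: xr.
have cN : 0 < 6 + 4 * C * N by rewrite ltr_wpDr// !mulr_ge0.
(* Chosen so that tolerances [c0 * 8^-1 ^+ j] in the estimate [pair] give the rate [ka * 8^-1 ^+ j]
   which [limit_state] requires. *)
pose c0 := Num.min 1 (ka * (kap / 2) / (6 + 4 * C * N)).
have c00 : 0 < c0 by rewrite lt_min ltr01/= divr_gt0// mulr_gt0// divr_gt0.
pose ep j := c0 * 8^-1 ^+ j.
have q0 j : 0 < (8^-1 : R) ^+ j by rewrite exprn_gt0// invr_gt0.
have ep0 j : 0 < ep j by rewrite mulr_gt0.
have c1 : c0 <= 1 by rewrite ge_min lexx.
have q1 j : (8^-1 : R) ^+ j <= 1 by rewrite exprn_ile1 ?invr_ge0// invf_le1// ler1n.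
have ep1 j : ep j <= 1 by rewrite -[1]mulr1 ler_pM// ltW.
have epS j : ep j.+1 <= ep j by rewrite ler_pM2l// exprS ler_piMl ?(ltW (q0 j))// invf_le1// ler1n.
have hk j : exists k, [/\ M - m k <= ep j, t k <= ep j, (j <= k)%N & forall i, `|ell' (p k).2 i - xb ord0 i| <= ep j].
  have [_ [K1 _ <-] h1] := sup_adherent (ep0 j) Msup.
  have [K2 h2] := near_cvg0_lt (ep0 j) (@cvg_harmonic R); pose K0 := maxn j (maxn K1 K2).
  have [||y [[k Kk <-] hy]] := clx [set y | exists2 k, (K0 <= k)%N & x k = y] (ball xb (ep j)).
  - by exists K0 => // k /= kK; exists k.
  - exact: nbhsx_ballx.
  exists k; move: Kk; rewrite !geq_max => /andP[jk /andP[k1 k2]]; split=> //.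
  - by have := mmono _ _ k1; move: h1; rewrite /= -/M -/(m K1); lra.
  - by have := h2 k k2; rewrite ger0_norm ?invr_ge0// => /ltW.
  - by move=> i; have /rV_ballP[_ /(_ i)] := hy; rewrite mxE distrC => /ltW.
have [kk hkk] := choice hk.
have fast j : V (fun q => (p (kk j.+1)).1 q - (p (kk j)).1 q) <= ka * 8^-1 ^+ j.
  have hc : 2 / kap * (6 + 4 * C * N) * ep j <= ka * 8^-1 ^+ j.
    rewrite /ep mulrA ler_pM2r//; apply: (@le_trans _ _ (2 / kap * (6 + 4 * C * N) * (ka * (kap / 2) / (6 + 4 * C * N)))).
      by apply: ler_wpM2l; [apply/ltW; apply: mulr_gt0 (divr_gt0 _ kap0) cN|rewrite ge_min lexx orbT].
    by apply: eqW; field; rewrite !gt_eqF.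
  have [a1 a2 _ a3] := hkk j; have [b1 b2 _ b3] := hkk j.+1; apply: le_trans hc.
  have tri i : `|ell' (p (kk j.+1)).2 i - ell' (p (kk j)).2 i| <= 2 * ep j.
    apply: le_trans (ler_distD (xb ord0 i) _ _) _; rewrite mulr2n mulrDl mul1r.
    by apply: lerD; [exact: le_trans (b3 i) (epS j)|rewrite distrC].
  (* The indices [kk j] need not increase, but the distance is symmetric. *)
  have [le|/ltnW le] := leqP (kk j) (kk j.+1); first exact: pair.
  rewrite sqBC; apply: pair => //; [exact: le_trans (epS j)|exact: le_trans (epS j)|].
  by move=> i; rewrite distrC.
have [w [y [Lw ly cw]]] := hka (fun j => (p (kk j)).1) (fun j => (p (kk j)).2) (fun j => let: And4 ck _ _ _ := hp (kk j) in CL _ _ ck) (fun j => let: And4 _ l _ _ := hp (kk j) in l) fast.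
have cone0 : Cone 0 w.
  apply: Cclosed Lw cw => j; have [ck _ _ _] := hp (kk j); have [_ _ jk _] := hkk j; exact: (Cmono _ _ _ (tmono _ _ jk) ck).
have Vw : V w = 1.
  have h : V (p (kk k)).1 @[k --> \oo] --> V w := sq_cvg mS (fun j => let: And4 ck _ _ _ := hp (kk j) in CL _ _ ck) Lw cw.
  rewrite (_ : (fun k => V (p (kk k)).1) = cst 1) in h; last by apply/funext => j; have [_ _ ->] := hp (kk j).
  exact: (cvg_unique (@norm_hausdorff _ R^o) h (cvg_cst _)).
have Jw : 0 < quad w y by apply: pos => //; rewrite Vw oner_eq0.
(* Now [e * CB] is a quarter of the positive value [quad w y]; the other terms will be below one
   half of it. *)
pose e := quad w y / (4 * CB); have e0 : 0 < e by rewrite divr_gt0// mulr_gt0.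
have lim : (1 + e) * ep j + (1 + e^-1) * (2 * CB) * V (fun q => (p (kk j)).1 q - w q) @[j --> \oo] --> (0 : R).
  rewrite -[X in _ --> X](_ : (1 + e) * 0 + (1 + e^-1) * (2 * CB) * 0 = 0); last by rewrite !mulr0 addr0.
  apply: cvgD; apply: cvgM; [exact: cvg_cst| |exact: cvg_cst|exact: cw].
  by apply: (@cvg0_geo _ _ c0) => j; rewrite lexx andbT ltW// ep0.
have [j0 /(_ j0 (leqnn _))] := near_cvg0_lt (divr_gt0 Jw (ltr0n R 2)) lim; rewrite ltr_norml => /andP[_].
have [ck lk Vk Jk] := hp (kk j0); have Lk := CL _ _ ck; have [_ tk _ _] := hkk j0; set vk := (p (kk j0)).1 in ck lk Vk Jk Lk *; set zk := (p (kk j0)).2 in lk Jk *.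
have [zd [ld [f1 f2 f3 f4]]] := lin_comb (-1) Lk Lw lk ly.
have Ld := L2D mS (L2Z mS (-1) Lk) Lw; set vd := fun q => -1 * vk q + w q in ld Ld *.
have [B hq] := quad_expand Ld ld Lk lk; pose B' := B + 2 * CB * inner lamS Sig vd vk.
(* The shifted form is nonnegative along the line through the near-minimizer in direction [vd]. Its
   value at [- e^-1] bounds the cross term, with the small weight [e] on the near-minimizer and the
   large weight [e^-1] on the vanishing difference. *)
have Pk k : 0 <= k ^+ 2 * (quad vd zd + CB * V vd) + k * B' + (quad vk zk + CB * V vk).
  have [z' [lz' fz']] := lin_comb k Ld Lk ld lk.
  have := hB _ _ (L2D mS (L2Z mS k Ld) Lk) lz'; rewrite (quad_fields _ fz') hq ler_norml => /andP[+ _].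
  by rewrite (sqD mS (L2Z mS k Ld) Lk) (sqZ mS k Ld) (ipZl mS k Ld Lk) -subr_ge0 opprK; congr (_ <= _); rewrite /B'; ring.
have Qw : quad w y = quad vd zd + B + quad vk zk.
  have := hq 1; rewrite expr1n !mul1r => <-.
  have -> : (fun q => 1 * vd q + vk q) = w by apply/funext => q; rewrite /vd; ring.
  apply/esym/quad_fields; split=> /=; [rewrite f1|rewrite f2|rewrite f3|rewrite f4] => /=.
  - by apply/funext => q; ring.
  - by apply/funext => i; apply/funext => q; ring.
  - by apply/funext => q; ring.
  - by apply/funext => s; apply/funext => q; ring.
have Vw' : V w = V vd + 2 * inner lamS Sig vd vk + V vk.
  by rewrite -(sqD mS Ld Lk); apply: eq_sq => q _; rewrite /vd; ring.
have Vd : V (fun q => vk q - w q) = V vd by rewrite sqBC; apply: eq_sq => q _; rewrite /vd; ring.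
rewrite Vd; have Bd := hB _ _ Ld ld; have P1 := Pk (- e^-1).
have {}P1 : B' <= e^-1 * (quad vd zd + CB * V vd) + e * (quad vk zk + CB * V vk).
  by rewrite -subr_ge0; have := mulr_ge0 (ltW e0) P1; congr (0 <= _); field; rewrite gt_eqF.
have Pd : quad vd zd + CB * V vd <= 2 * CB * V vd.
  by rewrite -mulrA mulr2n mulrDl mul1r lerD2r; apply: le_trans Bd; exact: ler_norm.
have Pv : quad vk zk + CB * V vk <= ep j0 + CB.
  by rewrite Vk mulr1 lerD2r; apply: (le_trans (ltW Jk)); rewrite -[ep j0]add0r; exact: lerD.
have e1 : 0 <= 1 + e^-1 by rewrite addr_ge0// invr_ge0 ltW.
have e2 : 0 <= 1 + e by rewrite addr_ge0// ltW.
have h1 := ler_wpM2l e1 Pd; have h2 := ler_wpM2l e2 Pv.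
have eCB : e * CB = quad w y / 4 by rewrite /e; field; rewrite gt_eqF.
rewrite ltNge => /negP; apply; rewrite -subr_ge0.
have h3 : quad w y + CB * V w = quad vd zd + CB * V vd + B' + (quad vk zk + CB * V vk) by rewrite Qw Vw' /B'; ring.
rewrite Vw mulr1 in h3; move: P1 h1 h2 h3; rewrite mulrA.
rewrite [(1 + e^-1) * (quad _ _ + _)]mulrDl [(1 + e) * (quad _ _ + _)]mulrDl [(1 + e) * (ep j0 + CB)]mulrDr [(1 + e) * CB]mulrDl eCB !mul1r.
move: (quad vd zd + _) (quad vk zk + _) => p1 p2; move: (e^-1 * p1) (e * p2) ((1 + e) * _) (_ * V vd) (quad w y) Jw => a1 a2 a3 a4 a5 *; lra.
Qed.

End evolution.

(** * From the optimality system to the abstract quadratic form *)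

Local Notation Iop T := (`]0, T[%classic : set (measurableTypeR _)).

(** [dy a] along the state agrees only almost everywhere with a measurable function; [Rintegral_ae]
    permits the exchange although measurability is known for [f] alone. *)
Lemma weak_solution_ae {R : realType} {n : nat} (Om : set 'rV[R]_n) (sigma : {measure set 'rV[R]_n -> \bar R}) (T s : R) A
    (f f' h : 'rV[R]_n * measurableTypeR R -> R) z : domain Om sigma ->
  measurable_fun (Om `*` Iop T) f ->
  (\forall q \ae (leb n \x @lebesgue_measure R)%E, (Om `*` Iop T) q -> f q = f' q) ->
  weak_solution Om sigma T s A f h z <-> weak_solution Om sigma T s A f' h z.
Proof.
move=> dom mf ff; have mO := mOm dom; have sO := leb_sigma_finite (R := R) n; have mIT := mI T.
have hs := ae_slice sO ff.
have e t w : t \in `]0, T[ -> (\forall x \ae leb n, Om x -> f (x, t) = f' (x, t)) -> measurable_fun Om w ->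
    \int[leb n]_(x in Om) (f (x, t) * w x) = \int[leb n]_(x in Om) (f' (x, t) * w x).
  move=> tT ft mw; apply/esym/Rintegral_ae => //; last by apply: filterS ft => x h' Ox; rewrite h'.
  by apply: measurable_funM => //; exact: (measurable_ysec mO mIT mf).
split=> hw; apply: (ae_imp (m := @lebesgue_measure R) (ae_and (m := @lebesgue_measure R) hs hw)) => t [h1 h2] tT w Dw tw wH wt;
  have := h2 tT w Dw tw wH wt; have [[mw _] _ _] := wH; rewrite (e t w tT (h1 _) mw)//.
Qed.

Theorem theorem3p12 (R : realType) (d : nat) (hd : d = 2%N \/ d = 3%N)
  (T : R) (hT : 0 < T)
  (Om : set 'rV[R]_d) (Om_open : open Om) (Om_bounded : bounded_set Om)
  (Om_connected : connected Om) (Om_lipschitz : lipschitz_boundary Om)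
  (sigma : {measure set 'rV[R]_d -> \bar R}) (hsigma : surface_measure Om sigma)
  (A : 'I_d -> 'I_d -> 'rV[R]_d -> R) (LamA lamA : R)
  (hA : elliptic Om A LamA lamA)
  (r s : R) (hr : 2 <= r) (hs : 2 <= s) (hrs : r^-1 + d%:R / (2 * s) < 1)
  (a : 'rV[R]_d * measurableTypeR R -> R -> R) (ha : assumption_a Om T r s a)
  (y0 : 'rV[R]_d -> R) (hy0 : Linfty (leb d) Om y0)
  (rh sh : R) (hrh : 1 <= rh) (hsh : 1 <= sh)
  (hrsh : rh^-1 + (d.-1)%:R / (2 * sh) < 1 / 2)
  (g : 'rV[R]_d * measurableTypeR R -> R)
  (hg : L2 (sigma \x lebesgue_measure)%E (bdry Om `*` `]0, T[) g)
  (hg' : Lmixed sigma (bdry Om) T rh sh g)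
  (L : 'rV[R]_d * measurableTypeR R -> R -> R) (hL : assumption_L Om T r s L)
  (l : 'rV[R]_d -> R -> R) (hl : assumption_l Om l)
  (hI_II :
    (\forall x \ae leb d, Om x -> forall y, 0 <= dyy l x y) \/
    (C11_boundary Om /\ lipschitz_coefficients Om A))
  (kappa alpha beta : R) (hkappa : 0 < kappa) (halpha : 0 <= alpha)
  (hab : alpha < beta)
  (u : 'rV[R]_d * measurableTypeR R -> R) (hu : Uad Om sigma T alpha beta u)
  (y phi : trajectory) (hy : is_state Om sigma T A a g y0 u y)
  (hphi : is_adjoint_state Om sigma T A a L l u y phi)
  (hopt : first_order Om sigma T kappa alpha beta u y phi)
  (hstrict : (sigma \x lebesgue_measure)%E
               (degenerate_set Om T kappa alpha beta u y phi) = 0%E) :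
  extended_cone Om sigma T kappa 0 u y phi =
    critical_cone Om sigma T kappa alpha beta u y phi
  /\
  ((forall v, critical_cone Om sigma T kappa alpha beta u y phi v ->
      ~ (\forall q \ae (sigma \x lebesgue_measure)%E,
           (bdry Om `*` `]0, T[) q -> v q = 0) ->
      forall z, is_linearized_state Om sigma T A a u y v z ->
        0 < second_derivative Om sigma T kappa a L l y phi v z) ->
   exists tau nu : R,
     [/\ 0 < tau, 0 < nu &
       forall v, extended_cone Om sigma T kappa tau u y phi v ->
       forall z, is_linearized_state Om sigma T A a u y v z ->
         nu * sqnorm (sigma \x lebesgue_measure)%E (bdry Om `*` `]0, T[) v
           <= second_derivative Om sigma T kappa a L l y phi v z]).
Proof.
have dom : domain Om sigma by split=> //; case: hd => ->.
have mO := mOm dom; have mIT := mI T; have mQ := measurableX mO mIT; have mS := measurableX (mbd Om) mIT.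
have TT : 0 <= T <= T by rewrite lexx ltW.
have [[yW Ly] _ _] := hy; have [[pW Lp] _ _] := hphi.
have Lty := trace_Linfty dom (conj yW Ly); have Ltp := trace_Linfty dom (conj pW Lp); have [Lu hu'] := hu.
have ms : measurable_fun (bdry Om `*` Iop T) (switching kappa u y phi).
  apply: measurable_funB; mfun.
have part1 : extended_cone Om sigma T kappa 0 u y phi = critical_cone Om sigma T kappa alpha beta u y phi.
  apply/seteqP; split=> v [Lv hv]; split=> //; last first.
    by apply: (ae_imp (m := (sigma \x lebesgue_measure)%E) hv) => q h Sq; rewrite normr_gt0 => sq; have [h1 _ _] := h Sq; exact: h1.
  (* By strict complementarity, almost everywhere on the set where the control is at a bound the
     switching function is nonzero; [v] vanishes there, and the sign conditions of the critical cone
     hold trivially. *)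
  have nd : \forall q \ae (sigma \x lebesgue_measure)%E, (bdry Om `*` `]0, T[) q ->
      ~ ((u q = alpha \/ u q = beta) /\ switching kappa u y phi q = 0).
    (* A set witnessing an almost everywhere statement has to be measurable, so the degenerate set
       is written with preimages under [u] and under the switching function. *)
    exists (degenerate_set Om T kappa alpha beta u y phi); split=> //; last first.
      by move=> q /= h; apply: contrapT => nq; apply: h => Sq hq; apply: nq.
    set S := bdry Om `*` _ in mS ms Lu; rewrite (_ : _ _ _ _ _ _ _ _ =
        (S `&` u @^-1` [set alpha] `|` S `&` u @^-1` [set beta]) `&` (S `&` switching kappa u y phi @^-1` [set 0])).
      by apply: measurableI; [apply: measurableU; apply: Lu.1 => //|apply: ms].
    apply/seteqP; split=> q; first by move=> [Sq [[h|h] h']]; split; [left|split|right|split].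
    by move=> [[[Sq h]|[Sq h]] [_ h']]; split=> //; split=> //; [left|right].
  apply: (ae_imp (m := (sigma \x lebesgue_measure)%E) (ae_and (m := (sigma \x lebesgue_measure)%E) hv nd)) => q [h h'] Sq; have {}h : switching kappa u y phi q != 0 -> v q = 0.
    by move=> h0; apply: (h Sq); rewrite normr_gt0.
  have h2 : u q = alpha \/ u q = beta -> v q = 0.
    by move=> ab; apply: h; apply/eqP => h0; apply: (h' Sq).
  by split=> // e; rewrite h2//; [left|right].
split=> // pos.
(* The local bounds on [a], [L] and [l] are all taken at one positive level [M] that bounds the
   state; [final_bounded] makes it valid at the final time too. *)
have [mv [M0 hM0]] := Ly; pose M := `|M0| + 1; have Mp : 0 < M by rewrite ltr_wpDl.
have hM : \forall q \ae (leb d \x lebesgue_measure)%E, (Om `*` Iop T) q -> `|value y q| <= M.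
  apply: filterS hM0 => q h Qq; apply: le_trans (h Qq) _; apply: le_trans (ler_norm _) _; by rewrite lerDl.
have [[ca c2a] _ _ ba] := ha; have {ba} [Ca [Ka ba]] := ba M Mp.
have [ga [ga2 [mga mga2 ea ea2]]] := caratheodory_dy mQ ca c2a mv.
have [[cL c2L] _ bL] := hL; have {bL} [Psi [CL [KL [_ bL]]]] := bL M Mp.
have [_ [gL2 [_ mgL2 _ eL2]]] := caratheodory_dy mQ cL c2L mv.
have [[cl c2l] _ bl] := hl; have {bl} [Cl [Kl bl]] := bl M Mp.
have [_ [gl2 [_ mgl2 _ el2]]] := caratheodory_dy mO cl c2l (L2_meas (at_L2 yW TT)).
have Lga : Linfty (leb d \x lebesgue_measure)%E (Om `*` Iop T) ga.
  split=> //; exists Ca; apply: filterS3 ea ba hM => q e b h Qq; rewrite e//; apply: le_trans ((b Qq).1 _ (h Qq)).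
  by rewrite lerDl.
have Lga2 : Linfty (leb d \x lebesgue_measure)%E (Om `*` Iop T) ga2.
  split=> //; exists Ca; apply: filterS3 ea2 ba hM => q e b h Qq; rewrite e//; apply: le_trans ((b Qq).1 _ (h Qq)).
  by rewrite lerDr.
have LgL2 : Linfty (leb d \x lebesgue_measure)%E (Om `*` Iop T) gL2.
  by split=> //; exists CL; apply: filterS3 eL2 bL hM => q e b h Qq; rewrite e//; case: ((b Qq).1 _ (h Qq)).
have Lgl2 : Linfty (leb d) Om gl2.
  split=> //; exists Cl; apply: filterS3 el2 bl (final_bounded dom hT yW (ltW Mp) hM) => x e b h Ox.
  by rewrite e//; case: ((b Ox).1 _ (h Ox)).
have LK := Linfty_subM mQ LgL2 Lp Lga2.
have LLu : Linfty (sigma \x lebesgue_measure)%E (bdry Om `*` Iop T) u.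
  split; [exact: Lu.1|exists beta]; apply: (ae_imp (m := (sigma \x lebesgue_measure)%E) hu') => q h Sq; have /andP[h1 h2] := h Sq.
  by rewrite ger0_norm//; exact: le_trans h1.
have u0 : \forall q \ae (sigma \x lebesgue_measure)%E, (bdry Om `*` Iop T) q -> 0 <= u q.
  by apply: (ae_imp (m := (sigma \x lebesgue_measure)%E) hu') => q h Sq; have /andP[h1 _] := h Sq; exact: le_trans h1.
have linE v z : is_linearized_state Om sigma T A a u y v z <-> lin_state Om sigma T A ga u (trace y) v z.
  have eqv : in_W Om sigma T z -> weak_solution Om sigma T 1 A (fun q => ga q * value z q) (fun q => - (u q * trace z q + trace y q * v q)) z <->
      weak_solution Om sigma T 1 A (fun q => dy a q (value y q) * value z q) (fun q => - (u q * trace z q + trace y q * v q)) z.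
    move=> zW; have [[mz _] _ _] := fieldsW zW; apply: weak_solution_ae dom (measurable_funM mga mz) _.
    by apply: filterS ea => q e Qq; rewrite /= e.
  by split=> -[zW hw z0]; split=> //; apply/(eqv zW).
have quadE v z : in_W Om sigma T z -> second_derivative Om sigma T kappa a L l y phi v z =
    quad Om sigma T (fun q => gL2 q - value phi q * ga2 q) gl2 (trace phi) kappa v z.
  move=> zW; have [[mz _] _ _] := fieldsW zW; rewrite /quad /inner; congr (_ + _ - 2 * _ + _).
  - apply: Rintegral_ae => //; first mfun.
    by apply: filterS2 eL2 ea2 => q e1 e2 Qq; rewrite e1// e2// mulrA.
  - have mzT := L2_meas (at_L2 zW TT); apply: Rintegral_ae => //.
      mfun.
    by apply: filterS el2 => q e Qq; rewrite e// mulrA.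
  - by apply: eq_Rintegral => q _; rewrite mulrC mulrA.
(* The cones are linear subspaces that grow with the threshold, and [vanishing_closed] shows that
   limits along vanishing thresholds lie in the cone at 0. *)
have [|||||tau [nu [tau0 nu0 h]]] := minimizing_limit dom hT hA Lga LLu Lty u0 LK Lgl2 Ltp hkappa
  (Cone := fun t => extended_cone Om sigma T kappa t u y phi).
- by move=> t v [].
- move=> t k v v' [Lv hv] [Lv' hv']; split; first exact: (L2D mS (L2Z mS k Lv) Lv').
  by apply: (ae_imp (m := (sigma \x lebesgue_measure)%E) (ae_and (m := (sigma \x lebesgue_measure)%E) hv hv')) => q [h h'] Sq tq; rewrite h// h'// mulr0 addr0.
- move=> t t' v tt [Lv hv]; split=> //; apply: (ae_imp (m := (sigma \x lebesgue_measure)%E) hv) => q h Sq tq; apply: (h Sq); exact: le_lt_trans tq.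
- move=> v w hv Lw vw; split=> //; apply: (vanishing_closed mS ms _ Lw _ vw) => k; by have [] := hv k.
(* The cone at 0 is the critical cone by the first part, and a nonzero norm says that [v] is not
   zero almost everywhere. *)
- move=> v z cv lz V0; have [zW _ _] := lz; rewrite -(quadE v z zW); have [Lv _] := cv; apply: pos; last exact/linE.
    by rewrite -part1.
  by move=> v0; move: V0; rewrite (ae_sq0 mS (L2_meas Lv) v0).2 eqxx.
exists tau, nu; split=> // v cv z lz; have [zW _ _] := lz; rewrite (quadE v z zW); apply: h => //; exact/linE.
Qed.
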